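(* Let $N\ge 1$. There is a constant $C_N^{(2)}$ depending only on $N$ such that the following holds for every real symmetric positive definite $N\times N$ matrix $S$. For $J\in\mathcal{A}_N(\mathbb{R})$ set $B_J=(I+J)S$. The drift-diffusion operator $\mathcal{L}_J=-(B_Jx)\cdot\nabla+\Delta$ in $L^2(\mathbb{R}^N,\psi_\infty dx;\mathbb{C})$ with domain $$D(\mathcal{L}_J)=\left\{u\in L^2(\mathbb{R}^N,\psi_\infty dx;\mathbb{C}) : \mathcal{L}_Ju\in L^2(\mathbb{R}^N,\psi_\infty dx;\mathbb{C})\right\}$$ generates a contraction semigroup $(e^{t\mathcal{L}_J})_{t\ge 0}$ and has a compact resolvent. Optimizing its spectrum with respect to $J$ gives $$\max_{J\in\mathcal{A}_N(\mathbb{R})}\ \min\mathrm{Re}\,\big(\sigma(-\mathcal{L}_J)\setminus\{0\}\big)=\frac{\mathrm{Tr}(S)}{N},$$ and this maximum is attained for matrices $J_{opt}\in\mathcal{A}_N(\mathbb{R})$ that attain $\max_{J\in\mathcal{A}_N(\mathbb{R})}\min\mathrm{Re}(\sigma(B_J))=\mathrm{Tr}(S)/N$. Furthermore, such a matrix $J_{opt}$ can be chosen so that $$\left\|e^{t\mathcal{L}_{J_{opt}}}u-\int_{\mathbb{R}^N}u\,\psi_\infty dx\right\|_{L^2(\psi_\infty)}\le C_N^{(2)}\kappa(S)^{7/2}\exp\left(-\frac{\mathrm{Tr}(S)}{N}t\right)\left\|u-\int_{\mathbb{R}^N}u\,\psi_\infty dx\right\|_{L^2(\psi_\infty)}$$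 holds for all $u\in L^2(\mathbb{R}^N,\psi_\infty dx;\mathbb{C})$ and all $t\ge 0$.
   Context: $\mathcal{A}_N(\mathbb{R})$ is the set of real antisymmetric $N\times N$ matrices. $\psi_\infty(x)=\frac{\det(S)^{1/2}}{(2\pi)^{N/2}}\exp\left(-\frac{x^TSx}{2}\right)$. $L^2(\mathbb{R}^N,\psi_\infty dx;\mathbb{C})$ is the space of $f:\mathbb{R}^N\to\mathbb{C}$ with $\|f\|^2_{L^2(\psi_\infty)}=\int_{\mathbb{R}^N}|f|^2\psi_\infty\,dx<\infty$; in the domain, $\mathcal{L}_Ju$ is understood in the distribution sense. $\sigma(\cdot)$ denotes the spectrum, $\kappa(M)=\|M\|\,\|M^{-1}\|$ the condition number for the matrix norm induced by the Euclidean norm. *)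

(* Defs.v *)
From HB Require Import structures.
From mathcomp Require Import all_boot all_order all_algebra.
From mathcomp Require Import generic_quotient ring_quotient complex.
From mathcomp Require Import all_classical all_reals all_analysis.
From mathcomp Require Import measurable_realfun.

Set Implicit Arguments.
Unset Strict Implicit.
Unset Printing Implicit Defensive.
Import Order.TTheory GRing.Theory Num.Theory.
Import numFieldNormedType.Exports.
Local Open Scope classical_set_scope.
Local Open Scope ring_scope.
Local Open Scope complex_scope.

Definition measure_mx_display : measure_display. Proof. exact: default_measure_display. Qed.

Section measurable_mx.
Context {R : realType} (m n : nat).

(* The product sigma-algebra, generated by the coordinate maps. *)
Definition mx_cylinders : set (set 'M[R]_(m, n)) :=
  [set A | exists i j (B : set (measurableTypeR R)),
     measurable B /\ A = [set M : 'M[R]_(m, n) | B (M i j)]].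

Let mx_measurable := <<s mx_cylinders >>.

Let mx_set0 : mx_measurable set0. Proof. exact: sigma_algebra0. Qed.

Let mx_setC A : mx_measurable A -> mx_measurable (~` A).
Proof. exact: sigma_algebraC. Qed.

Let mx_bigcup (F : _^nat) :
  (forall i, mx_measurable (F i)) -> mx_measurable (\bigcup_i (F i)).
Proof. exact: sigma_algebra_bigcup. Qed.

HB.instance Definition _ := @isMeasurable.Build measure_mx_display
  'M[R]_(m, n) mx_measurable mx_set0 mx_setC mx_bigcup.

Lemma measurable_coord i j :
  measurable_fun setT (fun M : 'M[R]_(m, n) => M i j : measurableTypeR R).
Proof.
move=> _ B mB; rewrite setTI; apply: sub_sigma_algebra.
by exists i, j, B.
Qed.

Lemma measurable_fun_mx d (T : measurableType d) (f : T -> 'M[R]_(m, n)) :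
  (forall i j, measurable_fun setT (fun t => f t i j : measurableTypeR R)) ->
  measurable_fun setT f.
Proof.
move=> mf _ A mA.
have : mx_measurable `<=` [set A | measurable (setT `&` f @^-1` A)].
  apply: smallest_sub => [|_ [i [j [B [mB ->]]]]]; last exact: mf.
  split=> /=.
  - by rewrite preimage_set0 setI0.
  - move=> B; rewrite !setTI setTD => mB; rewrite preimage_setC.
    exact: measurableC.
  - move=> F mF; rewrite setTI preimage_bigcup; apply: bigcup_measurable => k _.
    by rewrite -[X in measurable X]setTI; exact: mF.
exact.
Qed.

End measurable_mx.

(* Lebesgue measure on R^n: the library only has it on R, so it is built as an
   iterated product, transported to column vectors. *)
Section lebesgue_cV.
Context {R : realType}.

Section step.
Context (n : nat) (mu : {sigma_finite_measure set 'cV[R]_n -> \bar R}).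

Definition cons_cV (p : measurableTypeR R * 'cV[R]_n) : 'cV[R]_n.+1 :=
  col_mx (p.1 : R)%:M p.2.

Let uncons_cV (x : 'cV[R]_n.+1) : measurableTypeR R * 'cV[R]_n :=
  (x 0 0, \col_i x (lift ord0 i) 0).

Let cons_cVK : cancel cons_cV uncons_cV.
Proof.
move=> [a x]; rewrite /uncons_cV /cons_cV /=; congr pair.
  by rewrite -(lshift0 n 0) (@col_mxEu _ 1) mxE mulr1n.
by apply/colP => i; rewrite mxE -rshift1 (@col_mxEd _ 1).
Qed.

Lemma measurable_cons_cV : measurable_fun setT cons_cV.
Proof.
apply: measurable_fun_mx => i j; rewrite ord1.
have [k ->|k ->] := @split_ordP 1 n i.
  rewrite ord1 (_ : (fun _ => _) = fst) //.
  by apply/funext => p; rewrite (@col_mxEu _ 1) mxE mulr1n.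
rewrite (_ : (fun _ => _) = (fun x : 'cV[R]_n => x k 0) \o snd); last first.
  by apply/funext => p /=; rewrite (@col_mxEd _ 1).
by apply: measurableT_comp => //; exact: measurable_coord.
Qed.

Let measurable_uncons : measurable_fun setT uncons_cV.
Proof.
apply: measurable_fun_pair; first exact: measurable_coord.
apply: measurable_fun_mx => i j.
rewrite (_ : (fun _ => _) = fun x : 'cV[R]_n.+1 => x (lift ord0 i) 0).
  exact: measurable_coord.
by apply/funext => x; rewrite mxE.
Qed.

Definition lebesgue_cons : set 'cV[R]_n.+1 -> \bar R :=
  pushforward (lebesgue_measure \x mu)%E cons_cV.

Let lebesgue_cons0 : lebesgue_cons set0 = 0%E.
Proof. by rewrite /lebesgue_cons /pushforward preimage_set0 measure0. Qed.

Let lebesgue_cons_ge0 A : (0 <= lebesgue_cons A)%E.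
Proof. by rewrite /lebesgue_cons /pushforward; exact: measure_ge0. Qed.

Let lebesgue_cons_sigma_additive : semi_sigma_additive lebesgue_cons.
Proof.
apply: (@measure_semi_sigma_additive _ _ _
  (pushforward (lebesgue_measure \x mu)%E cons_cV)).
exact: measurable_cons_cV.
Qed.

HB.instance Definition _ := isMeasure.Build _ _ _ lebesgue_cons
  lebesgue_cons0 lebesgue_cons_ge0 lebesgue_cons_sigma_additive.

Let lebesgue_cons_sigma_finite : sigma_finite setT lebesgue_cons.
Proof.
have /sigma_finiteP[F [FT ndF Foo]] := @sigma_finiteT _ _ _ (@lebesgue_measure R).
have /sigma_finiteP[G [GT ndG Goo]] := sigma_finiteT mu.
exists (fun k => uncons_cV @^-1` (F k `*` G k)).
  rewrite -preimage_bigcup (_ : \bigcup_k _ = setT) ?preimage_setT//.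
  apply/seteqP; split=> // -[x y] _.
  have [i _ Fx] : (\bigcup_i F i) x by rewrite -FT.
  have [j _ Gy] : (\bigcup_i G i) y by rewrite -GT.
  exists (maxn i j) => //; split => /=.
  - by move: x Fx; exact/subsetPset/ndF/leq_maxl.
  - by move: y Gy; exact/subsetPset/ndG/leq_maxr.
move=> k; have [mF Fk] := Foo k; have [mG Gk] := Goo k; split.
  by rewrite -[X in measurable X]setTI; apply: measurable_uncons => //;
    exact: measurableX.
rewrite /lebesgue_cons /pushforward -comp_preimage.
rewrite (_ : uncons_cV \o cons_cV = id) ?preimage_id; last exact/funext/cons_cVK.
by rewrite product_measure1E// lte_mul_pinfty// ge0_fin_numE.
Qed.

HB.instance Definition _ := Measure_isSigmaFinite.Build _ _ _ lebesgue_cons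
  lebesgue_cons_sigma_finite.

End step.

Fixpoint lebesgue_cV n : {sigma_finite_measure set 'cV[R]_n -> \bar R} :=
  match n with
  | 0%N => \d_ (0 : 'cV[R]_0)
  | k.+1 => lebesgue_cons (lebesgue_cV k)
  end.

End lebesgue_cV.

(* L^2(mu; C): functions with measurable real and imaginary parts and finite
   'N[mu]_2[|f|], modulo those of zero norm, i.e. modulo mu-a.e. equality. The
   library's LspaceType is restricted to real-valued functions. *)

Section L2.
Context d (T : measurableType d) (R : realType).
Variable mu : {measure set T -> \bar R}.
Implicit Types f g : T -> R[i]^o.

Definition modulus (z : R[i]) : R := complex.Re `|z|.

Definition L2norm f : \bar R := 'N[mu]_2%:E[(fun x => (modulus (f x))%:E)]%E.

Definition measurable_complex f :=
  measurable_fun setT (fun x => complex.Re (f x)) /\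
  measurable_fun setT (fun x => complex.Im (f x)).

Definition square_integrable f := measurable_complex f /\ (L2norm f < +oo)%E.

Lemma modulus_ge0 z : 0 <= modulus z.
Proof. by case: z => a b; rewrite /modulus /= sqrtr_ge0. Qed.

Lemma modulusE z : (modulus z)%:C = `|z|.
Proof. by case: z. Qed.

Lemma modulusD z w : modulus (z + w) <= modulus z + modulus w.
Proof. by rewrite -lecR rmorphD /= !modulusE ler_normD. Qed.

Lemma modulusM z w : modulus (z * w) = modulus z * modulus w.
Proof. by apply: complexI; rewrite rmorphM /= !modulusE normrM. Qed.

Lemma modulus0 : modulus 0 = 0.
Proof. by apply: complexI; rewrite modulusE normr0. Qed.

Lemma measurable_modulus f :
  measurable_complex f -> measurable_fun setT (fun x => modulus (f x)).
Proof.
move=> [mRe mIm].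
rewrite (_ : (fun _ => _) =
  (fun x => Num.sqrt (complex.Re (f x) ^+ 2 + complex.Im (f x) ^+ 2))).
  apply: (@measurableT_comp _ _ _ _ _ _ (@Num.sqrt R)) => //.
    apply: continuous_measurable_fun => x; exact: sqrt_continuous.
  by apply: measurable_funD; exact: measurable_funX.
by apply/funext => x; case: (f x).
Qed.

Lemma measurable_complexZD (a : R[i]) f g :
  measurable_complex f -> measurable_complex g ->
  measurable_complex (a *: f + g).
Proof.
move=> [mf1 mf2] [mg1 mg2]; split.
  rewrite (_ : (fun _ => _) = (fun x => complex.Re a * complex.Re (f x)
    - complex.Im a * complex.Im (f x) + complex.Re (g x))).
    by apply: measurable_funD => //; apply: measurable_funB; exact: measurable_funM.
  apply/funext => x; rewrite !fctE /GRing.scale /=.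
  by case: a (f x) (g x) => [a b] [r s] [t u].
rewrite (_ : (fun _ => _) = (fun x => complex.Re a * complex.Im (f x)
    + complex.Im a * complex.Re (f x) + complex.Im (g x))).
  by apply: measurable_funD => //; apply: measurable_funD; exact: measurable_funM.
apply/funext => x; rewrite !fctE /GRing.scale /=.
by case: a (f x) (g x) => [a b] [r s] [t u].
Qed.

Lemma measurable_complex0 : measurable_complex (0 : T -> R[i]^o).
Proof. by split; exact: measurable_cst. Qed.

Lemma L2norm_ge0 f : (0 <= L2norm f)%E.
Proof. exact: Lnorm_ge0. Qed.

Lemma L2norm0 : L2norm (0 : T -> R[i]^o) = 0%E.
Proof.
rewrite /L2norm (_ : (fun _ => _) = cst 0%E) ?Lnorm0 ?eqe ?pnatr_eq0//.
by apply/funext => x; rewrite modulus0.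
Qed.

Lemma le_L2norm f (g : T -> R) : measurable_complex f -> measurable_fun setT g ->
  (forall x, modulus (f x) <= g x) -> (L2norm f <= 'N[mu]_2%:E[EFin \o g])%E.
Proof.
move=> /measurable_modulus mf mg fg; rewrite /L2norm unlock.
have m2 (h : T -> R) : measurable_fun setT h ->
    measurable_fun setT (fun x => `|(h x)%:E| `^ 2)%E.
  move=> mh; apply: (@measurableT_comp _ _ _ _ _ _ (fun x => x `^ 2)%E) => //=.
    exact: measurable_poweR.
  by apply/measurable_EFinP; exact: measurableT_comp.
apply: gt0_ler_poweR; rewrite ?invr_ge0// ?in_itv/= ?leey ?andbT ?integral_ge0//.
apply: ge0_le_integral => //; [exact: m2|exact: m2|].
move=> x _; rewrite lee_fin ge0_ler_powR ?nnegrE//.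
by rewrite (ger0_norm (modulus_ge0 _)) (le_trans (fg x))// ler_norm.
Qed.

Lemma L2normD f g : measurable_complex f -> measurable_complex g ->
  (L2norm (f + g)%R <= L2norm f + L2norm g)%E.
Proof.
move=> mf mg.
have mF := measurable_modulus mf; have mG := measurable_modulus mg.
have le2 : (1 <= 2%:E :> \bar R)%E by rewrite lee_fin ler1n.
apply: le_trans (eminkowski mu mF mG le2); apply: le_L2norm => /=.
- by rewrite -[f]scale1r; exact: measurable_complexZD.
- exact: measurable_funD.
- by move=> x; exact: modulusD.
Qed.

Lemma L2normZ (a : R[i]) f : measurable_complex f ->
  (L2norm (a *: f)%R = (modulus a)%:E * L2norm f)%E.
Proof.
move=> /measurable_modulus mf; rewrite /L2norm unlock.
have a0 := modulus_ge0 a.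
under eq_integral => x _.
  rewrite /= modulusM normrM powRM// (ger0_norm a0) EFinM.
  over.
rewrite ge0_integralZl ?lee_fin ?powR_ge0//; last first.
  apply/measurable_EFinP.
  apply: (@measurableT_comp _ _ _ _ _ _ (@powR R ^~ 2)) => //.
  exact: measurableT_comp.
rewrite -poweR_EFin poweRM ?poweR_ge0 ?integral_ge0//.
by rewrite -poweRrM divff ?pnatr_eq0// poweRe1.
Qed.

Definition square_integrable_pred : {pred T -> R[i]^o} :=
  [pred f | `[< square_integrable f >]].

Lemma square_integrable_submod : submod_closed square_integrable_pred.
Proof.
split.
  apply/asboolP; split; first exact: measurable_complex0.
  by rewrite L2norm0.
move=> a f g /asboolP[mf ff] /asboolP[mg fg]; apply/asboolP.
have maf : measurable_complex (a *: f).
  by rewrite -[a *: f]addr0; exact: measurable_complexZD.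
split; first exact: measurable_complexZD.
apply: le_lt_trans (L2normD maf mg) _; rewrite lte_add_pinfty// L2normZ//.
by rewrite lte_mul_pinfty// ?lee_fin ?modulus_ge0.
Qed.

HB.instance Definition _ := GRing.isSubmodClosed.Build _ _
  square_integrable_pred square_integrable_submod.

Record L2fun := MkL2fun {
  L2fun_val :> T -> R[i]^o; _ : L2fun_val \in square_integrable_pred }.

HB.instance Definition _ := [isSub for L2fun_val].
HB.instance Definition _ := [Choice of L2fun by <:].
HB.instance Definition _ := [SubChoice_isSubLmodule of L2fun by <:].

Lemma L2funP (f : L2fun) : square_integrable f.
Proof. exact/asboolP/(valP f). Qed.

Definition null_pred : {pred L2fun} := [pred f : L2fun | L2norm f == 0%E].

Lemma null_submod : submod_closed null_pred.
Proof.
split; first by rewrite inE L2norm0.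
move=> a f g /eqP f0 /eqP g0; rewrite inE; apply/eqP/le_anti.
have [mf _] := L2funP f; have [mg _] := L2funP g; have [maf _] := L2funP (a *: f).
by rewrite L2norm_ge0 andbT (le_trans (L2normD maf mg))// L2normZ// f0 g0 mule0 add0e.
Qed.

HB.instance Definition _ := GRing.isSubmodClosed.Build _ _ null_pred null_submod.

Local Open Scope quotient_scope.

Definition L2 : Type := Quotient.quot null_pred.
HB.instance Definition _ := GRing.Zmodule.on L2.
HB.instance Definition _ := Quotient.on L2.

Let piL2 (f : L2fun) : L2 := \pi_(Quotient.quot null_pred) f.

Let L2eqP (f g : L2fun) : reflect (piL2 f = piL2 g) (f - g \in null_pred).
Proof.
by apply: (iffP idP); rewrite (Quotient.idealrBE null_pred) => /eqP.
Qed.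

Let piL2D (f g : L2fun) : piL2 (f + g) = piL2 f + piL2 g.
Proof. exact: Quotient.pi_add. Qed.

Definition scaleL2 (a : R[i]) (u : L2) : L2 := piL2 (a *: (repr u : L2fun)).

Let scaleL2_pi a (f : L2fun) : scaleL2 a (piL2 f) = piL2 (a *: f).
Proof.
apply/L2eqP; rewrite -scalerBr rpredZ//; apply/L2eqP.
by rewrite /piL2 reprK.
Qed.

Let scaleL2A a b u : scaleL2 a (scaleL2 b u) = scaleL2 (a * b) u.
Proof. by rewrite [X in scaleL2 a X]/scaleL2 scaleL2_pi scalerA. Qed.

Let scaleL21 : left_id 1 scaleL2.
Proof. by move=> u; rewrite /scaleL2 scale1r /piL2 reprK. Qed.

Let scaleL2Dr : right_distributive scaleL2 +%R.
Proof.
move=> a u v; rewrite -[u]reprK -[v]reprK -!/(piL2 _) -piL2D !scaleL2_pi.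
by rewrite -piL2D scalerDr.
Qed.

Let scaleL2Dl u : {morph scaleL2^~ u : a b / a + b}.
Proof. by move=> a b; rewrite /scaleL2 scalerDl piL2D. Qed.

HB.instance Definition _ := GRing.Zmodule_isLmodule.Build R[i] L2
  scaleL2A scaleL21 scaleL2Dr scaleL2Dl.

Definition L2repr (u : L2) : L2fun := repr u.
Coercion L2repr : L2 >-> L2fun.

Definition normL2 (u : L2) : R[i] := (fine (L2norm u))%:C.

Let L2norm_fin (f : L2fun) : L2norm f \is a fin_num.
Proof. by rewrite ge0_fin_numE ?L2norm_ge0//; have [] := L2funP f. Qed.

Let L2norm_pi (f : L2fun) : L2norm (piL2 f) = L2norm f.
Proof.
have /L2eqP/eqP : piL2 (L2repr (piL2 f)) = piL2 f by rewrite /piL2 /L2repr reprK.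
set g := L2repr _ => gf0; apply/le_anti/andP; split.
- have -> : g = (g - f) + f :> L2fun by rewrite subrK.
  have [m1 _] := L2funP (g - f); have [m2 _] := L2funP f.
  by rewrite (le_trans (L2normD m1 m2))// gf0 add0e.
- have -> : f = (-1) *: (g - f) + g :> L2fun.
    by rewrite scaleN1r opprB subrK.
  have [m1 _] := L2funP (g - f); have [m2 _] := L2funP g.
  have [m3 _] := L2funP (-1 *: (g - f)).
  by rewrite (le_trans (L2normD m3 m2))// L2normZ// gf0 mule0 add0e.
Qed.

Let normL2D (u v : L2) : normL2 (u + v) <= normL2 u + normL2 v.
Proof.
rewrite -[u]reprK -[v]reprK -!/(piL2 _) -piL2D /normL2 !L2norm_pi.
rewrite -rmorphD lecR -fineD//; apply: fine_le => //; first by rewrite fin_numD !L2norm_fin.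
by apply: L2normD; [have [] := L2funP (repr u)|have [] := L2funP (repr v)].
Qed.

Let normL2Z a (u : L2) : normL2 (a *: u) = `|a| * normL2 u.
Proof.
rewrite -{1}[u]reprK -/(piL2 _) [_ *: _]scaleL2_pi /normL2 L2norm_pi.
by rewrite L2normZ ?fineM// ?rmorphM ?modulusE//; have [] := L2funP (repr u).
Qed.

Let normL20_eq0 (u : L2) : normL2 u = 0 -> u = 0.
Proof.
move=> /(complexI (x2 := 0)) u0.
have <- : piL2 0 = 0 by apply: (addrI (piL2 0)); rewrite -piL2D !addr0.
rewrite -[u]reprK -/(piL2 _); apply/L2eqP.
by rewrite subr0 inE -[L2norm _]fineK// u0.
Qed.

HB.instance Definition _ := Lmodule_isNormed.Build R[i] L2
  normL2D normL2Z normL20_eq0.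

End L2.

(* Unbounded operators on a complex normed space are given by their graphs. *)

Section operators.
Context {R : realType} {V : normedModType R[i]}.
Implicit Types (A : set (V * V)) (T : R -> V -> V).

Definition oppop A : set (V * V) := [set uv | A (uv.1, - uv.2)].

Definition bounded_operator (B : V -> V) := linear B /\ continuous B.

(* B is the bounded inverse of A - z : D(A) -> V *)
Definition is_resolvent A (z : R[i]) (B : V -> V) :=
  bounded_operator B /\ forall u f, A (u, f + z *: u) <-> u = B f.

Definition resolvent_set A : set R[i] :=
  [set z | exists B, is_resolvent A z B].

Definition spectrum A : set R[i] := ~` resolvent_set A.

Definition compact_operator (B : V -> V) :=
  compact (closure (B @` [set u | `|u| <= 1])).

Definition has_compact_resolvent A :=
  resolvent_set A !=set0 /\
  forall z B, is_resolvent A z B -> compact_operator B.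

(* Only the values T t with t >= 0 are meaningful. *)
Definition contraction_semigroup T :=
  [/\ forall t, 0 <= t -> linear (T t) /\ forall u, `|T t u| <= `|u|,
      forall u, T 0 u = u,
      forall s t u, 0 <= s -> 0 <= t -> T (s + t) u = T s (T t u)
    & forall u, T t u @[t --> 0^'+] --> u].

Definition generator T : set (V * V) :=
  [set uv | (h^-1)%:C *: (T h uv.1 - uv.1) @[h --> 0^'+] --> uv.2].

Definition generates A T := contraction_semigroup T /\ generator T = A.

End operators.

Section distributions.
Context {R : realType} (N : nat).
Local Notation X := 'cV[R]_N.

Definition partial (i : 'I_N) (phi : X -> R) (x : X) : R :=
  'D_(delta_mx i 0) phi x.

Definition smooth (phi : X -> R) := forall s : seq 'I_N,
  let g := foldr partial phi s in
  continuous g /\ forall i x, derivable g x (delta_mx i 0).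

Definition test_function (phi : X -> R) :=
  smooth phi /\ compact (closure [set x | phi x != 0]).

Definition cintegral (mu : {measure set X -> \bar R}) (f : X -> R[i]) : R[i] :=
  (\int[mu]_x complex.Re (f x))%R +i* (\int[mu]_x complex.Im (f x))%R.

(* Complex distributions, as functionals on real test functions (which determine
   them by complex linearity). Linearity and continuity are not recorded: only
   equality on test functions of distributions coming from L^2 matters. *)
Definition distr := (X -> R) -> R[i].

Definition distr_of (f : X -> R[i]) : distr :=
  fun phi => cintegral (lebesgue_cV N) (fun x => f x * (phi x)%:C).

Definition distr_partial (i : 'I_N) (F : distr) : distr :=
  fun phi => - F (partial i phi).

Definition distr_mul (g : X -> R) (F : distr) : distr :=
  fun phi => F (fun x => g x * phi x).

End distributions.

Section drift_diffusion.
Context {R : realType} (N : nat).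
Local Notation X := 'cV[R]_N.
Implicit Types S J B : 'M[R]_N.

Definition antisymmetric_mx J := J^T = - J.

Definition sym_posdef S :=
  S^T = S /\ forall x : X, x != 0 -> 0 < (x^T *m S *m x) 0 0.

Definition gauss_density S (x : X) : R :=
  Num.sqrt (\det S) / (2 * pi) `^ (N%:R / 2) *
  expR (- ((x^T *m S *m x) 0 0 / 2)).

Lemma gauss_density_ge0 S x : 0 <= gauss_density S x.
Proof. by rewrite !mulr_ge0 ?invr_ge0 ?powR_ge0 ?expR_ge0 ?sqrtr_ge0. Qed.

Lemma measurable_gauss_density S : measurable_fun setT (gauss_density S).
Proof.
apply: measurable_funM => //; apply: measurableT_comp => //.
rewrite (_ : (fun _ => _) =
  (fun x : X => - ((\sum_j (\sum_i x i 0 * S i j) * x j 0) / 2))).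
  apply: measurableT_comp => //; apply: measurable_funM => //.
  apply: measurable_sum => j; apply: measurable_funM; last exact: measurable_coord.
  apply: measurable_sum => i; apply: measurable_funM => //; exact: measurable_coord.
apply/funext => x; rewrite mxE; congr (- (_ / _)); apply: eq_bigr => j _.
by rewrite mxE; congr (_ * _); apply: eq_bigr => i _; rewrite mxE.
Qed.

Definition gauss_measure S (A : set X) : \bar R :=
  (\int[lebesgue_cV N]_(x in A) (gauss_density S x)%:E)%E.

Section gauss_measure.
Variable S : 'M[R]_N.

Let gauss0 : gauss_measure S set0 = 0%E.
Proof. exact: integral_set0. Qed.

Let gauss_ge0 A : (0 <= gauss_measure S A)%E.
Proof. by apply: integral_ge0 => x _; rewrite lee_fin gauss_density_ge0. Qed.

Let gauss_sigma_additive : semi_sigma_additive (gauss_measure S).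
Proof.
move=> /= A mA tA mUA; rewrite /gauss_measure ge0_integral_bigcup//.
- apply: is_cvg_ereal_nneg_natsum_cond => n _ _.
  by apply: integral_ge0 => /= x _; rewrite lee_fin gauss_density_ge0.
- apply/measurable_EFinP; apply: measurable_funTS.
  exact: measurable_gauss_density.
- by move=> x _; rewrite lee_fin gauss_density_ge0.
Qed.

HB.instance Definition _ := isMeasure.Build _ _ _ (gauss_measure S)
  gauss0 gauss_ge0 gauss_sigma_additive.
End gauss_measure.

Definition drift_mx S J : 'M[R]_N := (1%:M + J) *m S.

(* - (B_J x) . nabla + Delta, acting on distributions *)
Definition distr_generator S J (F : distr N) : distr N := fun phi =>
  - (\sum_i distr_mul (fun x : X => (drift_mx S J *m x) i 0)
              (distr_partial i F) phi)
  + \sum_i distr_partial i (distr_partial i F) phi.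

(* The graph of L_J: (u, v) belongs to it when u and v are in L^2(psi dx) and
   L_J u = v as distributions, so the domain is the maximal one. *)
Definition drift_diffusion S J :
    set (L2 (gauss_measure S) * L2 (gauss_measure S)) :=
  [set uv : L2 (gauss_measure S) * L2 (gauss_measure S) |
     forall phi, test_function phi ->
     distr_generator S J (distr_of uv.1) phi = distr_of uv.2 phi].

(* The library's eigenvalue refers to row eigenvectors, which gives the same
   spectrum as column ones. *)
Definition mx_spectrum B : set R[i] :=
  [set z | eigenvalue (map_mx (real_complex R) B) z].

Definition enorm (x : X) : R := Num.sqrt (\sum_i x i 0 ^+ 2).

Definition opnorm B : R := sup [set enorm (B *m x) | x in [set x | enorm x = 1]].

Definition cond_number B : R := opnorm B * opnorm (invmx B).

Definition mean S (u : L2 (gauss_measure S)) : R[i] :=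
  cintegral (lebesgue_cV N) (fun x => u x * (gauss_density S x)%:C).

(* || u - c || for a constant function c. The norm is taken at the level of
   functions; it is finite since gauss_measure S is, for S positive definite. *)
Definition dist_cst S (u : L2 (gauss_measure S)) (c : R[i]) : R :=
  fine (L2norm (gauss_measure S) (fun x => u x - c)).

End drift_diffusion.

Arguments drift_diffusion {R N} S J _.

Section extrema.
Context {R : realType}.

(* The minimum (maximum) exists, i.e. is attained, and equals m. *)
Definition is_min (E : set R) (m : R) := E m /\ lbound E m.
Definition is_max (E : set R) (m : R) := E m /\ ubound E m.
Definition min_Re (E : set R[i]) (m : R) := is_min [set complex.Re z | z in E] m.

End extrema.

(* Main.v *)
(* Factor S = U U^T. In the coordinates y = U^T x the Gaussian measure is standard,
   and on the Hermite polynomials L_J becomes the quadratic expression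
   - \sum_(k, l) A_kl a*_l a_k in the ladder operators a_k, a*_k, with
   A = U^T (1 + J) U, a matrix similar to (1 + J) S whose symmetric part U^T U is
   positive definite. Hence L_J preserves each space of homogeneous Hermite
   polynomials; it dissipates at least lam n in degree n, which gives the
   semigroup, grade by grade, and the compactness of the resolvent. Since
   [a_j, L_J] = - \sum_k A_kj a_k, derivation turns an eigenfunction of - L_J for z
   into one for z - x with x an eigenvalue of A; so the minimal real parts of the
   two spectra agree, and Tr A = Tr S bounds them by Tr S / N.

   For optimality U is rotated until all the columns of U have the squared norm
   c = Tr S / N. With weights mu_k = k, J is then chosen so that the symmetric part
   of A diag(mu) is exactly c diag(mu). The weighted norm of the gradient thus
   decays like exp(- c t), and on each space of degree n >= 1 it is n times the
   norm up to a factor in [1, N]: the decay holds with the constant sqrt N, and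
   kappa(S) >= 1. *)

From mathcomp Require Import all_boot all_order all_algebra complex.
From mathcomp Require Import ring lra zify.
From mathcomp Require Import all_classical all_reals all_analysis measurable_realfun.
Require Import Defs.
Set Implicit Arguments.
Unset Strict Implicit.
Unset Printing Implicit Defensive.
Import Order.TTheory GRing.Theory Num.Theory.
Import numFieldNormedType.Exports.
Local Open Scope classical_set_scope.
Local Open Scope ring_scope.

(** * Fock space over multi-indices *)

(** The domain is the maximal one, so the operator is known only through test functions, while all
    estimates take place on coefficients. Two facts join the sides: the Hermite polynomials are
    total, which makes the coefficients an isometry onto square summable families, and the
    distributional equation holds exactly when the coefficients satisfy the algebraic one. To read
    off coefficients, polynomials have to serve as tests, which costs a cutoff and a limit. On
    coefficients each degree is finite-dimensional, so exponentials are power series and resolvents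
    are matrix inverses; dissipation makes the bounds uniform in the degree. The decay is claimed
    for every semigroup with the given generator, hence a uniqueness argument besides the
    construction. As for J: with G = U^T U, an antisymmetric K = U^T J U has to cancel the
    off-diagonal part of the symmetrized (G + K) diag(mu), which forces K_kj = G_kj (mu_k + mu_j) /
    (mu_k - mu_j). So the weights must be distinct; and K is 0 on the diagonal, where G must
    therefore equal c already, whence the rotation of U. *)

Section multi_index.
Variable N : nat.

Definition mindex := {ffun 'I_N -> nat}.
Implicit Types (a b : mindex) (i j k l : 'I_N).

Definition msucc k a : mindex := [ffun i => a i + (i == k)]%N.
Definition mpred k a : mindex := [ffun i => a i - (i == k)]%N.
Definition mdeg a := (\sum_i a i)%N.
Definition mfact a := (\prod_i (a i)`!)%N.
Definition mzero : mindex := [ffun=> 0%N].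

(** An entry of a multi-index of degree n is at most n, so functions into ['I_n.+1] are enough to
    list the degree without repetition. *)
Definition grade n : seq mindex :=
  [seq ([ffun i => nat_of_ord (f i)] : mindex) |
     f : {ffun 'I_N -> 'I_n.+1} <- enum {: {ffun 'I_N -> 'I_n.+1}} &
       (\sum_i f i)%N == n].

Lemma mem_grade n a : (a \in grade n) = (mdeg a == n).
Proof.
apply/mapP/eqP => [[f]|an].
  rewrite mem_filter => /andP[/eqP fn _] ->.
  by rewrite /mdeg -[RHS]fn; apply: eq_bigr => i _; rewrite ffunE.
have lta i : (a i < n.+1)%N by rewrite ltnS -an /mdeg (bigD1 i)//= leq_addr.
exists [ffun i => Ordinal (lta i)]; last first.
  by apply/ffunP => i; rewrite !ffunE.
rewrite mem_filter mem_enum inE andbT; apply/eqP; rewrite -[RHS]an.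
by apply: eq_bigr => i _; rewrite ffunE.
Qed.

Lemma grade_uniq n : uniq (grade n).
Proof.
rewrite map_inj_uniq ?filter_uniq -?enumT ?enum_uniq// => f g /ffunP fg.
by apply/ffunP => i; apply: val_inj; have := fg i; rewrite !ffunE.
Qed.

Lemma msuccK k a : mpred k (msucc k a) = a.
Proof. by apply/ffunP => i; rewrite !ffunE addnK. Qed.

Lemma mpredK k a : (0 < a k)%N -> msucc k (mpred k a) = a.
Proof.
move=> ak; apply/ffunP => i; rewrite !ffunE.
by case: eqVneq => [->|_] /=; rewrite ?subnK// subn0 addn0.
Qed.

Lemma msucc_inj k : injective (msucc k).
Proof. exact: can_inj (msuccK k). Qed.

Lemma msuccC j k a : msucc j (msucc k a) = msucc k (msucc j a).
Proof. by apply/ffunP => i; rewrite !ffunE addnAC. Qed.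

Lemma msucc_pred j k a : j != k -> msucc j (mpred k a) = mpred k (msucc j a).
Proof.
move=> jk; apply/ffunP => i; rewrite !ffunE.
by case: (eqVneq i j) => [->|_]; rewrite ?(negbTE jk) ?addn0 ?subn0.
Qed.

Lemma mdeg_succ k a : mdeg (msucc k a) = (mdeg a).+1.
Proof.
rewrite /mdeg (bigD1 k)//= [in RHS](bigD1 k)//= ffunE eqxx addn1 addSn.
by congr (_ + _).+1; apply: eq_bigr => i /negbTE ik; rewrite ffunE ik addn0.
Qed.

Lemma mdeg_pred k a : (0 < a k)%N -> mdeg a = (mdeg (mpred k a)).+1.
Proof. by move=> ak; rewrite -{1}(mpredK ak) mdeg_succ. Qed.

Lemma mdeg_mzero : mdeg mzero = 0%N.
Proof. by rewrite /mdeg big1// => i _; rewrite ffunE. Qed.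

Lemma mdeg_eq0 a : (mdeg a == 0)%N = (a == mzero).
Proof.
apply/idP/eqP => [|->]; last by rewrite mdeg_mzero.
rewrite /mdeg sum_nat_eq0 => /forallP a0; apply/ffunP => i.
by rewrite ffunE; exact/eqP/a0.
Qed.

Lemma mfact_succ k a : mfact (msucc k a) = ((a k).+1 * mfact a)%N.
Proof.
rewrite /mfact (bigD1 k)//= [in RHS](bigD1 k)//= ffunE eqxx addn1 factS mulnA.
by congr (_ * _)%N; apply: eq_bigr => i /negbTE ik; rewrite ffunE ik addn0.
Qed.

Lemma mfact_gt0 a : (0 < mfact a)%N.
Proof. by rewrite prodn_gt0// => i; exact: fact_gt0. Qed.

(** Raising the k-th entry is injective and misses only the multi-indices whose k-th entry is 0.
    This reindexing makes [ann k] and [cre k] adjoint. *)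
Lemma big_grade_succ (R : nmodType) n k (F : mindex -> R) :
  \sum_(a <- grade n.+1 | (0 < a k)%N) F a = \sum_(b <- grade n) F (msucc k b).
Proof.
rewrite -big_filter -(big_map (msucc k) predT F); apply: perm_big.
apply: uniq_perm; first by rewrite filter_uniq// grade_uniq.
  by rewrite map_inj_uniq ?grade_uniq//; exact: msucc_inj.
move=> a; rewrite mem_filter mem_grade; apply/andP/mapP => [[ak /eqP an]|[b]].
  by exists (mpred k a); rewrite ?mpredK// mem_grade -eqSS -(mdeg_pred ak) an.
by rewrite mem_grade => /eqP bn ->; rewrite mdeg_succ bn ffunE eqxx addn1.
Qed.

End multi_index.
Arguments mzero {N}.

(* c : mindex N -> F stands for the formal sum of the c a *: H_a, where H_a is
   the product of the Hermite polynomials of degrees a i. [ann k] is then the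
   derivation along the k-th coordinate, [cre k] its Gaussian adjoint, and
   [ip n] the scalar product of the components of degree n. *)
Section fock.
Variables (N : nat) (F : comNzRingType).
Implicit Types (c d : mindex N -> F) (a b : mindex N) (A : 'M[F]_N).

Definition ann k c b : F := (b k).+1%:R * c (msucc k b).
Definition cre k c b : F := if (0 < b k)%N then c (mpred k b) else 0.
Definition gen A c b : F := - \sum_k \sum_l A k l * cre l (ann k c) b.
Definition ip n c d : F := \sum_(a <- grade N n) (mfact a)%:R * (c a * d a).

(** Canonical commutation relation. For j = l the factor b_j + 1 of the derivative splits into b_j,
    which goes with the lowered index, and 1, which is the commutator. *)
Lemma ann_cre j l c b :
  ann j (cre l c) b = cre l (ann j c) b + (j == l)%:R * c b.
Proof.
rewrite /ann /cre ffunE eq_sym; have [->|jl] := eqVneq l j.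
  rewrite addn1 /= msuccK; case: ifP => [bj|]; last first.
    by case: (b j) => // _; rewrite add0r.
  rewrite mpredK// ffunE eqxx subn1 prednK// -[in LHS]addn1 natrD mulrDl.
  by rewrite !mul1r.
rewrite addn0 mul0r addr0; case: ifP => _; last by rewrite mulr0.
rewrite msucc_pred 1?eq_sym// ffunE.
by rewrite eq_sym (negbTE jl) subn0.
Qed.

Lemma annC j k c b : ann j (ann k c) b = ann k (ann j c) b.
Proof.
rewrite /ann !ffunE msuccC mulrCA !mulrA; congr (_ * _).
by rewrite [j == k]eq_sym; case: eqVneq => [->|_]; rewrite ?addn0 mulrC.
Qed.

(** The number operator. *)
Lemma sum_cre_ann c b : \sum_k cre k (ann k c) b = (mdeg b)%:R * c b.
Proof.
rewrite /mdeg natr_sum mulr_suml; apply: eq_bigr => k _; rewrite /cre /ann.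
case: ifP => bk; first by rewrite mpredK// ffunE eqxx subn1 prednK.
by move: bk; case: (b k) => //; rewrite mul0r.
Qed.

Lemma eq_ann k c d : c =1 d -> ann k c =1 ann k d.
Proof. by move=> cd b; rewrite /ann cd. Qed.

Lemma eq_cre k c d : c =1 d -> cre k c =1 cre k d.
Proof. by move=> cd b; rewrite /cre cd. Qed.

Lemma eq_gen A c d : c =1 d -> gen A c =1 gen A d.
Proof.
move=> cd b; congr (- _); apply: eq_bigr => k _; apply: eq_bigr => l _.
by congr (_ * _); apply/eq_cre/eq_ann.
Qed.

Lemma ann_lin k x c d b :
  ann k (fun a => x * c a + d a) b = x * ann k c b + ann k d b.
Proof. by rewrite /ann; ring. Qed.

Lemma cre_lin k x c d b :
  cre k (fun a => x * c a + d a) b = x * cre k c b + cre k d b.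
Proof. by rewrite /cre; case: ifP => _ //; rewrite mulr0 addr0. Qed.

Lemma gen_lin A x c d b :
  gen A (fun a => x * c a + d a) b = x * gen A c b + gen A d b.
Proof.
rewrite /gen mulrN mulr_sumr -opprD -big_split; congr (- _).
apply: eq_bigr => k _ /=; rewrite mulr_sumr -big_split; apply: eq_bigr => l _ /=.
have /eq_cre -> : ann k (fun a => x * c a + d a) =1
  (fun a => x * ann k c a + ann k d a) by move=> ?; exact: ann_lin.
by rewrite cre_lin; ring.
Qed.

Lemma gen0 A b : gen A (fun=> 0) b = 0.
Proof.
rewrite /gen big1 ?oppr0// => k _; rewrite big1// => l _.
by rewrite /cre /ann; case: ifP; rewrite ?mulr0.
Qed.

Lemma gen_sum A (I : Type) (r : seq I) (c : I -> mindex N -> F) x b :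
  gen A (fun a => \sum_(i <- r) x i * c i a) b = \sum_(i <- r) x i * gen A (c i) b.
Proof.
elim: r => [|i r ih].
  by rewrite big_nil (@eq_gen A _ (fun=> 0)) ?gen0// => a; rewrite big_nil.
rewrite big_cons -ih -gen_lin; apply: eq_gen => a; by rewrite big_cons.
Qed.

(** By [ann_cre], [ann j] fails to commute with [gen A] only through the factor [cre j], which
    leaves first derivatives. The gradient of a solution thus solves the same equation with an added
    matrix term; both the location of the spectrum and the decay rate come from it. *)
Lemma ann_gen A j c b :
  ann j (gen A c) b = gen A (ann j c) b - \sum_k A k j * ann k c b.
Proof.
rewrite /gen -opprD -big_split /= {1}/ann mulrN mulr_sumr; congr (- _).
apply: eq_bigr => k _; rewrite mulr_sumr.
transitivity (\sum_l (A k l * cre l (ann k (ann j c)) b +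
  A k l * (j == l)%:R * ann k c b)).
  apply: eq_bigr => l _; rewrite mulrCA -/(ann j (cre l (ann k c)) b) ann_cre.
  by rewrite (@eq_cre l _ (ann k (ann j c)))//; [ring|move=> ?; exact: annC].
rewrite big_split; congr (_ + _) => /=; rewrite (bigD1 j)//= eqxx mulr1.
by rewrite big1 ?addr0// => l /negbTE; rewrite eq_sym => ->; rewrite mulr0 mul0r.
Qed.

Lemma ipC n c d : ip n c d = ip n d c.
Proof. by apply: eq_bigr => a _; rewrite [c a * _]mulrC. Qed.

Lemma eq_ip n c c' d d' : c =1 c' -> d =1 d' -> ip n c d = ip n c' d'.
Proof. by move=> cc dd; apply: eq_bigr => a _; rewrite cc dd. Qed.

Lemma ip_sumr (I : Type) (r : seq I) (x : I -> F) (d : I -> mindex N -> F) n c :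
  ip n c (fun a => \sum_(i <- r) x i * d i a) = \sum_(i <- r) x i * ip n c (d i).
Proof.
rewrite /ip; under [RHS]eq_bigr do rewrite mulr_sumr; rewrite exchange_big.
apply: eq_bigr => a _; rewrite !mulr_sumr; apply: eq_bigr => i _; ring.
Qed.

Lemma ip_creL n k c d : ip n.+1 (cre k c) d = ip n c (ann k d).
Proof.
rewrite /ip (bigID (fun a : mindex N => (0 < a k)%N))/= [X in _ + X]big1 ?addr0.
  rewrite (big_grade_succ _ _ (fun a => (mfact a)%:R * (cre k c a * d a))).
  apply: eq_bigr => b _; rewrite /cre /ann ffunE eqxx addn1/= msuccK mfact_succ.
  by rewrite natrM; ring.
by move=> a /negbTE ak; rewrite /cre ak mul0r mulr0.
Qed.

Lemma gen_grade0 A c : gen A c mzero = 0.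
Proof.
rewrite /gen big1 ?oppr0// => k _; rewrite big1// => l _.
by rewrite /cre ffunE/= mulr0.
Qed.

(** [cre l] moves to the other argument as [ann l]: the form of [gen A] involves only gradients,
    whose degree is one less. *)
Lemma ip_gen A n c d :
  ip n.+1 d (gen A c) = - \sum_k \sum_l A k l * ip n (ann k c) (ann l d).
Proof.
rewrite -[LHS]opprK; congr (- _).
have -> : - ip n.+1 d (gen A c) = ip n.+1 d
    (fun a => \sum_k 1 * (\sum_l A k l * cre l (ann k c) a)).
  rewrite /ip -sumrN; apply: eq_bigr => a _; rewrite /gen; under [in RHS]eq_bigr do rewrite mul1r.
  by rewrite mulrN mulrN opprK.
rewrite ip_sumr; apply: eq_bigr => k _; rewrite mul1r ip_sumr.
by apply: eq_bigr => l _; rewrite ipC ip_creL.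
Qed.

(** This is [sum_cre_ann] in weak form; through it, coercivity of A yields a dissipation that grows
    linearly with the degree. *)
Lemma sum_ip_ann n c d : \sum_k ip n (ann k c) (ann k d) = n.+1%:R * ip n.+1 c d.
Proof.
under eq_bigr do rewrite -ip_creL; rewrite /ip exchange_big mulr_sumr/=.
rewrite big_seq [RHS]big_seq; apply: eq_bigr => a; rewrite mem_grade => /eqP an.
by rewrite -mulr_sumr -mulr_suml sum_cre_ann an; ring.
Qed.

End fock.

Section fock_order.
Variables (N : nat) (R : realFieldType).
Implicit Types (c d : mindex N -> R) (A : 'M[R]_N).

Definition coercive_mx (lam : R) A :=
  forall x : 'I_N -> R, lam * \sum_k x k ^+ 2 <= \sum_k \sum_l A k l * (x k * x l).

(** In matrix form: the symmetric part of A diag(mu) dominates c0 diag(mu). For mu = 1 it is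
    coercivity with constant c0; the freedom in mu lets c0 reach the mean of the eigenvalues of
    A. *)
Definition lyapunov_mx (mu : 'I_N -> R) (c0 : R) A :=
  forall x : 'I_N -> R, c0 * \sum_k mu k * x k ^+ 2 <=
     \sum_j \sum_k mu j * A k j * (x j * x k).

Lemma ip_ge0 n c : 0 <= ip n c c.
Proof. by apply: sumr_ge0 => a _; rewrite mulr_ge0// -expr2 sqr_ge0. Qed.

Lemma ip_eq0 n c : ip n c c = 0 -> forall a, mdeg a = n -> c a = 0.
Proof.
rewrite /ip big_seq => /eqP; rewrite psumr_eq0; last first.
  by move=> a _; rewrite mulr_ge0// -expr2 sqr_ge0.
move=> /allP c0 a /eqP an; have /c0 : a \in grade N n by rewrite mem_grade.
rewrite mem_grade an /= mulf_eq0 pnatr_eq0 gtn_eqF ?mfact_gt0//= mulf_eq0 orbb.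
by move=> /eqP.
Qed.

(** The sum over multi-indices is brought outside, so that an inequality between quadratic forms on
    R^N can be applied to the vector of the [d k a], one a at a time. *)
Lemma ip_sum_quad n (M : 'I_N -> 'I_N -> R) (d : 'I_N -> mindex N -> R) :
  \sum_k \sum_l M k l * ip n (d k) (d l) =
  \sum_(a <- grade N n) (mfact a)%:R * \sum_k \sum_l M k l * (d k a * d l a).
Proof.
rewrite /ip; under eq_bigr do under eq_bigr do rewrite mulr_sumr.
under eq_bigr do rewrite exchange_big /=; rewrite exchange_big/=.
apply: eq_bigr => a _; rewrite mulr_sumr; apply: eq_bigr => k _.
by rewrite mulr_sumr; apply: eq_bigr => l _; ring.
Qed.

Lemma ip_gen_le lam A n c : coercive_mx lam A ->
  ip n.+1 c (gen A c) <= - (lam * n.+1%:R) * ip n.+1 c c.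
Proof.
move=> cA; rewrite ip_gen mulNr lerN2 -mulrA -sum_ip_ann.
rewrite (ip_sum_quad n (fun k l => A k l) (fun k => ann k c)) /ip exchange_big/=.
rewrite mulr_sumr; apply: ler_sum => a _.
rewrite -mulr_sumr mulrCA ler_wpM2l//; apply: le_trans (cA _).
by rewrite le_eqVlt; apply/orP; left; apply/eqP; congr (_ * _); apply: eq_bigr.
Qed.

Lemma ip_gen_le0 lam A n c : 0 <= lam -> coercive_mx lam A ->
  ip n c (gen A c) <= 0.
Proof.
move=> lam0 cA; case: n => [|n].
  rewrite /ip big_seq big1// => a; rewrite mem_grade mdeg_eq0 => /eqP ->.
  by rewrite gen_grade0 !mulr0.
by apply: le_trans (ip_gen_le _ _ cA) _; rewrite mulNr oppr_le0 !mulr_ge0// ip_ge0.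
Qed.

(* Norm of the weighted gradient. For non-symmetric A the norm [ip n.+1] need not
   contract at the rate given by the spectrum of A; this one does, as the drift
   acts on the gradient through the transpose of A (lemma ann_gen). *)
Definition wip (mu : 'I_N -> R) n c d : R := \sum_j mu j * ip n (ann j c) (ann j d).

(** By [ann_gen] the form splits into the dissipation of the components of the gradient, which has a
    sign, and the quadratic form of A diag(mu) at the gradient, which [lyapunov_mx] bounds. *)
Lemma wip_gen_le lam mu (c0 : R) A n c : 0 <= lam -> coercive_mx lam A ->
  (forall j, 0 <= mu j) -> lyapunov_mx mu c0 A ->
  wip mu n c (gen A c) <= - c0 * wip mu n c c.
Proof.
move=> lam0 cA mu0 lA.
have -> : wip mu n c (gen A c) = \sum_j mu j * ip n (ann j c) (gen A (ann j c))
    - \sum_j \sum_k mu j * A k j * ip n (ann j c) (ann k c).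
  rewrite -sumrB; apply: eq_bigr => j _.
  transitivity (mu j * (ip n (ann j c) (gen A (ann j c)) -
      ip n (ann j c) (fun b => \sum_k A k j * ann k c b))).
    congr (_ * _); rewrite /ip -sumrB; apply: eq_bigr => a _.
    by rewrite ann_gen; ring.
  rewrite mulrBr ip_sumr; congr (_ - _); rewrite mulr_sumr.
  by apply: eq_bigr => k _; rewrite mulrA.
have h1 : \sum_j mu j * ip n (ann j c) (gen A (ann j c)) <= 0.
  by apply: sumr_le0 => j _; rewrite mulr_ge0_le0// (ip_gen_le0 _ _ lam0 cA).
suff : c0 * wip mu n c c <= \sum_j \sum_k mu j * A k j * ip n (ann j c) (ann k c).
  lra.
rewrite (ip_sum_quad n (fun j k => mu j * A k j) (fun k => ann k c)).
rewrite /wip /ip; under eq_bigr do rewrite mulr_sumr; rewrite exchange_big/=.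
rewrite mulr_sumr; apply: ler_sum => a _.
apply: le_trans (ler_wpM2l _ (lA (fun k => ann k c a))) => //.
rewrite mulrCA le_eqVlt; apply/orP; left; apply/eqP; congr (_ * _).
by rewrite mulr_sumr; apply: eq_bigr => k _; ring.
Qed.

Lemma wip_ge mu n c (m : R) : (forall j, m <= mu j) ->
  m * n.+1%:R * ip n.+1 c c <= wip mu n c c.
Proof.
move=> mmu; rewrite -mulrA -sum_ip_ann mulr_sumr; apply: ler_sum => j _.
by rewrite ler_wpM2r// ip_ge0.
Qed.

Lemma wip_le mu n c (m : R) : (forall j, mu j <= m) ->
  wip mu n c c <= m * n.+1%:R * ip n.+1 c c.
Proof.
move=> mmu; rewrite -mulrA -sum_ip_ann mulr_sumr; apply: ler_sum => j _.
by rewrite ler_wpM2r// ip_ge0.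
Qed.

End fock_order.

Section fock_complex.
Variables (N : nat) (R : rcfType).
Local Notation C := R[i].
Local Notation toC := (map_mx (real_complex R)).
Implicit Types (d : mindex N -> C) (A : 'M[R]_N).

Lemma Re_rM (x : R) (z : C) : complex.Re (x%:C * z)%C = x * complex.Re z.
Proof. by case: z => a b /=; rewrite mul0r subr0. Qed.

Lemma Im_rM (x : R) (z : C) : complex.Im (x%:C * z)%C = x * complex.Im z.
Proof. by case: z => a b /=; rewrite mul0r addr0. Qed.

Lemma natC (n : nat) : n%:R = (n%:R : R)%:C%C :> C.
Proof. by rewrite rmorph_nat. Qed.

Lemma Re_gen A d b : complex.Re (gen (toC A) d b) =
  gen A (fun a => complex.Re (d a)) b.
Proof.
rewrite /gen raddfN raddf_sum; congr (- _); apply: eq_bigr => k _.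
rewrite raddf_sum; apply: eq_bigr => l _ /=; rewrite mxE Re_rM; congr (_ * _).
by rewrite /cre /ann; case: ifP => // _; rewrite natC Re_rM.
Qed.

Lemma Im_gen A d b : complex.Im (gen (toC A) d b) =
  gen A (fun a => complex.Im (d a)) b.
Proof.
rewrite /gen raddfN raddf_sum; congr (- _); apply: eq_bigr => k _.
rewrite raddf_sum; apply: eq_bigr => l _ /=; rewrite mxE Im_rM; congr (_ * _).
by rewrite /cre /ann; case: ifP => // _; rewrite natC Im_rM.
Qed.

Definition cnorm2 n d : R :=
  ip n (fun a => complex.Re (d a)) (fun a => complex.Re (d a)) +
  ip n (fun a => complex.Im (d a)) (fun a => complex.Im (d a)).

Lemma cnorm2_ge0 n d : 0 <= cnorm2 n d.
Proof. by rewrite addr_ge0// ip_ge0. Qed.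

Lemma cnorm2_eq0 n d : cnorm2 n d = 0 -> forall a, mdeg a = n -> d a = 0.
Proof.
move=> /eqP; rewrite paddr_eq0 ?ip_ge0// => /andP[/eqP d1 /eqP d2] a an.
have := ip_eq0 d1 an; have := ip_eq0 d2 an; by case: (d a) => x y /= -> ->.
Qed.

Lemma eq_cnorm2 n d d' : (forall a, mdeg a = n -> d a = d' a) ->
  cnorm2 n d = cnorm2 n d'.
Proof.
move=> dd; rewrite /cnorm2 /ip; congr (_ + _); rewrite big_seq [RHS]big_seq;
by apply: eq_bigr => a; rewrite mem_grade => /eqP/dd ->.
Qed.

(** Each step down is followed by a step up, so [gen] preserves the degree. *)
Lemma gen_local A d d' b : (forall a, mdeg a = mdeg b -> d a = d' a) ->
  gen (toC A) d b = gen (toC A) d' b.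
Proof.
move=> dd; congr (- _); apply: eq_bigr => k _; apply: eq_bigr => l _.
rewrite /cre /ann; case: ifP => // bl; rewrite dd// mdeg_succ.
by rewrite (mdeg_pred bl).
Qed.

(** The equation is paired with the component of d of degree [mdeg b], which is not zero;
    dissipation in that degree then bounds Re nu. *)
Lemma eigen_gen_Re A d lam (nu : C) b : 0 <= lam -> coercive_mx lam A ->
  (forall a, gen (toC A) d a = nu * d a) -> d b != 0 ->
  complex.Re nu <= - (lam * (mdeg b)%:R).
Proof.
move=> lam0 cA dn db; set n := mdeg b.
have ->: - (lam * n%:R) = - lam * n%:R by rewrite mulNr.
have npos : 0 < cnorm2 n d.
  rewrite lt_neqAle cnorm2_ge0 andbT eq_sym; apply: contra db => /eqP n0.
  by rewrite (cnorm2_eq0 n0).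
rewrite -(ler_pM2r npos).
have cA' e : ip n e (gen A e) <= - lam * n%:R * ip n e e.
  clear npos; case: n => [|m]; first by rewrite mulr0 mul0r (ip_gen_le0 _ _ lam0).
  by rewrite mulNr; exact: ip_gen_le.
have := lerD (cA' (fun a => complex.Re (d a))) (cA' (fun a => complex.Im (d a))).
rewrite -mulrDr; apply: le_trans; rewrite le_eqVlt; apply/orP; left; apply/eqP.
rewrite /cnorm2 /ip -!big_split/= mulr_sumr; apply: eq_bigr => a _.
rewrite -Re_gen -Im_gen dn; case: nu {dn} => x y; case: (d a) => u v /=; ring.
Qed.

(* If d is an eigenfunction for - z, its gradient W satisfies this equation. W is
   multiplied by the factors of char_poly A until the product vanishes: the last
   nonzero one is a (left) eigenvector of A for x at each multi-index. *)
Lemma eigen_descend A (rs : seq C) (z : C) (W : mindex N -> 'rV[C]_N) :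
  (forall b j, gen (toC A) (fun a => W a 0 j) b =
     (W b *m toC A) 0 j - z * W b 0 j) ->
  (exists b, W b != 0) ->
  (forall b, W b *m foldr (fun x M => (toC A - x%:M) *m M) 1%:M rs = 0) ->
  exists2 x, x \in rs &
    exists2 d, (forall b, gen (toC A) d b = (x - z) * d b) & exists b, d b != 0.
Proof.
elim: rs W => [W _ [b Wb] /(_ b)/=|x rs ih W gW [b Wb] W0].
  by rewrite mulmx1 => W0; rewrite W0 eqxx in Wb.
pose W' a := W a *m (toC A - x%:M).
have [[b' Wb']|nW'] := pselect (exists b', W' b' != 0).
  have [||a|y yrs [d d1 d2]] := ih W'.
  - move=> a j.
    transitivity (gen (toC A) (fun c => \sum_k (toC A - x%:M) k j * W c 0 k) a).
      apply: eq_gen => c; rewrite mxE; apply: eq_bigr => k _; exact: mulrC.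
    rewrite gen_sum; under eq_bigr do rewrite gW mulrBr.
    rewrite sumrB; congr (_ - _); last first.
      rewrite mxE mulr_sumr; apply: eq_bigr => k _; ring.
    rewrite /W' -mulmxA.
    have -> : (toC A - x%:M) *m toC A = toC A *m (toC A - x%:M).
      by rewrite mulmxBl mulmxBr scalar_mxC.
    by rewrite mulmxA mxE; apply: eq_bigr => k _; exact: mulrC.
  - by exists b'.
  - by rewrite -mulmxA W0.
  - by exists y; [rewrite inE yrs orbT|exists d].
have [j Wbj] : exists j, W b 0 j != 0.
  apply: contrapT => h; move/negP: Wb; apply; apply/eqP/rowP => j; rewrite mxE.
  by apply: contrapT => /eqP Wj; apply: h; exists j.
exists x; rewrite ?mem_head//; exists (fun a => W a 0 j); last by exists b.
move=> a; rewrite gW.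
have : W' a = 0 by apply: contrapT => /eqP Wa; apply: nW'; exists a.
rewrite /W' mulmxBr => /eqP; rewrite subr_eq0 => /eqP ->.
by rewrite mul_mx_scalar mxE mulrBl.
Qed.

(** A form of [ann_gen] which shows that the gradient of an eigenfunction satisfies the hypothesis
    of [eigen_descend]. *)
Lemma eigen_ann A (z : C) d : (forall a, gen (toC A) d a = z * d a) ->
  forall b j, gen (toC A) (fun a => ann j d a) b =
    ((\row_j ann j d b) *m toC A) 0 j + z * ann j d b.
Proof.
move=> dz b j.
have -> : z * ann j d b = ann j (gen (toC A) d) b by rewrite /ann dz mulrCA.
have -> : ((\row_j ann j d b) *m toC A) 0 j = \sum_k toC A k j * ann k d b.
  by rewrite mxE; apply: eq_bigr => k _; rewrite mxE mulrC.
by rewrite ann_gen addrC subrK.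
Qed.

End fock_complex.

(** * Eigenvalues of the matrix and eigenvalues on formal series *)

Section spectrum_mx.
Variables (n : nat) (R : realType).
Local Notation N := n.+1.
Local Notation C := R[i].
Local Notation toC := (map_mx (real_complex R)).
Implicit Types (d : mindex N -> C) (A : 'M[R]_N).

Lemma char_poly_roots A : exists2 rs : seq C, size rs = N &
  char_poly (toC A) = \prod_(x <- rs) ('X - x%:P).
Proof.
have [rs def] := closed_field_poly_normal (char_poly (toC A)).
move: def; rewrite (monicP (char_poly_monic _)) scale1r => def; exists rs => //.
have := size_char_poly (toC A); rewrite def size_prod_XsubC.
by case.
Qed.

Lemma root_mx_spectrum A (rs : seq C) :
  char_poly (toC A) = \prod_(x <- rs) ('X - x%:P) ->
  forall x, (x \in rs) <-> mx_spectrum A x.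
Proof.
by move=> def x; rewrite /mx_spectrum /= eigenvalue_root_char def root_prod_XsubC.
Qed.

Lemma seq_argmin (T : eqType) (f : T -> R) (s : seq T) : s != [::] ->
  exists2 x, x \in s & forall y, y \in s -> f x <= f y.
Proof.
elim: s => // a [|b s] ih _; first by exists a; rewrite ?mem_head// => y; rewrite inE => /eqP ->.
have [//|x xs xmin] := ih; have [ax|xa] := leP (f a) (f x).
  exists a; rewrite ?mem_head// => y; rewrite inE => /orP[/eqP ->//|/xmin].
  exact: le_trans.
exists x; first by rewrite inE xs orbT.
move=> y; rewrite inE => /orP[/eqP ->|/xmin//]; exact: ltW.
Qed.

(** The trace is the sum of the N roots of the characteristic polynomial, and the least real part is
    at most their average. *)
Lemma min_Re_mx_spectrum A : exists2 m, min_Re (mx_spectrum A) m &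
  m <= \tr A / N%:R.
Proof.
have [rs srs def] := char_poly_roots A.
have rs0 : rs != [::] by rewrite -size_eq0 srs.
have [x xrs xmin] := seq_argmin (fun z : C => complex.Re z) rs0.
exists (complex.Re x).
  split; first by exists x => //; apply/(root_mx_spectrum def).
  by move=> _ [y /(root_mx_spectrum def) yrs <-]; exact: xmin.
have trA : \tr (toC A) = \sum_(z <- rs) z.
  apply: oppr_inj; rewrite -coefPn_prod_XsubC -?def ?srs// char_poly_trace//.
have : \tr A = \sum_(z <- rs) complex.Re z.
  rewrite -raddf_sum -trA /mxtrace raddf_sum; apply: eq_bigr => i _.
  by rewrite mxE.
move=> ->; rewrite ler_pdivlMr ?ltr0n// -srs -sum1_size natr_sum mulr_sumr.
rewrite big_seq [leRHS]big_seq; apply: ler_sum => z zrs.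
by rewrite mulr1 xmin.
Qed.

(** An eigenfunction with a component of positive degree has a nonzero gradient; by Cayley-Hamilton
    [eigen_descend] applies to it, with the eigenvalues of A as the list of roots. *)
Lemma eigen_gen_mx_spectrum A d lam z : 0 <= lam -> coercive_mx lam A ->
  (forall a, gen (toC A) d a = - z * d a) ->
  (exists2 a, mdeg a != 0%N & d a != 0) ->
  exists2 x, mx_spectrum A x & complex.Re x <= complex.Re z.
Proof.
move=> lam0 cA dz [a a0 da]; have [rs srs def] := char_poly_roots A.
have [|||x xrs [e e1 [b eb]]] :=
  @eigen_descend N R A rs z (fun b => \row_j ann j d b).
- move=> b j; rewrite [in X in _ - X]mxE -mulNr -(eigen_ann dz b j).
  by apply: eq_gen => c; rewrite mxE.
- have [k ak] : exists k, (0 < a k)%N.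
    apply: contrapT => h; move/negP: a0; apply; rewrite mdeg_eq0; apply/eqP.
    apply/ffunP => k; rewrite ffunE; apply/eqP; rewrite -leqn0 leqNgt.
    by apply/negP => ak; apply: h; exists k.
  exists (mpred k a); apply/negP => /eqP/rowP/(_ k)/eqP; rewrite !mxE /ann mpredK//.
  by rewrite mulf_eq0 (negbTE da) pnatr_eq0.
- move=> b.
  suff -> : foldr (fun x M => (toC A - x%:M) *m M) 1%:M rs =
      horner_mx (toC A) (\prod_(x <- rs) ('X - x%:P)).
    by rewrite -def Cayley_Hamilton mulmx0.
  elim: (rs) => [|y s ih] /=; first by rewrite big_nil [RHS]rmorph1.
  by rewrite big_cons rmorphM/= ih rmorphB/= horner_mx_X horner_mx_C.
exists x; first exact/(root_mx_spectrum def).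
(* e is an eigenfunction of [gen] for x - z, whose real part dissipation makes nonpositive. *)
have := eigen_gen_Re lam0 cA e1 eb; rewrite raddfB/= lerBlDr => /le_trans; apply.
by rewrite gerDr oppr_le0 mulr_ge0.
Qed.

(** A left eigenvector v of A, read as the linear form with coefficients v, is an eigenfunction of
    degree one. *)
Lemma mx_spectrum_eigen_gen A z : mx_spectrum A z ->
  exists2 d, (forall a, gen (toC A) d a = - z * d a) &
    (forall a, mdeg a != 1%N -> d a = 0) /\
    (exists2 a, mdeg a = 1%N & d a != 0).
Proof.
move=> /eigenvalueP[v vA v0].
have [k vk] : exists k, v 0 k != 0.
  apply: contrapT => h; move/negP: v0; apply; apply/eqP/rowP => j; rewrite mxE.
  by apply: contrapT => /eqP Wj; apply: h; exists j.
(* In degree one a single entry of a is 1, say the l-th, and the sum is v_l. *)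
pose d a : C := if mdeg a == 1%N then \sum_k (a k)%:R * v 0 k else 0.
have dsucc l : d (msucc l mzero) = v 0 l.
  rewrite /d mdeg_succ mdeg_mzero eqxx (bigD1 l)//= big1 ?addr0.
    by rewrite !ffunE eqxx mul1r.
  by move=> i /negbTE il; rewrite !ffunE il mul0r.
exists d; last first.
  split=> [a /negbTE a1|]; first by rewrite /d a1.
  by exists (msucc k mzero); rewrite ?dsucc// mdeg_succ mdeg_mzero.
move=> a; have [a1|a1] := eqVneq (mdeg a) 1%N; last first.
  rewrite {2}/d (negbTE a1) mulr0; rewrite (@gen_local _ _ _ _ (fun=> 0)) ?gen0//.
  by move=> b ba; rewrite /d ba (negbTE a1).
have al l : (0 < a l)%N -> a = msucc l mzero.
  move=> al; rewrite -(mpredK al); congr msucc; apply/eqP; rewrite -mdeg_eq0.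
  by move: (mdeg_pred al); rewrite a1 => -[<-].
have [l0 al0] : exists l, (0 < a l)%N.
  apply: contrapT => h; have /eqP : mdeg a = 0%N; last by rewrite a1.
  apply/eqP; rewrite mdeg_eq0; apply/eqP/ffunP => k'; rewrite ffunE; apply/eqP.
  by rewrite -leqn0 leqNgt; apply/negP => ak; apply: h; exists k'.
have ea := al _ al0; rewrite {2}ea dsucc.
rewrite /gen mulNr; congr (- _).
transitivity (\sum_k toC A k l0 * v 0 k); last first.
  have /rowP/(_ l0) := vA; rewrite !mxE => <-; apply: eq_bigr => j _.
  exact: mulrC.
apply: eq_bigr => j _; rewrite (bigD1 l0)//= big1 ?addr0.
  rewrite /cre al0 ea msuccK /ann dsucc ffunE mul1r//.
move=> l ll; rewrite /cre ea !ffunE (negbTE ll) mulr0//.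
Qed.

End spectrum_mx.

(** * Drift matrices *)

Section posdef.
Variable R : realType.

(** Lagrange's identity: twice the difference of the two sides is a double sum of squares. *)
Lemma cauchy_schwarz_sum (I : Type) (r : seq I) (a b : I -> R) :
  (\sum_(i <- r) a i * b i) ^+ 2 <=
  (\sum_(i <- r) a i ^+ 2) * (\sum_(i <- r) b i ^+ 2).
Proof.
have : 0 <= \sum_(i <- r) \sum_(j <- r) (a i * b j - a j * b i) ^+ 2.
  by apply: sumr_ge0 => i _; apply: sumr_ge0 => j _; exact: sqr_ge0.
have -> : \sum_(i <- r) \sum_(j <- r) (a i * b j - a j * b i) ^+ 2 =
    \sum_(i <- r) \sum_(j <- r) (a i ^+ 2 * b j ^+ 2) + \sum_(i <- r) \sum_(j <- r) (a j ^+ 2 * b i ^+ 2)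
    - 2 * \sum_(i <- r) \sum_(j <- r) (a i * b i) * (a j * b j).
  rewrite mulr_sumr -big_split -sumrB/=; apply: eq_bigr => i _.
  rewrite mulr_sumr -big_split -sumrB/=; apply: eq_bigr => j _; ring.
rewrite [X in _ + X - _]exchange_big/=.
have e (f g : I -> R) : \sum_(i <- r) \sum_(j <- r) f i * g j = (\sum_(i <- r) f i) * (\sum_(j <- r) g j).
  by rewrite mulr_suml; apply: eq_bigr => i _; rewrite mulr_sumr.
by rewrite !e -expr2; lra.
Qed.

Lemma quad_mxE n (A : 'M[R]_n) (x : 'cV[R]_n) :
  (x^T *m A *m x) 0 0 = \sum_k \sum_l A k l * (x k 0 * x l 0).
Proof.
rewrite mxE exchange_big; apply: eq_bigr => l _ /=; rewrite mxE mulr_suml.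
by apply: eq_bigr => k _; rewrite mxE; ring.
Qed.

Lemma norm_mxE m n (U : 'M[R]_(m, n)) (x : 'cV[R]_n) :
  (x^T *m (U^T *m U) *m x) 0 0 = \sum_i (U *m x) i 0 ^+ 2.
Proof.
have -> : x^T *m (U^T *m U) *m x = (U *m x)^T *m (U *m x).
  by rewrite trmx_mul !mulmxA.
by rewrite mxE; apply: eq_bigr => i _; rewrite mxE expr2.
Qed.

(** One step of symmetric Gaussian elimination: s is the pivot and D the Schur complement. Both the
    factorization of S and the Gaussian integral are inductions on it. *)
Lemma posdef_schur n (S : 'M[R]_(1 + n)) : sym_posdef S ->
  exists s (w : 'cV[R]_n) (D : 'M[R]_n), [/\ 0 < s, sym_posdef D &
   S = block_mx 1%:M 0 w 1%:M *m block_mx s%:M 0 0 D *m (block_mx 1%:M 0 w 1%:M)^T].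
Proof.
move=> [Ssym Spos]; pose s := S 0 0.
have ulS : ulsubmx S = s%:M.
  rewrite [ulsubmx S]mx11_scalar; congr (_%:M); rewrite !mxE.
  by congr (S _ _); apply: val_inj.
have dlS : ursubmx S = (dlsubmx S)^T.
  by rewrite trmx_dlsub Ssym.
have s0 : 0 < s.
  have := Spos (delta_mx 0 0); rewrite trmx_delta -rowE -colE !mxE; apply.
  by apply/negP => /eqP/matrixP/(_ 0 0)/eqP; rewrite !mxE oner_eq0.
pose w := s^-1 *: dlsubmx S; pose D := drsubmx S - s *: (w *m w^T).
have Seq : S = block_mx 1%:M 0 w 1%:M *m block_mx s%:M 0 0 D *m
    (block_mx 1%:M 0 w 1%:M)^T.
  rewrite tr_block_mx !mulmx_block !trmx1 trmx0.
  rewrite !(mul1mx, mulmx1, mul0mx, mulmx0, addr0, add0r).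
  rewrite -[LHS](submxK S) ulS dlS; congr block_mx.
  - by rewrite /w linearZ/= mul_scalar_mx scalerA divff ?gt_eqF// scale1r.
  - by rewrite /w mul_mx_scalar scalerA divff ?gt_eqF// scale1r.
  - by rewrite /D mul_mx_scalar -scalemxAl addrC subrK.
exists s, w, D; split=> //; split.
  rewrite /D linearB linearZ /= trmx_mul trmxK; congr (_ - _).
  by rewrite trmx_drsub Ssym.
move=> y y0.
(* The first block undoes the shear: L^T maps this vector to (0, y), so that S takes at it the value
   of D at y. *)
have := Spos (col_mx (- (w^T *m y)) y); rewrite Seq.
set L := block_mx 1%:M 0 w 1%:M; set x := col_mx _ y.
have e : L^T *m x = col_mx 0 y.
  rewrite /L /x tr_block_mx !trmx1 trmx0 mul_block_col !mul1mx mul0mx add0r.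
  by rewrite addNr.
have -> : x^T *m (L *m block_mx s%:M 0 0 D *m L^T) *m x =
    (col_mx 0 y)^T *m (block_mx (s%:M : 'M[R]_1) 0 0 D *m col_mx 0 y).
  by rewrite -e trmx_mul trmxK !mulmxA.
rewrite mul_block_col !mulmx0 mul0mx !add0r tr_col_mx mul_row_col trmx0 mul0mx.
rewrite add0r -?mulmxA; apply.
apply/negP => /eqP/(congr1 dsubmx); rewrite col_mxKd linear0 => yy.
by rewrite yy eqxx in y0.
Qed.

(** Cholesky factorization. It determines U up to a rotation on the right, a freedom that
    [balance_columns] exploits. *)
Lemma posdef_factor n (S : 'M[R]_n) : sym_posdef S ->
  exists2 U : 'M[R]_n, S = U *m U^T & U \in unitmx.
Proof.
elim: n S => [S _|n ih].
  by exists 1%:M; rewrite ?unitmx1//; apply/matrixP => -[].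
rewrite -[n.+1]/(1 + n)%N => S /posdef_schur[s [w [D [s0 /ih[U DU uU] ->]]]].
exists (block_mx 1%:M 0 w 1%:M *m block_mx (Num.sqrt s)%:M 0 0 U : 'M[R]_(1 + n)).
  rewrite trmx_mul !mulmxA; congr (_ *m _); rewrite -!mulmxA; congr (_ *m _).
  rewrite tr_block_mx !trmx0 tr_scalar_mx mulmx_block -DU.
  rewrite !(mulmx0, mul0mx, addr0, add0r) -scalar_mxM -expr2 sqr_sqrtr ?ltW//.
rewrite unitmxE det_mulmx det_lblock !det1 mulr1 mul1r det_lblock det_scalar1.
by rewrite unitrM -unitmxE uU andbT unitfE gt_eqF// sqrtr_gt0.
Qed.

(* Plane rotations of the columns, each of which gives one more column the mean
   squared norm: t is the tangent of the angle. *)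
Lemma balance_columns n (S U : 'M[R]_n.+1) : S = U *m U^T ->
  exists2 W : 'M[R]_n.+1, S = W *m W^T &
    forall k, \sum_a W a k ^+ 2 = \tr S / n.+1%:R.
Proof.
move=> SU; set c := \tr S / _.
pose bad (W : 'M[R]_n.+1) := #|[pred k | \sum_a W a k ^+ 2 != c]|.
have [m] := ubnP (bad U); elim: m => // m ih in U SU *; rewrite ltnS => badU.
have [|h] := pselect (forall k, \sum_a U a k ^+ 2 = c); first by exists U.
pose f k := \sum_a U a k ^+ 2 - c.
have sumf : \sum_k f k = 0.
  rewrite sumrB sumr_const card_ord -mulr_natr /c divfK ?pnatr_eq0//.
  apply/eqP; rewrite subr_eq0 exchange_big SU /mxtrace/=; apply/eqP.
  by apply: eq_bigr => a _; rewrite mxE; apply: eq_bigr => k _; rewrite mxE expr2.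
have [i0 fi0] : exists k, f k != 0.
  apply: contrapT => h'; apply: h => k; apply/eqP; rewrite -subr_eq0.
  by apply: contrapT => /negP fk; apply: h'; exists k.
have pos : exists i, 0 < f i.
  apply: contrapT => h'.
  have f0 k : 0 <= - f k by rewrite oppr_ge0 leNgt; apply/negP => fk; apply: h'; exists k.
  have /eqP := sumf; rewrite -oppr_eq0 -sumrN psumr_eq0// => /allP/(_ i0).
  by rewrite mem_index_enum oppr_eq0 (negbTE fi0) => /(_ isT).
have neg : exists j, f j < 0.
  apply: contrapT => h'.
  have f0 k : 0 <= f k by rewrite leNgt; apply/negP => fk; apply: h'; exists k.
  have /eqP := sumf; rewrite psumr_eq0// => /allP/(_ i0).
  by rewrite mem_index_enum (negbTE fi0) => /(_ isT).
have {pos} [i fi] := pos; have {neg} [j fj] := neg.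
have ci : \sum_a U a i ^+ 2 != c by rewrite -subr_eq0 gt_eqF.
have cj : \sum_a U a j ^+ 2 != c by rewrite -subr_eq0 lt_eqF.
have ij : i != j by apply: contraTneq fi => ->; rewrite -leNgt ltW.
pose p := \sum_a U a i * U a j.
(* A root of f_j t^2 + 2 p t + f_i = 0, the condition for the new column i to have squared norm c.
   The discriminant is positive because f i and f j have opposite signs. *)
pose t := (p + Num.sqrt (p ^+ 2 + - f j * f i)) / - f j.
have tE : - f j * t ^+ 2 - 2 * p * t - f i = 0.
  have q2 : Num.sqrt (p ^+ 2 + - f j * f i) ^+ 2 = p ^+ 2 + - f j * f i.
    by rewrite sqr_sqrtr// addr_ge0 ?sqr_ge0// mulr_ge0 ?oppr_ge0// ltW.
  rewrite /t; move: q2; set q := Num.sqrt _ => q2.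
  have fj0 : f j != 0 by rewrite lt_eqF.
  apply: (mulfI fj0); rewrite mulr0.
  rewrite (_ : f j * _ = - (q ^+ 2 - (p ^+ 2 + - f j * f i))); first by rewrite q2 subrr oppr0.
  by field.
pose r := Num.sqrt (1 + t ^+ 2).
have r2 : r ^+ 2 = 1 + t ^+ 2 by rewrite sqr_sqrtr// addr_ge0// sqr_ge0.
have r0 : r != 0 by rewrite gt_eqF// sqrtr_gt0 ltr_wpDr// sqr_ge0.
pose W : 'M[R]_n.+1 := \matrix_(a, k) if k == i then (U a i + t * U a j) / r
   else if k == j then (U a j - t * U a i) / r else U a k.
have Wi a : W a i = (U a i + t * U a j) / r by rewrite mxE eqxx.
have Wj a : W a j = (U a j - t * U a i) / r by rewrite mxE eq_sym (negbTE ij) eqxx.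
have Wk a k : k != i -> k != j -> W a k = U a k.
  by rewrite mxE => /negbTE -> /negbTE ->.
apply: (ih W).
  rewrite SU; apply/matrixP => a b; rewrite !mxE.
  rewrite (bigD1 i)//= (bigD1 j) 1?eq_sym//= [RHS](bigD1 i)//= [in RHS](bigD1 j) 1?eq_sym//=.
  rewrite !addrA; congr (_ + _); last first.
    by apply: eq_bigr => k /andP[ki kj]; rewrite !mxE (negbTE ki) (negbTE kj).
  rewrite ![_^T _ _]mxE !Wi !Wj.
  apply: (mulfI (expf_neq0 2 r0)); rewrite {1}r2; field; exact: r0.
(* Columns other than i and j are untouched, j was bad already and i becomes good: the number of bad
   columns drops. *)
apply: leq_trans badU; apply: proper_card; apply/properP; split.
  apply/fintype.subsetP => k; rewrite !inE.
  have [->|ki] := eqVneq k i; first by rewrite ci.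
  have [->|kj] := eqVneq k j; first by rewrite cj.
  by under eq_bigr do rewrite Wk//.
exists i; first by rewrite inE ci.
rewrite inE negbK; under eq_bigr do rewrite Wi.
apply/eqP; apply: (mulfI (expf_neq0 2 r0)); rewrite mulr_sumr.
transitivity (\sum_a U a i ^+ 2 + t * 2 * p + t ^+ 2 * \sum_a U a j ^+ 2).
  rewrite /p !mulr_sumr -!big_split/=; apply: eq_bigr => a _; field; exact: r0.
rewrite r2; have : \sum_a U a i ^+ 2 = f i + c by rewrite subrK.
have : \sum_a U a j ^+ 2 = f j + c by rewrite subrK.
by move=> -> ->; lra.
Qed.

Definition drift_conj n (U J : 'M[R]_n) := U^T *m (1%:M + J) *m U.

Lemma drift_conjE n (S U J : 'M[R]_n) : S = U *m U^T ->
  U^T *m drift_mx S J = drift_conj U J *m U^T.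
Proof. by move=> ->; rewrite /drift_mx /drift_conj !mulmxA. Qed.

Lemma quad_antisym n (J : 'M[R]_n) (x : 'cV[R]_n) : antisymmetric_mx J ->
  (x^T *m J *m x) 0 0 = 0.
Proof.
move=> aJ; have : (x^T *m J *m x)^T = - (x^T *m J *m x).
  by rewrite !trmx_mul trmxK aJ mulNmx mulmxN mulmxA.
move: (x^T *m J *m x) => M /matrixP/(_ 0 0); rewrite !mxE; lra.
Qed.

(** J drops out of the quadratic form, which is |U x|^2, so one constant serves all J. *)
Lemma coercive_drift_conj n (U : 'M[R]_n) : U \in unitmx ->
  exists2 lam, 0 < lam & forall J, antisymmetric_mx J ->
    coercive_mx lam (drift_conj U J).
Proof.
(* K is the squared Frobenius norm of U^-1, whence |x|^2 <= K |U x|^2; 1 + K is surely positive. *)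
move=> uU; pose K := \sum_k \sum_i (invmx U) k i ^+ 2.
have K0 : 0 <= K by apply: sumr_ge0 => k _; apply: sumr_ge0 => i _; exact: sqr_ge0.
have K1 : 0 < 1 + K by rewrite ltr_pwDl.
exists (1 + K)^-1; first by rewrite invr_gt0.
move=> J aJ x; pose y : 'cV[R]_n := \col_k x k.
have -> : \sum_k \sum_l drift_conj U J k l * (x k * x l) =
    \sum_i (U *m y) i 0 ^+ 2.
  transitivity ((y^T *m drift_conj U J *m y) 0 0).
    by rewrite quad_mxE; apply: eq_bigr => k _; apply: eq_bigr => l _; rewrite !mxE.
  rewrite /drift_conj mulmxDr mulmx1 mulmxDl mulmxDr mulmxDl mxE norm_mxE.
  rewrite [X in _ + X](_ : _ = 0) ?addr0//.
  rewrite -(quad_antisym (U *m y) aJ) trmx_mul !mulmxA//.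
rewrite ler_pdivrMl//.
apply: (@le_trans _ _ (K * \sum_i (U *m y) i 0 ^+ 2)); last first.
  by rewrite ler_wpM2r ?lerDr// sumr_ge0// => i _; exact: sqr_ge0.
rewrite mulr_suml; apply: ler_sum => k _.
have <- : (invmx U *m (U *m y)) k 0 = x k by rewrite mulKmx// mxE.
by rewrite mxE; exact: cauchy_schwarz_sum.
Qed.

Lemma eigenvalue_intertwine n (F : fieldType) (X A B : 'M[F]_n) z :
  X \in unitmx -> X *m B = A *m X -> eigenvalue A z -> eigenvalue B z.
Proof.
move=> uX XB /eigenvalueP[v vA v0]; apply/eigenvalueP; exists (v *m X).
  by rewrite -mulmxA XB mulmxA vA scalemxAl.
by apply: contra v0 => /eqP vX; rewrite -(mulmxK uX v) vX mul0mx.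
Qed.

Lemma mx_spectrum_drift n (S U J : 'M[R]_n) : S = U *m U^T -> U \in unitmx ->
  mx_spectrum (drift_mx S J) = mx_spectrum (drift_conj U J).
Proof.
move=> SU uU; have := drift_conjE J SU.
set X := U^T; set B := drift_mx S J; set A := drift_conj U J => XB.
have uX : X \in unitmx by rewrite unitmx_tr.
apply/seteqP; split=> z; rewrite /mx_spectrum /=.
  apply: (@eigenvalue_intertwine _ _ (map_mx (real_complex R) (invmx X))).
    by rewrite map_unitmx unitmx_inv.
  rewrite -!map_mxM; congr map_mx.
  by rewrite -[A](mulmxK uX) -XB -!mulmxA mulKmx.
apply: (@eigenvalue_intertwine _ _ (map_mx (real_complex R) X)).
  by rewrite map_unitmx.
by rewrite -!map_mxM XB.
Qed.

(** Cyclicity gives Tr (S (1 + J)), and the trace of a symmetric times an antisymmetric matrix is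
    0. *)
Lemma tr_drift_conj n (S U J : 'M[R]_n) : S = U *m U^T -> antisymmetric_mx J ->
  \tr (drift_conj U J) = \tr S.
Proof.
move=> SU aJ; rewrite /drift_conj mxtrace_mulC mulmxA -SU mulmxDr mulmx1 linearD/=.
rewrite [X in _ + X](_ : _ = 0) ?addr0//.
have : \tr (S *m J) = - \tr (S *m J).
  rewrite -{1}mxtrace_tr trmx_mul aJ mulNmx linearN/= mxtrace_mulC SU.
  by rewrite trmx_mul trmxK.
by move/eqP; rewrite -subr_eq0 opprK -mulr2n mulrn_eq0 => /eqP.
Qed.

Lemma optimal_drift n (S : 'M[R]_n.+1) : sym_posdef S ->
  exists U J : 'M[R]_n.+1, exists mu : 'I_n.+1 -> R,
   [/\ S = U *m U^T, U \in unitmx, antisymmetric_mx J,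
       forall k, 1 <= mu k <= n.+1%:R &
       lyapunov_mx mu (\tr S / n.+1%:R) (drift_conj U J)].
Proof.
move=> Sp; have [U0 SU0 uU0] := posdef_factor Sp.
have [U SU cU] := balance_columns SU0.
have uU : U \in unitmx.
  have : S \in unitmx by rewrite SU0 unitmx_mul uU0 unitmx_tr.
  by rewrite SU unitmx_mul unitmx_tr andbb.
set c := \tr S / _ in cU *.
pose G := U^T *m U.
have Gsym j k : G j k = G k j.
  by rewrite !mxE; apply: eq_bigr => a _; rewrite !mxE mulrC.
have Gd k : G k k = c.
  by rewrite -(cU k) mxE; apply: eq_bigr => a _; rewrite mxE expr2.
(* The quotients in K require distinct weights; the range from 1 to N costs a factor N in the
   comparison with the unweighted norm. *)
pose mu (k : 'I_n.+1) : R := k.+1%:R.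
pose K : 'M[R]_n.+1 := \matrix_(k, j)
  if k == j then 0 else G k j * (mu k + mu j) / (mu k - mu j).
have aK : K^T = - K.
  have KE a b : K a b =
    if a == b then 0 else G a b * (mu a + mu b) / (mu a - mu b) by rewrite mxE.
  apply/matrixP => k j; rewrite mxE [RHS]mxE !KE eq_sym.
  case: eqVneq => [_|jk]; first by rewrite oppr0.
  by rewrite Gsym [mu j + _]addrC -[mu j - _]opprB invrN mulrN.
(* With J = V K V^T the conjugate U^T J U is K, and J inherits the antisymmetry of K. *)
pose V := (invmx U)^T.
exists U, (V *m K *m V^T), mu; split=> //.
- by rewrite /antisymmetric_mx !trmx_mul trmxK aK mulNmx mulmxN mulmxA.
- by move=> k; rewrite /mu ler1n ler_nat /=.
have -> : drift_conj U (V *m K *m V^T) = G + K.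
  rewrite /drift_conj mulmxDr mulmx1 mulmxDl; congr (_ + _).
  rewrite /V trmxK !mulmxA -trmx_mul mulVmx// trmx1 mul1mx.
  by rewrite -mulmxA mulVmx// mulmx1.
move=> x.
have -> : \sum_j \sum_k mu j * (G + K) k j * (x j * x k) =
    \sum_j \sum_k (mu j * (G + K) k j + mu k * (G + K) j k) / 2 * (x j * x k).
  have e : \sum_j \sum_k mu j * (G + K) k j * (x j * x k) =
      \sum_j \sum_k mu k * (G + K) j k * (x j * x k).
    rewrite exchange_big; apply: eq_bigr => j _; apply: eq_bigr => k _ /=.
    by rewrite [x j * _]mulrC.
  transitivity ((\sum_j \sum_k mu j * (G + K) k j * (x j * x k) +
    \sum_j \sum_k mu k * (G + K) j k * (x j * x k)) / 2); first by rewrite -e; lra.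
  rewrite -big_split mulr_suml/=; apply: eq_bigr => j _.
  by rewrite -big_split mulr_suml/=; apply: eq_bigr => k _; ring.
rewrite le_eqVlt; apply/orP; left; apply/eqP; rewrite mulr_sumr.
apply: eq_bigr => j _; rewrite (bigD1 j)//= big1 ?addr0.
  have Kjj : K j j = 0 by rewrite mxE eqxx.
  by rewrite mxE Kjj Gd; field.
move=> k kj; have Kkj : K k j = G k j * (mu k + mu j) / (mu k - mu j).
  by rewrite mxE (negbTE kj).
have Kjk : K j k = - K k j.
  by have := congr1 (fun M : 'M[R]_n.+1 => M k j) aK; rewrite !mxE.
have mukj : mu k - mu j != 0.
  by rewrite subr_eq0 eqr_nat eqSS; apply: contra kj => /eqP/val_inj ->.
(* The symmetrized off-diagonal entry; its vanishing is the equation that K solves. *)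
have key (a b g : R) : a - b != 0 ->
    (b * (g + g * (a + b) / (a - b)) + a * (g - g * (a + b) / (a - b))) / 2 = 0.
  by move=> ab; field.
by rewrite [(G + K) k j]mxE [(G + K) j k]mxE Kjk Kkj [G j k]Gsym key// mul0r.
Qed.

End posdef.

(** * The semigroup on formal Hermite series *)

Lemma cvg_sum_seq (R : numFieldType) (T I : Type) (F : set_system T) {FF : Filter F} (r : seq I)
    (f : I -> T -> R) (l : I -> R) :
  (forall i, f i x @[x --> F] --> l i) ->
  (\sum_(i <- r) f i x) @[x --> F] --> \sum_(i <- r) l i.
Proof.
move=> fl; elim: r => [|i r ih].
  rewrite big_nil; rewrite (_ : (fun _ => _) = fun=> 0); first exact: cvg_cst.
  by apply/funext => x; rewrite big_nil.
rewrite big_cons (_ : (fun _ => _) = fun x => f i x + \sum_(j <- r) f j x).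
  by apply: cvgD => //; exact: fl.
by apply/funext => x; rewrite big_cons.
Qed.

Lemma is_derive_sum_seq (R : realType) (I : Type) (r : seq I)
    (f : I -> R -> R) (l : I -> R) (t : R) :
  (forall i, is_derive t 1 (f i) (l i)) ->
  is_derive t 1 (fun x => \sum_(i <- r) f i x) (\sum_(i <- r) l i).
Proof.
move=> fl; elim: r => [|i r ih].
  rewrite big_nil (_ : (fun _ => _) = cst 0); first exact: is_derive_cst.
  by apply/funext => x; rewrite big_nil.
rewrite big_cons (_ : (fun _ => _) = f i + (fun x => \sum_(j <- r) f j x)).
  exact: is_deriveD.
by apply/funext => x; rewrite big_cons.
Qed.

Lemma is_derive_nincr (R : realType) (f df : R -> R) (t : R) :
  (forall s : R, is_derive s 1 f (df s)) -> (forall s, df s <= 0) -> 0 <= t ->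
  f t <= f 0.
Proof.
move=> fdf df0 t0.
have dv (s : R) : derivable f s 1 by case: (fdf s).
apply: (@ler0_derive1_nincry _ f 0) => //.
- by move=> s _; rewrite derive1E (@derive_val _ _ _ _ _ _ _ (fdf s)).
- apply: continuous_subspaceT => s; apply: differentiable_continuous.
  exact/derivable1_diffP.
Qed.

Section semigroup_seq.
Variables (R : realType) (N : nat).
Implicit Types (c d : mindex N -> R) (a b : mindex N) (A : 'M[R]_N).
Implicit Types (t s x h : R) (mu : 'I_N -> R).

Lemma gen_cvg A (T : Type) (F : set_system T) {FF : Filter F} (u : T -> mindex N -> R) c b :
  (forall a, u x a @[x --> F] --> c a) ->
  gen A (u x) b @[x --> F] --> gen A c b.
Proof.
move=> uc; apply: cvgN; apply: cvg_sum_seq => k; apply: cvg_sum_seq => l.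
apply: cvgMr; rewrite /cre /ann; case: ifP => _; last exact: cvg_cst.
by apply: cvgMr; exact: uc.
Qed.

Definition abs_sum n c := \sum_(a <- grade N n) `|c a|.

(** A crude operator bound of [gen A] in degree n for the norm [abs_sum]; its purpose is to make the
    exponential series converge. *)
Definition gen_bound A n : R :=
  \sum_(a <- grade N n) \sum_k \sum_l `|A k l| * n.+1%:R.

Lemma le_abs_sum n c a : mdeg a = n -> `|c a| <= abs_sum n c.
Proof.
move=> an; rewrite /abs_sum (bigD1_seq a)/= ?grade_uniq// ?mem_grade ?an//.
by rewrite lerDl sumr_ge0.
Qed.

Lemma abs_sum_gen A n c : abs_sum n (gen A c) <= gen_bound A n * abs_sum n c.
Proof.
have M0 : 0 <= abs_sum n c by rewrite sumr_ge0.
rewrite mulr_suml /abs_sum big_seq [leRHS]big_seq; apply: ler_sum => a.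
rewrite mem_grade => /eqP an; rewrite normrN (le_trans (ler_norm_sum _ _ _))//.
rewrite mulr_suml; apply: ler_sum => k _; rewrite (le_trans (ler_norm_sum _ _ _))//.
rewrite mulr_suml; apply: ler_sum => l _; rewrite normrM -mulrA ler_wpM2l//.
rewrite /cre /ann; case: ifP => al; last by rewrite normr0 mulr_ge0.
rewrite normrM normr_nat ler_pM//.
  rewrite ler_nat ltnS -an (mdeg_pred al) leqW//.
  by rewrite /mdeg (bigD1 k)//= leq_addr.
by rewrite le_abs_sum// mdeg_succ -mdeg_pred.
Qed.

Lemma iter_gen_le A c a j :
  `|iter j (gen A) c a| <= abs_sum (mdeg a) c * gen_bound A (mdeg a) ^+ j.
Proof.
have K0 : 0 <= gen_bound A (mdeg a).
  by rewrite !sumr_ge0// => b _; rewrite sumr_ge0// => k _; rewrite sumr_ge0// => l _; rewrite mulr_ge0.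
apply: (le_trans (le_abs_sum _ (erefl (mdeg a)))).
elim: j => [|j ih]; first by rewrite expr0 mulr1.
apply: (le_trans (abs_sum_gen _ _ _)).
by rewrite exprS mulrCA ler_wpM2l.
Qed.

Definition exp_coeffs A c a (j : nat) : R := iter j (gen A) c a / j`!%:R.

Lemma pseries_diffs_exp_coeffs A c a :
  pseries_diffs (exp_coeffs A c a) = exp_coeffs A (gen A c) a.
Proof.
apply/funext => j; rewrite /pseries_diffs /exp_coeffs -iterSr factS natrM.
by rewrite invfM mulrCA [_.+1%:R * (_ * _)]mulrA mulfV ?pnatr_eq0// mul1r.
Qed.

Lemma is_cvg_exp_coeffs A c a t : cvgn (pseries (exp_coeffs A c a) t).
Proof.
apply: normed_cvg; set M := abs_sum (mdeg a) c; set K := gen_bound A (mdeg a).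
have K0 : 0 <= K.
  by rewrite !sumr_ge0// => b _; rewrite sumr_ge0// => k _; rewrite sumr_ge0// => l _; rewrite mulr_ge0.
have M0 : 0 <= M by rewrite sumr_ge0.
apply: (@series_le_cvg _ _ (fun j => M * exp_coeff (K * `|t|) j)) => //.
- by move=> j /=; exact: normr_ge0.
- by move=> j; rewrite mulr_ge0// exp_coeff_ge0// mulr_ge0.
- move=> j; rewrite /exp_coeffs /exp_coeff/= !normrM normfV normr_nat normrX exprMn.
  rewrite mulrAC !mulrA ler_wpM2r// ler_wpM2r ?exprn_ge0//.
  exact: iter_gen_le.
rewrite (_ : (fun _ => _) = M *: exp_coeff (K * `|t|)); last by apply/funext.
by apply: is_cvg_seriesZ; exact: is_cvg_series_exp_coeff.
Qed.

(** The exponential of t [gen A], a power series in t at each multi-index. It converges for every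
    formal series c, since each degree is finite-dimensional and preserved. *)
Definition egen A t c a : R := limn (pseries (exp_coeffs A c a) t).

Lemma egen_is_derive A t c a :
  is_derive t 1 (fun s => egen A s c a) (egen A t (gen A c) a).
Proof.
rewrite /egen -pseries_diffs_exp_coeffs.
apply: (@pseries_snd_diffs _ _ (`|t| + 1)); rewrite ?pseries_diffs_exp_coeffs;
  try exact: is_cvg_exp_coeffs.
by rewrite [ltRHS]ger0_norm ?addr_ge0// ltrDl.
Qed.

(** At each multi-index [gen A] is a finite sum, so it commutes with the limit of the series. *)
Lemma gen_egen A t c a : gen A (egen A t c) a = egen A t (gen A c) a.
Proof.
apply/esym/cvg_lim => //.
rewrite (_ : pseries _ _ = fun n => gen A (fun b => pseries (exp_coeffs A c b) t n) a).
  by apply: gen_cvg => b; exact: is_cvg_exp_coeffs.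
apply/funext => n; rewrite /pseries /series /=.
transitivity (gen A (fun b => \sum_(0 <= j < n) (t ^+ j / j`!%:R) * iter j (gen A) c b) a).
  rewrite gen_sum; apply: eq_bigr => j _; rewrite /exp_coeffs -iterSr iterS; ring.
by apply: eq_gen => b; apply: eq_bigr => j _; rewrite /exp_coeffs; ring.
Qed.

Lemma egen0 A c a : egen A 0 c a = c a.
Proof.
apply/cvg_lim => //; rewrite -cvg_shiftS (_ : (fun _ => _) = fun=> c a).
  exact: cvg_cst.
apply/funext => n; rewrite /pseries /series /= big_nat_recl// expr0 mulr1 big1 ?addr0.
  by rewrite /exp_coeffs/= divr1.
by move=> i _; rewrite expr0n mulr0.
Qed.

(** Coordinatewise solutions of y' = gen y. The estimates are stated for all of them, so that they
    apply to differences and time shifts too, which gives uniqueness and the semigroup law. *)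
Definition flow A (y : R -> mindex N -> R) :=
  forall (t : R) a, is_derive t 1 (fun s => y s a) (gen A (y t) a).

Lemma egen_flow A c : flow A (fun t => egen A t c).
Proof. by move=> t a; rewrite gen_egen; exact: egen_is_derive. Qed.

Lemma flow_lin A x y z : flow A y -> flow A z ->
  flow A (fun t a => x * y t a + z t a).
Proof.
move=> fy fz t a; rewrite gen_lin.
have := is_deriveD (is_deriveZ x (fy t a)) (fz t a); exact.
Qed.

Lemma flow_shift A y s : flow A y -> flow A (fun t => y (t + s)).
Proof.
move=> fy t a; rewrite -[gen _ _ _]mulr1.
apply: (@is_derive1_comp _ (fun s => y s a) (fun t => t + s)); first exact: fy.
by rewrite -[1 in X in is_derive _ _ _ X]addr0; exact: is_deriveD.
Qed.

Lemma flow_is_derive_ip A y n d t : flow A y ->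
  is_derive t 1 (fun s => ip n (y s) d) (ip n (gen A (y t)) d).
Proof.
move=> fy; apply: is_derive_sum_seq => a.
rewrite (_ : (fun _ => _) = ((mfact a)%:R * d a) *: (fun s => y s a)).
  have := is_deriveZ ((mfact a)%:R * d a) (fy t a).
  rewrite /GRing.scale/= => h; apply: is_derive_eq h _; ring.
by apply/funext => s; rewrite [y s a * d a]mulrC mulrA.
Qed.

Lemma flow_is_derive_ip2 A y n t : flow A y ->
  is_derive t 1 (fun s => ip n (y s) (y s)) (2 * ip n (y t) (gen A (y t))).
Proof.
move=> fy; rewrite /ip mulr_sumr; apply: is_derive_sum_seq => a.
rewrite (_ : (fun _ => _) = (mfact a)%:R *: ((fun s => y s a) * (fun s => y s a))).
  have := is_deriveZ (mfact a)%:R (is_deriveM (fy t a) (fy t a)).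
  rewrite /GRing.scale/= => h; apply: is_derive_eq h _; ring.
by apply/funext.
Qed.

Lemma flow_is_derive_wip A y mu n t : flow A y ->
  is_derive t 1 (fun s => wip mu n (y s) (y s)) (2 * wip mu n (y t) (gen A (y t))).
Proof.
move=> fy; rewrite /wip mulr_sumr; apply: is_derive_sum_seq => j.
rewrite mulrCA /ip !mulr_sumr.
rewrite (_ : (fun _ => _) = fun s => \sum_(a <- grade N n)
    mu j * ((mfact a)%:R * (ann j (y s) a * ann j (y s) a))); last first.
  by apply/funext => s; rewrite mulr_sumr.
apply: is_derive_sum_seq => a.
rewrite (_ : (fun _ => _) = (mu j * (mfact a)%:R * (a j).+1%:R ^+ 2) *:
    ((fun s => y s (msucc j a)) * (fun s => y s (msucc j a)))).
  have := is_deriveZ (mu j * (mfact a)%:R * (a j).+1%:R ^+ 2)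
    (is_deriveM (fy t (msucc j a)) (fy t (msucc j a))).
  rewrite /GRing.scale/= => h; apply: is_derive_eq h _; rewrite /ann; ring.
by apply/funext => s; rewrite /ann /GRing.scale /= fctE /GRing.scale/=; ring.
Qed.

Section dissipative.
Variables (A : 'M[R]_N) (lam : R).
Hypotheses (lam0 : 0 <= lam) (cA : coercive_mx lam A).

Lemma flow_ip_le y n t : flow A y -> 0 <= t ->
  ip n (y t) (y t) <= ip n (y 0) (y 0).
Proof.
move=> fy; apply: (is_derive_nincr (fun s => flow_is_derive_ip2 n s fy)) => s.
by rewrite pmulr_rle0// (ip_gen_le0 _ _ lam0).
Qed.

(** Gronwall: multiplied by exp (2 c0 s), the weighted norm is nonincreasing. *)
Lemma flow_wip_le mu (c0 : R) y n t : (forall j, 0 <= mu j) -> lyapunov_mx mu c0 A ->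
  flow A y -> 0 <= t ->
  wip mu n (y t) (y t) <= expR (- (2 * c0) * t) * wip mu n (y 0) (y 0).
Proof.
move=> mu0 lA fy t0.
pose f s := expR (2 * c0 * s) * wip mu n (y s) (y s).
have fd s : is_derive s 1 f (expR (2 * c0 * s) *
    (2 * c0 * wip mu n (y s) (y s) + 2 * wip mu n (y s) (gen A (y s)))).
  have e1 : is_derive s 1 (fun s => expR (2 * c0 * s)) (expR (2 * c0 * s) * (2 * c0)).
    apply: (@is_derive1_comp _ expR (fun s => 2 * c0 * s)).
    rewrite -[X in is_derive _ _ _ X]mulr1; exact: is_deriveZ.
  have := is_deriveM e1 (flow_is_derive_wip mu n s fy).
  rewrite /GRing.scale/= => h; apply: is_derive_eq h _; ring.
have : f t <= f 0.
  apply: (is_derive_nincr fd) => // s; rewrite pmulr_rle0 ?expR_gt0//.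
  have := wip_gen_le n (y s) lam0 cA mu0 lA; lra.
rewrite /f mulr0 expR0 mul1r -ler_pdivlMl ?expR_gt0// -expRN mulNr//.
Qed.

(** The difference is a flow whose norm in each degree starts at 0 and cannot grow. *)
Lemma flow_uniq y z t a : flow A y -> flow A z -> (forall b, y 0 b = z 0 b) ->
  0 <= t -> y t a = z t a.
Proof.
move=> fy fz yz t0; pose w s b := (-1) * y s b + z s b.
have fw : flow A w by exact: flow_lin.
have w0 : ip (mdeg a) (w t) (w t) = 0.
  apply/le_anti; rewrite ip_ge0 andbT (le_trans (flow_ip_le _ fw t0))//.
  by rewrite /ip big1// => b _; rewrite /w yz mulN1r addNr mul0r mulr0.
by have /eqP := ip_eq0 w0 (erefl _); rewrite /w mulN1r addrC subr_eq0 => /eqP.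
Qed.

Lemma egen_lin t x c d a : 0 <= t ->
  egen A t (fun b => x * c b + d b) a = x * egen A t c a + egen A t d a.
Proof.
apply: (flow_uniq a (@egen_flow A _)
  (flow_lin x (@egen_flow A c) (@egen_flow A d))).
by move=> b; rewrite !egen0.
Qed.

Lemma egenD s t c a : 0 <= s -> 0 <= t ->
  egen A (s + t) c a = egen A s (egen A t c) a.
Proof.
move=> s0 t0; apply: (flow_uniq a (flow_shift t (@egen_flow A c)) (@egen_flow A _)) => //.
by move=> b; rewrite add0r egen0.
Qed.

Lemma egen_ip_le t n c : 0 <= t -> ip n (egen A t c) (egen A t c) <= ip n c c.
Proof.
move=> t0; apply: le_trans (flow_ip_le n (@egen_flow A c) t0) _.
by rewrite (@eq_ip _ _ _ _ c _ c)// => a; rewrite egen0.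
Qed.

Lemma egen_wip_le mu (c0 : R) t n c : (forall j, 0 <= mu j) -> lyapunov_mx mu c0 A ->
  0 <= t -> wip mu n (egen A t c) (egen A t c) <= expR (- (2 * c0) * t) * wip mu n c c.
Proof.
move=> mu0 lA t0; apply: le_trans (flow_wip_le n mu0 lA (@egen_flow A c) t0) _.
rewrite ler_wpM2l ?expR_ge0// /wip; apply: ler_sum => j _.
rewrite (@eq_ip _ _ _ _ (ann j c) _ (ann j c))//; apply: eq_ann => a;
  by rewrite egen0.
Qed.

(** The weighted form [wip] lies between 1 and m times n + 1 times the squared norm. The factor n +
    1 occurs at both ends and cancels, so the loss is m in every degree. *)
Lemma egen_decay mu (c0 m : R) t n c : (forall j, 1 <= mu j <= m) -> lyapunov_mx mu c0 A ->
  0 <= t -> ip n.+1 (egen A t c) (egen A t c) <= m * expR (- (2 * c0) * t) * ip n.+1 c c.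
Proof.
move=> mum lA t0.
have n0 : 0 < n.+1%:R :> R by rewrite ltr0n.
rewrite -(ler_pM2l n0) mulrCA [leRHS](_ : _ =
  expR (- (2 * c0) * t) * (m * n.+1%:R * ip n.+1 c c)); last by ring.
have -> : n.+1%:R * ip n.+1 (egen A t c) (egen A t c) =
  1 * n.+1%:R * ip n.+1 (egen A t c) (egen A t c) by rewrite mul1r.
apply: (@le_trans _ _ (wip mu n (egen A t c) (egen A t c))).
  by apply: wip_ge => j; have /andP[] := mum j.
apply: (@le_trans _ _ (expR (- (2 * c0) * t) * wip mu n c c)).
  apply: egen_wip_le => // j; have /andP[mu1 _] := mum j.
  by rewrite (le_trans _ mu1).
by rewrite ler_wpM2l ?expR_ge0// wip_le// => j; have /andP[] := mum j.
Qed.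

(** The mean value theorem is applied to the scalar function s -> <egen s c, w>, where w = egen h c
    - c is frozen. The result dominates the difference quotients when the generator is computed. *)
Lemma egen_diff_le n h c : 0 <= h ->
  ip n (fun a => egen A h c a - c a) (fun a => egen A h c a - c a) <=
  h ^+ 2 * ip n (gen A c) (gen A c).
Proof.
rewrite le_eqVlt => /predU1P[<-|h0].
  rewrite expr0n mul0r /ip big1// => a _; rewrite egen0 subrr !mulr0//.
set w := fun a => _; pose g s := ip n (egen A s c) w.
have gd s : is_derive s 1 g (ip n (egen A s (gen A c)) w).
  have := flow_is_derive_ip n w s (@egen_flow A c).
  by rewrite (@eq_ip _ _ _ _ (egen A s (gen A c)) _ w)// => a; exact: gen_egen.
have [|xi xih e] := MVT h0 (fun s _ => gd s).
  apply: continuous_subspaceT => s; apply: differentiable_continuous.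
  exact/derivable1_diffP; case: (gd s).
have gw : g h - g 0 = ip n w w.
  rewrite /g /ip -sumrB; apply: eq_bigr => a _; rewrite egen0 /w; ring.
have xi0 : 0 <= xi by move: xih; rewrite in_itv/= => /andP[/ltW].
have h1 := egen_ip_le n (gen A c) xi0.
(* Young's inequality, so that half of |w|^2 can be absorbed. *)
have h2 : h * ip n (egen A xi (gen A c)) w <=
    (h ^+ 2 * ip n (egen A xi (gen A c)) (egen A xi (gen A c)) + ip n w w) / 2.
  rewrite /ip !mulr_sumr -big_split mulr_suml/=; apply: ler_sum => a _.
  have := mulr_ge0 (ler0n R (mfact a)) (sqr_ge0 (h * egen A xi (gen A c) a - w a)).
  by rewrite !expr2; lra.
have h3 : h ^+ 2 * ip n (egen A xi (gen A c)) (egen A xi (gen A c)) <=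
  h ^+ 2 * ip n (gen A c) (gen A c) by rewrite ler_wpM2l// sqr_ge0.
move: e; rewrite gw subr0; lra.
Qed.

Lemma egen_cvg c a : (egen A h c a - c a) / h @[h --> 0^'+] --> gen A c a.
Proof.
have dv := egen_is_derive A 0 c a.
have /cvg_ex[l hl] : derivable (fun s => egen A s c a) 0 1 by case: dv.
have e : l = gen A c a.
  rewrite -(egen0 A (gen A c) a) -(@derive_val _ _ _ _ _ _ _ dv).
  by apply/esym/cvg_lim.
rewrite -e; apply: cvg_trans (cvg_dnbhs_at_right hl); apply: near_eq_cvg.
near=> h; rewrite /= [h *: 1]mulr1 addr0 egen0 mulrC.
by [].
Unshelve. all: by end_near.
Qed.

End dissipative.
End semigroup_seq.

(** * Complex coefficients and resolvent estimates by degree *)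

Section cnorm2_theory.
Variables (R : realType) (N : nat).
Local Notation C := R[i].
Local Notation toC := (map_mx (real_complex R)).
Local Notation re c := (fun a => complex.Re (c a)).
Local Notation im c := (fun a => complex.Im (c a)).
Implicit Types (c d f : mindex N -> C) (A : 'M[R]_N) (z : C).

Definition nrm2 z : R := complex.Re z ^+ 2 + complex.Im z ^+ 2.

Lemma nrm2_ge0 z : 0 <= nrm2 z.
Proof. by rewrite addr_ge0// sqr_ge0. Qed.

Lemma nrm2_eq0 z : nrm2 z = 0 -> z = 0.
Proof.
case: z => x y /eqP; rewrite /nrm2 /= paddr_eq0 ?sqr_ge0// !sqrf_eq0.
by move=> /andP[/eqP -> /eqP ->].
Qed.

Lemma nrm2M z w : nrm2 (z * w) = nrm2 z * nrm2 w.
Proof. by case: z w => x y [u v]; rewrite /nrm2 /=; ring. Qed.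

Lemma nrm2_sum (I : Type) (r : seq I) (z : I -> C) :
  nrm2 (\sum_(j <- r) z j) <= (size r)%:R * \sum_(j <- r) nrm2 (z j).
Proof.
have h (x : I -> R) : (\sum_(j <- r) x j) ^+ 2 <= (size r)%:R * \sum_(j <- r) x j ^+ 2.
  have := cauchy_schwarz_sum r (fun=> 1) x.
  under eq_bigr do rewrite mul1r.
  by under [X in _ <= X * _ -> _]eq_bigr do rewrite expr1n -[1]/(1%:R); rewrite -natr_sum sum1_size.
rewrite /nrm2 !raddf_sum big_split mulrDr; exact: lerD.
Qed.

Lemma cnorm2E n c : cnorm2 n c = \sum_(a <- grade N n) (mfact a)%:R * nrm2 (c a).
Proof.
by rewrite /cnorm2 /ip -big_split; apply: eq_bigr => a _; rewrite /nrm2/= !expr2; ring.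
Qed.

Lemma cnorm2Z n z c : cnorm2 n (fun a => z * c a) = nrm2 z * cnorm2 n c.
Proof.
by rewrite !cnorm2E mulr_sumr; apply: eq_bigr => a _; rewrite nrm2M mulrCA.
Qed.

Lemma cnorm2_sum (I : Type) (r : seq I) n (d : I -> mindex N -> C) :
  cnorm2 n (fun a => \sum_(j <- r) d j a) <= (size r)%:R * \sum_(j <- r) cnorm2 n (d j).
Proof.
rewrite cnorm2E; under [in leRHS]eq_bigr do rewrite cnorm2E.
rewrite exchange_big mulr_sumr; apply: ler_sum => a _.
by rewrite -mulr_sumr mulrCA ler_wpM2l// nrm2_sum.
Qed.

Lemma cnorm2D n c d : cnorm2 n (fun a => c a + d a) <= 2 * (cnorm2 n c + cnorm2 n d).
Proof.
have := cnorm2_sum [:: c; d] n id; rewrite big_cons big_seq1.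
by apply: le_trans; rewrite !cnorm2E; under [leRHS]eq_bigr do rewrite big_cons big_seq1.
Qed.

Lemma nrm2_le_cnorm2 c a : nrm2 (c a) <= cnorm2 (mdeg a) c.
Proof.
rewrite cnorm2E (bigD1_seq a)/= ?grade_uniq// ?mem_grade// ler_wpDr//.
  by rewrite sumr_ge0// => b _; rewrite mulr_ge0// nrm2_ge0.
by rewrite ler_peMl ?nrm2_ge0// ler1n mfact_gt0.
Qed.

Definition delta a : mindex N -> C := fun b => (b == a)%:R.

Lemma sum_delta n c b : mdeg b = n -> \sum_(a <- grade N n) c a * delta a b = c b.
Proof.
move=> bn; rewrite (bigD1_seq b)/= ?grade_uniq// ?mem_grade ?bn// /delta eqxx mulr1.
by rewrite big1 ?addr0// => a /negbTE; rewrite eq_sym => ->; rewrite mulr0.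
Qed.

Variables (A : 'M[R]_N).

Definition noneigen z := forall d, (forall a, gen (toC A) d a = z * d a) ->
  forall a, d a = 0.

Definition restr n d : mindex N -> C := fun a => if mdeg a == n then d a else 0.

Lemma gen_restr n d b : gen (toC A) (restr n d) b =
  if mdeg b == n then gen (toC A) d b else 0.
Proof.
case: ifPn => bn.
  by apply: gen_local => a; rewrite /restr => ->; rewrite bn.
rewrite (@gen_local _ _ _ _ (fun=> 0)) ?gen0// => a; rewrite /restr => ->.
by rewrite (negbTE bn).
Qed.

(** In the basis [delta] of degree n, [gen] - z is a square matrix M with trivial kernel, and s a is
    the row of its inverse at a. *)
Lemma noneigen_grade_solve z n : noneigen z ->
  exists s : mindex N -> mindex N -> C, forall a b, mdeg a = n -> mdeg b = n ->
    gen (toC A) (s a) b - z * s a b = delta a b.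
Proof.
move=> nz; pose g := grade N n; pose k := size g; pose e (i : 'I_k) := nth mzero g i.
have eg i : mdeg (e i) = n by apply/eqP; rewrite -mem_grade mem_nth.
have e_inj i j : (e i == e j) = (i == j).
  by rewrite /e nth_uniq ?grade_uniq//.
have exe b : mdeg b = n -> exists i, b = e i.
  move=> bn; have bg : b \in g by rewrite mem_grade bn.
  have ib : (index b g < k)%N by rewrite index_mem.
  by exists (Ordinal ib); rewrite /e nth_index.
pose M : 'M[C]_k := \matrix_(j, i) (gen (toC A) (delta (e j)) (e i) - z * delta (e j) (e i)).
pose cv (v : 'rV[C]_k) b := \sum_i v 0 i * delta (e i) b.
have cve v i : cv v (e i) = v 0 i.
  rewrite /cv (bigD1 i)//= /delta eqxx mulr1 big1 ?addr0// => j ji.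
  by rewrite e_inj eq_sym (negbTE ji) mulr0.
have vM v i : (v *m M) 0 i = gen (toC A) (cv v) (e i) - z * cv v (e i).
  rewrite /cv gen_sum mulr_sumr -sumrB mxE; apply: eq_bigr => j _.
  by rewrite mxE; ring.
have Mu : M \in unitmx.
  rewrite -row_free_unit; apply: inj_row_free => v v0.
  (* A kernel vector, extended by zero to the other degrees, is an eigenfunction for z. *)
  have vz a : restr n (cv v) a = 0.
    apply: nz => {}a; rewrite gen_restr /restr; case: eqP => [|_]; last by rewrite mulr0.
    move=> /exe[i ->]; apply/eqP; rewrite -subr_eq0 -vM v0 mxE//.
  by apply/rowP => i; rewrite mxE -cve -(vz (e i)) /restr eg eqxx.
exists (fun a => cv (\row_i delta a (e i) *m invmx M)) => a b an /exe[i ->].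
by rewrite -vM mulmxKV// mxE.
Qed.

(** The bound K depends on n here; uniformity comes from [gen_resolvent_le], valid for large n. *)
Lemma noneigen_solve z : noneigen z -> exists s : (mindex N -> C) -> mindex N -> C,
  (forall f a, gen (toC A) (s f) a = f a + z * s f a) /\
  forall n, exists2 K, 0 <= K & forall f, cnorm2 n (s f) <= K * cnorm2 n f.
Proof.
move=> nz; have /choice[s sE] n := noneigen_grade_solve n nz.
pose S f b := \sum_(a <- grade N (mdeg b)) f a * s (mdeg b) a b.
exists S; split=> [f b|n].
  have -> : gen (toC A) (S f) b =
      gen (toC A) (fun b' => \sum_(a <- grade N (mdeg b)) f a * s (mdeg b) a b') b.
    by apply: gen_local => a ab; rewrite /S ab.
  rewrite gen_sum; apply/eqP; rewrite -subr_eq /S mulr_sumr -sumrB.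
  rewrite -[X in _ == X](sum_delta f (erefl (mdeg b))); apply/eqP.
  rewrite big_seq [RHS]big_seq; apply: eq_bigr => a; rewrite mem_grade => /eqP ab.
  by rewrite -(sE (mdeg b))//; ring.
exists ((size (grade N n))%:R * \sum_(a <- grade N n) cnorm2 n (s n a)).
  by rewrite mulr_ge0// sumr_ge0// => a _; exact: cnorm2_ge0.
move=> f; rewrite (@eq_cnorm2 _ _ _ _ (fun b => \sum_(a <- grade N n) f a * s n a b)).
  rewrite (le_trans (cnorm2_sum _ _ _))// -mulrA ler_wpM2l// mulr_suml.
  rewrite big_seq [leRHS]big_seq; apply: ler_sum => a; rewrite mem_grade => /eqP an.
  by rewrite cnorm2Z mulrC ler_wpM2l ?cnorm2_ge0// -an nrm2_le_cnorm2.
by move=> b bn; rewrite /S bn.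
Qed.

(** Pairing with c, dissipation gives D |c|^2 <= - Re <c, f> with D = lam n + Re z; Young's
    inequality then absorbs half of D^2 |c|^2. *)
Lemma gen_resolvent_le lam z n f c : coercive_mx lam A -> 0 <= lam ->
  (forall a, gen (toC A) c a = f a + z * c a) ->
  0 < lam * n%:R + complex.Re z ->
  (lam * n%:R + complex.Re z) ^+ 2 * cnorm2 n c <= cnorm2 n f.
Proof.
move=> cA lam0 gc; set D := _ + _ => D0.
have cA' e : ip n e (gen A e) <= - lam * n%:R * ip n e e.
  case: n {D D0} => [|m]; first by rewrite mulr0 mul0r (ip_gen_le0 _ _ lam0).
  by rewrite mulNr; exact: ip_gen_le.
have h := lerD (cA' (re c)) (cA' (im c)).
rewrite -mulrDr -/(cnorm2 n c) in h.
have e : ip n (re c) (gen A (re c)) + ip n (im c) (gen A (im c)) =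
    ip n (re c) (re f) + ip n (im c) (im f) + complex.Re z * cnorm2 n c.
  rewrite /cnorm2 /ip -!big_split/= mulr_sumr -big_split; apply: eq_bigr => a _ /=.
  rewrite -Re_gen -Im_gen gc; case: z {gc D D0} => x y; case: (c a) => u v.
  by case: (f a) => p q /=; ring.
rewrite e in h.
have h2 : D * (- (ip n (re c) (re f) + ip n (im c) (im f))) <=
    (D ^+ 2 * cnorm2 n c + cnorm2 n f) / 2.
  rewrite /cnorm2 /ip -!big_split/= -sumrN !mulr_sumr -big_split mulr_suml/=.
  apply: ler_sum => a _.
  have := mulr_ge0 (ler0n R (mfact a)) (sqr_ge0 (D * complex.Re (c a) + complex.Re (f a))).
  have := mulr_ge0 (ler0n R (mfact a)) (sqr_ge0 (D * complex.Im (c a) + complex.Im (f a))).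
  by rewrite !expr2; lra.
have h3 : D * (D * cnorm2 n c) <= D * (- (ip n (re c) (re f) + ip n (im c) (im f))).
  rewrite ler_pM2l//; rewrite /D mulrDl; move: h; rewrite mulNr; lra.
by move: h2 h3; rewrite !mulrA -expr2; lra.
Qed.

(** A is real, so real and imaginary parts evolve separately. *)
Definition egenC t c a : C := (egen A t (re c) a +i* egen A t (im c) a)%C.

Lemma cnorm2_egenC lam t n c : 0 <= lam -> coercive_mx lam A -> 0 <= t ->
  cnorm2 n (egenC t c) <= cnorm2 n c.
Proof. by move=> l0 cA t0; apply: lerD; exact: (egen_ip_le l0 cA). Qed.

Lemma cnorm2_egenC_decay lam mu (c0 m : R) t n c : 0 <= lam -> coercive_mx lam A ->
  (forall j, 1 <= mu j <= m) -> lyapunov_mx mu c0 A -> 0 <= t ->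
  cnorm2 n.+1 (egenC t c) <= m * expR (- (2 * c0) * t) * cnorm2 n.+1 c.
Proof.
by move=> l0 cA mum lA t0; rewrite /cnorm2 mulrDr; apply: lerD;
  apply: (egen_decay l0 cA _ _ mum lA).
Qed.

(** [gen] vanishes in degree 0, so [egen_diff_le] leaves no motion there: the mean is conserved. *)
Lemma egenC_mzero lam t c : 0 <= lam -> coercive_mx lam A -> 0 <= t ->
  egenC t c mzero = c mzero.
Proof.
move=> l0 cA t0.
have h (x : mindex N -> R) : egen A t x mzero = x mzero.
  have := egen_diff_le l0 cA 0 x t0; rewrite [X in _ <= _ * X](_ : _ = 0).
    rewrite mulr0 => le0; have /ip_eq0 : ip 0 (fun a => egen A t x a - x a)
      (fun a => egen A t x a - x a) = 0 by apply/le_anti; rewrite le0 ip_ge0.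
    by move=> /(_ mzero (mdeg_mzero N))/eqP; rewrite subr_eq0 => /eqP.
  rewrite /ip big_seq big1// => a; rewrite mem_grade mdeg_eq0 => /eqP ->.
  by rewrite gen_grade0 !mulr0.
by rewrite /egenC !h; case: (c mzero).
Qed.

Lemma cnorm2_egenC_diff lam h n c : 0 <= lam -> coercive_mx lam A -> 0 <= h ->
  cnorm2 n (fun a => egenC h c a - c a) <= h ^+ 2 * cnorm2 n (gen (toC A) c).
Proof.
move=> l0 cA h0; rewrite /cnorm2 mulrDr.
have -> : (fun a => complex.Re (egenC h c a - c a)) =
  (fun a => egen A h (re c) a - complex.Re (c a)).
  by apply/funext => a; rewrite /egenC; case: (c a).
have -> : (fun a => complex.Im (egenC h c a - c a)) =
  (fun a => egen A h (im c) a - complex.Im (c a)).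
  by apply/funext => a; rewrite /egenC; case: (c a).
have -> : re (gen (toC A) c) = gen A (re c) by apply/funext => a; rewrite Re_gen.
have -> : im (gen (toC A) c) = gen A (im c) by apply/funext => a; rewrite Im_gen.
by apply: lerD; exact: (egen_diff_le l0 cA).
Qed.

Lemma egenC_lin lam t z c d a : 0 <= lam -> coercive_mx lam A -> 0 <= t ->
  egenC t (fun b => z * c b + d b) a = z * egenC t c a + egenC t d a.
Proof.
move=> l0 cA t0; case: z => x y; rewrite /egenC.
have -> : re (fun b => (x +i* y)%C * c b + d b) =
    (fun b => x * complex.Re (c b) + (- y * complex.Im (c b) + complex.Re (d b))).
  by apply/funext => b; case: (c b) (d b) => u v [p q] /=; ring.
have -> : im (fun b => (x +i* y)%C * c b + d b) =
    (fun b => x * complex.Im (c b) + (y * complex.Re (c b) + complex.Im (d b))).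
  by apply/funext => b; case: (c b) (d b) => u v [p q] /=; ring.
rewrite !(egen_lin l0 cA)//.
by apply/eqP; rewrite eq_complex /=; apply/andP; split; apply/eqP; ring.
Qed.

Lemma egenC0 c a : egenC 0 c a = c a.
Proof. by rewrite /egenC !egen0; case: (c a). Qed.

Lemma egenCD lam s t c a : 0 <= lam -> coercive_mx lam A -> 0 <= s -> 0 <= t ->
  egenC (s + t) c a = egenC s (egenC t c) a.
Proof. by move=> l0 cA s0 t0; rewrite /egenC !(egenD l0 cA). Qed.

End cnorm2_theory.

(** * Semigroup, resolvent and generator in an abstract Hilbert space *)

Lemma cvg_sum_seq0 (R : numFieldType) (T I : Type) (F : set_system T) {FF : Filter F}
    (r : seq I) (f : I -> T -> R) :
  (forall i, f i x @[x --> F] --> 0) -> (\sum_(i <- r) f i x) @[x --> F] --> 0.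
Proof.
move=> f0; have e : \sum_(i <- r) (0 : R) = 0 by rewrite big1.
by rewrite -[X in _ --> X]e; exact: cvg_sum_seq.
Qed.

Section rnorm_theory.
Variables (R : realType) (V : normedModType R[i]).

(** Norms of a space over R[i] have their values in R[i]; estimates and limits are done with this
    real number. *)
Definition rnorm (u : V) : R := complex.Re `|u|.

Lemma rnormE u : `|u| = (rnorm u)%:C%C.
Proof.
have : 0 <= `|u| by [].
by rewrite lecE /rnorm; case: `|u| => x y /= /andP[/eqP -> _].
Qed.

Lemma rnorm_ge0 u : 0 <= rnorm u.
Proof. by have : 0 <= `|u| by []; rewrite rnormE (lecR 0). Qed.

Lemma rnormD u v : rnorm (u + v) <= rnorm u + rnorm v.
Proof. by rewrite -lecR rmorphD /= -!rnormE ler_normD. Qed.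

Lemma rnormN u : rnorm (- u) = rnorm u.
Proof. by rewrite /rnorm normrN. Qed.

Lemma rnorm_distC u v : rnorm (u - v) = rnorm (v - u).
Proof. by rewrite -opprB rnormN. Qed.

Lemma rnorm_eq0 u : rnorm u = 0 -> u = 0.
Proof. by move=> u0; apply: normr0_eq0; rewrite rnormE u0. Qed.

Lemma rnorm0 : rnorm 0 = 0.
Proof. by rewrite /rnorm normr0. Qed.

Lemma le_normE u v : (`|u| <= `|v|) = (rnorm u <= rnorm v).
Proof. by rewrite !rnormE lecR. Qed.

Lemma rnormZ x u : rnorm (x *: u) ^+ 2 = nrm2 x * rnorm u ^+ 2.
Proof.
rewrite /rnorm normrZ rnormE; case: x => a b; rewrite /nrm2 /= mulr0 subr0.
by rewrite exprMn sqr_sqrtr// addr_ge0// sqr_ge0.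
Qed.

Lemma rcvgP (T : Type) (F : set_system T) {FF : Filter F} (f : T -> V) (y : V) :
  f x @[x --> F] --> y <->
  forall e : R, 0 < e -> \forall t \near F, rnorm (f t - y) < e.
Proof.
split=> [/cvgrPdist_lt fy e e0|fy].
  have ec : 0 < (e%:C)%C by rewrite ltcR.
  near=> t; rewrite rnorm_distC -ltcR -rnormE; near: t; exact: fy.
apply/cvgrPdist_lt => e e0.
have eE : e = ((complex.Re e)%:C)%C.
  by move: e0; rewrite ltcE; case: (e) => a b /= /andP[/eqP ->].
have e0' : 0 < complex.Re e by move: e0; rewrite eE ltcR.
near=> t; rewrite eE rnormE ltcR rnorm_distC; near: t; exact: fy.
Unshelve. all: by end_near. Qed.

End rnorm_theory.

Section coordinates.
Variables (R : realType) (N : nat) (V : normedModType R[i]).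
Variable crd : V -> mindex N -> R[i].
Local Notation C := R[i].
Local Notation toC := (map_mx (real_complex R)).
Implicit Types (u v : V) (c d : mindex N -> C) (t h : R).
(* crd is an isometry of V onto the square summable families of coefficients. *)
Hypothesis crd_lin : forall (x : C) u v a, crd (x *: u + v) a = x * crd u a + crd v a.
Hypothesis crd_norm : forall u,
  (fun m => \sum_(n < m) cnorm2 n (crd u)) @ \oo --> rnorm u ^+ 2.
Hypothesis crd_surj : forall c (K : R), (forall m, \sum_(n < m) cnorm2 n c <= K) ->
  exists u, forall a, crd u a = c a.

Lemma crdD u v a : crd (u + v) a = crd u a + crd v a.
Proof. by rewrite -{1}[u]scale1r crd_lin mul1r. Qed.

Lemma crd0 a : crd 0 a = 0.
Proof. by have := crdD 0 0 a; rewrite addr0 => /eqP; rewrite -subr_eq subrr => /eqP. Qed.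

Lemma crdZ (x : C) u a : crd (x *: u) a = x * crd u a.
Proof. by rewrite -[_ *: _]addr0 crd_lin crd0 addr0. Qed.

Lemma crdN u a : crd (- u) a = - crd u a.
Proof. by rewrite -scaleN1r crdZ mulN1r. Qed.

Lemma crdB u v a : crd (u - v) a = crd u a - crd v a.
Proof. by rewrite crdD crdN. Qed.

Lemma crd_sum (I : Type) (r : seq I) (x : I -> V) a :
  crd (\sum_(i <- r) x i) a = \sum_(i <- r) crd (x i) a.
Proof.
by elim: r => [|i r ih]; rewrite ?big_nil ?crd0// !big_cons crdD ih.
Qed.

Lemma sum_cnorm2_homo c : {homo (fun m => \sum_(n < m) cnorm2 n c) : n m / (n <= m)%N >-> n <= m}.
Proof.
move=> m m' mm; rewrite -(subnKC mm) big_split_ord/= lerDl sumr_ge0// => i _.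
exact: cnorm2_ge0.
Qed.

Lemma sum_cnorm2_le u m : \sum_(n < m) cnorm2 n (crd u) <= rnorm u ^+ 2.
Proof.
rewrite -(cvg_lim _ (@crd_norm u))//.
apply: (nondecreasing_cvgn_le (@sum_cnorm2_homo (crd u))).
by apply/cvg_ex; exists (rnorm u ^+ 2); exact: crd_norm.
Qed.

Lemma cnorm2_le u n : cnorm2 n (crd u) <= rnorm u ^+ 2.
Proof.
apply: le_trans (sum_cnorm2_le u n.+1); rewrite big_ord_recr/= lerDr sumr_ge0// => i _.
exact: cnorm2_ge0.
Qed.

Lemma rnorm_le u (K : R) : (forall m, \sum_(n < m) cnorm2 n (crd u) <= K) ->
  rnorm u ^+ 2 <= K.
Proof.
move=> uK; rewrite -(cvg_lim _ (@crd_norm u))//; apply: limr_le.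
  by apply/cvg_ex; exists (rnorm u ^+ 2); exact: crd_norm.
by apply: nearW => m; exact: uK.
Qed.

Lemma crd_inj u v : (forall a, crd u a = crd v a) -> u = v.
Proof.
move=> uv; apply/eqP; rewrite -subr_eq0; apply/eqP; apply: rnorm_eq0.
apply/eqP; rewrite -sqrf_eq0; apply/eqP/le_anti; rewrite sqr_ge0 andbT.
apply: rnorm_le => m; rewrite big1// => n _.
by rewrite cnorm2E big1// => a _; rewrite crdB uv subrr /nrm2/= expr0n addr0 mulr0.
Qed.

Lemma nrm2_crd_le u a : nrm2 (crd u a) <= rnorm u ^+ 2.
Proof. exact: le_trans (nrm2_le_cnorm2 _ _) (cnorm2_le _ _). Qed.

(** The default value u is reached only when no vector has the coordinates [f (crd u)], that is,
    when they are not square summable. *)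
Definition spectral_lift (f : (mindex N -> C) -> mindex N -> C) u : V :=
  xget u [set v | forall a, crd v a = f (crd u) a].

Lemma crd_lift f (K : R) u : (forall n, cnorm2 n (f (crd u)) <= K * cnorm2 n (crd u)) ->
  0 <= K -> forall a, crd (spectral_lift f u) a = f (crd u) a.
Proof.
move=> fK K0; rewrite /spectral_lift; case: xgetP => [v _ //|no].
have [m|v cv] := @crd_surj (f (crd u)) (K * rnorm u ^+ 2).
  apply: le_trans (ler_wpM2l K0 (sum_cnorm2_le u m)).
  by rewrite mulr_sumr; apply: ler_sum => n _.
by have := no v.
Qed.

Lemma le_sqr_rnorm u v : rnorm u ^+ 2 <= rnorm v ^+ 2 -> rnorm u <= rnorm v.
Proof. by rewrite ler_sqr ?nnegrE ?rnorm_ge0. Qed.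

(** Dominated convergence over the degrees: beyond some m the tail is small by g, uniformly in x,
    and below m there are finitely many coordinates. *)
Lemma dominated_cvg_crd (T : Type) (F : set_system T) {FF : Filter F}
    (f : T -> V) (y : V) (g : nat -> R) :
  cvgn (fun m => \sum_(n < m) g n) ->
  (\forall x \near F, forall n, cnorm2 n (fun a => crd (f x) a - crd y a) <= g n) ->
  (forall a, complex.Re (crd (f x) a) @[x --> F] --> complex.Re (crd y a)) ->
  (forall a, complex.Im (crd (f x) a) @[x --> F] --> complex.Im (crd y a)) ->
  f x @[x --> F] --> y.
Proof.
move=> gc fg fR fI; apply/rcvgP => e e0.
(* F may be improper: without such a point it contains the empty set and the claim is trivial. The
   point also shows that g is nonnegative. *)
have [[x0 fx0]|noT] := pselect (exists x0, forall n, cnorm2 n (fun a => crd (f x0) a - crd y a) <= g n); last first.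
  near=> x; exfalso; apply: noT; exists x; near: x; exact: fg.
have g0 n : 0 <= g n by apply: le_trans (cnorm2_ge0 _ _) (fx0 n).
have homo : {homo (fun m => \sum_(n < m) g n) : n m / (n <= m)%N >-> n <= m}.
  by move=> m m' mm; rewrite -(subnKC mm) big_split_ord/= lerDl sumr_ge0.
set s := fun m => _ in gc homo.
have e2 : 0 < e ^+ 2 / 2 by rewrite divr_gt0// exprn_gt0.
have [m sm] : exists m, limn s - s m < e ^+ 2 / 2.
  have /cvgrPdist_lt/(_ _ e2) [m _ /(_ m (leqnn _))] := gc.
  by rewrite /= ger0_norm ?subr_ge0 ?nondecreasing_cvgn_le//; exists m.
have cv : (\sum_(0 <= n < m) cnorm2 n (fun a => crd (f x) a - crd y a)) @[x --> F] --> 0.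
  apply: cvg_sum_seq0 => n; under eq_cvg do rewrite cnorm2E.
  apply: cvg_sum_seq0 => a.
  rewrite -(mulr0 (mfact a)%:R); apply: cvgMr.
  have q (h : T -> R) l : h x @[x --> F] --> l -> (h x - l) ^+ 2 @[x --> F] --> 0.
    move=> hl; rewrite -(mulr0 0); under eq_cvg do rewrite expr2.
    have hl0 : h x - l @[x --> F] --> 0 by rewrite -(subrr l); apply: cvgB => //; exact: cvg_cst.
    exact: cvgM.
  rewrite -[0]addr0; apply: cvgD.
    by under eq_cvg do rewrite raddfB/=; exact: q.
  by under eq_cvg do rewrite raddfB/=; exact: q.
near=> x.
have fx : forall n, cnorm2 n (fun a => crd (f x) a - crd y a) <= g n by near: x.
rewrite -(ltr_pXn2r (n := 2))// ?nnegrE ?rnorm_ge0 ?ltW//.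
apply: (@le_lt_trans _ _ (\sum_(0 <= n < m) cnorm2 n (fun a => crd (f x) a - crd y a) +
   (limn s - s m))); last first.
  rewrite [ltRHS](_ : _ = e ^+ 2 / 2 + e ^+ 2 / 2); last by lra.
  apply: ltrD => //; near: x.
  have := cv; move=> /cvgrPdist_lt/(_ _ e2); apply: filterS => x.
  by rewrite sub0r normrN; apply: le_lt_trans; exact: ler_norm.
apply: rnorm_le => M.
have -> : crd (f x - y) = fun a => crd (f x) a - crd y a by apply/funext => a; exact: crdB.
have lim0 : forall k, (m <= k)%N -> \sum_(n < k) cnorm2 n (fun a => crd (f x) a - crd y a) <=
   \sum_(0 <= n < m) cnorm2 n (fun a => crd (f x) a - crd y a) + (limn s - s m).
  move=> k mk; rewrite -(subnKC mk) big_split_ord/= lerD//.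
    by rewrite big_mkord.
  rewrite lerBrDl; apply: le_trans (nondecreasing_cvgn_le homo gc k).
  by rewrite /s -[in leRHS](subnKC mk) big_split_ord/= lerD2l; apply: ler_sum.
have [Mm|/ltnW mM] := leqP m M; first exact: lim0.
apply: le_trans (lim0 m (leqnn _)).
exact: (@sum_cnorm2_homo (fun a => crd (f x) a - crd y a)).
Unshelve. all: by end_near. Qed.

Lemma crd_cvg (T : Type) (F : set_system T) {FF : Filter F} (f : T -> V) y a :
  f x @[x --> F] --> y ->
  complex.Re (crd (f x) a) @[x --> F] --> complex.Re (crd y a) /\
  complex.Im (crd (f x) a) @[x --> F] --> complex.Im (crd y a).
Proof.
move=> /rcvgP fy.
have h (p : C -> R) : {morph p : x y / x - y} -> (forall z, p z ^+ 2 <= nrm2 z) ->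
    p (crd (f x) a) @[x --> F] --> p (crd y a).
  move=> pB p2; apply/cvgrPdist_lt => e e0; near=> x.
  rewrite distrC -pB -crdB; apply: (@le_lt_trans _ _ (rnorm (f x - y))); last first.
    by near: x; exact: fy.
  rewrite -(ler_pXn2r (n := 2))// ?nnegrE ?rnorm_ge0// real_normK ?num_real//.
  exact: le_trans (p2 _) (nrm2_crd_le _ _).
split; apply: h => [x z|z]; rewrite ?raddfB// /nrm2 ?lerDl ?lerDr ?sqr_ge0//.
Unshelve. all: by end_near. Qed.

Lemma cnorm2N n c : cnorm2 n (fun a => - c a) = cnorm2 n c.
Proof.
by rewrite !cnorm2E; apply: eq_bigr => a _; rewrite /nrm2 !raddfN !sqrrN.
Qed.

Lemma cnorm2B n c d : cnorm2 n (fun a => c a - d a) <= 2 * (cnorm2 n c + cnorm2 n d).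
Proof. by rewrite -(cnorm2N n d); exact: cnorm2D. Qed.

Lemma cvg_sum_cnorm2 (k : R) u : cvgn (fun m => \sum_(n < m) k * cnorm2 n (crd u)).
Proof.
under eq_fun do rewrite -mulr_sumr.
apply/cvg_ex; exists (k * rnorm u ^+ 2); apply: cvgMr; exact: crd_norm.
Qed.

(** The image of F under phi is an ultrafilter that contains a compact segment. *)
Lemma ultra_real_cvg (T : Type) (F : set_system T) (phi : T -> R) (rho : R) :
  UltraFilter F -> F [set x | - rho <= phi x <= rho] ->
  exists l : R, phi x @[x --> F] --> l.
Proof.
move=> UF Frho.
have UG : UltraFilter (phi x @[x --> F]).
  split; first exact: fmap_proper_filter.
  move=> G PG sG; apply/seteqP; split=> P; last exact: sG.
  move=> GP; have [//|FC] := in_ultra_setVsetC (phi @^-1` P) UF.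
  have G0 : G set0 by rewrite -(setICr P); exact: filterI (sG (~` P) FC).
  by exfalso; exact: (@filter_not_empty _ G).
have := @segment_compact R (- rho) rho; rewrite compact_ultra => /(_ _ UG)[].
  have : F (phi @^-1` `[- rho, rho]) by apply: filterS Frho => x /= h; rewrite in_itv.
  exact.
by move=> l [_ pl]; exists l.
Qed.

(** A Hilbert cube. Along an ultrafilter every coordinate converges, being bounded; the limits obey
    the same bounds, and r dominates the convergence. *)
Lemma cube_compact (r : nat -> R) : cvgn (fun m => \sum_(n < m) r n) ->
  compact [set u : V | forall n, cnorm2 n (crd u) <= r n].
Proof.
move=> rc; rewrite compact_ultra => F UF FQ.
have [u0 /= u0Q] := filter_ex FQ.
have r0 n : 0 <= r n by apply: le_trans (u0Q n); exact: cnorm2_ge0.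
have bd (p : C -> R) a : (forall z, p z ^+ 2 <= nrm2 z) ->
    exists l : R, p (crd x a) @[x --> F] --> l.
  move=> p2; apply: (@ultra_real_cvg _ _ _ (1 + r (mdeg a))).
  apply: filterS FQ => x /= /(_ (mdeg a)) xr; rewrite -ler_norml.
  have h := le_trans (p2 (crd x a)) (le_trans (nrm2_le_cnorm2 _ _) xr).
  rewrite -(ler_pXn2r (n := 2))// ?nnegrE ?addr_ge0// real_normK ?num_real//.
  apply: le_trans h _; have := r0 (mdeg a); have := sqr_ge0 (r (mdeg a)).
  by rewrite sqrrD expr1n mul1r; lra.
have re2 (z : C) : complex.Re z ^+ 2 <= nrm2 z by rewrite /nrm2 lerDl sqr_ge0.
have [reL reE] := choice (fun a => bd _ a re2).
have im2 (z : C) : complex.Im z ^+ 2 <= nrm2 z by rewrite /nrm2 lerDr sqr_ge0.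
have [imL imE] := choice (fun a => bd _ a im2).
pose d a : C := (reL a +i* imL a)%C.
have dr n : cnorm2 n d <= r n.
  have c1 : cnorm2 n (crd x) @[x --> F] --> cnorm2 n d.
    under eq_cvg do rewrite cnorm2E.
    rewrite cnorm2E; apply: cvg_sum_seq => a; apply: cvgMr.
    by apply: cvgD; rewrite expr2; under eq_cvg do rewrite expr2; apply: cvgM.
  rewrite -(cvg_lim _ c1)//; apply: limr_le; first by apply/cvg_ex; exists (cnorm2 n d).
  by apply: filterS FQ => x; exact.
have [m|u uE] := @crd_surj d (limn (fun m => \sum_(n < m) r n)).
  have homo : {homo (fun m => \sum_(n < m) r n) : n m / (n <= m)%N >-> n <= m}.
    by move=> k k' kk; rewrite -(subnKC kk) big_split_ord/= lerDl sumr_ge0.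
  by apply: le_trans (nondecreasing_cvgn_le homo rc m); apply: ler_sum.
exists u; split.
  by move=> n /=; apply: le_trans (dr n); rewrite (@eq_cnorm2 _ _ _ _ d).
apply: (@dominated_cvg_crd _ F _ id u (fun n => 4 * r n)).
- under eq_fun do rewrite -mulr_sumr.
  by move: rc => /cvg_ex[l rl]; apply/cvg_ex; exists (4 * l); apply: cvgMr.
- apply: filterS FQ => x /= xr n; apply: le_trans (cnorm2B _ _ _) _.
  by have := xr n; have := dr n; rewrite (@eq_cnorm2 _ _ _ d (crd u))// => ? ?; lra.
- by move=> a; rewrite uE; exact: reE.
- by move=> a; rewrite uE; exact: imE.
Qed.

Variables (A : 'M[R]_N) (lam : R).
Hypotheses (lam0 : 0 < lam) (cA : coercive_mx lam A).
Let lam0' : 0 <= lam := ltW lam0.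

Definition gen_graph : set (V * V) :=
  [set uv | forall a, crd uv.2 a = gen (toC A) (crd uv.1) a].

Definition exp_gen t : V -> V := spectral_lift (egenC A t).

Lemma crd_exp_gen t u a : 0 <= t -> crd (exp_gen t u) a = egenC A t (crd u) a.
Proof.
move=> t0; apply: (@crd_lift _ 1) => // n.
by rewrite mul1r; exact: (cnorm2_egenC n _ lam0' cA).
Qed.

Lemma exp_gen_contraction : contraction_semigroup exp_gen.
Proof.
split.
- move=> t t0; split=> [x u v|u].
    apply: crd_inj => a; rewrite crd_lin !crd_exp_gen// -(egenC_lin _ _ _ _ lam0' cA)//.
    have -> : crd (x *: u + v) = fun b => x * crd u b + crd v b.
      by apply/funext => b; rewrite crd_lin.
    by [].
  rewrite le_normE; apply: le_sqr_rnorm; apply: rnorm_le => m.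
  apply: le_trans (sum_cnorm2_le u m); apply: ler_sum => n _.
  rewrite (@eq_cnorm2 _ _ _ _ (egenC A t (crd u))).
    exact: (cnorm2_egenC n _ lam0' cA).
  by move=> a _; exact: crd_exp_gen.
- by move=> u; apply: crd_inj => a; rewrite crd_exp_gen// egenC0.
- move=> s t u s0 t0; apply: crd_inj => a; rewrite !crd_exp_gen ?addr_ge0//.
  have -> : crd (exp_gen t u) = egenC A t (crd u).
    by apply/funext => b; rewrite crd_exp_gen.
  by rewrite (egenCD _ _ lam0' cA).
(* In each degree both terms of the difference are bounded by the component of u, whence the
   majorant. *)
move=> u; apply: (@dominated_cvg_crd _ _ _ _ u (fun n => 4 * cnorm2 n (crd u))).
- exact: cvg_sum_cnorm2.
- near=> t => n; have t0 : 0 <= t by apply: ltW; near: t; exact: nbhs_right_gt.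
  apply: le_trans (cnorm2B _ _ _) _.
  have := cnorm2_egenC n (crd u) lam0' cA t0.
  rewrite (@eq_cnorm2 _ _ _ (crd (exp_gen t u)) (egenC A t (crd u))); first lra.
  by move=> a _; exact: crd_exp_gen.
- move=> a; pose g t := egen A t (fun a => complex.Re (crd u a)) a.
  have g0 : g 0 = complex.Re (crd u a) by rewrite /g egen0.
  rewrite -g0; have gc : g x @[x --> 0^'+] --> g 0.
    apply: cvg_at_right_filter; apply: differentiable_continuous.
    by apply/derivable1_diffP; case: (egen_is_derive A 0 (fun a => complex.Re (crd u a)) a).
  apply: cvg_trans gc; apply: near_eq_cvg; near=> t.
  by rewrite crd_exp_gen//; apply: ltW; near: t; exact: nbhs_right_gt.
- move=> a; pose g t := egen A t (fun a => complex.Im (crd u a)) a.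
  have g0 : g 0 = complex.Im (crd u a) by rewrite /g egen0.
  rewrite -g0; have gc : g x @[x --> 0^'+] --> g 0.
    apply: cvg_at_right_filter; apply: differentiable_continuous.
    by apply/derivable1_diffP; case: (egen_is_derive A 0 (fun a => complex.Im (crd u a)) a).
  apply: cvg_trans gc; apply: near_eq_cvg; near=> t.
  by rewrite crd_exp_gen//; apply: ltW; near: t; exact: nbhs_right_gt.
Unshelve. all: by end_near. Qed.

Lemma crd_quotient h u a : 0 < h ->
  crd ((h^-1)%:C%C *: (exp_gen h u - u)) a = (h^-1)%:C%C * (egenC A h (crd u) a - crd u a).
Proof. by move=> h0; rewrite crdZ crdB crd_exp_gen// ltW. Qed.

Lemma exp_gen_Re_cvg u a :
  complex.Re (crd ((h^-1)%:C%C *: (exp_gen h u - u)) a) @[h --> 0^'+] -->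
  complex.Re (gen (toC A) (crd u) a).
Proof.
rewrite Re_gen; apply: cvg_trans (@egen_cvg R N A (fun a => complex.Re (crd u a)) a).
apply: near_eq_cvg; near=> h; have h0 : 0 < h by near: h; exact: nbhs_right_gt.
rewrite crd_quotient// Re_rM mulrC; congr (_ * _); by rewrite raddfB.
Unshelve. all: by end_near. Qed.

Lemma exp_gen_Im_cvg u a :
  complex.Im (crd ((h^-1)%:C%C *: (exp_gen h u - u)) a) @[h --> 0^'+] -->
  complex.Im (gen (toC A) (crd u) a).
Proof.
rewrite Im_gen; apply: cvg_trans (@egen_cvg R N A (fun a => complex.Im (crd u a)) a).
apply: near_eq_cvg; near=> h; have h0 : 0 < h by near: h; exact: nbhs_right_gt.
rewrite crd_quotient// Im_rM mulrC; congr (_ * _); by rewrite raddfB.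
Unshelve. all: by end_near. Qed.

(** A limit in norm is a limit of coordinates, hence the one of [egen]. Conversely, when the
    coordinates of v are [gen] of those of u, [cnorm2_egenC_diff] bounds each degree of the quotient
    by that of v, and coordinatewise convergence is dominated. *)
Lemma exp_gen_generator : generator exp_gen = gen_graph.
Proof.
apply/seteqP; split=> -[u v] /= uv.
  move=> a /=; have [hR hI] := crd_cvg a uv.
  have e1 := cvg_unique (@Rhausdorff R) hR (@exp_gen_Re_cvg u a).
  have e2 := cvg_unique (@Rhausdorff R) hI (@exp_gen_Im_cvg u a).
  by apply/eqP; rewrite eq_complex e1 e2 !eqxx.
rewrite /generator /=; apply: (@dominated_cvg_crd _ _ _ _ v (fun n => 4 * cnorm2 n (crd v))).
- exact: cvg_sum_cnorm2.
- near=> h => n; have h0 : 0 < h by near: h; exact: nbhs_right_gt.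
  apply: le_trans (cnorm2B _ _ _) _.
  rewrite (@eq_cnorm2 _ _ _ (crd (_ *: _)) (fun a => (h^-1)%:C%C * (egenC A h (crd u) a - crd u a))).
    rewrite cnorm2Z; have := cnorm2_egenC_diff n (crd u) lam0' cA (ltW h0).
    rewrite (@eq_cnorm2 _ _ _ (gen (toC A) (crd u)) (crd v)) => [le1|a _]; last first.
      by rewrite (uv a).
    have -> : nrm2 (h^-1)%:C%C = (h ^+ 2)^-1 by rewrite /nrm2/= expr0n addr0 exprVn.
    rewrite -(ler_pdivrMl _ _ (exprn_gt0 2 h0)) in le1; lra.
  by move=> a _; exact: crd_quotient.
- by move=> a; rewrite (uv a); exact: exp_gen_Re_cvg.
- by move=> a; rewrite (uv a); exact: exp_gen_Im_cvg.
Unshelve. all: by end_near. Qed.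

(* The factor n.+1 ^- 2 is summable, so the image of a ball lies in a Hilbert cube:
   the resolvent is compact. *)
Definition has_bounded_solver z := exists s : (mindex N -> C) -> mindex N -> C, exists M : R,
  [/\ 0 <= M, forall f a, gen (toC A) (s f) a = f a + z * s f a &
      forall n f, cnorm2 n (s f) <= M / n.+1%:R ^+ 2 * cnorm2 n f].

(** From n0 on, dissipation bounds the solver by 4 / (lam (n + 1))^2; the finitely many degrees
    below have their own constants, which M absorbs. *)
Lemma noneigen_bounded_solver z : noneigen A z -> has_bounded_solver z.
Proof.
move=> nz; have [s [sE sK]] := noneigen_solve nz.
have {}sK n : exists K, 0 <= K /\ forall f, cnorm2 n (s f) <= K * cnorm2 n f.
  by have [K K0 KE] := sK n; exists K.
have /choice[K KE] := sK.
(* For n >= n0, lam n + Re z is at least lam (n + 1) / 2. *)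
pose x := complex.Re z; pose n0 := Num.bound (1 + 2 * `|x| / lam).
have n0E : 1 + 2 * `|x| / lam < n0%:R.
  by apply: archi_boundP; rewrite addr_ge0// divr_ge0// mulr_ge0.
pose M := 4 / lam ^+ 2 + \sum_(n < n0) K n * n.+1%:R ^+ 2.
have M1 : 0 <= \sum_(n < n0) K n * n.+1%:R ^+ 2.
  by rewrite sumr_ge0// => n _; rewrite mulr_ge0 ?sqr_ge0//; have [] := KE n.
have M2 : 0 <= 4 / lam ^+ 2 by rewrite divr_ge0// sqr_ge0.
exists s, M; split=> //; first exact: addr_ge0.
move=> n f; have sq0 : 0 < n.+1%:R ^+ 2 :> R by rewrite exprn_gt0.
have [nn0|n0n] := ltnP n n0.
  have [K0 /(_ f)] := KE n; move/le_trans; apply; rewrite ler_wpM2r ?cnorm2_ge0//.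
  rewrite ler_pdivlMr// /M (bigD1 (Ordinal nn0))//= addrCA lerDl addr_ge0//.
  by rewrite sumr_ge0// => m _; rewrite mulr_ge0 ?sqr_ge0//; have [] := KE m.
have Dn : lam / 2 * n.+1%:R <= lam * n%:R + x.
  have : 1 + 2 * `|x| / lam <= n%:R by apply: le_trans (ltW n0E) _; rewrite ler_nat.
  rewrite -(ler_pM2l lam0) mulrDr mulr1 [lam * (_ / _)]mulrC divfK ?gt_eqF// => h.
  have -> : lam / 2 * n.+1%:R = (lam * n%:R + lam) / 2 by rewrite -natr1; field.
  have := ler_norm (- x); rewrite normrN; lra.
have D0 : 0 < lam / 2 * n.+1%:R by rewrite mulr_gt0 ?divr_gt0// ltr0n.
have h := @gen_resolvent_le _ _ _ lam z n f (s f) cA lam0' (sE f) (lt_le_trans D0 Dn).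
rewrite mulrAC ler_pdivlMr// mulrC.
apply: (@le_trans _ _ (4 / lam ^+ 2 * cnorm2 n f)); last first.
  by rewrite ler_wpM2r ?cnorm2_ge0// lerDl.
rewrite [leRHS]mulrAC ler_pdivlMr ?exprn_gt0//.
have h2 : (lam / 2 * n.+1%:R) ^+ 2 * cnorm2 n (s f) <= cnorm2 n f.
  apply: le_trans h; rewrite ler_wpM2r ?cnorm2_ge0// ler_sqr ?nnegrE ?(ltW D0)//.
  exact: le_trans (ltW D0) Dn.
move: h2; rewrite !exprMn; lra.
Qed.

Lemma noneigen_uniq z c d f : noneigen A z ->
  (forall a, gen (toC A) c a = f a + z * c a) ->
  (forall a, gen (toC A) d a = f a + z * d a) -> forall a, c a = d a.
Proof.
move=> nz cf df a; apply/eqP; rewrite -subr_eq0; apply/eqP.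
have := nz (fun a => (-1) * d a + c a) _ a.
rewrite mulN1r addrC; apply => b.
by rewrite gen_lin cf df; ring.
Qed.

(** Comparison with the telescoping series of 1 / (n (n + 1)). *)
Lemma inv_sqr_summable (M : R) : 0 <= M ->
  cvgn (fun m => \sum_(n < m) M / n.+1%:R ^+ 2).
Proof.
move=> M0; apply: nondecreasing_is_cvgn.
  move=> m m' mm; rewrite -(subnKC mm) big_split_ord/= lerDl sumr_ge0// => n _.
  by rewrite divr_ge0// sqr_ge0.
exists (M * 2) => _ [m _ <-]; rewrite -mulr_sumr ler_wpM2l//.
case: m => [|m]; first by rewrite big_ord0.
suff : \sum_(n < m.+1) (n.+1%:R ^+ 2)^-1 <= 2 - (m.+1%:R)^-1 :> R.
  by move/le_trans; apply; rewrite gerBl invr_ge0.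
elim: m => [|m ih]; first by rewrite big_ord1 expr1n invr1; lra.
rewrite big_ord_recr/=; apply: le_trans (lerD ih (lexx _)) _.
rewrite -lerBrDl; have a0 : 0 < m.+1%:R :> R by rewrite ltr0n.
have -> : m.+2%:R = m.+1%:R + 1 :> R by rewrite natr1.
set y := m.+1%:R in a0 *.
have y1 : 0 < y + 1 by rewrite addr_gt0.
rewrite [leRHS](_ : _ = (y * (y + 1))^-1); last by field; rewrite !gt_eqF.
by rewrite lef_pV2 ?posrE ?mulr_gt0 ?exprn_gt0// expr2 ler_pM2r// lerDl.
Qed.

(** Linearity of the lifted solver follows from uniqueness of solutions, its continuity from a bound
    uniform in the degree. *)
Lemma noneigen_resolvent z : noneigen A z -> resolvent_set gen_graph z.
Proof.
move=> nz; have [s [M [M0 sE sM]]] := noneigen_bounded_solver nz.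
have sM' n f : cnorm2 n (s f) <= M * cnorm2 n f.
  apply: le_trans (sM n f) _; rewrite ler_wpM2r ?cnorm2_ge0// ler_piMr//.
  by rewrite invf_le1 ?exprn_gt0// exprn_ege1// ler1n.
pose B := spectral_lift s.
have crdB' f a : crd (B f) a = s (crd f) a by apply: (@crd_lift s M).
have sB f a : gen (toC A) (crd (B f)) a = crd f a + z * crd (B f) a.
  have -> : crd (B f) = s (crd f) by apply/funext => b; exact: crdB'.
  exact: sE.
have linB : linear B.
  move=> x u v; apply: crd_inj; apply: (noneigen_uniq nz (sB _)) => a.
  have -> : crd (x *: B u + B v) = fun b => x * crd (B u) b + crd (B v) b.
    by apply/funext => b; rewrite crd_lin.
  by rewrite gen_lin !sB crd_lin; ring.
have BM u : rnorm (B u) ^+ 2 <= M * rnorm u ^+ 2.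
  apply: rnorm_le => m; apply: le_trans (ler_wpM2l M0 (sum_cnorm2_le u m)).
  rewrite mulr_sumr; apply: ler_sum => n _; apply: le_trans (sM' n (crd u)).
  by rewrite (@eq_cnorm2 _ _ _ _ (s (crd u)))// => a _; exact: crdB'.
exists B; split; first split=> //.
- move=> u; apply/rcvgP => e e0.
  have Bsub v : B v - B u = B (v - u).
    by have := linB (-1) u v; rewrite /= !scaleN1r addrC => <-; rewrite addrC.
  have e1 : 0 < e / (1 + M) by rewrite divr_gt0// ltr_pwDl.
  have /rcvgP/(_ _ e1) hv : (fun v : V => v) v @[v --> u] --> u by exact: cvg_id.
  near=> v; have vu : rnorm (v - u) < e / (1 + M) by near: v; exact: hv.
  rewrite Bsub -(ltr_pXn2r (n := 2))// ?nnegrE ?rnorm_ge0 ?(ltW e0)//.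
  apply: le_lt_trans (BM _) _.
  have M1 : 0 < 1 + M by rewrite ltr_pwDl.
  move: vu; rewrite ltr_pdivlMr// -(ltr_pXn2r (n := 2)) ?nnegrE ?mulr_ge0 ?rnorm_ge0 ?(ltW e0) ?(ltW M1)//.
  apply: le_lt_trans; rewrite exprMn mulrC ler_wpM2l ?sqr_ge0//.
  by have := sqr_ge0 M; rewrite sqrrD expr1n mul1r; lra.
- move=> u f; split=> [uf|->] /=.
    apply: crd_inj; apply: (noneigen_uniq nz _ (sB f)) => a.
    by rewrite -(uf a) /= crdD crdZ.
  by move=> a /=; rewrite sB crdD crdZ.
Unshelve. all: by end_near. Qed.

(** Restricted to one degree, a formal eigenfunction has finite support and so comes from V: formal
    and true eigenvalues agree. *)
Lemma eigenvector_in_V z d n a : (forall a, gen (toC A) d a = z * d a) ->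
  mdeg a = n -> d a != 0 ->
  exists u, (forall b, gen (toC A) (crd u) b = z * crd u b) /\ crd u a != 0.
Proof.
move=> dz an da; have [m|u uE] := @crd_surj (restr n d) (cnorm2 n d).
  have h k : cnorm2 k (restr n d) = (k == n)%:R * cnorm2 n d.
    have [->|kn] := eqVneq k n.
      by rewrite mul1r; apply: eq_cnorm2 => b bn; rewrite /restr bn eqxx.
    rewrite mul0r cnorm2E big_seq big1// => b; rewrite mem_grade => /eqP bk.
    by rewrite /restr bk (negbTE kn) /nrm2/= expr0n addr0 mulr0.
  have [mn|nm] := leqP m n.
    rewrite big1 ?cnorm2_ge0// => k _; rewrite h ltn_eqF ?mul0r//.
    exact: leq_trans (ltn_ord k) mn.
  rewrite (bigD1 (Ordinal nm))//= big1 ?addr0; first by rewrite h eqxx mul1r.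
  move=> k kn; rewrite h; case: (eqVneq (k : nat)) => [kE|_]; rewrite ?mul0r//.
  by case/negP: kn; apply/eqP/val_inj.
have uE' : crd u = restr n d by apply/funext.
exists u; rewrite uE'; split; last by rewrite /restr an eqxx.
by move=> b; rewrite gen_restr /restr dz; case: ifP => // _; rewrite mulr0.
Qed.

Lemma resolvent_noneigen z B : is_resolvent gen_graph z B -> noneigen A z.
Proof.
move=> [[linB _] BE] d dz a; apply: contrapT => /eqP da.
have [u [uz ua]] := eigenvector_in_V dz (erefl _) da.
have B0 : B 0 = 0.
  by have := linB 1 0 0; rewrite scale1r addr0 => /eqP; rewrite scale1r -subr_eq subrr => /eqP.
have : u = B 0 by apply/BE => b /=; rewrite add0r crdZ.
by rewrite B0 => u0; move: ua; rewrite u0 crd0 eqxx.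
Qed.

Lemma gen_graph_compact_resolvent : has_compact_resolvent gen_graph.
Proof.
split.
  (* Eigenvalues of [gen] have nonpositive real part, so 1 is not among them. *)
  exists 1; apply: noneigen_resolvent => d dz a.
  have [//|da] := eqVneq (d a) 0.
  exfalso; have := eigen_gen_Re lam0' cA dz da => /=.
  by have := mulr_ge0 lam0' (ler0n R (mdeg a)); lra.
move=> z B Bz; have nz := resolvent_noneigen Bz.
have [s [M [M0 sE sM]]] := noneigen_bounded_solver nz.
(* Formal solutions are unique, so any resolvent has the coordinates of the bounded solver. *)
have Bs f a : crd (B f) a = s (crd f) a.
  apply: (noneigen_uniq nz _ (sE (crd f))) => b.
  by have [_ /(_ (B f) f)[_ /(_ erefl)/(_ b)]] := Bz; rewrite /= crdD crdZ.
have cQ := @cube_compact (fun n => M / n.+1%:R ^+ 2) (inv_sqr_summable M0).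
apply: (subclosed_compact _ cQ); first exact: closed_closure.
rewrite [X in _ `<=` X](closure_id _).1; last first.
  by apply: compact_closed cQ; exact: norm_hausdorff.
apply: closureS => _ [f /= f1 <-] n.
rewrite (@eq_cnorm2 _ _ _ _ (s (crd f))) => [|a _]; last exact: Bs.
apply: le_trans (sM n _) _; rewrite ler_piMr//.
  by rewrite divr_ge0// sqr_ge0.
apply: le_trans (cnorm2_le f n) _; rewrite -[1](expr1n _ 2) ler_sqr ?nnegrE ?rnorm_ge0//.
by rewrite -lecR -rnormE.
Qed.

(** A bounded inverse of the opposite operator at z is minus a bounded inverse of the operator at -
    z; an eigenvector prevents both. *)
Lemma spectrum_oppop z : spectrum (oppop gen_graph) z <-> ~ noneigen A (- z).
Proof.
split=> [sz nz|nnz [B [[linB cB] BE]]].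
  apply: sz; have [B [[linB cB] BE]] := noneigen_resolvent nz.
  exists (fun f => - B f); split; first split.
  - by move=> x u v; rewrite linB opprD scalerN.
  - by move=> u; apply: cvgN; exact: cB.
  move=> u f; have BN : - B f = B (- f).
    have B0 : B 0 = 0.
      by have := linB 1 0 0; rewrite scale1r addr0 => /eqP; rewrite scale1r -subr_eq subrr => /eqP.
    by have := linB (-1) f 0; rewrite !scaleN1r !addr0 B0 addr0.
  rewrite BN -BE /oppop /=; have -> : - f + - z *: u = - (f + z *: u).
    by rewrite opprD scaleNr.
  by [].
apply: nnz => d dz a; apply: contrapT => /eqP da.
have [u [uz ua]] := eigenvector_in_V dz (erefl _) da.
have B0 : B 0 = 0.
  by have := linB 1 0 0; rewrite scale1r addr0 => /eqP; rewrite scale1r -subr_eq subrr => /eqP.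
have : u = B 0 by apply/BE => b /=; rewrite add0r crdN crdZ uz mulNr.
by rewrite B0 => u0; move: ua; rewrite u0 crd0 eqxx.
Qed.

Lemma rnorm_contraction T t u v : contraction_semigroup T -> 0 <= t ->
  rnorm (T t u - T t v) <= rnorm (u - v).
Proof.
move=> [cT _ _ _] t0; have [linT normT] := cT t t0.
have := normT (u - v); rewrite le_normE; apply: le_trans.
by have := linT (-1) v u; rewrite !scaleN1r [- v + _]addrC [- T t v + _]addrC => <-.
Qed.

(** The basis vectors; they have squared norm a!, not 1. *)
Definition unitv a : V := xget 0 [set v | forall b, crd v b = delta R a b].

Lemma crd_unitv a b : crd (unitv a) b = delta R a b.
Proof.
rewrite /unitv; case: xgetP => [v _ /=//|no].
have [m|v cv] := @crd_surj (delta R a) (mfact a)%:R; last by have := no v.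
have h k : cnorm2 k (delta R a) = (k == mdeg a)%:R * (mfact a)%:R.
  rewrite cnorm2E /delta; have [->|kn] := eqVneq k (mdeg a).
    rewrite (bigD1_seq a)/= ?grade_uniq ?mem_grade// eqxx big1 => [|b' /negbTE ->].
      by rewrite /nrm2/= expr1n expr0n !addr0 mulr1 mul1r.
    by rewrite /nrm2/= expr0n addr0 mulr0.
  rewrite mul0r big_seq big1// => b'; rewrite mem_grade => /eqP bk.
  case: eqP => [ba|_]; first by rewrite -bk ba eqxx in kn.
  by rewrite /nrm2/= expr0n addr0 mulr0.
have [mn|nm] := leqP m (mdeg a).
  rewrite big1// => k _; rewrite h ltn_eqF ?mul0r//.
  exact: leq_trans (ltn_ord k) mn.
rewrite (bigD1 (Ordinal nm))//= big1 ?addr0; first by rewrite h eqxx mul1r.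
move=> k kn; rewrite h; case: (eqVneq (k : nat)) => [kE|_]; rewrite ?mul0r//.
  by case/negP: kn; apply/eqP/val_inj.
Qed.

Lemma crd_in_span u (r : seq (mindex N)) : uniq r ->
  (forall a, a \notin r -> crd u a = 0) -> u = \sum_(a <- r) crd u a *: unitv a.
Proof.
move=> ur u0; apply: crd_inj => b; rewrite crd_sum.
under eq_bigr do rewrite crdZ crd_unitv /delta.
have [br|bnr] := boolP (b \in r).
  rewrite (bigD1_seq b)//= eqxx mulr1 big1 ?addr0// => a /negbTE.
  by rewrite eq_sym => ->; rewrite mulr0.
rewrite u0// big_seq big1// => a ar; case: eqP => [ba|_]; last by rewrite mulr0.
by rewrite -ba (negbTE bnr) in ar.
Qed.

Lemma rnorm_sum (I : Type) (r : seq I) (x : I -> V) :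
  rnorm (\sum_(i <- r) x i) <= \sum_(i <- r) rnorm (x i).
Proof.
elim: r => [|i r ih]; first by rewrite !big_nil rnorm0.
by rewrite !big_cons; apply: le_trans (rnormD _ _) _; rewrite lerD2l.
Qed.

Lemma linear_sum_scale (B : V -> V) (I : Type) (r : seq I) (x : I -> C) (e : I -> V) :
  linear B -> B (\sum_(i <- r) x i *: e i) = \sum_(i <- r) x i *: B (e i).
Proof.
move=> lB; elim: r => [|i r ih]; last by rewrite !big_cons lB ih.
rewrite !big_nil; have := lB 1 0 0; rewrite scale1r addr0 => /eqP.
by rewrite scale1r -subr_eq subrr => /eqP.
Qed.

Lemma rnormZ_le (x : C) v (k : R) : nrm2 x <= k ^+ 2 -> 0 <= k ->
  rnorm (x *: v) <= k * rnorm v.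
Proof.
move=> xk k0; rewrite -(ler_pXn2r (n := 2))// ?nnegrE ?mulr_ge0 ?rnorm_ge0//.
by rewrite rnormZ exprMn ler_wpM2r ?sqr_ge0.
Qed.

(* Over a subdivision of step h = t / k of [0, t], the defect T h - exp_gen h
   is o(h) uniformly on the orbit of u, which stays in a finite dimensional
   space of elements of the domain. *)
Lemma generated_finite T m u t : contraction_semigroup T -> generator T = gen_graph ->
  (forall a, (m <= mdeg a)%N -> crd u a = 0) -> 0 <= t -> T t u = exp_gen t u.
Proof.
move=> cT gT u0 t0.
have cS := exp_gen_contraction.
pose r := [seq a <- flatten [seq grade N n | n <- iota 0 m] | true].
pose r' := undup r.
have mr a : (a \in r') = (mdeg a < m)%N.
  rewrite mem_undup mem_filter/=; apply/flattenP/idP => [[s /mapP[n]]|am].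
    by rewrite mem_iota/= add0n => nm ->; rewrite mem_grade => /eqP ->.
  by exists (grade N (mdeg a)); rewrite ?mem_grade//; apply: map_f; rewrite mem_iota.
have S0 s a : 0 <= s -> a \notin r' -> crd (exp_gen s u) a = 0.
  rewrite mr -leqNgt => s0 am; rewrite crd_exp_gen//; apply: nrm2_eq0; apply/le_anti.
  rewrite nrm2_ge0 andbT; apply: le_trans (nrm2_le_cnorm2 _ _) _.
  apply: le_trans (cnorm2_egenC _ _ lam0' cA s0) _.
  rewrite cnorm2E big_seq big1// => b; rewrite mem_grade => /eqP ba.
  by rewrite u0 ?ba// /nrm2/= expr0n addr0 mulr0.
pose w h a := rnorm (T h (unitv a) - exp_gen h (unitv a)).
(* By induction on k: contraction of T h carries over the previous error, and the new one is the
   defect of one step at the orbit point, expanded over the [unitv a] with coefficients bounded by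
   the norm of u. *)
have wE h k : 0 <= h ->
    rnorm (T (h *+ k) u - exp_gen (h *+ k) u) <= k%:R * (rnorm u * \sum_(a <- r') w h a).
  move=> h0; elim: k => [|k ih].
    have [_ -> _ _] := cT; have [_ -> _ _] := cS.
    by rewrite subrr rnorm0 mul0r.
  have hk0 : 0 <= h *+ k by rewrite mulrn_wge0.
  have [_ _ TD _] := cT; have [_ _ SD _] := cS; rewrite mulrS TD// SD//.
  set x := T (h *+ k) u; set y := exp_gen (h *+ k) u.
  have -> : T h x - exp_gen h y = (T h x - T h y) + (T h y - exp_gen h y).
    by rewrite addrA subrK.
  rewrite -natr1 mulrDl mul1r; apply: le_trans (rnormD _ _) _; apply: lerD.
    by apply: le_trans ih; exact: rnorm_contraction.
  rewrite (@crd_in_span y r') ?undup_uniq//; last by move=> a; exact: S0.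
  have [/(_ h h0)[linT _] _ _ _] := cT; have [/(_ h h0)[linS _] _ _ _] := cS.
  rewrite (@linear_sum_scale (T h) _ _ _ _ linT) (@linear_sum_scale (exp_gen h) _ _ _ _ linS).
  rewrite -sumrB; apply: le_trans (rnorm_sum _ _) _.
  rewrite mulr_sumr; apply: ler_sum => a _; rewrite -scalerBr.
  apply: rnormZ_le; last exact: rnorm_ge0.
  apply: le_trans (nrm2_crd_le _ _) _; rewrite ler_sqr ?nnegrE ?rnorm_ge0// -le_normE.
  by have [/(_ _ hk0)[_ /(_ u)]] := cS.
(* Both generators take the same value at [unitv a], so the two difference quotients cancel in the
   limit. *)
have wo a : w h a / h @[h --> 0^'+] --> 0.
  have [v uv] : exists v, gen_graph (unitv a, v).
    have [k|v vE] := @crd_surj (gen (toC A) (delta R a)) (cnorm2 (mdeg a) (gen (toC A) (delta R a))).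
      have h i : cnorm2 i (gen (toC A) (delta R a)) = (i == mdeg a)%:R * cnorm2 (mdeg a) (gen (toC A) (delta R a)).
        have [->|ia] := eqVneq i (mdeg a); first by rewrite mul1r.
        rewrite mul0r cnorm2E big_seq big1// => b; rewrite mem_grade => /eqP bi.
        rewrite (@gen_local _ _ _ _ (fun=> 0)) ?gen0 => [|c]; first by rewrite /nrm2/= expr0n addr0 mulr0.
        rewrite bi /delta => ci; case: eqP => // ca; by rewrite -ci ca eqxx in ia.
      have [km|mk] := leqP k (mdeg a).
        rewrite big1 ?cnorm2_ge0// => i _; rewrite h ltn_eqF ?mul0r//.
        exact: leq_trans (ltn_ord i) km.
      rewrite (bigD1 (Ordinal mk))//= big1 ?addr0// => i ik.
      rewrite h; case: (eqVneq (i : nat)) => [iE|_]; rewrite ?mul0r//.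
      by case/negP: ik; apply/eqP/val_inj.
    exists v => b /=; rewrite vE; apply: gen_local => c _; by rewrite crd_unitv.
  have h1 : generator T (unitv a, v) by rewrite gT.
  have h2 : generator exp_gen (unitv a, v) by rewrite exp_gen_generator.
  have h3 : ((h^-1)%:C%C *: (T h (unitv a) - unitv a) -
      (h^-1)%:C%C *: (exp_gen h (unitv a) - unitv a)) @[h --> 0^'+] --> v - v.
    exact: cvgB h1 h2.
  move/rcvgP in h3.
  apply/cvgrPdist_lt => e e0; near=> h.
  have h0 : 0 < h by near: h; exact: nbhs_right_gt.
  have : rnorm ((h^-1)%:C%C *: (T h (unitv a) - unitv a) - (h^-1)%:C%C *: (exp_gen h (unitv a) - unitv a) - (v - v)) < e.
    by near: h; exact: h3.
  rewrite subrr subr0 -scalerBr opprB addrA subrK sub0r normrN => h4.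
  rewrite ger0_norm ?divr_ge0 ?rnorm_ge0 ?(ltW h0)//.
  apply: le_lt_trans h4; rewrite -(ler_pXn2r (n := 2))// ?nnegrE ?divr_ge0 ?rnorm_ge0 ?(ltW h0)//.
  by rewrite rnormZ exprMn mulrC /nrm2 /= expr0n addr0.
have [->|t_neq0] := eqVneq t 0.
  by have [_ -> _ _] := cT; have [_ -> _ _] := cS.
have t_gt0 : 0 < t by rewrite lt_neqAle eq_sym t_neq0.
apply/eqP; rewrite -subr_eq0; apply/eqP; apply: rnorm_eq0; apply/eqP.
rewrite eq_le rnorm_ge0 andbT; apply/ler_addgt0Pr => e e0; rewrite add0r.
have so : (\sum_(a <- r') w h a / h) @[h --> 0^'+] --> 0 by exact: cvg_sum_seq0.
pose e' : R := e / (1 + t * rnorm u).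
have K0 : 0 < 1 + t * rnorm u by rewrite ltr_pwDl// mulr_ge0 ?rnorm_ge0.
have e'0 : 0 < e' by rewrite divr_gt0.
have [d /= d0 dE] : \forall h \near 0^'+, `|0 - \sum_(a <- r') w h a / h| < e'.
  by move/cvgrPdist_lt : so; exact.
pose k := (Num.bound (t / d)).+1.
have k0 : 0 < k%:R :> R by rewrite ltr0n.
have h0 : 0 < t / k%:R by rewrite divr_gt0.
have hd : t / k%:R < d.
  rewrite ltr_pdivrMr// -ltr_pdivrMl// mulrC.
  apply: lt_le_trans (archi_boundP _) _; first by rewrite divr_ge0// ltW.
  by rewrite ler_nat.
have := dE (t / k%:R); rewrite /ball_/= !sub0r !normrN gtr0_norm// => /(_ hd h0) le1.
have htk : (t / k%:R) *+ k = t by rewrite -[LHS]mulr_natr divfK// gt_eqF.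
have := wE _ k (ltW h0); rewrite htk => /le_trans; apply.
rewrite -mulr_suml in le1.
have le2 : \sum_(a <- r') w (t / k%:R) a <= e' * (t / k%:R).
  by rewrite -ler_pdivrMr//; apply: le_trans (ler_norm _) (ltW le1).
apply: (@le_trans _ _ (k%:R * (rnorm u * (e' * (t / k%:R))))).
  by rewrite !ler_wpM2l ?rnorm_ge0// ltW.
have key (a b c x : R) : a != 0 -> a * (b * (c * (x / a))) = c * (x * b).
  by move=> a0; field.
rewrite key ?gt_eqF// /e' mulrAC ler_pdivrMr// ler_wpM2l ?(ltW e0)//; lra.
Unshelve. all: by end_near. Qed.

(** Truncations of u to finitely many degrees converge to u, and both semigroups are contractions.
    Estimates for [exp_gen] thereby hold for every T with this generator. *)
Lemma generated_unique T u t : contraction_semigroup T -> generator T = gen_graph ->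
  0 <= t -> T t u = exp_gen t u.
Proof.
move=> cT gT t0; apply/eqP; rewrite -subr_eq0; apply/eqP; apply: rnorm_eq0; apply/eqP.
rewrite eq_le rnorm_ge0 andbT; apply/ler_addgt0Pr => e e0; rewrite add0r.
have trunc m : {v | forall a, crd v a = if (mdeg a < m)%N then crd u a else 0}.
  apply: cid; apply: (@crd_surj _ (rnorm u ^+ 2)) => k.
  apply: le_trans (sum_cnorm2_le u k); apply: ler_sum => n _.
  rewrite !cnorm2E; apply: ler_sum => a _; rewrite ler_wpM2l//; case: ifP => // _.
  by rewrite {1}/nrm2/= expr0n addr0 nrm2_ge0.
have : (fun m => sval (trunc m)) m @[m --> \oo] --> u.
  apply: (@dominated_cvg_crd _ _ _ _ u (fun n => 4 * cnorm2 n (crd u))).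
  - exact: cvg_sum_cnorm2.
  - apply: nearW => m n; apply: le_trans (cnorm2B _ _ _) _.
    suff : cnorm2 n (crd (sval (trunc m))) <= cnorm2 n (crd u) by lra.
    rewrite !cnorm2E; apply: ler_sum => a _; rewrite ler_wpM2l//.
    rewrite (svalP (trunc m)); case: ifP => // _.
    by rewrite {1}/nrm2/= expr0n addr0 nrm2_ge0.
  - move=> a; apply: (@cvg_near_cst _ _ _ _ _ _ _); near=> m.
    by rewrite (svalP (trunc m)) ifT//; near: m; exact: nbhs_infty_gt.
  - move=> a; apply: (@cvg_near_cst _ _ _ _ _ _ _); near=> m.
    by rewrite (svalP (trunc m)) ifT//; near: m; exact: nbhs_infty_gt.
move=> /rcvgP/(_ (e / 2)); rewrite divr_gt0// => /(_ isT)[m _ /(_ m (leqnn _))].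
rewrite /=; set v := sval (trunc m) => vu.
have TS : T t v = exp_gen t v.
  apply: (@generated_finite T m) => // a am.
  by rewrite (svalP (trunc m)) ltnNge am.
have -> : T t u - exp_gen t u = (T t u - T t v) + (exp_gen t v - exp_gen t u).
  by rewrite TS addrA subrK.
apply: le_trans (rnormD _ _) _; rewrite (splitr e); apply: lerD.
  by apply: le_trans (rnorm_contraction _ _ cT t0) _; rewrite rnorm_distC ltW.
by apply: le_trans (rnorm_contraction _ _ exp_gen_contraction t0) _; exact: ltW.
Unshelve. all: by end_near. Qed.

End coordinates.

(** * Minimal real parts and decay in coordinates *)

Section spectral_bound.
Variables (R : realType) (k : nat) (V : normedModType R[i]).
Local Notation N := k.+1.
Variable crd : V -> mindex N -> R[i].
Local Notation C := R[i].
Local Notation toC := (map_mx (real_complex R)).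
Hypothesis crd_lin : forall (x : C) u v a, crd (x *: u + v) a = x * crd u a + crd v a.
Hypothesis crd_norm : forall u,
  (fun m => \sum_(n < m) cnorm2 n (crd u)) @ \oo --> rnorm u ^+ 2.
Hypothesis crd_surj : forall c (K : R), (forall m, \sum_(n < m) cnorm2 n c <= K) ->
  exists u, forall a, crd u a = c a.
Variables (A : 'M[R]_N) (lam : R).
Hypotheses (lam0 : 0 < lam) (cA : coercive_mx lam A).

(** As z is nonzero, its eigenfunctions do not live in degree 0, where [gen] vanishes, and
    [eigen_gen_mx_spectrum] applies. *)
Lemma spectrum_above z : spectrum (oppop (gen_graph crd A)) z -> z != 0 ->
  exists2 x, mx_spectrum A x & complex.Re x <= complex.Re z.
Proof.
move=> /(spectrum_oppop crd_lin crd_norm crd_surj lam0 cA) nn z0.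
have [d dz [a da]] : exists2 d, forall a, gen (toC A) d a = - z * d a & exists a, d a != 0.
  apply: contrapT => h; apply: nn => d dz a; apply: contrapT => /eqP da.
  by apply: h; exists d => //; exists a.
apply: (eigen_gen_mx_spectrum (ltW lam0) cA dz); exists a => //.
apply/negP; rewrite mdeg_eq0 => /eqP a0.
have := dz a; rewrite {1}a0 gen_grade0 => /esym/eqP; rewrite mulf_eq0 oppr_eq0.
by rewrite (negbTE z0) (negbTE da).
Qed.

Lemma mx_spectrum_sub x : mx_spectrum A x ->
  spectrum (oppop (gen_graph crd A)) x /\ x != 0.
Proof.
move=> /mx_spectrum_eigen_gen[d dz [_ [a a1 da]]]; split.
  apply/(spectrum_oppop crd_lin crd_norm crd_surj lam0 cA) => nn.
  by move: da; rewrite (nn d dz a) eqxx.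
apply/eqP => x0; have := eigen_gen_Re (ltW lam0) cA dz da.
by rewrite x0 oppr0 a1 mulr1/= oppr_ge0 leNgt lam0.
Qed.

(** The two preceding lemmas give one direction; the other follows because the matrix spectrum has a
    minimum and minima are unique. *)
Lemma min_Re_spectrum m : min_Re (mx_spectrum A) m <->
  min_Re (spectrum (oppop (gen_graph crd A)) `\` [set 0]) m.
Proof.
have sub m' : min_Re (mx_spectrum A) m' ->
    min_Re (spectrum (oppop (gen_graph crd A)) `\` [set 0]) m'.
  move=> [[x xA xm] lb]; split.
    by exists x => //; have [? /eqP] := mx_spectrum_sub xA.
  move=> _ [z [zs /eqP z0] <-]; have [y yA yz] := spectrum_above zs z0.
  by apply: le_trans yz; apply: lb; exists y.
split=> [/sub//|[sm lb]].
have [m' hm _] := min_Re_mx_spectrum A; have [sm' lb'] := sub _ hm.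
suff -> : m = m' by [].
by apply/le_anti; rewrite lb// lb'.
Qed.

Lemma semigroup_decay T u (mu : 'I_N -> R) (c0 m t : R) n :
  contraction_semigroup T -> generator T = gen_graph crd A ->
  (forall j, 1 <= mu j <= m) -> lyapunov_mx mu c0 A -> 0 <= t ->
  cnorm2 n.+1 (crd (T t u)) <= m * expR (- (2 * c0) * t) * cnorm2 n.+1 (crd u).
Proof.
move=> cT gT mum lA t0.
rewrite (generated_unique crd_lin crd_norm crd_surj lam0 cA _ cT gT t0).
rewrite (@eq_cnorm2 _ _ _ _ (egenC A t (crd u))).
  exact: (cnorm2_egenC_decay _ _ (ltW lam0) cA mum lA).
by move=> a _; exact: (crd_exp_gen crd_norm crd_surj lam0 cA).
Qed.

Lemma semigroup_mean T u t :
  contraction_semigroup T -> generator T = gen_graph crd A -> 0 <= t ->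
  crd (T t u) mzero = crd u mzero.
Proof.
move=> cT gT t0.
rewrite (generated_unique crd_lin crd_norm crd_surj lam0 cA _ cT gT t0).
rewrite (crd_exp_gen crd_norm crd_surj lam0 cA)//.
exact: (egenC_mzero _ (ltW lam0) cA).
Qed.

End spectral_bound.

(** * Integration on column vectors *)

Section measure_density.
Local Open Scope ereal_scope.
Context d (T : measurableType d) (R : realType).
Variables (mu nu : {measure set T -> \bar R}) (g : T -> R).
Hypothesis mg : measurable_fun setT g.
Hypothesis g0 : forall x, (0 <= g x)%R.
Hypothesis nuE : forall A, measurable A -> nu A = \int[mu]_(x in A) (g x)%:E.
Import HBNNSimple.

Let mgE : measurable_fun setT (EFin \o g). Proof. exact/measurable_EFinP. Qed.

Let density_indic E : measurable E ->
  \int[nu]_x (\1_E x)%:E = \int[mu]_x ((\1_E x)%:E * (g x)%:E).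
Proof.
move=> mE; rewrite integral_indic// setIT nuE// integral_mkcond; apply: eq_integral => x _.
by rewrite patchE indicE; case: ifP => _; rewrite ?mul1e ?mul0e.
Qed.

Let density_nnsfun (f : {nnsfun T >-> R}) :
  \int[nu]_x (f x)%:E = \int[mu]_x ((f x)%:E * (g x)%:E).
Proof.
under [LHS]eq_integral do rewrite fimfunE -fsumEFin//.
rewrite [LHS]ge0_integral_fsum//; last 2 first.
  - by move=> r; exact/measurable_EFinP/measurableT_comp.
  - by move=> n x _; rewrite EFinM nnfun_muleindic_ge0.
under [RHS]eq_integral.
  move=> x xD; rewrite fimfunE -fsumEFin// ge0_mule_fsuml; last first.
    by move=> r; rewrite EFinM nnfun_muleindic_ge0.
  over.
rewrite [RHS]ge0_integral_fsum//; last 2 first.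
  - by move=> r; apply: emeasurable_funM => //; exact/measurable_EFinP/measurableT_comp.
  - by move=> n x _; apply: mule_ge0; [rewrite EFinM nnfun_muleindic_ge0|rewrite lee_fin].
apply: eq_fsbigr => r; rewrite inE => -[x _ xr].
have r0 : (0 <= r)%R by rewrite -xr.
under eq_integral do rewrite EFinM.
under [RHS]eq_integral do rewrite EFinM -muleA.
rewrite ge0_integralZl//; [|exact/measurable_EFinP].
rewrite ge0_integralZl// ?density_indic//.
- by apply: emeasurable_funM => //; exact/measurable_EFinP.
- by move=> y _; rewrite mule_ge0 ?lee_fin.
Qed.

(** Monotone convergence along simple functions; for indicators it is the hypothesis on nu. *)
Lemma ge0_integral_density (f : T -> \bar R) :
  measurable_fun setT f -> (forall x, 0 <= f x) ->
  \int[nu]_x f x = \int[mu]_x (f x * (g x)%:E).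
Proof.
move=> mf f0; pose f_ := nnsfun_approx measurableT mf.
have cvf x : (f_ n x)%:E @[n --> \oo] --> f x.
  by apply: cvg_nnsfun_approx.
transitivity (lim (\int[nu]_x (f_ n x)%:E @[n --> \oo])).
  rewrite -monotone_convergence//=.
  - by apply: eq_integral => x _; apply/esym/cvg_lim => //; exact: cvf.
  - by move=> n; exact/measurable_EFinP/measurable_funTS.
  - by move=> n ? _; rewrite lee_fin.
  - by move=> ? _ ? ? mn; rewrite lee_fin; exact/lefP/nd_nnsfun_approx.
under eq_fun do rewrite density_nnsfun.
rewrite -monotone_convergence//=.
- apply: eq_integral => x _; apply/cvg_lim => //.
  by apply: cvgeZr => //; exact: cvf.
- by move=> n; apply: emeasurable_funM => //; exact/measurable_EFinP/measurable_funTS.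
- by move=> n ? _; rewrite mule_ge0 ?lee_fin.
- move=> x _ m n mn; rewrite lee_wpmul2r ?lee_fin//.
  exact/lefP/nd_nnsfun_approx.
Qed.

Lemma integrable_density (f : T -> R) : measurable_fun setT f ->
  nu.-integrable setT (EFin \o f) <-> mu.-integrable setT (EFin \o (f \* g)%R).
Proof.
move=> mf; have e : \int[nu]_x `|(f x)%:E| = \int[mu]_x `|(f x * g x)%:E|.
  rewrite ge0_integral_density//; last by apply: measurableT_comp => //; exact/measurable_EFinP.
  by apply: eq_integral => x _; rewrite EFinM abseM [`|(g x)%:E|]gee0_abs ?lee_fin.
split=> /integrableP[_ h]; apply/integrableP; split; rewrite /= ?e// -?e//.
- by apply/measurable_EFinP; exact: measurable_funM.
- exact/measurable_EFinP.
Qed.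

Lemma integral_density (f : T -> R) : measurable_fun setT f ->
  \int[nu]_x (f x)%:E = \int[mu]_x (f x * g x)%:E.
Proof.
move=> mf; have mfE : measurable_fun setT (EFin \o f) by exact/measurable_EFinP.
rewrite integralE [RHS]integralE !ge0_integral_density//; first last.
- exact: measurable_funepos.
- exact: measurable_funeneg.
congr (_ - _); apply: eq_integral => x _; rewrite ?funeposE ?funenegE.
- rewrite /= -!EFin_max -EFinM maxr_pMl// mul0r.
  by [].
- transitivity (maxe (- f x)%R%:E 0%R%:E * (g x)%:E); first by [].
  by rewrite -EFin_max -EFinM maxr_pMl// mul0r mulNr EFin_max.
Qed.

Lemma Rintegral_density (f : T -> R) : measurable_fun setT f ->
  (\int[nu]_x f x = \int[mu]_x (f x * g x))%R.
Proof. by move=> mf; rewrite /Rintegral integral_density. Qed.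

End measure_density.

(** * Lebesgue and Gaussian integrals on column vectors *)

Section lebesgue_cV_theory.
Context {R : realType}.

Lemma ge0_integral_lebesgue_cons n (f : 'cV[R]_n.+1 -> \bar R) :
  measurable_fun setT f -> (forall x, 0 <= f x)%E ->
  (\int[lebesgue_cV n.+1]_x f x =
   \int[lebesgue_cV n]_y \int[lebesgue_measure]_a f (cons_cV (a, y)))%E.
Proof.
move=> mf f0; rewrite /= /lebesgue_cons ge0_integral_pushforward//; last first.
  exact: measurable_cons_cV.
rewrite preimage_setT fubini_tonelli2//; last by move=> x; exact: f0.
exact: measurableT_comp mf (@measurable_cons_cV R n).
Qed.

Lemma integral_lebesgue_cons n (f : 'cV[R]_n.+1 -> R) :
  (lebesgue_cV n.+1).-integrable setT (EFin \o f) ->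
  (lebesgue_measure \x lebesgue_cV n)%E.-integrable setT (EFin \o f \o @cons_cV R n) /\
  (\int[lebesgue_cV n.+1]_x (f x)%:E =
   \int[lebesgue_measure \x lebesgue_cV n]_p (f (cons_cV p))%:E)%E.
Proof.
move=> /integrableP[mf fo]; have mc := @measurable_cons_cV R n.
have i1 : (lebesgue_measure \x lebesgue_cV n)%E.-integrable setT (EFin \o f \o @cons_cV R n).
  apply/integrableP; split; first exact: measurableT_comp mf mc.
  have mfa : measurable_fun setT (abse \o (EFin \o f)) by exact: measurableT_comp.
  have := @ge0_integral_pushforward _ _ _ _ _ _ mc (lebesgue_measure \x lebesgue_cV n)%E
    setT _ measurableT mfa (fun y _ => abse_ge0 _).
  by rewrite preimage_setT => <-.
split=> //; rewrite /= /lebesgue_cons (integral_pushforward mc mf)//.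
Qed.

Lemma measurable_quad n (S : 'M[R]_n) :
  measurable_fun setT (fun x : 'cV[R]_n => (x^T *m S *m x) 0 0).
Proof.
rewrite (_ : (fun _ => _) =
    fun x : 'cV[R]_n => \sum_k \sum_l S k l * (x k 0 * x l 0)).
  apply: measurable_sum => k; apply: measurable_sum => l; apply: measurable_funM => //.
  by apply: measurable_funM; exact: measurable_coord.
by apply/funext => x; rewrite quad_mxE.
Qed.

Lemma measurable_gaussian n (S : 'M[R]_n) :
  measurable_fun setT (fun x : 'cV[R]_n => (expR (- ((x^T *m S *m x) 0 0 / 2)))%:E).
Proof.
apply/measurable_EFinP; apply: measurableT_comp => //; apply: measurableT_comp => //.
by apply: measurable_funM => //; exact: measurable_quad.
Qed.

Lemma measurable_normal (s c : R) : measurable_fun [set: measurableTypeR R]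
  (fun x => (expR (- (s * (x + c) ^+ 2 / 2)))%:E).
Proof.
apply/measurable_EFinP; apply: measurableT_comp => //; apply: measurableT_comp => //.
apply: measurable_funM => //; apply: measurable_funM => //; apply: measurable_funX.
exact: measurable_funD.
Qed.

(** Up to its peak value, the integrand is the normal density of mean - c and deviation s^(-1/2). *)
Lemma integral_normal (s c : R) : 0 < s ->
  (\int[lebesgue_measure]_a (expR (- (s * (a + c) ^+ 2 / 2)))%:E =
   (Num.sqrt (2 * pi / s))%:E)%E.
Proof.
move=> s0; pose sg := (Num.sqrt s)^-1.
have sg0 : sg != 0 by rewrite invr_eq0 gt_eqF// sqrtr_gt0.
have sg2 : sg ^+ 2 = s^-1 by rewrite exprVn sqr_sqrtr// ltW.
have := @integral_normal_pdf R (- c) sg.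
have -> : (fun x => (normal_pdf (- c) sg x)%:E) =
    (fun x => (normal_peak sg)%:E * (expR (- (s * (x + c) ^+ 2 / 2)))%:E)%E.
  apply/funext => x; rewrite /normal_pdf (negbTE sg0) EFinM /normal_fun opprK sg2.
  congr (_ * (expR _)%:E)%E; rewrite mulNr; congr (- _).
  by rewrite -mulr_natr invfM invrK; ring.
have pk0 := normal_peak_gt0 sg0.
have mexp := measurable_normal s c.
rewrite ge0_integralZl//; last by rewrite lee_fin ltW.
set I := (\int[_]_x _)%E => e.
have -> : (Num.sqrt (2 * pi / s))%:E = ((normal_peak sg)^-1)%:E.
  rewrite /normal_peak invrK sg2; congr (Num.sqrt _)%:E.
  by rewrite -mulr_natr; ring.
have := congr1 (fun z => ((normal_peak sg)^-1)%:E * z)%E e.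
by rewrite muleA -EFinM mulVf ?gt_eqF// mul1e mule1.
Qed.

(** Tonelli and the Schur complement: in the first coordinate the exponent is a shifted square with
    coefficient s, whose integral does not depend on the shift, and D governs the other coordinates.
    Positivity of det S comes from the same induction. *)
Lemma integral_gaussian n (S : 'M[R]_n) : sym_posdef S ->
  0 < \det S /\
  (\int[lebesgue_cV n]_x (expR (- ((x^T *m S *m x) 0 0 / 2)))%:E =
   (Num.sqrt ((2 * pi) ^+ n / \det S))%:E)%E.
Proof.
elim: n S => [S _|n ih].
  split; first by rewrite det_mx00.
  have mf := measurable_gaussian S.
  rewrite [LHS](integral_dirac _ measurableT mf) diracT mul1e; congr (_%:E).
  by rewrite det_mx00 divr1 expr0 sqrtr1 mxE big_ord0 mul0r oppr0 expR0.
rewrite -[n.+1]/(1 + n)%N => S Sp.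
have [s [w [D [s0 Dp SE]]]] := posdef_schur Sp.
have [D0 ID] := ih D Dp.
have dS : \det S = s * \det D.
  rewrite SE !det_mulmx det_tr !det_lblock !det1 det_scalar1; ring.
have qS a y : ((cons_cV (a, y))^T *m S *m cons_cV (a, y)) 0 0 =
    s * (a + (w^T *m y) 0 0) ^+ 2 + (y^T *m D *m y) 0 0.
  set L := block_mx 1%:M 0 w 1%:M in SE.
  have e : L^T *m cons_cV (a, y) = col_mx (a + (w^T *m y) 0 0)%:M y.
    rewrite /L /cons_cV tr_block_mx !trmx1 trmx0 mul_block_col !mul1mx mul0mx add0r.
    by rewrite raddfD/=; congr (col_mx (_ + _) _); rewrite -mx11_scalar.
  rewrite SE -!mulmxA e mulmxA.
  have -> : (cons_cV (a, y))^T *m L = (L^T *m cons_cV (a, y))^T by rewrite trmx_mul trmxK.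
  rewrite e mul_block_col tr_col_mx mul_row_col !mul0mx addr0 add0r.
  rewrite [LHS]mxE; congr (_ + _).
  by rewrite tr_scalar_mx -!scalar_mxM mxE mulr1n; ring.
split; first by rewrite dS mulr_gt0.
rewrite (ge0_integral_lebesgue_cons (measurable_gaussian S)); last first.
  by move=> x; rewrite lee_fin expR_ge0.
under eq_integral => y _.
  under eq_integral do rewrite qS mulrDl opprD expRD EFinM.
  rewrite ge0_integralZr; [|by []|exact: measurable_normal| |]; last 2 first.
  - by move=> x _; rewrite lee_fin expR_ge0.
  - by rewrite lee_fin expR_ge0.
  rewrite integral_normal//.
  over.
rewrite ge0_integralZl; [|by []|exact: measurable_gaussian| |]; last 2 first.
- by move=> x _; rewrite lee_fin expR_ge0.
- by rewrite lee_fin sqrtr_ge0.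
have ? := @pi_gt0 R.
rewrite ID -EFinM -sqrtrM ?divr_ge0 ?mulr_ge0 ?(ltW s0)// ?pi_ge0//; congr (Num.sqrt _)%:E.
by rewrite dS exprS; field; rewrite !gt_eqF.
Qed.

End lebesgue_cV_theory.

(** * Topology and measurability of column vectors *)

Section matrix_topology.
Context {R : realType}.

Lemma cvg_mx m n (T : Type) (F : set_system T) {FF : Filter F}
    (f : T -> 'M[R]_(m, n)) (l : 'M[R]_(m, n)) :
  (forall i j, f x i j @[x --> F] --> l i j) -> f x @[x --> F] --> l.
Proof.
move=> fl; apply/cvg_ballP => e e0.
have h : \forall x \near F, forall i j, ball (l i j) e (f x i j).
  apply: filter_forall => i; apply: filter_forall => j.
  by move/cvg_ballP : (fl i j); exact.
by apply: filterS h => x h; split.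
Qed.

Lemma cons_cV0 n (a : R) (y : 'cV[R]_n) : cons_cV (a, y) 0 0 = a.
Proof. by rewrite /cons_cV -(lshift0 n 0) (@col_mxEu _ 1) mxE mulr1n. Qed.

Lemma cons_cVS n (a : R) (y : 'cV[R]_n) i : cons_cV (a, y) (lift ord0 i) 0 = y i 0.
Proof. by rewrite /cons_cV -rshift1 (@col_mxEd _ 1). Qed.

Lemma cons_cV_ext n (x y : 'cV[R]_n.+1) :
  x 0 0 = y 0 0 -> (forall i, x (lift ord0 i) 0 = y (lift ord0 i) 0) -> x = y.
Proof. by move=> e0 eS; apply/colP => i; have [j ->|->] := unliftP ord0 i. Qed.

(** The sigma-algebra is generated by the coordinates, so an open set is written as the countable
    union of the boxes with rational centre and radius 1 / (k + 1) that it contains. *)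
Lemma open_measurable_cV n (O : set 'cV[R]_n) : open O -> measurable O.
Proof.
move=> oO.
pose box (q : 'cV[rat]_n * nat) : set 'cV[R]_n :=
  [set x | forall i, ratr (q.1 i 0) - (q.2.+1%:R)^-1 < x i 0 < ratr (q.1 i 0) + (q.2.+1%:R)^-1].
have mbox q : measurable (box q).
  rewrite (_ : box q = \bigcap_(i in [set: 'I_n]) [set x : 'cV[R]_n |
      `]ratr (q.1 i 0) - (q.2.+1%:R)^-1, ratr (q.1 i 0) + (q.2.+1%:R)^-1[%classic (x i 0)]).
    apply: fin_bigcap_measurable; first exact: finite_finset.
    move=> i _; rewrite -[X in measurable X]setTI.
    by apply: measurable_coord => //; exact: measurable_itv.
  apply/seteqP; split=> x; first by move=> xq i _ /=; rewrite in_itv/= xq.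
  by move=> xq i; have := xq i I; rewrite /= in_itv.
pose F q := if `[< box q `<=` O >] then box q else set0.
have -> : O = \bigcup_q F q.
  apply/seteqP; split=> x; last first.
    by move=> [q _]; rewrite /F; case: ifP => // /asboolP qO /qO.
  move=> Ox; have : nbhs x O by exact: open_nbhs_nbhs.
  move=> /nbhs_ballP[e /= e0 eO].
  (* A box of half-width 1 / (k + 1) around a point near x stays within 2 / (k + 1) < e of x. *)
  pose k := Num.bound (2 / e).
  have k0 : 0 < k.+1%:R :> R by rewrite ltr0n.
  have ke : (k.+1%:R)^-1 * 2 < e.
    rewrite mulrC ltr_pdivrMr// mulrC -ltr_pdivrMr//.
    apply: lt_le_trans (archi_boundP _) _; first by rewrite divr_ge0// ltW.
    by rewrite ler_nat.
  have /choice[q qE] (i : 'I_n) : exists r : rat,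
      x i 0 - (k.+1%:R)^-1 < ratr r < x i 0 + (k.+1%:R)^-1.
    have : x i 0 - (k.+1%:R)^-1 < x i 0 + (k.+1%:R)^-1.
      by rewrite ltrBlDr -addrA ltrDl addr_gt0// invr_gt0.
    by move=> /rat_in_itvoo[r]; rewrite in_itv/= => rE; exists r.
  exists (\col_i q i, k) => //; rewrite /F.
  have xb : box (\col_i q i, k) x.
    move=> i /=; rewrite mxE; have /andP[h1 h2] := qE i.
    by rewrite -ltrBDr opprK h2/= -ltrBlDr h1.
  rewrite ifT//; apply/asboolP => y yb; apply: eO; split=> // i j.
  rewrite ord1 /ball/= ltr_norml; have /andP[h3 h4] := yb i; have /andP[h1 h2] := qE i.
  rewrite /= mxE in h3 h4; move: (ratr _) (_^-1) ke h1 h2 h3 h4 => r s ke h1 h2 h3 h4.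
  by apply/andP; split; lra.
apply: countable_bigcupT_measurable => [|q]; first exact: countableP.
by rewrite /F; case: ifP => _; [exact: mbox|exact: measurable0].
Qed.

Lemma continuous_measurable_cV n (f : 'cV[R]_n -> R) :
  continuous f -> measurable_fun setT f.
Proof.
move=> /continuousP cf; apply: (measurability _ (RGenOpens.measurableE R)).
move=> _ [_ [a [b -> <-]]]; rewrite setTI; apply: open_measurable_cV.
by apply: cf; exact: interval_open.
Qed.

Lemma compact_box n (M : R) : compact [set x : 'cV[R]_n | forall i, - M <= x i 0 <= M].
Proof.
have := @rV_compact R n (fun=> `[- M, M]%classic) (fun=> @segment_compact R _ _).
move=> c; have ct : continuous (trmx : 'rV[R]_n -> 'cV[R]_n).
  move=> x; apply: (@cvg_mx n 1 'rV[R]_n (nbhs x) (nbhs_filter x) trmx x^T) => i j.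
  rewrite mxE (_ : (fun _ => _) = fun x : 'rV[R]_n => x j i); first exact: coord_continuous.
  by apply/funext => y; rewrite mxE.
have := continuous_compact (continuous_subspaceT ct) c.
congr compact; apply/seteqP; split=> [_ [x xM <-] i|x xM]; first by rewrite mxE; have := xM i; rewrite /= in_itv.
by exists x^T; rewrite ?trmxK// => i /=; rewrite mxE in_itv/=.
Qed.

Lemma measurable_box n (M : R) : measurable [set x : 'cV[R]_n | forall i, - M <= x i 0 <= M].
Proof.
rewrite -[X in measurable X]setCK; apply: measurableC; apply: open_measurable_cV.
apply: closed_openC; apply: compact_closed; first exact: norm_hausdorff.
exact: (@compact_box n M).
Qed.

Lemma lebesgue_box n (M : R) :
  (lebesgue_cV n [set x : 'cV[R]_n | forall i, (- M <= x i 0 <= M)%R] < +oo)%E.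
Proof.
elim: n => [|n ih]; first by rewrite /= diracE ltry.
rewrite /= /lebesgue_cons /pushforward.
have sub : (@cons_cV R n) @^-1` [set x : 'cV[R]_n.+1 | forall i, - M <= x i 0 <= M]
   `<=` `[- M, M]%classic `*` [set x : 'cV[R]_n | forall i, - M <= x i 0 <= M].
  move=> [a y] /= h; split=> /=.
    by have := h 0; rewrite in_itv/= cons_cV0.
  by move=> i; have := h (lift ord0 i); rewrite cons_cVS.
apply: (@le_lt_trans _ _ ((lebesgue_measure \x lebesgue_cV n)%E (`[(- M)%R, M]%classic `*`
    [set x : 'cV[R]_n | forall i, (- M <= x i 0 <= M)%R]))).
  apply: le_measure (sub); rewrite ?inE.
- rewrite -[X in measurable X]setTI; apply: measurable_cons_cV => //.
  exact: measurable_box.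
- by apply: measurableX; [exact: measurable_itv|exact: measurable_box].
rewrite product_measure1E; [|exact: measurable_itv|exact: measurable_box].
rewrite lte_mul_pinfty//.
have e : (lebesgue_measure `[- M, M]%classic : \bar R) \is a fin_num.
    by rewrite ge0_fin_numE// lebesgue_measure_itv/=; case: ifP; rewrite ?ltry.
  exact: e.
Qed.

End matrix_topology.

(** * Continuous functions supported in a box *)

Section compact_support.
Context {R : realType}.

(** Compact support in a form that passes to sections with one coordinate fixed, as inductions on n
    require. *)
Definition cbox n (f : 'cV[R]_n -> R) := continuous f /\
  exists M : R, forall x, f x != 0 -> forall i, - M <= x i 0 <= M.

Lemma cbox_bounded n (f : 'cV[R]_n -> R) : cbox f ->
  exists2 K : R, 0 <= K & forall x, `|f x| <= K.
Proof.
move=> [cf [M fM]].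
have := @compact_bounded R R^o _ (@continuous_compact _ _ f _ (continuous_subspaceT cf) (@compact_box R n M)).
move=> [K [Kr Kb]]; exists (`|K| + 1); first by rewrite addr_ge0.
move=> x; have [->|fx] := eqVneq (f x) 0; first by rewrite normr0 addr_ge0.
apply: (Kb (`|K| + 1)); first by rewrite (le_lt_trans (ler_norm _))// ltrDl.
by exists x => //; exact: fM.
Qed.

Lemma cbox_integrable n (f : 'cV[R]_n -> R) : cbox f ->
  (lebesgue_cV n).-integrable setT (EFin \o f).
Proof.
move=> fc; have [K K0 fK] := cbox_bounded fc; have [cf [M fM]] := fc.
have mf := continuous_measurable_cV cf.
pose D := [set x : 'cV[R]_n | forall i, (- M <= x i 0 <= M)%R].
have mD : measurable D by exact: measurable_box.
apply: (@le_integrable _ _ _ _ _ measurableT _ (EFin \o (fun x => K * \1_D x))).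
- exact/measurable_EFinP.
- move=> x _; rewrite /= lee_fin [leRHS]ger0_norm ?mulr_ge0//.
  have [->|fx] := eqVneq (f x) 0; first by rewrite normr0 mulr_ge0.
  by rewrite indicE mem_set ?mulr1//; exact: fM.
apply/integrableP; split.
  by apply/measurable_EFinP; apply: measurable_funM => //; exact: measurable_indic.
under eq_integral => x _ do rewrite /= ger0_norm ?mulr_ge0// EFinM.
rewrite ge0_integralZl//; last first.
  by apply/measurable_EFinP; exact: measurable_indic.
rewrite integral_indic// setIT lte_mul_pinfty//; exact: lebesgue_box.
Qed.

End compact_support.

(** * Partial derivatives and vanishing integrals *)

Section partial_derivatives.
Context {R : realType}.

(** The difference quotients are the same function, so one-variable calculus applies to partial
    derivatives. *)
Lemma is_derive_line (V : normedModType R) (f : V -> R) (x v : V) d :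
  is_derive x v f d <-> is_derive (0 : R) 1 (fun t : R => f (t *: v + x)) d.
Proof.
have e : (fun h : R => h^-1 *: ((f \o shift x) (h *: v) - f x)) =
    (fun h : R => h^-1 *: (((fun t : R => f (t *: v + x)) \o shift 0) (h *: 1) - f (0 *: v + x))).
  by apply/funext => h; rewrite /= scale0r add0r addr0 [h *: 1]mulr1.
by split=> -[dv <-]; split; rewrite /derivable /derive ?e// -?e.
Qed.

Lemma is_derive_chain (V : normedModType R) (h : R -> R) (f : V -> R) (x v : V) dh df :
  is_derive (f x) 1 h dh -> is_derive x v f df -> is_derive x v (h \o f) (dh * df).
Proof.
move=> hh /is_derive_line hf; apply/is_derive_line.
apply: (@is_derive1_comp _ h (fun t : R => f (t *: v + x))) => //.
by rewrite scale0r add0r.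
Qed.

Lemma cons_cVD n a (y : 'cV[R]_n) h b (z : 'cV[R]_n) :
  h *: cons_cV (b, z) + cons_cV (a, y) = cons_cV (h * b + a, h *: z + y) :> 'cV[R]_n.+1.
Proof. by apply: cons_cV_ext => [|i]; rewrite [LHS]mxE [X in X + _]mxE ?(cons_cV0, cons_cVS)// !mxE. Qed.

Lemma delta_cons0 n : delta_mx 0 0 = cons_cV (1, 0 : 'cV[R]_n) :> 'cV[R]_n.+1.
Proof. by apply: cons_cV_ext => [|i]; rewrite [LHS]mxE ?(cons_cV0, cons_cVS)// mxE. Qed.

Lemma delta_cons_lift n (i : 'I_n) :
  delta_mx (lift ord0 i) 0 = cons_cV (0, delta_mx i 0 : 'cV[R]_n) :> 'cV[R]_n.+1.
Proof.
apply: cons_cV_ext => [|j]; rewrite [LHS]mxE ?(cons_cV0, cons_cVS)// mxE.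
by rewrite (inj_eq lift_inj).
Qed.

Lemma partial_cons0 n (F : 'cV[R]_n.+1 -> R) a (y : 'cV[R]_n) d :
  is_derive (cons_cV (a, y) : 'cV[R]_n.+1) (delta_mx 0 0) F d ->
  is_derive a 1 (fun b : R => F (cons_cV (b, y))) d.
Proof.
move=> /is_derive_line h; apply/is_derive_line; have -> : (fun t : R => F (cons_cV (t *: 1 + a, y))) =
    (fun t : R => F (t *: delta_mx 0 0 + cons_cV (a, y))) => //.
by apply/funext => t; rewrite delta_cons0 cons_cVD scaler0 add0r.
Qed.

Lemma partial_consS n (F : 'cV[R]_n.+1 -> R) a (y : 'cV[R]_n) i d :
  is_derive (cons_cV (a, y) : 'cV[R]_n.+1) (delta_mx (lift ord0 i) 0) F d ->
  is_derive y (delta_mx i 0) (fun z => F (cons_cV (a, z))) d.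
Proof.
move=> /is_derive_line h; apply/is_derive_line.
have -> : (fun t : R => F (cons_cV (a, t *: delta_mx i 0 + y))) =
    (fun t : R => F (t *: delta_mx (lift ord0 i) 0 + cons_cV (a, y))) => //.
by apply/funext => t; rewrite delta_cons_lift cons_cVD mulr0 add0r.
Qed.

Lemma continuous_consl n (y : 'cV[R]_n) : continuous (fun a : R => cons_cV (a, y) : 'cV[R]_n.+1).
Proof.
move=> a; apply: (@cvg_mx R n.+1 1 R (nbhs a) (nbhs_filter a) (fun a : R => cons_cV (a, y))) => i j.
rewrite ord1; have [k ->|->] := unliftP ord0 i.
  by rewrite cons_cVS (_ : (fun _ => _) = cst (y k 0)); [exact: cvg_cst|apply/funext => b; rewrite cons_cVS].
by rewrite cons_cV0 (_ : (fun _ => _) = id); [exact: cvg_id|apply/funext => b; rewrite cons_cV0].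
Qed.

Lemma continuous_consr n (a : R) : continuous (fun y : 'cV[R]_n => cons_cV (a, y) : 'cV[R]_n.+1).
Proof.
move=> y; apply: (@cvg_mx R n.+1 1 'cV[R]_n (nbhs y) (nbhs_filter y) (fun y : 'cV[R]_n => cons_cV (a, y))) => i j.
rewrite ord1; have [k ->|->] := unliftP ord0 i.
  rewrite cons_cVS (_ : (fun _ => _) = fun z : 'cV[R]_n => z k 0); last by apply/funext => b; rewrite cons_cVS.
  exact: coord_continuous.
by rewrite cons_cV0 (_ : (fun _ => _) = cst a); [exact: cvg_cst|apply/funext => b; rewrite cons_cV0].
Qed.

Lemma integral_derive_compact (f f' : R -> R) (M : R) :
  (forall t, f t != 0 -> - M <= t <= M) -> (forall t, f' t != 0 -> - M <= t <= M) ->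
  continuous f -> continuous f' -> (forall t : R, is_derive t 1 f (f' t)) ->
  (\int[lebesgue_measure]_t (f' t)%:E = 0)%E.
Proof.
(* K exceeds both M and 0: f vanishes at the ends of [- K, K] and f' outside. *)
move=> fM fM' cf cf' df; pose K := `|M| + 1.
have MK : M < K by rewrite (le_lt_trans (ler_norm _))// ltrDl.
have K0 : - K < K by rewrite gtrN// (le_lt_trans (normr_ge0 M))// ltrDl.
have fz t : ~~ (- M <= t <= M) -> f t = 0 by move=> h; apply/eqP; apply: contraNT h; exact: fM.
rewrite (_ : (\int[_]_t _ = \int[lebesgue_measure]_(t in `[(- K)%R, K]) (f' t)%:E)%E).
  rewrite (continuous_FTC2 (F := f) K0).
  - have hK : ~~ (- M <= K <= M) by rewrite negb_and -!ltNge MK orbT.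
    have hK' : ~~ (- M <= - K <= M) by rewrite negb_and -!ltNge ltrN2 MK.
    by rewrite !fz// sube0.
  - exact: continuous_subspaceT.
  - split; first by move=> t _; have [] := df t.
    + by apply: cvg_at_right_filter; exact: cf.
    + by apply: cvg_at_left_filter; exact: cf.
  - by move=> t _; rewrite derive1E; have [_ ->] := df t.
rewrite [RHS]integral_mkcond; apply: eq_integral => t _; rewrite patchE.
case: ifPn => //; rewrite notin_setE/= in_itv/= => h; congr (_%:E); apply/eqP.
apply: contra_notT h => /fM' /andP[h1 h2].
by rewrite (le_trans h2 (ltW MK)) (le_trans _ h1)// lerN2 ltW.
Qed.

Lemma cbox_consl n (F : 'cV[R]_n.+1 -> R) y : cbox F ->
  continuous (fun a : R => F (cons_cV (a, y))).
Proof. by move=> [cF _] a; apply: continuous_comp; [exact: continuous_consl|exact: cF]. Qed.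

Lemma cbox_consr n (F : 'cV[R]_n.+1 -> R) a : cbox F -> cbox (fun y => F (cons_cV (a, y))).
Proof.
move=> [cF [M FM]]; split; first by move=> y; apply: continuous_comp; [exact: continuous_consr|exact: cF].
by exists M => y /FM h i; have := h (lift ord0 i); rewrite cons_cVS.
Qed.

(** Fubini with the differentiated variable inside: for the first coordinate this is
    [integral_derive_compact], for the others the induction hypothesis on sections. *)
Lemma integral_partial_cbox n (F F' : 'cV[R]_n -> R) i : cbox F -> cbox F' ->
  (forall x, is_derive x (delta_mx i 0) F (F' x)) ->
  (\int[lebesgue_cV n]_x (F' x)%:E = 0)%E.
Proof.
elim: n F F' i => [? ? []//|n ih F F' i cF cF' dF].
have [iF ->] := integral_lebesgue_cons (cbox_integrable cF').
have [j ij|i0] := unliftP ord0 i.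
  rewrite -(integral12_prod_meas1 iF)/= integral0_eq// => a _.
  apply: (ih (fun y => F (cons_cV (a, y))) _ j); [exact: cbox_consr|exact: cbox_consr|].
  by move=> y; apply: partial_consS; rewrite -ij.
rewrite -(integral21_prod_meas1 iF)/= integral0_eq// => y _.
have [_ [M FM]] := cF; have [_ [M' FM']] := cF'.
apply: (@integral_derive_compact (fun a : R => F (cons_cV (a, y)))
  (fun a : R => F' (cons_cV (a, y))) (Num.max M M')).
- move=> t /FM /(_ ord0); rewrite cons_cV0 => /andP[h1 h2].
  by rewrite lerNl in h1; rewrite lerNl !le_max h1 h2.
- move=> t /FM' /(_ ord0); rewrite cons_cV0 => /andP[h1 h2].
  by rewrite lerNl in h1; rewrite lerNl !le_max h1 h2 !orbT.
- exact: cbox_consl.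
- exact: cbox_consl.
- by move=> t; apply: partial_cons0; move: (dF (cons_cV (t, y))); rewrite i0.
Qed.

End partial_derivatives.

(** * A class of smooth functions *)

Section smooth_algebra.
Context {R : realType}.

(* The powers s ^- k make the family stable under derivation. *)
Definition flat k (s : R) : R := if 0 < s then s ^- k * expR (- s^-1) else 0.

Lemma flat_ge0 k s : 0 <= flat k s.
Proof.
by rewrite /flat; case: ifP => // s0; rewrite mulr_ge0 ?expR_ge0 ?invr_ge0 ?exprn_ge0 ?ltW.
Qed.

Lemma flat_gt0 k s : (0 < flat k s) = (0 < s).
Proof.
by rewrite /flat; case: ifP => // s0; rewrite mulr_gt0 ?expR_gt0 ?invr_gt0 ?exprn_gt0.
Qed.

(** The exponential of 1 / s exceeds the term of order k + 1 of its series, which beats s^-k with a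
    factor s to spare. *)
Lemma flat_le k s : flat k s <= k.+1`!%:R * `|s|.
Proof.
rewrite /flat; case: ifP => [s0|_]; last by rewrite mulr_ge0.
have h := @expR_ge1Dxn R s^-1 k; rewrite invr_ge0 (ltW s0) in h; have {}h := h isT.
have f0 : 0 < k.+1`!%:R :> R by rewrite ltr0n fact_gt0.
rewrite gtr0_norm// expRN ler_pdivrMr ?expR_gt0//.
have -> : s ^- k = k.+1`!%:R * s * (s^-1 ^+ k.+1 / k.+1`!%:R).
  by rewrite exprVn exprS; field; rewrite ?gt_eqF ?exprn_gt0.
apply: ler_wpM2l; first by rewrite mulr_ge0 ?ltW.
by apply: le_trans h; rewrite lerDr.
Qed.

Lemma is_derive_flat k (s : R) : is_derive s 1 (flat k) (- k%:R * flat k.+1 s + flat k.+2 s).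
Proof.
have [s0|s0|->] := ltgtP s 0.
- rewrite /flat ltNge (ltW s0)/= mulr0 addr0.
  apply: (@near_eq_is_derive _ _ _ (cst 0) _ s 1 0).
  near=> t; rewrite ifF//; apply/negbTE; rewrite -leNgt; apply/ltW.
  by near: t; exact: lt_nbhsl.
- have sN : s != 0 by rewrite gt_eqF.
  have dV : is_derive s 1 (fun t : R => t^-1) (- s ^- 2).
    by have := @is_deriveV R id s 1 1 sN (is_derive_id _ _); rewrite /GRing.scale/= mulr1.
  have dE : is_derive s 1 (expR \o (fun t : R => - t^-1)) (expR (- s^-1) * s ^- 2).
    apply: is_derive_chain; rewrite -[s ^- 2]opprK; exact: is_deriveN.
  have dX : is_derive s 1 ((fun t : R => t^-1) ^+ k) ((k%:R * s^-1 ^+ k.-1) *: - s ^- 2).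
    exact: is_deriveX.
  have := is_deriveM dX dE => d.
  rewrite /flat s0; apply: (near_eq_is_derive
      (f := ((fun t : R => t^-1) ^+ k) * (expR \o (fun t : R => - t^-1)))); last first.
    apply: is_derive_eq d _; rewrite /GRing.scale/= fctE -!exprVn.
    case: k {dX} => [|k]; first by rewrite !mul0r mulr0 oppr0 !mul0r add0r addr0; ring.
    by rewrite /= !exprS expr0; ring.
  near=> t; rewrite ifT; first by rewrite !fctE/= exprVn.
  by near: t; exact: lt_nbhsr.
(* At 0 the difference quotient of [flat k] is [flat k.+1], which tends to 0 by [flat_le]. *)
have -> : - k%:R * flat k.+1 0 + flat k.+2 0 = 0 by rewrite /flat ltxx mulr0 addr0.
have h : h^-1 *: ((flat k \o shift 0) (h *: 1) - flat k 0) @[h --> 0^'] --> (0 : R).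
  apply/cvgr0Pnorm_le => e e0.
  near=> h; rewrite /= addr0 [h *: 1]mulr1 {2}/flat ltxx subr0.
  have -> : h^-1 *: flat k h = flat k.+1 h.
    rewrite /flat; case: ifP => h0; last by rewrite scaler0.
    by rewrite /GRing.scale/= exprS invfM mulrA.
  rewrite ger0_norm ?flat_ge0// (le_trans (flat_le _ _))// mulrC -ler_pdivlMr ?ltr0n ?fact_gt0//.
  near: h; apply: dnbhs0_le; by rewrite divr_gt0 ?ltr0n ?fact_gt0.
by split; [apply/cvg_ex; exists 0; exact: h|apply: cvg_lim => //; exact: h].
Unshelve. all: by end_near. Qed.

Lemma continuous_flat k : continuous (flat k).
Proof.
by move=> s; apply/differentiable_continuous/derivable1_diffP; have [] := is_derive_flat k s.
Qed.

Variable n : nat.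

(* A syntactic class of smooth functions, closed under partial derivatives, that
   contains the Gaussian density, the polynomials and a cutoff function. *)
Inductive salg : ('cV[R]_n -> R) -> Prop :=
| salg_cst c : salg (fun=> c)
| salg_coord i : salg (fun x => x i 0)
| salgD f g : salg f -> salg g -> salg (fun x => f x + g x)
| salgM f g : salg f -> salg g -> salg (fun x => f x * g x)
| salg_expR f : salg f -> salg (fun x => expR (f x))
| salg_flat k f : salg f -> salg (fun x => flat k (f x)).

Lemma salgN f : salg f -> salg (fun x => - f x).
Proof.
by move=> /(salgM (salg_cst (-1))); under eq_fun do rewrite mulN1r.
Qed.

Lemma salg_sum (I : Type) (s : seq I) (f : I -> 'cV[R]_n -> R) :
  (forall i, salg (f i)) -> salg (fun x => \sum_(i <- s) f i x).
Proof.
move=> sf; elim: s => [|i s ih].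
  by under eq_fun do rewrite big_nil; exact: salg_cst.
by under eq_fun do rewrite big_cons; exact: salgD.
Qed.

Lemma salg_prod (I : Type) (s : seq I) (f : I -> 'cV[R]_n -> R) :
  (forall i, salg (f i)) -> salg (fun x => \prod_(i <- s) f i x).
Proof.
move=> sf; elim: s => [|i s ih].
  by under eq_fun do rewrite big_nil; exact: salg_cst.
by under eq_fun do rewrite big_cons; exact: salgM.
Qed.

Lemma salg_continuous f : salg f -> continuous f.
Proof.
elim=> {f} [c|i|f g _ cf _ cg|f g _ cf _ cg|f _ cf|k f _ cf] x.
- exact: cst_continuous.
- exact: coord_continuous.
- exact: cvgD (cf x) (cg x).
- exact: cvgM (cf x) (cg x).
- by apply: continuous_comp; [exact: cf|exact: continuous_expR].
- by apply: continuous_comp; [exact: cf|exact: continuous_flat].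
Qed.

Lemma is_derive_coord (i j : 'I_n) (x : 'cV[R]_n) :
  is_derive x (delta_mx i 0) (fun y : 'cV[R]_n => y j 0) (j == i)%:R.
Proof.
apply/is_derive_line.
have -> : (fun t : R => (t *: delta_mx i 0 + x) j 0) = ((j == i)%:R \*: id + cst (x j 0)).
  by apply/funext => t; rewrite !mxE eqxx andbT fctE/= mulrC.
by apply: is_derive_eq; rewrite addr0 [_ *: _]mulr1.
Qed.

Lemma salg_derive f i : salg f ->
  exists2 g, salg g & forall x, is_derive x (delta_mx i 0) f (g x).
Proof.
elim=> {f} [c|j|f g sf [f' sf' df] sg [g' sg' dg]|f g sf [f' sf' df] sg [g' sg' dg]|
    f sf [f' sf' df]|k f sf [f' sf' df]].
- by exists (fun=> 0); [exact: salg_cst|move=> x; exact: is_derive_cst].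
- by exists (fun=> (j == i)%:R); [exact: salg_cst|move=> x; exact: is_derive_coord].
- exists (fun x => f' x + g' x); [exact: salgD|move=> x; exact: is_deriveD].
- exists (fun x => f x * g' x + g x * f' x); first by apply: salgD; exact: salgM.
  move=> x; exact: (is_deriveM (df x) (dg x)).
- exists (fun x => expR (f x) * f' x); first by apply: salgM => //; exact: salg_expR.
  move=> x; exact: is_derive_chain.
- exists (fun x => (- k%:R * flat k.+1 (f x) + flat k.+2 (f x)) * f' x).
    apply: salgM => //; apply: salgD; last exact: salg_flat.
    by apply: salgM; [exact: salg_cst|exact: salg_flat].
  move=> x; apply: is_derive_chain (df x); exact: is_derive_flat.
Qed.

Lemma salg_partial f i : salg f ->
  salg (partial i f) /\ forall x, is_derive x (delta_mx i 0) f (partial i f x).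
Proof.
move=> /(salg_derive i)[g sg dg].
suff -> : partial i f = g by [].
by apply/funext => x; have [_ <-] := dg x.
Qed.

Lemma salg_smooth f : salg f -> smooth f.
Proof.
move=> sf s /=; have sg : salg (foldr (@partial R n) f s).
  by elim: s => //= i s /(salg_partial i)[].
split; first exact: salg_continuous.
by move=> i x; have [_ /(_ x)[]] := salg_partial i sg.
Qed.

End smooth_algebra.

(** * Integrable and square integrable functions *)

Section L1.
Context d (T : measurableType d) (R : realType).
Variable mu : {measure set T -> \bar R}.
Implicit Types f g : T -> R.

Definition L1 f := mu.-integrable [set: T] (EFin \o f).

Lemma L1_measurable f : L1 f -> measurable_fun setT f.
Proof. by move=> /integrableP[/measurable_EFinP]. Qed.

Lemma L1D f g : L1 f -> L1 g -> L1 (fun x => f x + g x).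
Proof. by move=> h1 h2; apply: eq_integrable (integrableD measurableT h1 h2). Qed.

Lemma L1Zl (c : R) f : L1 f -> L1 (fun x => c * f x).
Proof. by move=> h1; apply: eq_integrable (integrableZl measurableT c h1). Qed.

Lemma L1N f : L1 f -> L1 (fun x => - f x).
Proof. by move=> /(L1Zl (-1)); under eq_fun do rewrite mulN1r. Qed.

Lemma L1B f g : L1 f -> L1 g -> L1 (fun x => f x - g x).
Proof. by move=> h1 /L1N h2; exact: L1D h1 h2. Qed.

Lemma L1_0 : L1 (fun=> 0).
Proof. exact: integrable0. Qed.

Lemma L1_sum (I : Type) (s : seq I) (f : I -> T -> R) :
  (forall i, L1 (f i)) -> L1 (fun x => \sum_(i <- s) f i x).
Proof.
move=> sf; elim: s => [|i s ih].
  rewrite (_ : (fun _ => _) = fun=> 0); first exact: L1_0.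
  by apply/funext => x; rewrite big_nil.
rewrite (_ : (fun _ => _) = fun x => f i x + \sum_(j <- s) f j x); first exact: L1D.
by apply/funext => x; rewrite big_cons.
Qed.

Lemma L1_le f g : measurable_fun setT f -> (forall x, `|f x| <= g x) -> L1 g -> L1 f.
Proof.
move=> mf fg; apply: le_integrable => //; first exact/measurable_EFinP.
by move=> x _; rewrite /= lee_fin (le_trans (fg x))// ler_norm.
Qed.

Lemma L1_norm f : L1 f -> L1 (fun x => `|f x|).
Proof. by move=> lf; apply: eq_integrable (integrable_abse lf). Qed.

Lemma Rintegral_sum (I : Type) (s : seq I) (f : I -> T -> R) :
  (forall i, L1 (f i)) ->
  \int[mu]_x (\sum_(i <- s) f i x) = \sum_(i <- s) \int[mu]_x f i x.
Proof.
move=> sf; elim: s => [|i s ih].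
  under eq_Rintegral do rewrite big_nil.
  by rewrite big_nil Rintegral_cst// mul0r.
under eq_Rintegral do rewrite big_cons.
rewrite big_cons -ih RintegralD//; [exact: sf|exact: (@L1_sum I s f sf)].
Qed.

Lemma Rintegral_le f g : L1 f -> L1 g -> (forall x, f x <= g x) ->
  \int[mu]_x f x <= \int[mu]_x g x.
Proof. by move=> lf lg fg; apply: le_Rintegral. Qed.

Lemma L1_integralE f : L1 f -> (\int[mu]_x (f x)%:E)%E = (\int[mu]_x f x)%:E.
Proof. by move=> lf; rewrite fineK//; exact: integrable_fin_num. Qed.

Lemma L1_ge0_bound f (K : R) : measurable_fun setT f -> (forall x, 0 <= f x) ->
  (\int[mu]_x (f x)%:E <= K%:E)%E -> L1 f /\ \int[mu]_x f x <= K.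
Proof.
move=> mf f0 fK; have lf : L1 f.
  apply/integrableP; split; first exact/measurable_EFinP.
  under eq_integral do rewrite /= ger0_norm//.
  exact: le_lt_trans fK (ltry _).
by split=> //; rewrite -lee_fin -L1_integralE.
Qed.

Lemma L1_dominated (f_ : nat -> T -> R) f g : (forall n, measurable_fun setT (f_ n)) ->
  (forall x, f_ n x @[n --> \oo] --> f x) -> L1 g -> (forall n x, `|f_ n x| <= g x) ->
  L1 f /\ \int[mu]_x f_ n x @[n --> \oo] --> \int[mu]_x f x.
Proof.
move=> mf ff lg fg.
have mf' n : measurable_fun setT (EFin \o f_ n) by exact/measurable_EFinP.
have lf : L1 f.
  apply: (L1_le _ _ lg); first by apply: measurable_fun_cvg => // x _; exact: ff.
  move=> x; have h : `|f_ n x| @[n --> \oo] --> `|f x| by exact: cvg_norm (ff x).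
  rewrite -(cvg_lim _ h)//.
  by apply: limr_le; [apply/cvg_ex; exists (`|f x|)|apply: nearW => n; exact: fg].
split=> //.
have := @dominated_cvg _ _ _ mu _ measurableT _ _ _ mf' _ _ lg _.
move=> /(_ (EFin \o f)) h; apply: fine_cvg; rewrite -L1_integralE//; apply: h => //.
- by move=> x _; apply: cvg_EFin; [exact: nearW|exact: ff].
- by move=> n x _; rewrite /= lee_fin.
Qed.

Definition Lsq f := measurable_fun setT f /\ L1 (fun x => f x ^+ 2).

Lemma Lsq_mul f g : Lsq f -> Lsq g -> L1 (fun x => f x * g x).
Proof.
move=> [mf lf] [mg lg]; apply: (L1_le _ _ (L1D lf lg)); first exact: measurable_funM.
move=> x; rewrite ler_norml; have := sqr_ge0 (f x + g x); have := sqr_ge0 (f x - g x).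
have := sqr_ge0 (f x); have := sqr_ge0 (g x); rewrite sqrrB sqrrD => h1 h2 h3 h4.
by apply/andP; split; lra.
Qed.

Lemma LsqD f g : Lsq f -> Lsq g -> Lsq (fun x => f x + g x).
Proof.
move=> lf lg; split; first by apply: measurable_funD; [case: lf|case: lg].
have := L1D (L1D lf.2 (L1Zl 2 (Lsq_mul lf lg))) lg.2.
by congr L1; apply/funext => x; ring.
Qed.

Lemma LsqZl (c : R) f : Lsq f -> Lsq (fun x => c * f x).
Proof.
move=> lf; split; first by apply: measurable_funM => //; case: lf.
have := L1Zl (c ^+ 2) lf.2.
by congr L1; apply/funext => x; ring.
Qed.

Lemma LsqB f g : Lsq f -> Lsq g -> Lsq (fun x => f x - g x).
Proof.
by move=> lf /(LsqZl (-1))/(LsqD lf); under eq_fun do rewrite mulN1r.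
Qed.

Lemma Lsq0 : Lsq (fun=> 0).
Proof. by split=> //; under eq_fun do rewrite expr0n/=; exact: L1_0. Qed.

Lemma Lsq_sum (I : Type) (s : seq I) (f : I -> T -> R) :
  (forall i, Lsq (f i)) -> Lsq (fun x => \sum_(i <- s) f i x).
Proof.
move=> sf; elim: s => [|i s ih].
  rewrite (_ : (fun _ => _) = fun=> 0); first exact: Lsq0.
  by apply/funext => x; rewrite big_nil.
rewrite (_ : (fun _ => _) = fun x => f i x + \sum_(j <- s) f j x); first exact: LsqD.
by apply/funext => x; rewrite big_cons.
Qed.

Lemma Lsq_bounded_mul f g (K : R) : measurable_fun setT g -> (forall x, `|g x| <= K) ->
  Lsq f -> Lsq (fun x => g x * f x).
Proof.
move=> mg gK [mf lf]; split; first exact: measurable_funM.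
apply: (L1_le _ _ (L1Zl (K ^+ 2) lf)).
  by apply: measurable_funX; exact: measurable_funM.
move=> x; rewrite ger0_norm ?sqr_ge0// exprMn ler_wpM2r ?sqr_ge0//.
by rewrite -[leLHS]real_normK ?num_real// lerXn2r ?nnegrE// (le_trans _ (gK x)).
Qed.

Lemma Lsq_int_ge0 f : 0 <= \int[mu]_x (f x ^+ 2).
Proof. by apply: Rintegral_ge0 => x _; rewrite sqr_ge0. Qed.

(** The integral of (f + t g)^2 is a nonnegative polynomial in t. *)
Lemma Lsq_CauchySchwarz f g : Lsq f -> Lsq g ->
  (\int[mu]_x (f x * g x)) ^+ 2 <= \int[mu]_x (f x ^+ 2) * \int[mu]_x (g x ^+ 2).
Proof.
move=> lf lg; set A := \int[mu]_x (f x ^+ 2); set B := \int[mu]_x (f x * g x).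
set C := \int[mu]_x (g x ^+ 2).
have q t : 0 <= A + 2 * t * B + t ^+ 2 * C.
  have := Lsq_int_ge0 (fun x => f x + t * g x).
  have -> : \int[mu]_x ((f x + t * g x) ^+ 2) =
      \int[mu]_x (f x ^+ 2 + (2 * t * (f x * g x) + t ^+ 2 * g x ^+ 2)).
    by apply: eq_Rintegral => x _; ring.
  have lfg := Lsq_mul lf lg.
  rewrite RintegralD//; [|by case: lf|by apply: L1D; apply: L1Zl => //; case: lg].
  rewrite RintegralD//; [|exact: L1Zl|by apply: L1Zl; case: lg].
  by rewrite !RintegralZl// ?addrA//; case: lg.
have C0 : 0 <= C by exact: Lsq_int_ge0.
have [C1|C1] := eqVneq C 0.
  suff -> : B = 0 by rewrite expr0n/= C1 mulr0.
  (* For C = 0 the polynomial is affine, and at this t it would be -1. *)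
  apply/eqP/contraT => B0; have := q (- (A + 1) / (2 * B)).
  rewrite C1 mulr0 addr0 (_ : 2 * _ * B = - (A + 1)); last by field.
  by rewrite opprD addrA subrr sub0r oppr_ge0 ler10.
have := q (- B / C); rewrite (_ : _ + _ = (A * C - B ^+ 2) / C); last by field.
by rewrite pmulr_lge0 ?invr_gt0 ?lt_def ?C1// subr_ge0.
Qed.

Lemma Lsq_ae0 f : Lsq f -> \int[mu]_x (f x ^+ 2) = 0 -> ae_eq mu setT f (fun=> 0).
Proof.
move=> [mf lf] f0.
have : (\int[mu]_x `|(f x ^+ 2)%:E| = 0)%E.
  under eq_integral do rewrite /= ger0_norm ?sqr_ge0//.
  by rewrite L1_integralE// f0.
have mf2 : measurable_fun setT (EFin \o (fun x => f x ^+ 2)).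
  by apply/measurable_EFinP; exact: measurable_funX.
move=> /(ae_eq_integral_abs mu measurableT mf2); apply: filterS => x h xT.
by have [/eqP] := h xT; rewrite sqrf_eq0 => /eqP.
Qed.

Lemma ae_eq_Rintegral f g : measurable_fun setT f -> measurable_fun setT g ->
  ae_eq mu setT f g -> \int[mu]_x f x = \int[mu]_x g x.
Proof.
move=> mf mg fg; congr fine; apply: ae_eq_integral => //.
- exact/measurable_EFinP.
- exact/measurable_EFinP.
- by apply: filterS fg => x h xT /=; rewrite h.
Qed.

End L1.

(** * Completeness of the square integrable functions *)

Section completeness.
Context d (T : measurableType d) (R : realType).
Variable mu : {measure set T -> \bar R}.
Hypothesis mu_fin : (mu setT < +oo)%E.
Implicit Types f g : T -> R.

Lemma L1_cst (c : R) : L1 mu (fun=> c).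
Proof.
apply/integrableP; split; first exact/measurable_EFinP.
by rewrite integral_cst// lte_mul_pinfty.
Qed.

Lemma Lsq_cst (c : R) : Lsq mu (fun=> c).
Proof. by split=> //; exact: L1_cst. Qed.

Lemma L1_Lsq f : Lsq mu f -> L1 mu f.
Proof. by move=> /Lsq_mul/(_ (Lsq_cst 1)); under eq_fun do rewrite mulr1. Qed.

(** Young's inequality with weights p and 1 / p. For p = 2^j it turns squared increments of order
    4^-j into increments of order 2^-j in L1. *)
Let amgm (p q t : R) : p * q = 1 -> 0 <= p -> t <= p / 2 * t ^+ 2 + q / 2 * 1.
Proof.
move=> pq p0; rewrite -subr_ge0.
have -> : p / 2 * t ^+ 2 + q / 2 * 1 - t = p / 2 * (t - q) ^+ 2 + (p * q - 1) * (t - q / 2).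
  by field.
by rewrite pq subrr mul0r addr0 mulr_ge0 ?sqr_ge0// divr_ge0.
Qed.

Let pq1 j : 2 ^+ j * 2^-1 ^+ j = 1 :> R.
Proof. by rewrite -exprMn divff// expr1n. Qed.

(** Riesz-Fischer: as the mass is finite, the increments are summable in L1, so the sum W of their
    absolute values is finite almost everywhere, and there the sequence converges. *)
Let summable_sequence (h : nat -> T -> R) :
  (forall j, Lsq mu (h j)) ->
  (forall j, \int[mu]_x ((h j.+1 x - h j x) ^+ 2) <= 4%:R ^- j) ->
  exists g, measurable_fun setT g /\ {ae mu, forall x, h j x @[j --> \oo] --> g x}.
Proof.
move=> lh hj; pose dd j x := h j.+1 x - h j x.
have ld j : Lsq mu (dd j) by exact: LsqB.
pose W x := (\sum_(j <oo) `|dd j x|%:E)%E.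
have md j : measurable_fun setT (fun x => `|dd j x|%:E).
  by apply/measurable_EFinP; apply: measurableT_comp => //; case: (ld j).
have mW : measurable_fun setT W by apply: ge0_emeasurable_sum => // k x _ _; rewrite lee_fin.
pose m := \int[mu]_x (1 : R).
have m0 : 0 <= m by apply: Rintegral_ge0.
have idj j : (\int[mu]_x `|dd j x|%:E <= ((2^-1) ^+ j * (1 + m) / 2)%:E)%E.
  have l1 := L1_norm (L1_Lsq (ld j)).
  rewrite L1_integralE// lee_fin.
  have := @Rintegral_le _ _ _ mu (fun x => `|dd j x|)
    (fun x => 2 ^+ j / 2 * dd j x ^+ 2 + (2^-1) ^+ j / 2 * 1) l1.
  move=> /(_ (L1D (L1Zl _ (ld j).2) (L1Zl _ (L1_cst 1)))) hle.
  apply: (le_trans (hle _)) => [x|].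
    rewrite -[dd j x ^+ 2]real_normK ?num_real//.
    by apply: amgm; [exact: pq1|exact: exprn_ge0].
  rewrite RintegralD//; [|exact: L1Zl (ld j).2|exact: L1Zl (L1_cst 1)].
  rewrite !RintegralZl//; [|exact: L1_cst|exact: (ld j).2].
  rewrite (_ : 2^-1 ^+ j * (1 + m) / 2 = 2^-1 ^+ j / 2 + 2^-1 ^+ j / 2 * m); last by ring.
  rewrite lerD2r; apply: (@le_trans _ _ (2 ^+ j / 2 * 4%:R ^- j)).
    by apply: ler_wpM2l; [rewrite divr_ge0// exprn_ge0|exact: hj].
  have -> : 4%:R ^- j = 2^-1 ^+ j * 2^-1 ^+ j :> R.
    by rewrite -exprMn -exprVn; congr (_ ^+ _); field.
  rewrite (_ : 2 ^+ j / 2 * _ = (2 ^+ j * 2^-1 ^+ j) * (2^-1 ^+ j / 2)); last by ring.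
  by rewrite pq1 mul1r.
have iW : mu.-integrable setT W.
  apply/integrableP; split=> //.
  rewrite (_ : (\int[mu]_x `|W x|)%E = (\int[mu]_x W x)%E); last first.
    by apply: eq_integral => x _; rewrite gee0_abs// nneseries_ge0.
  rewrite integral_nneseries//.
  apply: (@le_lt_trans _ _ (1 + m)%:E); last exact: ltry.
  apply: lime_le; first by apply: is_cvg_nneseries => n _ _; exact: integral_ge0.
  apply: nearW => n; apply: le_trans (lee_sum _ (fun j _ => idj j)) _.
  rewrite sumEFin lee_fin -!mulr_suml -[leRHS]mul1r -mulrA mulrCA.
  rewrite [leRHS]mulrC; apply: ler_wpM2l; rewrite ?addr_ge0//.
  have := @geometric_le_lim R n 1 2^-1 ler01 _ _.
  rewrite seriesEnat/= => hg; rewrite ler_pdivrMr// mul1r.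
  under eq_bigr do rewrite -[_ ^+ _]mul1r.
  apply: le_trans (hg _ _) _ => //; first by rewrite ger0_norm// invf_lt1// ltr1n.
  by rewrite div1r (_ : 1 - 2^-1 = 2^-1 :> R) ?invrK//; field.
pose E := [set x | W x \is a fin_num].
have mE : measurable E.
  by rewrite -[E]setTI; exact: emeasurable_fin_num.
have cE x : E x -> cvgn (h ^~ x).
  move=> Ex; have c1 : cvgn [normed series (fun j => dd j x)].
    apply: nondecreasing_is_cvgn; first by apply: nondecreasing_series => *; exact: normr_ge0.
    exists (fine (W x)) => _ [n _ <-]; rewrite -lee_fin fineK//.
    rewrite (_ : [normed series (dd^~ x)] n = \sum_(0 <= j < n) `|dd j x|)// -sumEFin.
    exact: nneseries_lim_ge.
  have := @normed_cvg _ R^o _ c1; rewrite /dd => c2.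
  have -> : h ^~ x = (fun n => series (fun j => h j.+1 x - h j x) n + h 0 x).
    by apply/funext => n; rewrite seriesEnat/= telescope_sumr// subrK.
  by apply: is_cvgD => //; exact: is_cvg_cst.
pose g x := if `[< E x >] then limn (h ^~ x) else 0.
exists g; split.
  apply: (@measurable_fun_cvg _ _ _ _ (fun n x => \1_E x * h n x)) => [n|x _].
    by apply: measurable_funM; [exact: measurable_indic|case: (lh n)].
  rewrite /g indicE; case: asboolP => Ex.
    rewrite mem_set//; under eq_fun do rewrite mul1r; exact: cE.
  by rewrite memNset//; under eq_fun do rewrite mul0r; exact: cvg_cst.
have := integrable_ae measurableT iW; apply: filterS => x /(_ I) Ex.
by rewrite /g asboolT//; exact: cE.
Qed.

(** Along a fast subsequence Fatou's lemma passes the bound on s n - s m to the limit with the same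
    e m; this explicit rate is used in the synthesis from coefficients. *)
Lemma Lsq_complete (s : nat -> T -> R) (e : nat -> R) :
  (forall n, Lsq mu (s n)) -> e n @[n --> \oo] --> 0 ->
  (forall m n, (m <= n)%N -> \int[mu]_x ((s n x - s m x) ^+ 2) <= e m) ->
  exists g, Lsq mu g /\ forall m, \int[mu]_x ((g x - s m x) ^+ 2) <= e m.
Proof.
move=> ls e0 se.
have /choice[K KP] (j : nat) : exists K, forall n, (K <= n)%N -> e n <= 4%:R ^- j.
  have p : 0 < 4%:R ^- j :> R by rewrite invr_gt0 exprn_gt0.
  have [N _ NP] := cvgr0_norm_le e e0 _ p.
  by exists N => n /NP/=; exact: le_trans (ler_norm _).
(* k is increasing, at least K j for the rate 4^-j, and at least j, so that k (n + m) is beyond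
   m. *)
pose k j := (\sum_(i < j.+1) (K i).+1)%N.
have kS j : (k j <= k j.+1)%N by rewrite /k [leqRHS]big_ord_recr/= leq_addr.
have kK j : (K j <= k j)%N by rewrite /k big_ord_recr/= (leq_trans (leqnSn _))// leq_addl.
have kj j : (j <= k j)%N.
  by elim: j => // j ih; rewrite (leq_ltn_trans ih)// /k [ltnRHS]big_ord_recr/= -addSnnS leq_addr.
have [g [mg hg]] := @summable_sequence (fun j => s (k j)) (fun j => ls _)
  (fun j => le_trans (se _ _ (kS j)) (KP _ _ (kK j))).
suff gm m : (\int[mu]_x ((g x - s m x) ^+ 2)%:E <= (e m)%:E)%E.
  have lgm m : L1 mu (fun x => (g x - s m x) ^+ 2) /\
      \int[mu]_x ((g x - s m x) ^+ 2) <= e m.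
    apply: L1_ge0_bound => //; last by move=> x; rewrite sqr_ge0.
    by apply: measurable_funX; apply: measurable_funB => //; case: (ls m).
  exists g; split; last by move=> m; case: (lgm m).
  have : Lsq mu (fun x => (g x - s 0 x) + s 0 x).
    apply: LsqD => //; split; last by case: (lgm 0).
    by apply: measurable_funB => //; case: (ls 0).
  by under eq_fun do rewrite subrK.
pose v n x := ((s (k (n + m)%N) x - s m x) ^+ 2)%:E.
have mv n : measurable_fun setT (v n).
  apply/measurable_EFinP; apply: measurable_funX; apply: measurable_funB.
    by case: (ls (k (n + m)%N)).
  by case: (ls m).
have v0 n x : setT x -> (0 <= v n x)%E by move=> _; rewrite lee_fin sqr_ge0.
have := fatou mu measurableT mv v0.
have -> : (\int[mu]_x limn_einf (v ^~ x) = \int[mu]_x ((g x - s m x) ^+ 2)%:E)%E.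
  apply: ae_eq_integral => //.
  - rewrite (_ : (fun _ => _) = fun x => (- limn_esup (fun n => - v n x))%E).
      apply: measurableT_comp => //; apply: measurable_fun_limn_esup => n.
      exact: measurableT_comp.
    by apply/funext => x; rewrite -[LHS]oppeK -limn_esupN.
  - apply/measurable_EFinP; apply: measurable_funX; apply: measurable_funB => //.
    by case: (ls m).
  - apply: filterS hg => x hx _.
    have cv : v n x @[n --> \oo] --> ((g x - s m x) ^+ 2)%:E.
      apply: cvg_EFin; first exact: nearW.
      have h : s (k (n + m)%N) x @[n --> \oo] --> g x.
        by move: hx; rewrite -(cvg_shiftn m).
      have h2 : s (k (n + m)%N) x - s m x @[n --> \oo] --> g x - s m x.
        by apply: cvgB => //; exact: cvg_cst.
      exact: (cvgM h2 h2).
    by rewrite is_cvg_limn_einfE ?(cvg_lim _ cv)//; apply/cvg_ex; eexists; exact: cv.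
move=> /le_trans; apply; rewrite limn_einf_lim; apply: lime_le; first exact: is_cvg_einfs.
apply: nearW => n; apply: ereal_inf_le.
exists (\int[mu]_x v n x)%E; first by exists n => /=.
rewrite L1_integralE; last exact: (LsqB (ls _) (ls m)).2.
by rewrite lee_fin se// (leq_trans _ (kj _))// leq_addl.
Qed.

End completeness.

(** * Test functions and cutoffs *)

Section cutoff.
Context {R : realType} (n : nat).
Local Notation X := 'cV[R]_n.
Implicit Types (f g : X -> R) (x : X).

Lemma is_derive_scale (f : X -> R) (e : R) x v d :
  is_derive (e *: x) v f d -> is_derive x v (fun y => f (e *: y)) (e * d).
Proof.
move=> /is_derive_line hf; apply/is_derive_line.
have -> : (fun t : R => f (e *: (t *: v + x))) =
    (fun s : R => f (s *: v + e *: x)) \o (fun t : R => e * t).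
  by apply/funext => t; rewrite /= scalerDr scalerA.
rewrite mulrC; apply: is_derive1_comp; first by rewrite mulr0.
have -> : (fun t : R => e * t) = e \*: id by [].
by apply: is_derive_eq; rewrite [_ *: _]mulr1.
Qed.

Lemma partial_scale f (e : R) i x :
  (forall y, derivable f y (delta_mx i 0)) ->
  partial i (fun y => f (e *: y)) x = e * partial i f (e *: x).
Proof.
move=> df; have /is_derive_scale : is_derive (e *: x) (delta_mx i 0) f (partial i f (e *: x)).
  by split.
by case.
Qed.

(** The box is closed, so around a point outside it f vanishes on a neighbourhood, and its
    derivative is 0. *)
Lemma cbox_partial f i : cbox f -> continuous (partial i f) -> cbox (partial i f).
Proof.
move=> [cf [M fM]] cp; split=> //; exists M => x; apply: contra_neqP.
move=> /existsNP[j xj]; rewrite /partial.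
have : nbhs x (~` [set y : X | forall i, - M <= y i 0 <= M]).
  apply: open_nbhs_nbhs; split.
    apply: closed_openC; apply: compact_closed; first exact: norm_hausdorff.
    exact: (@compact_box R n M).
  by move=> /(_ j).
move=> nx; rewrite (@near_eq_derive _ _ _ f (cst 0) x (delta_mx i 0)) ?derive_cst//.
apply: filterS nx => y; apply: contra_notP => /eqP; exact: fM.
Qed.

Lemma cboxM f g : continuous f -> cbox g -> cbox (fun x => f x * g x).
Proof.
move=> cf [cg [M gM]]; split; first by move=> x; exact: cvgM (cf x) (cg x).
by exists M => x; rewrite mulf_eq0 negb_or => /andP[_]; exact: gM.
Qed.

Lemma cboxD f g : cbox f -> cbox g -> cbox (fun x => f x + g x).
Proof.
move=> [cf [M fM]] [cg [M' gM]]; split; first by move=> x; exact: cvgD (cf x) (cg x).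
exists (Num.max M M') => x h i; suff : (- M <= x i 0 <= M) \/ (- M' <= x i 0 <= M').
  by case=> /andP[h1 h2]; rewrite lerNl in h1; rewrite lerNl !le_max h1 h2 ?orbT.
have [fx|fx] := eqVneq (f x) 0; last by left; exact: fM.
by right; apply: gM; move: h; rewrite fx add0r.
Qed.

Lemma cbox_sum (I : Type) (s : seq I) (f : I -> X -> R) :
  (forall i, cbox (f i)) -> cbox (fun x => \sum_(i <- s) f i x).
Proof.
move=> sf; elim: s => [|i s ih].
  rewrite (_ : (fun _ => _) = fun=> 0); last by apply/funext => x; rewrite big_nil.
  by split; [exact: cst_continuous|exists 0 => x; rewrite eqxx].
rewrite (_ : (fun _ => _) = fun x => f i x + \sum_(j <- s) f j x); first exact: cboxD.
by apply/funext => x; rewrite big_cons.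
Qed.

Lemma cbox_compact f : cbox f -> compact (closure [set x | f x != 0]).
Proof.
move=> [cf [M fM]]; apply: (@subclosed_compact _ _ _ _ (@compact_box R n M)).
  exact: closed_closure.
have : closed [set x : X | forall i, - M <= x i 0 <= M].
  by apply: compact_closed; [exact: norm_hausdorff|exact: compact_box].
by move=> /closure_id ->; apply: closure_subset => x; exact: fM.
Qed.

Lemma test_function_cbox f : test_function f -> cbox f.
Proof.
move=> [sf cf]; split; first by have [] := sf [::].
have [K [Kr KP]] := @compact_bounded R X _ cf.
exists (`|K| + 1) => x fx i; rewrite -ler_norml.
apply: le_trans (KP (`|K| + 1) _ x _); last exact: subset_closure.
  by rewrite [leRHS]mx_normrE; exact: (le_bigmax _ (fun ij => `|x ij.1 ij.2|) (i, 0)).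
by rewrite (le_lt_trans (ler_norm _))// ltrDl.
Qed.

Lemma test_function_partial f i : test_function f ->
  cbox (partial i f) /\ forall x, is_derive x (delta_mx i 0) f (partial i f x).
Proof.
move=> tf; have [sf _] := tf; split; first by apply: cbox_partial; [exact: test_function_cbox|have [] := sf [:: i]].
by move=> x; split=> //; have [_] := sf [::]; exact.
Qed.

Lemma test_function_partial2 f i j : test_function f ->
  cbox (partial j (partial i f)) /\
  forall x, is_derive x (delta_mx j 0) (partial i f) (partial j (partial i f) x).
Proof.
move=> tf; have [sf _] := tf; split.
  by apply: cbox_partial; [case: (test_function_partial i tf)|have [] := sf [:: j; i]].
by move=> x; split=> //; have [_] := sf [:: i]; exact.
Qed.

(** Each factor vanishes unless |x_i| < 1, and the constant exp 2 makes it 1 at the origin. *)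
Definition cut (x : X) : R :=
  \prod_i (flat 0 (1 - x i 0) * flat 0 (1 + x i 0) * expR 2).

Lemma salg_cut : salg cut.
Proof.
apply: salg_prod => i; apply: salgM; last exact: salg_cst.
apply: salgM; apply: salg_flat; apply: salgD; try exact: salg_cst.
  exact/salgN/salg_coord.
exact: salg_coord.
Qed.

Lemma cut0 : cut 0 = 1.
Proof.
rewrite /cut big1// => i _; rewrite mxE subr0 addr0 /flat ltr01 expr0 invr1 mul1r.
by rewrite -!expRD (_ : -1 + -1 + 2 = 0) ?expR0//; ring.
Qed.

Lemma cbox_cut : cbox cut.
Proof.
split; first exact: salg_continuous salg_cut.
exists 1 => x /prodf_neq0 h i; have := h i isT.
rewrite !mulf_eq0 !negb_or -andbA => /and3P[h1 h2 _].
have := flat_ge0 0 (1 - x i 0); have := flat_ge0 0 (1 + x i 0).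
rewrite !le_eqVlt !(eq_sym 0) (negbTE h1) (negbTE h2)/= !flat_gt0 => h3 h4.
by apply/andP; split; lra.
Qed.

Lemma salg_scale f (e : R) : salg f -> salg (fun x => f (e *: x)).
Proof.
elim=> {f} [c|i|f g _ sf _ sg|f g _ sf _ sg|f _ sf|k f _ sf].
- exact: salg_cst.
- rewrite (_ : (fun _ => _) = fun x : X => e * x i 0); last by apply/funext => x; rewrite mxE.
  by apply: salgM; [exact: salg_cst|exact: salg_coord].
- exact: salgD.
- exact: salgM.
- exact: salg_expR.
- exact: salg_flat.
Qed.

Lemma cbox_scale f (e : R) : 0 < e -> cbox f -> cbox (fun x => f (e *: x)).
Proof.
move=> e0 [cf [M fM]]; split.
  by move=> x; apply: continuous_comp; [exact: scaler_continuous|exact: cf].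
exists (M / e) => x /fM h i; have := h i; rewrite mxE -mulNr.
by rewrite ler_pdivlMr// ler_pdivrMr// mulrC.
Qed.

Definition eps m : R := m.+1%:R^-1.

Lemma eps_gt0 m : 0 < eps m. Proof. by rewrite invr_gt0. Qed.

Lemma cvg_eps : eps m @[m --> \oo] --> (0 : R).
Proof. exact: cvg_harmonic. Qed.

(** Dominated convergence. With g = [cut] the limit is the integral of f; with derivatives of [cut]
    the limit is finite, and the factors [eps m] produced by the scaling make those terms vanish. *)
Lemma cvg_cutoff (mu : {measure set X -> \bar R}) f g : L1 mu f -> cbox g ->
  \int[mu]_x (f x * g (eps m *: x)) @[m --> \oo] --> g 0 * \int[mu]_x f x.
Proof.
move=> lf bg; have [K K0 gK] := cbox_bounded bg; have [cg _] := bg.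
have mg m : measurable_fun setT (fun x : X => g (eps m *: x)).
  by apply: continuous_measurable_cV; case: (cbox_scale (eps_gt0 m) bg).
have mf := L1_measurable lf.
have := @L1_dominated _ _ _ mu (fun m x => f x * g (eps m *: x)) (fun x => g 0 * f x)
  (fun x => K * `|f x|) _ _ (L1Zl K (L1_norm lf)).
case=> [m|x|m x|_]; first exact: measurable_funM.
- rewrite mulrC; apply: cvgMr; have h : eps m *: x @[m --> \oo] --> (0 : X).
    by rewrite -[X in _ --> X](scale0r x); exact: cvgZ cvg_eps (cvg_cst x).
  exact: (cvg_comp _ _ h (cg 0)).
- by rewrite normrM mulrC ler_wpM2r.
- by rewrite RintegralZl.
Qed.

Lemma integral_partial_mul f g g' i : salg f -> cbox g -> cbox g' ->
  (forall x, is_derive x (delta_mx i 0) g (g' x)) ->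
  \int[lebesgue_cV n]_x (partial i f x * g x) = - \int[lebesgue_cV n]_x (f x * g' x).
Proof.
move=> sf cg cp dg; have [sp dp] := salg_partial i sf.
have c1 := cboxM (salg_continuous sp) cg; have c2 := cboxM (salg_continuous sf) cp.
apply/eqP; rewrite -addr_eq0 addrC -RintegralD//; [|exact: cbox_integrable|exact: cbox_integrable].
apply/eqP; rewrite /Rintegral.
suff -> : (\int[lebesgue_cV n]_x (f x * g' x + partial i f x * g x)%:E = 0)%E by [].
apply: (@integral_partial_cbox R n (fun x => f x * g x) _ i).
- exact: cboxM (salg_continuous sf) cg.
- exact: cboxD.
- by move=> x; have := is_deriveM (dp x) (dg x); rewrite /GRing.scale/= [g x * _]mulrC.
Qed.

End cutoff.

(** * Gaussian measure and Hermite polynomials *)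

Section partial_rules.
Context {R : realType} (n : nat).
Implicit Types (f g : 'cV[R]_n -> R).

Lemma partial_eq f i x d : is_derive x (delta_mx i 0) f d -> partial i f x = d.
Proof. by case. Qed.

Lemma partial_cst (c : R) i (x : 'cV[R]_n) : partial i (fun=> c) x = 0.
Proof. exact: derive_cst. Qed.

Lemma partial_coord i j (x : 'cV[R]_n) : partial i (fun y => y j 0) x = (j == i)%:R.
Proof. exact/partial_eq/is_derive_coord. Qed.

Lemma partialD f g i x : salg f -> salg g ->
  partial i (fun y => f y + g y) x = partial i f x + partial i g x.
Proof.
move=> /(salg_partial i)[_ df] /(salg_partial i)[_ dg]; exact: partial_eq.
Qed.

Lemma partialM f g i x : salg f -> salg g ->
  partial i (fun y => f y * g y) x = f x * partial i g x + g x * partial i f x.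
Proof.
move=> /(salg_partial i)[_ df] /(salg_partial i)[_ dg]; exact: partial_eq.
Qed.

Lemma partialZ (c : R) f i x : salg f -> partial i (fun y => c * f y) x = c * partial i f x.
Proof. by move=> sf; rewrite partialM ?partial_cst ?mulr0 ?addr0//; exact: salg_cst. Qed.

Lemma partialN f i x : salg f -> partial i (fun y => - f y) x = - partial i f x.
Proof.
move=> sf; rewrite (_ : (fun y => - f y) = (fun y => -1 * f y)) ?partialZ ?mulN1r//.
by apply/funext => y; rewrite mulN1r.
Qed.

Lemma partial_sum (I : Type) (s : seq I) (f : I -> 'cV[R]_n -> R) i x :
  (forall k, salg (f k)) ->
  partial i (fun y => \sum_(k <- s) f k y) x = \sum_(k <- s) partial i (f k) x.
Proof.
move=> sf; elim: s => [|k s ih].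
  rewrite big_nil (_ : (fun _ => _) = fun=> 0) ?partial_cst//.
  by apply/funext => y; rewrite big_nil.
rewrite big_cons -ih -partialD//; last exact: salg_sum.
by congr partial; apply/funext => y; rewrite big_cons.
Qed.

Lemma partial_expR f i x : salg f ->
  partial i (fun y => expR (f y)) x = expR (f x) * partial i f x.
Proof.
move=> /(salg_partial i)[_ df]; apply: partial_eq; exact: is_derive_chain.
Qed.

End partial_rules.

Section tame.
Context {R : realType} (n : nat).
Local Notation X := 'cV[R]_n.
Implicit Types (f g : X -> R).

Definition sqn (x : X) : R := \sum_i x i 0 ^+ 2.

Lemma sqn_ge0 x : 0 <= sqn x.
Proof. by apply: sumr_ge0 => i _; rewrite sqr_ge0. Qed.

(** Growth below every Gaussian. The class contains polynomials and exponentials of absolute values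
    of affine functions, and is closed under products because c can be halved. *)
Definition tame f := measurable_fun setT f /\
  forall c : R, 0 < c -> exists C : R, forall x, `|f x| <= C * expR (c * sqn x).

Lemma tame_bounded f (K : R) : measurable_fun setT f -> (forall x, `|f x| <= K) -> tame f.
Proof.
move=> mf fK; split=> // c c0; exists K => x; apply: (le_trans (fK x)).
have K0 : 0 <= K by exact: le_trans (fK x).
rewrite ler_peMr// -[leLHS](expR0 R) ler_expR mulr_ge0 ?sqn_ge0 ?ltW//.
Qed.

Lemma tame_cst (c : R) : tame (fun=> c).
Proof. exact: (@tame_bounded _ `|c|). Qed.

Lemma tame_coord i : tame (fun x => x i 0).
Proof.
split=> [|c c0]; first exact: measurable_coord.
exists (1 + c^-1) => x; have c'0 : 0 <= c^-1 by rewrite invr_ge0 ltW.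
have h : x i 0 ^+ 2 <= sqn x.
  by rewrite /sqn (bigD1 i)//= lerDl sumr_ge0// => j _; rewrite sqr_ge0.
have h2 : 1 + c * sqn x <= expR (c * sqn x) by exact: expR_ge1Dx.
apply: (@le_trans _ _ (1 + sqn x)).
  apply: le_trans (_ : 1 + x i 0 ^+ 2 <= _); last by rewrite lerD2l.
  rewrite -[x i 0 ^+ 2]real_normK ?num_real//; set t := `|x i 0|.
  have := sqr_ge0 (t - 1); have : 0 <= t by exact: normr_ge0.
  rewrite sqrrB expr1n mulr1 => h3 h4; have := sqr_ge0 t; lra.
rewrite mulrDl mul1r; apply: lerD.
  by rewrite (le_trans _ h2)// lerDl mulr_ge0 ?sqn_ge0 ?ltW.
by rewrite mulrC ler_pdivlMr// mulrC (le_trans _ h2)// lerDr.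
Qed.

Lemma tameD f g : tame f -> tame g -> tame (fun x => f x + g x).
Proof.
move=> [mf tf] [mg tg]; split=> [|c c0]; first exact: measurable_funD.
have [C fC] := tf c c0; have [D gD] := tg c c0; exists (C + D) => x.
by rewrite (le_trans (ler_normD _ _))// mulrDl lerD.
Qed.

Lemma tameM f g : tame f -> tame g -> tame (fun x => f x * g x).
Proof.
move=> [mf tf] [mg tg]; split=> [|c c0]; first exact: measurable_funM.
have c2 : 0 < c / 2 by rewrite divr_gt0.
have [C fC] := tf _ c2; have [D gD] := tg _ c2; exists (C * D) => x.
rewrite normrM (_ : C * D * expR (c * sqn x) =
  C * expR (c / 2 * sqn x) * (D * expR (c / 2 * sqn x))); first exact: ler_pM.
rewrite (_ : c * sqn x = c / 2 * sqn x + c / 2 * sqn x); last by field.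
by rewrite expRD; ring.
Qed.

Lemma tameN f : tame f -> tame (fun x => - f x).
Proof.
move=> /(tameM (tame_cst (-1))); congr tame; apply/funext => x; exact: mulN1r.
Qed.

Lemma tame_sum (I : Type) (s : seq I) (f : I -> X -> R) :
  (forall i, tame (f i)) -> tame (fun x => \sum_(i <- s) f i x).
Proof.
move=> sf; elim: s => [|i s ih].
  rewrite (_ : (fun _ => _) = fun=> 0); first exact: tame_cst.
  by apply/funext => x; rewrite big_nil.
rewrite (_ : (fun _ => _) = fun x => f i x + \sum_(j <- s) f j x); first exact: tameD.
by apply/funext => x; rewrite big_cons.
Qed.

Lemma tame_prod (I : Type) (s : seq I) (f : I -> X -> R) :
  (forall i, tame (f i)) -> tame (fun x => \prod_(i <- s) f i x).
Proof.
move=> sf; elim: s => [|i s ih].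
  rewrite (_ : (fun _ => _) = fun=> 1); first exact: tame_cst.
  by apply/funext => x; rewrite big_nil.
rewrite (_ : (fun _ => _) = fun x => f i x * \prod_(j <- s) f j x); first exact: tameM.
by apply/funext => x; rewrite big_cons.
Qed.

End tame.

Section gauss.
Context {R : realType} (n : nat).
Local Notation X := 'cV[R]_n.
Variable S : 'M[R]_n.
Hypothesis hS : sym_posdef S.
Implicit Types (f g : X -> R).
Local Notation psi := (gauss_density S).
Local Notation gam := (gauss_measure S).

(** Room in the exponent: a function bounded by a multiple of exp (c |x|^2) remains integrable for
    the Gaussian measure. *)
Lemma posdef_shift : exists2 c : R, 0 < c & sym_posdef (S - (2 * c)%:M).
Proof.
have [U SU uU] := posdef_factor hS.
pose W := invmx U^T; have uW : U^T \in unitmx by rewrite unitmx_tr.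
pose K := \sum_i \sum_k W i k ^+ 2.
have K0 : 0 <= K by apply: sumr_ge0 => i _; apply: sumr_ge0 => k _; rewrite sqr_ge0.
have hK x : sqn x <= K * (x^T *m S *m x) 0 0.
  rewrite {1}SU -{1}[U]trmxK norm_mxE /K mulr_suml; apply: ler_sum => i _.
  rewrite -{1}[x](mulKmx uW) mxE; exact: cauchy_schwarz_sum.
(* Since |x|^2 <= K x^T S x, this c keeps 2 c |x|^2 at most half of x^T S x. *)
exists ((K + 1)^-1 / 4) => [|]; first by rewrite divr_gt0// invr_gt0 ltr_wpDl.
have [Ss Sp] := hS; split=> [|x x0].
  by rewrite linearB/= Ss tr_scalar_mx.
rewrite mulmxBr mulmxBl mul_mx_scalar -scalemxAl !mxE.
have -> : \sum_j x^T 0 j * x j 0 = sqn x.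
  by apply: eq_bigr => j _; rewrite mxE expr2.
have := Sp x x0; rewrite mxE; set q := \sum_j _ => q0.
have := hK x; rewrite mxE -/q => h.
rewrite subr_gt0; apply: (@le_lt_trans _ _ (q / 2)); last by rewrite ltr_pdivrMr// ltr_pMr// ltr1n.
rewrite (_ : 2 * _ = (K + 1)^-1 / 2); last by field; rewrite gt_eqF// ltr_wpDl.
rewrite mulrAC ler_wpM2r// mulrC ler_pdivrMr ?ltr_wpDl//.
by rewrite (le_trans h)// mulrC ler_wpM2l ?lerDl ?ltW.
Qed.

Lemma gauss_density_gt0 x : 0 < psi x.
Proof.
have [d0 _] := integral_gaussian hS.
by rewrite mulr_gt0 ?expR_gt0// divr_gt0 ?sqrtr_gt0// powR_gt0// mulr_gt0 ?pi_gt0.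
Qed.

Lemma gauss_measureE A : measurable A ->
  gam A = (\int[lebesgue_cV n]_(x in A) (psi x)%:E)%E.
Proof. by []. Qed.

Lemma gauss_total : gam setT = 1%E.
Proof.
have [d0 e] := integral_gaussian hS.
rewrite gauss_measureE// /gauss_density.
under eq_integral do rewrite EFinM.
have p0 : 0 < 2 * pi :> R by rewrite mulr_gt0 ?pi_gt0.
rewrite ge0_integralZl//; [|exact: measurable_gaussian|]; last first.
  by rewrite lee_fin divr_ge0 ?sqrtr_ge0 ?powR_ge0.
rewrite e -EFinM; congr (_%:E).
have -> : (2 * pi) `^ (n%:R / 2) = Num.sqrt ((2 * pi) ^+ n) :> R.
  by rewrite powRrM powR12_sqrt ?powR_ge0// powR_mulrn// ltW.
have q0 : 0 < (2 * pi) ^+ n :> R by rewrite exprn_gt0.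
rewrite mulrC mulrA -sqrtrM; last by rewrite divr_ge0 ?ltW.
by rewrite divfK ?gt_eqF// divff// gt_eqF// sqrtr_gt0.
Qed.

Lemma gauss_fin : (gam setT < +oo)%E.
Proof. by rewrite gauss_total ltry. Qed.

Lemma L1_gauss f : measurable_fun setT f ->
  L1 gam f <-> L1 (lebesgue_cV n) (fun x => f x * psi x).
Proof.
exact: integrable_density (measurable_gauss_density S) (gauss_density_ge0 S) gauss_measureE _.
Qed.

Lemma Rintegral_gauss f : measurable_fun setT f ->
  \int[gam]_x f x = \int[lebesgue_cV n]_x (f x * psi x).
Proof.
exact: Rintegral_density (measurable_gauss_density S) (gauss_density_ge0 S) gauss_measureE _.
Qed.

Lemma tame_L1 f : tame f -> L1 gam f.
Proof.
move=> [mf tf]; apply/L1_gauss => //.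
have [c c0 hSc] := posdef_shift; have [C fC] := tf c c0.
pose Z := Num.sqrt (\det S) / (2 * pi) `^ (n%:R / 2).
have Z0 : 0 <= Z by rewrite divr_ge0 ?sqrtr_ge0 ?powR_ge0.
pose h (x : X) : R := expR (- ((x^T *m (S - (2 * c)%:M) *m x) 0 0 / 2)).
have lh : L1 (lebesgue_cV n) h.
  apply/integrableP; split; first exact: measurable_gaussian.
  under eq_integral do rewrite /= ger0_norm ?expR_ge0//.
  by have [_ ->] := integral_gaussian hSc; rewrite ltry.
apply: (L1_le _ _ (L1Zl (C * Z) lh)).
  by apply: measurable_funM => //; exact: measurable_gauss_density.
move=> x; rewrite normrM [X in _ * X]ger0_norm ?gauss_density_ge0//.
rewrite /gauss_density -/Z /h.
have -> : (x^T *m (S - (2 * c)%:M) *m x) 0 0 = (x^T *m S *m x) 0 0 - 2 * c * sqn x.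
  rewrite mulmxBr mulmxBl mul_mx_scalar -scalemxAl [LHS]mxE [X in _ + X]mxE [X in _ - X]mxE.
  by congr (_ - _ * _); rewrite mxE; apply: eq_bigr => j _; rewrite mxE expr2.
rewrite mulrBl opprB expRD (_ : 2 * c * sqn x / 2 = c * sqn x); last by field.
rewrite (_ : C * Z * _ = C * expR (c * sqn x) * (Z * expR (- ((x^T *m S *m x) 0 0 / 2)))); last by ring.
by apply: ler_wpM2r => //; rewrite mulr_ge0 ?expR_ge0.
Qed.

Lemma tame_Lsq f : tame f -> Lsq gam f.
Proof.
move=> tf; split; first by case: tf.
have := tame_L1 (tameM tf tf); congr L1; apply/funext => x; exact: expr2.
Qed.

Lemma salg_gauss_density : salg psi.
Proof.
apply: salgM; first exact: salg_cst.
apply: salg_expR; apply: salgN; apply: salgM; last exact: salg_cst.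
rewrite (_ : (fun _ => _) = fun x : X => \sum_k \sum_l S k l * (x k 0 * x l 0)).
  apply: salg_sum => k; apply: salg_sum => l; apply: salgM; first exact: salg_cst.
  by apply: salgM; exact: salg_coord.
by apply/funext => x; rewrite quad_mxE.
Qed.

Lemma partial_gauss_density i x : partial i psi x = - (S *m x) i 0 * psi x.
Proof.
pose q (y : X) := \sum_k \sum_l S k l * (y k 0 * y l 0).
have qE y : (y^T *m S *m y) 0 0 = q y by rewrite quad_mxE.
have sc k l : salg (fun y : X => S k l * (y k 0 * y l 0)).
  by apply: salgM; [exact: salg_cst|apply: salgM; exact: salg_coord].
have sq : salg q by apply: salg_sum => k; apply: salg_sum => l.
have dq : partial i q x = 2 * (S *m x) i 0.
  rewrite partial_sum; last by move=> k; exact: salg_sum.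
  under eq_bigr => k _.
    rewrite partial_sum; last by move=> l; exact: sc.
    under eq_bigr => l _.
      rewrite partialZ; last by apply: salgM; exact: salg_coord.
      rewrite partialM ?partial_coord; try exact: salg_coord.
      rewrite mulrDr; over.
    rewrite big_split; over.
  rewrite big_split/= mulr_natl mulr2n; congr (_ + _).
    rewrite mxE; apply: eq_bigr => k _; rewrite (bigD1 i)//= eqxx mulr1 big1 ?addr0.
      by congr (_ * _); case: hS => /matrixP/(_ i k) <-; rewrite mxE.
    by move=> l /negbTE ->; rewrite !mulr0.
  rewrite (bigD1 i)//= [X in _ + X]big1 ?addr0; last first.
    by move=> k /negbTE ik; apply: big1 => l _; rewrite ik !mulr0.
  by rewrite mxE; apply: eq_bigr => l _; rewrite eqxx mulr1.
have -> : psi = fun y => Num.sqrt (\det S) / (2 * pi) `^ (n%:R / 2) * expR (- 2^-1 * q y).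
  by apply/funext => y; rewrite /gauss_density qE; congr (_ * expR _); field.
have s2 : salg (fun y => - 2^-1 * q y) by apply: salgM => //; exact: salg_cst.
rewrite partialZ; last exact: salg_expR.
rewrite partial_expR// partialZ// dq; move: (_ / _ `^ _) (expR _) ((S *m x) i 0) => Z E s; field; exact: isT.
Qed.

(** The logarithmic derivative of the density is - (S x)_i. Integration by parts against a scaled
    cutoff leaves an error with a factor [eps m], which vanishes in the limit. *)
Lemma gauss_ibp f i : salg f -> tame f -> tame (partial i f) ->
  \int[gam]_x partial i f x = \int[gam]_x ((S *m x) i 0 * f x).
Proof.
move=> sf tf tpf; have [spf dpf] := salg_partial i sf.
have tS : tame (fun x => (S *m x) i 0 * f x).
  apply: tameM => //; rewrite (_ : (fun _ => _) = fun x : X => \sum_j S i j * x j 0).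
    by apply: tame_sum => j; apply: tameM; [exact: tame_cst|exact: tame_coord].
  by apply/funext => x; rewrite mxE.
have [sc dc] := salg_partial i (@salg_cut R n); have bc := @cbox_cut R n.
have bpc : cbox (partial i (@cut R n)).
  by apply: cbox_partial => //; exact: salg_continuous.
have L1f := tame_L1 tf; have L1S := tame_L1 tS; have L1p := tame_L1 tpf.
have lD : L1 gam (fun x => partial i f x - (S *m x) i 0 * f x) by exact: L1B.
have c1 := cvg_cutoff lD bc; have c2 := cvg_cutoff L1f bpc.
have tpc m : tame (fun x : X => partial i (@cut R n) (eps m *: x)).
  have [K _ bK] := cbox_bounded bpc; apply: (@tame_bounded _ _ _ K) => [|x]; last exact: bK.
  exact: continuous_measurable_cV (salg_continuous (salg_scale (eps m) sc)).
have e m : \int[gam]_x ((partial i f x - (S *m x) i 0 * f x) * cut (eps m *: x)) =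
    - (eps m * \int[gam]_x (f x * partial i (@cut R n) (eps m *: x))).
  have sfp : salg (fun x => f x * psi x) by apply: salgM => //; exact: salg_gauss_density.
  have tc : test_function (fun x : X => cut (eps m *: x)).
    split; first exact/salg_smooth/salg_scale/salg_cut.
    by apply: cbox_compact; apply: cbox_scale bc; exact: eps_gt0.
  have [cpc dpc] := test_function_partial i tc.
  have := integral_partial_mul sfp (test_function_cbox tc) cpc dpc.
  have mc := continuous_measurable_cV (proj1 (test_function_cbox tc)).
  have mpc := continuous_measurable_cV (salg_continuous (salg_scale (eps m) sc)).
  rewrite -RintegralZl//; last exact: tame_L1 (tameM tf (tpc m)).
  rewrite !Rintegral_gauss//; first last.
  - by apply: measurable_funM; [case: (tameD tpf (tameN tS))|exact: mc].
  - by apply: measurable_funM => //; case: (tameM tf (tpc m)).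
  move=> h; apply: etrans (etrans h _).
    by apply: eq_Rintegral => x _; rewrite partialM ?partial_gauss_density; [ring|..|exact: salg_gauss_density].
  congr (- _); apply: eq_Rintegral => x _; rewrite partial_scale; first by ring.
  by move=> y; have [] := dc y.
have c3 : - (eps m * \int[gam]_x (f x * partial i (@cut R n) (eps m *: x))) @[m --> \oo] --> (0 : R).
  by rewrite -oppr0 -[X in - X](mul0r (partial i (@cut R n) 0 * \int[gam]_x f x));
    apply: cvgN; exact: cvgM (@cvg_eps R) c2.
have c4 : - (eps m * \int[gam]_x (f x * partial i (@cut R n) (eps m *: x))) @[m --> \oo] -->
    \int[gam]_x (partial i f x - (S *m x) i 0 * f x).
  by rewrite -[X in _ --> X]mul1r -(@cut0 R n); under eq_fun do rewrite -e.
have e0 : \int[gam]_x (partial i f x - (S *m x) i 0 * f x) = 0.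
  by rewrite -(cvg_lim _ c4)// (cvg_lim _ c3).
by move: e0; rewrite RintegralB// => /eqP; rewrite subr_eq0 => /eqP.
Qed.

End gauss.

Section hermite.
Context {R : realType} (n : nat).
Local Notation X := 'cV[R]_n.
Variable U : 'M[R]_n.
Implicit Types (a b : mindex n) (x : X).

(** The probabilists' Hermite polynomials, by their three-term recurrence. *)
Fixpoint hermite m (y : R) : R :=
  match m with
  | 0%N => 1
  | p.+1 => y * hermite p y - (if p is q.+1 then p%:R * hermite q y else 0)
  end.

Lemma hermiteS m y : hermite m.+1 y = y * hermite m y - m%:R * hermite m.-1 y.
Proof. by case: m => [|m]; rewrite //= mul0r. Qed.

Definition yc k (x : X) : R := (U^T *m x) k 0.
Definition hermite_mv a x : R := \prod_k hermite (a k) (yc k x).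
Local Notation H := hermite_mv.

Let ycE k : yc k = fun x : X => \sum_j U j k * x j 0.
Proof. by apply/funext => x; rewrite /yc mxE; apply: eq_bigr => j _; rewrite mxE. Qed.

Lemma salg_yc k : salg (yc k).
Proof. by rewrite ycE; apply: salg_sum => j; apply: salgM; [exact: salg_cst|exact: salg_coord]. Qed.

Lemma tame_yc k : tame (yc k).
Proof. by rewrite ycE; apply: tame_sum => j; apply: tameM; [exact: tame_cst|exact: tame_coord]. Qed.

Lemma partial_yc i k x : partial i (yc k) x = U i k.
Proof.
rewrite ycE partial_sum => [|j]; last by apply: salgM; [exact: salg_cst|exact: salg_coord].
rewrite (bigD1 i)//= partialZ; last exact: salg_coord.
rewrite partial_coord eqxx mulr1 big1 ?addr0// => j /negbTE ji.
by rewrite partialZ ?partial_coord ?ji ?mulr0//; exact: salg_coord.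
Qed.

(** Two-step induction; degree 1 is reached by the step with c = 0. *)
Lemma hermite_ind (P : (R -> R) -> Prop) : P (fun=> 1) -> (forall p q : R -> R, forall c,
  P p -> P q -> P (fun y => y * p y - c * q y)) -> forall m, P (hermite m).
Proof.
move=> P0 PS m; suff : P (hermite m) /\ P (hermite m.+1) by case.
elim: m => [|m [h1 h2]]; last first.
  split=> //; rewrite (_ : hermite m.+2 = fun y => y * hermite m.+1 y - m.+1%:R * hermite m y)//.
  exact: PS.
split=> //; rewrite (_ : hermite 1 = fun y => y * hermite 0 y - 0 * hermite 0 y); first exact: PS.
by apply/funext => y /=; rewrite mul0r.
Qed.

Lemma salg_hermite m k : salg (fun x => hermite m (yc k x)).
Proof.
apply: (@hermite_ind (fun p => salg (fun x => p (yc k x)))) => [|p q c sp sq]; first exact: salg_cst.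
apply: salgD; first by apply: salgM => //; exact: salg_yc.
by apply: salgN; apply: salgM => //; exact: salg_cst.
Qed.

Lemma tame_hermite m k : tame (fun x => hermite m (yc k x)).
Proof.
apply: (@hermite_ind (fun p => tame (fun x => p (yc k x)))) => [|p q c sp sq]; first exact: tame_cst.
apply: tameD; first by apply: tameM => //; exact: tame_yc.
by apply: tameN; apply: tameM => //; exact: tame_cst.
Qed.

Lemma partial_hermite i m k x :
  partial i (fun z => hermite m (yc k z)) x = m%:R * hermite m.-1 (yc k x) * U i k.
Proof.
suff : forall m, partial i (fun z => hermite m (yc k z)) x = m%:R * hermite m.-1 (yc k x) * U i k /\
    partial i (fun z => hermite m.+1 (yc k z)) x = m.+1%:R * hermite m (yc k x) * U i k.
  by move=> /(_ m)[].
have rec p : partial i (fun z => hermite p.+1 (yc k z)) x =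
    yc k x * partial i (fun z => hermite p (yc k z)) x + hermite p (yc k x) * U i k -
    p%:R * partial i (fun z => hermite p.-1 (yc k z)) x.
  rewrite (_ : (fun _ => _) = fun z => yc k z * hermite p (yc k z) +
     - (p%:R * hermite p.-1 (yc k z))); last by apply/funext => z; rewrite hermiteS.
  have s1 : salg (fun z => p%:R * hermite p.-1 (yc k z)).
    by apply: salgM; [exact: salg_cst|exact: salg_hermite].
  rewrite partialD; [|by apply: salgM; [exact: salg_yc|exact: salg_hermite]|exact: salgN].
  rewrite partialN// partialZ; last exact: salg_hermite.
  by rewrite partialM ?partial_yc//; [exact: salg_yc|exact: salg_hermite].
elim=> [|{}m [ih1 ih2]].
  have e : partial i (fun z => hermite 0 (yc k z)) x = 0 by exact: partial_cst.
  by split; rewrite ?rec /= e; ring.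
split=> //; rewrite rec ih2 ih1 [m.+2%:R]mulrS !hermiteS; ring.
Qed.

Lemma salg_H a : salg (H a).
Proof. by apply: salg_prod => k; exact: salg_hermite. Qed.

Lemma tame_H a : tame (H a).
Proof. by apply: tame_prod => k; exact: tame_hermite. Qed.

Lemma partial_prod (I : eqType) (s : seq I) (f : I -> X -> R) i x : uniq s ->
  (forall k, salg (f k)) -> partial i (fun y => \prod_(k <- s) f k y) x =
  \sum_(k <- s) partial i (f k) x * \prod_(j <- s | j != k) f j x.
Proof.
move=> + sf; elim: s => [_|k s ih /andP[ks us]].
  rewrite big_nil (_ : (fun _ => _) = fun=> 1) ?partial_cst//.
  by apply/funext => y; rewrite big_nil.
rewrite big_cons (_ : (fun _ => _) = fun y => f k y * \prod_(j <- s) f j y); last first.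
  by apply/funext => y; rewrite big_cons.
rewrite partialM//; last exact: salg_prod.
rewrite ih// addrC; congr (_ + _).
  rewrite big_cons eqxx/= mulrC; congr (_ * _); rewrite big_seq [RHS]big_seq_cond.
  apply: eq_bigl => j; case: (boolP (j \in s)) => //= js; apply/esym.
  by apply: contraNneq ks => <-.
rewrite mulr_sumr; apply: eq_big_seq => j js.
rewrite big_cons (_ : k != j); last by apply: contraNneq ks => ->.
by ring.
Qed.

Lemma H_pred k a x : H (mpred k a) x =
  hermite (a k).-1 (yc k x) * \prod_(j | j != k) hermite (a j) (yc j x).
Proof.
rewrite /H (bigD1 k)//= ffunE eqxx subn1; congr (_ * _).
by apply: eq_bigr => j /negbTE jk; rewrite ffunE jk subn0.
Qed.

Lemma H_succ k a x : H (msucc k a) x =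
  hermite (a k).+1 (yc k x) * \prod_(j | j != k) hermite (a j) (yc j x).
Proof.
rewrite /H (bigD1 k)//= ffunE eqxx addn1; congr (_ * _).
by apply: eq_bigr => j /negbTE jk; rewrite ffunE jk addn0.
Qed.

Lemma partial_H i a x :
  partial i (H a) x = \sum_k U i k * (a k)%:R * H (mpred k a) x.
Proof.
rewrite /H partial_prod ?index_enum_uniq//; last by move=> k; exact: salg_hermite.
by apply: eq_bigr => k _; rewrite partial_hermite -/(H _ x) H_pred; ring.
Qed.

Lemma yc_H k a x : yc k x * H a x = H (msucc k a) x + (a k)%:R * H (mpred k a) x.
Proof. by rewrite H_succ H_pred hermiteS {1}/H (bigD1 k)//=; ring. Qed.

Lemma H_zero x : H mzero x = 1.
Proof. by rewrite /H big1// => k _; rewrite ffunE. Qed.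

Lemma tame_partial_H i a : tame (partial i (H a)).
Proof.
rewrite (_ : partial i (H a) = fun x => \sum_k U i k * (a k)%:R * H (mpred k a) x).
  by apply: tame_sum => k; apply: tameM; [exact: tame_cst|exact: tame_H].
by apply/funext => x; exact: partial_H.
Qed.

Lemma partial2_H i j a x : partial j (partial i (H a)) x =
  \sum_k \sum_l U i k * U j l * ((a k)%:R * (mpred k a l)%:R * H (mpred l (mpred k a)) x).
Proof.
rewrite (_ : partial i (H a) = fun x => \sum_k U i k * (a k)%:R * H (mpred k a) x); last first.
  by apply/funext => y; exact: partial_H.
rewrite partial_sum => [|k]; last by apply: salgM; [exact: salg_cst|exact: salg_H].
apply: eq_bigr => k _; rewrite partialZ; last exact: salg_H.
by rewrite partial_H mulr_sumr; apply: eq_bigr => l _; ring.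
Qed.

Variable S : 'M[R]_n.
Hypothesis SU : S = U *m U^T.

Lemma drift_yc J i x :
  (drift_mx S J *m x) i 0 = \sum_l ((1%:M + J) *m U) i l * yc l x.
Proof. by rewrite /drift_mx SU -!mulmxA mulmxA mxE. Qed.

(** By [yc_H], multiplication by y_l raises and lowers. The lowering parts are contracted with an
    expression T symmetric in (k, l), on which the antisymmetric part of A vanishes and the
    symmetric part cancels the Laplacian. *)
Lemma generator_H J a x : antisymmetric_mx J ->
  \sum_i partial i (partial i (H a)) x -
  \sum_i (drift_mx S J *m x) i 0 * partial i (H a) x =
  - \sum_k \sum_l drift_conj U J k l * ((a k)%:R * H (msucc l (mpred k a)) x).
Proof.
move=> aJ; pose T k l := (a k)%:R * (mpred k a l)%:R * H (mpred l (mpred k a)) x.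
have TC k l : T k l = T l k.
  have mC : mpred l (mpred k a) = mpred k (mpred l a).
    by apply/ffunP => i; rewrite !ffunE subnAC.
  rewrite /T mC; congr (_ * _); rewrite !ffunE [l == k]eq_sym.
  by case: eqVneq => [->//|_]; rewrite !subn0 mulrC.
have e1 : \sum_i partial i (partial i (H a)) x = \sum_k \sum_l (U^T *m U) k l * T k l.
  under eq_bigr do rewrite partial2_H; rewrite exchange_big/=; apply: eq_bigr => k _.
  rewrite exchange_big/=; apply: eq_bigr => l _; rewrite -mulr_suml mxE.
  by congr (_ * _); apply: eq_bigr => i _; rewrite mxE.
have e2 : \sum_i (drift_mx S J *m x) i 0 * partial i (H a) x =
    \sum_k \sum_l drift_conj U J k l * ((a k)%:R * (yc l x * H (mpred k a) x)).
  under eq_bigr => i _.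
    rewrite drift_yc partial_H mulr_sumr.
    under eq_bigr do rewrite mulr_suml.
    over.
  rewrite exchange_big/=; apply: eq_bigr => k _; rewrite exchange_big/=.
  apply: eq_bigr => l _; rewrite /drift_conj -mulmxA mxE mulr_suml.
  by apply: eq_bigr => i _; rewrite [U^T _ _]mxE; ring.
have e3 : \sum_k \sum_l drift_conj U J k l * T k l = \sum_k \sum_l (U^T *m U) k l * T k l.
  pose K := U^T *m J *m U.
  have KE k l : drift_conj U J k l = (U^T *m U) k l + K k l.
    by rewrite /drift_conj /K mulmxDr mulmx1 mulmxDl mxE.
  have aK k l : K k l = - K l k.
    have : K^T = - K by rewrite /K !trmx_mul trmxK aJ mulNmx mulmxN mulmxA.
    by move=> /matrixP/(_ l k); rewrite !mxE => ->.
  under eq_bigr do under eq_bigr do rewrite KE mulrDl.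
  under eq_bigr do rewrite big_split/=.
  rewrite big_split/= [X in _ + X](_ : _ = 0) ?addr0//.
  set s := (X in X = 0); have : s = - s.
    rewrite {1}/s exchange_big/= -sumrN; apply: eq_bigr => k _; rewrite -sumrN.
    by apply: eq_bigr => l _; rewrite aK TC mulNr.
  by move/eqP; rewrite -addr_eq0 -mulr2n -mulr_natl mulf_eq0 pnatr_eq0/= => /eqP.
rewrite e1 e2 -e3 -sumrB -sumrN; apply: eq_bigr => k _; rewrite -sumrB -sumrN.
by apply: eq_bigr => l _; rewrite yc_H /T; ring.
Qed.

(** Reversing J transposes A, which reflects that L_(-J) is the Gaussian adjoint of L_J. *)
Lemma drift_conjN J k l : antisymmetric_mx J -> drift_conj U (- J) k l = drift_conj U J l k.
Proof.
move=> aJ; have -> : drift_conj U (- J) = (drift_conj U J)^T; last by rewrite mxE.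
by rewrite /drift_conj !trmx_mul trmxK [(1%:M + J)^T]raddfD/= aJ trmx1 mulmxA.
Qed.

(** The products a! c_a are the integrals against H_a when c is a family of Hermite coefficients. On
    them [gen] takes the shape of [generator_H], with A transposed. *)
Lemma mfact_gen (A : 'M[R]_n) (c : mindex n -> R) a :
  (mfact a)%:R * gen A c a = - \sum_k \sum_l A k l *
    ((a l)%:R * ((mfact (msucc k (mpred l a)))%:R * c (msucc k (mpred l a)))).
Proof.
rewrite /gen mulrN mulr_sumr; congr (- _); apply: eq_bigr => k _; rewrite mulr_sumr.
apply: eq_bigr => l _; rewrite mulrCA; congr (_ * _); rewrite /cre /ann.
case: ifPn => [al|]; last by rewrite -eqn0Ngt => /eqP ->; rewrite mulr0 mul0r.
rewrite mfact_succ -{1}(mpredK al) mfact_succ ffunE eqxx subn1 prednK// !natrM.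
by ring.
Qed.

Hypothesis hS : sym_posdef S.
Hypothesis uU : U \in unitmx.
Local Notation gam := (gauss_measure S).

(** Integration by parts in the directions x_i gives U w = 0 for the vector w of the defects, and U
    is invertible: each y_k behaves as a standard Gaussian variable. *)
Lemma ibp_H k a b : \int[gam]_x (yc k x * (H a x * H b x)) =
  (a k)%:R * \int[gam]_x (H (mpred k a) x * H b x) +
  (b k)%:R * \int[gam]_x (H a x * H (mpred k b) x).
Proof.
pose w : X := \col_k (\int[gam]_x (yc k x * (H a x * H b x)) -
  ((a k)%:R * \int[gam]_x (H (mpred k a) x * H b x) +
  (b k)%:R * \int[gam]_x (H a x * H (mpred k b) x))).
suff w0 : w = 0.
  have /matrixP/(_ k 0) := w0; rewrite !mxE => /eqP.
  by rewrite subr_eq0 => /eqP.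
suff Uw : U *m w = 0 by rewrite -[w](mulKmx uU) Uw mulmx0.
apply/colP => i; rewrite !mxE.
under eq_bigr do rewrite mxE mulrBr; rewrite sumrB; apply/eqP; rewrite subr_eq0; apply/eqP.
have tHH c d : tame (fun x => H c x * H d x) by apply: tameM; exact: tame_H.
have sHH : salg (fun x => H a x * H b x) by apply: salgM; exact: salg_H.
have pE x : partial i (fun x => H a x * H b x) x = \sum_k U i k *
    ((a k)%:R * (H (mpred k a) x * H b x) + (b k)%:R * (H a x * H (mpred k b) x)).
  rewrite partialM; try exact: salg_H.
  rewrite !partial_H !mulr_sumr -big_split/=; apply: eq_bigr => j _; ring.
have t1 j : tame (fun x => (a j)%:R * (H (mpred j a) x * H b x)).
  by apply: tameM; [exact: tame_cst|exact: tHH].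
have t2 j : tame (fun x => (b j)%:R * (H a x * H (mpred j b) x)).
  by apply: tameM; [exact: tame_cst|exact: tHH].
have := gauss_ibp hS (i := i) sHH (tHH a b).
rewrite (_ : partial i _ = fun x => \sum_k U i k *
    ((a k)%:R * (H (mpred k a) x * H b x) + (b k)%:R * (H a x * H (mpred k b) x))); last first.
  by apply/funext => x; exact: pE.
have tU j : tame (fun x => U i j *
    ((a j)%:R * (H (mpred j a) x * H b x) + (b j)%:R * (H a x * H (mpred j b) x))).
  by apply: tameM; [exact: tame_cst|apply: tameD].
move=> /(_ (tame_sum _ tU)).
rewrite Rintegral_sum; last by move=> j; exact: tame_L1 (tU j).
have ty j : tame (fun x => yc j x * (H a x * H b x)).
  by apply: tameM; [exact: tame_yc|exact: tHH].
rewrite (_ : \int[gam]_x ((S *m x) i 0 * (H a x * H b x)) =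
    \int[gam]_x \sum_j U i j * (yc j x * (H a x * H b x))); last first.
  apply: eq_Rintegral => x _; rewrite {1}SU -mulmxA mxE mulr_suml.
  by apply: eq_bigr => j _; exact: esym (mulrA _ _ _).
rewrite Rintegral_sum; last by move=> j; apply: L1Zl; exact: tame_L1 (ty j).
move=> /esym h; apply: etrans (etrans h _); apply: eq_bigr => j _.
  by rewrite RintegralZl//; exact: tame_L1 (ty j).
rewrite RintegralZl//; last by apply: tame_L1 => //; exact: tameD.
rewrite RintegralD//; try exact: tame_L1.
by rewrite !RintegralZl//; apply: tame_L1.
Qed.

(** Raising is adjoint to differentiation: the term of [ibp_H] that differentiates H_a cancels the
    lowering part of y_k H_a. *)
Lemma H_succ_ip k a b : \int[gam]_x (H (msucc k a) x * H b x) =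
  (b k)%:R * \int[gam]_x (H a x * H (mpred k b) x).
Proof.
have tHH c d : L1 gam (fun x => H c x * H d x).
  by apply: tame_L1 => //; apply: tameM; exact: tame_H.
have := ibp_H k a b.
rewrite (_ : \int[gam]_x (yc k x * (H a x * H b x)) = \int[gam]_x
  (H (msucc k a) x * H b x + (a k)%:R * (H (mpred k a) x * H b x))); last first.
  by apply: eq_Rintegral => x _; rewrite mulrA yc_H; ring.
rewrite RintegralD//; [|exact: tHH|by apply: L1Zl; exact: tHH].
rewrite RintegralZl//; last exact: tHH.
by rewrite addrC => /addrI.
Qed.

(** Induction on the degree of a: a unit of a positive entry a_k moves to the other side, where it
    lowers b and gives a factor b_k; if b_k = 0 the integral vanishes. *)
Lemma H_orthogonal a b :
  \int[gam]_x (H a x * H b x) = if a == b then (mfact a)%:R else 0.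
Proof.
have ipC c d : \int[gam]_x (H c x * H d x) = \int[gam]_x (H d x * H c x).
  by apply: eq_Rintegral => x _; rewrite mulrC.
have ex_pos c : c != mzero -> exists k, (0 < c k)%N.
  move=> c0; apply/existsP; apply: contraR c0; rewrite negb_exists => /forallP h.
  by apply/eqP/ffunP => k; rewrite ffunE; apply/eqP; rewrite -leqn0 leqNgt.
have [m] := ubnP (mdeg a); elim: m a b => // m ih a b am.
have [->|/ex_pos[k ak]] := eqVneq a mzero.
  have [<-|] := eqVneq mzero b.
    rewrite (_ : \int[gam]_x _ = \int[gam]_x (1 : R)); last first.
      by apply: eq_Rintegral => x _; rewrite H_zero mulr1.
    transitivity (1 * fine (gauss_measure S setT)); first exact: Rintegral_cst.
    rewrite (gauss_total hS) mulr1.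
    by rewrite /mfact big1// => k _; rewrite ffunE.
  rewrite eq_sym => /ex_pos[k bk].
  by rewrite ipC -(mpredK bk) H_succ_ip ffunE mul0r.
rewrite -(mpredK ak) H_succ_ip; have [bk|bk] := posnP (b k).
  rewrite bk mul0r ifF//; apply/negbTE/eqP => e.
  by move: bk; rewrite -e ffunE eqxx addn1.
rewrite ih; last by move: am; rewrite (mdeg_pred ak) ltnS.
rewrite -(inj_eq (@msucc_inj _ k) (mpred k a) (mpred k b)) (mpredK bk).
case: eqP => [<-|_]; last by rewrite mulr0.
by rewrite mfact_succ [msucc k _ k]ffunE eqxx addn1 natrM.
Qed.

End hermite.

(** * Completeness of the Hermite polynomials *)

Section hermite_totality.
Context {R : realType} (n : nat).
Local Notation X := 'cV[R]_n.
Variables S U : 'M[R]_n.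
Hypothesis SU : S = U *m U^T.
Hypothesis uU : U \in unitmx.
Hypothesis hS : sym_posdef S.
Local Notation gam := (gauss_measure S).
Local Notation H := (hermite_mv U).
Implicit Types (f g : X -> R).

Let gfin := gauss_fin hS.

Definition perp f := forall a, \int[gam]_x (f x * H a x) = 0.

Lemma Lsq_H a : Lsq gam (H a).
Proof. exact: tame_Lsq (tame_H U a). Qed.

Lemma coord_yc (x : X) i : x i 0 = \sum_k invmx U^T i k * yc U k x.
Proof. by rewrite -{1}[x](@mulKmx _ _ _ U^T) ?unitmx_tr// mxE. Qed.

(** A coordinate is a combination of the y_k, and by [yc_H] each y_k H_a is one of Hermite
    polynomials, so the power can be lowered one factor at a time. *)
Lemma perp_affine f (t s : R) i m : Lsq gam f -> perp f -> forall a,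
  \int[gam]_x (f x * ((t * x i 0 + s) ^+ m * H a x)) = 0.
Proof.
move=> lf pf; elim: m => [|m ih] a.
  by rewrite -[RHS](pf a); apply: eq_Rintegral => x _; rewrite expr0 mul1r.
have tz : tame (fun x : X => t * x i 0 + s).
  by apply: tameD; [apply: tameM; [exact: tame_cst|exact: tame_coord]|exact: tame_cst].
have tzm : tame (fun x : X => (t * x i 0 + s) ^+ m).
  elim: (m) => [|p hp]; first by under eq_fun do rewrite expr0; exact: tame_cst.
  by under eq_fun do rewrite exprS; exact: tameM.
have l1 b : L1 gam (fun x => f x * ((t * x i 0 + s) ^+ m * H b x)).
  by apply: Lsq_mul => //; apply: tame_Lsq => //; apply: tameM => //; exact: tame_H.
pose V := invmx U^T.
rewrite (_ : \int[gam]_x _ = \int[gam]_x (s * (f x * ((t * x i 0 + s) ^+ m * H a x)) +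
   \sum_k (t * V i k) * ((f x * ((t * x i 0 + s) ^+ m * H (msucc k a) x)) +
     (a k)%:R * (f x * ((t * x i 0 + s) ^+ m * H (mpred k a) x))))); last first.
  apply: eq_Rintegral => x _.
  have -> : \sum_k (t * V i k) * ((f x * ((t * x i 0 + s) ^+ m * H (msucc k a) x)) +
     (a k)%:R * (f x * ((t * x i 0 + s) ^+ m * H (mpred k a) x))) =
     t * (f x * (t * x i 0 + s) ^+ m * H a x) * x i 0.
    transitivity (t * (f x * (t * x i 0 + s) ^+ m * H a x) * \sum_k V i k * yc U k x).
      rewrite mulr_sumr; apply: eq_bigr => k _.
    have := yc_H U k a x; move: (yc U k x) (_ ^+ m) => y z e.
    rewrite (_ : t * (f x * z * H a x) * (V i k * y) = t * V i k * f x * z * (y * H a x)); last by ring.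
    by rewrite e; ring.
    by rewrite -coord_yc.
  by rewrite exprS; ring.
have l2 k : L1 gam (fun x => (f x * ((t * x i 0 + s) ^+ m * H (msucc k a) x)) +
     (a k)%:R * (f x * ((t * x i 0 + s) ^+ m * H (mpred k a) x))).
  by apply: L1D => //; exact: L1Zl.
rewrite RintegralD//; [|exact: L1Zl|by apply: L1_sum => k; exact: L1Zl].
rewrite RintegralZl//; last exact: l1.
rewrite ih mulr0 add0r Rintegral_sum; last by move=> k; exact: L1Zl.
apply: big1 => k _; rewrite RintegralZl//; last exact: l2.
rewrite RintegralD//; [|exact: l1|exact: L1Zl].
by rewrite RintegralZl ?ih ?mulr0 ?addr0 ?mulr0//; exact: l1.
Qed.

Lemma exp_coeff_le (z : R) m : 0 <= z -> series (exp_coeff z) m <= expR z.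
Proof.
move=> z0; apply: nondecreasing_cvgn_le; last exact: is_cvg_series_exp_coeff.
by apply: nondecreasing_series => i _ _; exact: exp_coeff_ge0.
Qed.

Lemma sin_coeff_le (z : R) m : `|series (sin_coeff z) m| <= expR `|z|.
Proof.
apply: le_trans (exp_coeff_le m (normr_ge0 z)).
rewrite !seriesEnat/=; apply: le_trans (ler_norm_sum _ _ _) _; apply: ler_sum => i _.
rewrite /sin_coeff /exp_coeff/= !normrM normrX normfV !normr_nat.
rewrite ler_wpM2r ?invr_ge0// normrX normrN1 expr1n mulr1 ler_piMl ?exprn_ge0//.
by case: (odd i).
Qed.

(** Taylor polynomials of the sine are covered by [perp_affine], and all are dominated by exp |z|,
    which is [tame]. *)
Lemma perp_sin f (t s : R) i : Lsq gam f -> perp f ->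
  perp (fun x => sin (t * x i 0 + s) * f x).
Proof.
move=> lf pf a.
pose z (x : X) := t * x i 0 + s.
have tz : tame z.
  by apply: tameD; [apply: tameM; [exact: tame_cst|exact: tame_coord]|exact: tame_cst].
have te : tame (fun x => expR `|z x|).
  split.
    by apply: measurableT_comp => //; apply: measurableT_comp => //; case: tz.
  (* From |t x_i| <= t^2 / (4 c) + c x_i^2. *)
  move=> c c0; exists (expR (t ^+ 2 / (4 * c) + `|s|)) => x.
  rewrite ger0_norm ?expR_ge0// -expRD ler_expR.
  have h : x i 0 ^+ 2 <= sqn x.
    by rewrite /sqn (bigD1 i)//= lerDl sumr_ge0// => j _; rewrite sqr_ge0.
  rewrite /z; apply: le_trans (ler_normD _ _) _; rewrite [leRHS]addrAC lerD2r normrM.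
  apply: (@le_trans _ _ (t ^+ 2 / (4 * c) + c * x i 0 ^+ 2)); last first.
    by rewrite lerD2l ler_wpM2l// ltW.
  rewrite -[t ^+ 2]real_normK ?num_real// -[x i 0 ^+ 2]real_normK ?num_real//.
  rewrite -subr_ge0; move: `|t| `|x i 0| => p q.
  have -> : p ^+ 2 / (4 * c) + c * q ^+ 2 - p * q = (p / 2 - c * q) ^+ 2 / c.
    by field; rewrite gt_eqF.
  by rewrite divr_ge0 ?sqr_ge0// ltW.
pose cf k : R := (odd k)%:R * (-1) ^+ k.-1./2 / k`!%:R.
have termE m x : series (sin_coeff (z x)) m * f x * H a x =
    \sum_(0 <= k < m) cf k * (f x * (z x ^+ k * H a x)).
  rewrite seriesEnat/= -mulrA mulr_suml; apply: eq_bigr => k _; rewrite /cf /sin_coeff/=; ring.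
have l1 k : L1 gam (fun x => f x * (z x ^+ k * H a x)).
  apply: Lsq_mul => //; apply: tame_Lsq => //; apply: tameM (tame_H U a).
  elim: k => [|p hp]; first by under eq_fun do rewrite expr0; exact: tame_cst.
  by under eq_fun do rewrite exprS; exact: tameM.
have lm m : L1 gam (fun x => series (sin_coeff (z x)) m * f x * H a x).
  rewrite (_ : (fun _ => _) = fun x => \sum_(0 <= k < m) cf k * (f x * (z x ^+ k * H a x))).
    by apply: L1_sum => k; exact: L1Zl.
  by apply/funext => x; exact: termE.
have ld := L1_norm (Lsq_mul lf (tame_Lsq hS (tameM te (tame_H U a)))).
have [|x|m x|_ ] := @L1_dominated _ _ _ gam (fun m x => series (sin_coeff (z x)) m * f x * H a x)
  (fun x => sin (z x) * f x * H a x) _ _ _ ld.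
- by move=> m; exact: L1_measurable (lm m).
- have h : series (sin_coeff (z x)) m @[m --> \oo] --> sin (z x).
    by rewrite unlock; exact: is_cvg_series_sin_coeff.
  exact: (cvgM (cvgM h (cvg_cst (f x))) (cvg_cst (H a x))).
- rewrite -mulrA normrM (_ : f x * _ = expR `|z x| * (f x * H a x)); last by ring.
  by rewrite [leRHS]normrM [X in _ <= X * _]ger0_norm ?expR_ge0// ler_wpM2r// sin_coeff_le.
rewrite (_ : (fun m => _) = (fun=> 0 : R)); last first.
  apply/funext => m; rewrite (eq_Rintegral _ (g := fun x => \sum_(0 <= k < m)
    cf k * (f x * (z x ^+ k * H a x)))); last by move=> x _; exact: termE.
  rewrite Rintegral_sum; last by move=> k; exact: L1Zl.
  by apply: big1 => k _; rewrite RintegralZl ?perp_affine ?mulr0//; exact: l1.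
by move=> h; rewrite -(cvg_lim _ h)// lim_cst.
Qed.

(* Multipliers preserve the orthogonal complement of the Hermite polynomials. They
   are stable under products and bounded pointwise limits; the sines of affine
   functions are multipliers by Taylor expansion, hence so are the indicators of
   half-spaces, and finally those of all the measurable sets. *)
Definition multiplier g := [/\ measurable_fun setT g, exists K : R, forall x, `|g x| <= K
  & forall f, Lsq gam f -> perp f -> perp (fun x => g x * f x)].

Lemma multiplier_Lsq g f : multiplier g -> Lsq gam f -> Lsq gam (fun x => g x * f x).
Proof. by move=> [mg [K gK] _] lf; exact: Lsq_bounded_mul gK lf. Qed.

Lemma multiplier_cst (c : R) : multiplier (fun=> c).
Proof.
split=> //; first by exists `|c|.
move=> f lf pf a; transitivity (\int[gam]_x (c * (f x * H a x))).
  by apply: eq_Rintegral => x _; rewrite mulrA.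
by rewrite RintegralZl ?pf ?mulr0//; exact: Lsq_mul lf (Lsq_H a).
Qed.

Lemma multiplierM g h : multiplier g -> multiplier h -> multiplier (fun x => g x * h x).
Proof.
move=> Mg Mh; have [mg [K gK] pg] := Mg; have [mh [L hL] ph] := Mh.
split; first exact: measurable_funM.
  by exists (K * L) => x; rewrite normrM ler_pM.
move=> f lf pf a; have := pg _ (multiplier_Lsq Mh lf) (ph _ lf pf) a.
by under eq_Rintegral do rewrite mulrA.
Qed.

Lemma multiplierD g h : multiplier g -> multiplier h -> multiplier (fun x => g x + h x).
Proof.
move=> Mg Mh; have [mg [K gK] pg] := Mg; have [mh [L hL] ph] := Mh.
split; first exact: measurable_funD.
  by exists (K + L) => x; rewrite (le_trans (ler_normD _ _))// lerD.
move=> f lf pf a; transitivity (\int[gam]_x (g x * f x * H a x + h x * f x * H a x)).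
  by apply: eq_Rintegral => x _; ring.
rewrite RintegralD ?pg ?ph ?addr0//; apply: Lsq_mul (Lsq_H a); exact: multiplier_Lsq.
Qed.

Lemma multiplier_lim (g_ : nat -> X -> R) g (K : R) : (forall m, multiplier (g_ m)) ->
  (forall m x, `|g_ m x| <= K) -> (forall x, g_ m x @[m --> \oo] --> g x) -> multiplier g.
Proof.
move=> Mg gK gg; have K0 : 0 <= K by exact: le_trans (gK 0%N 0).
have mg : measurable_fun setT g.
  by apply: (@measurable_fun_cvg _ _ _ _ g_) => [m|x _]; [case: (Mg m)|exact: gg].
split=> //.
  exists K => x; have h : `|g_ m x| @[m --> \oo] --> `|g x| by exact: cvg_norm (gg x).
  rewrite -(cvg_lim _ h)//.
  by apply: limr_le; [apply/cvg_ex; exists (`|g x|)|apply: nearW => m; exact: gK].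
move=> f lf pf a; have l1 := Lsq_mul lf (Lsq_H a).
have [|||_ ] := @L1_dominated _ _ _ gam (fun m x => g_ m x * f x * H a x)
  (fun x => g x * f x * H a x) _ _ _ (L1Zl K (L1_norm l1)).
- by move=> m; apply: L1_measurable; apply: Lsq_mul (Lsq_H a); exact: multiplier_Lsq.
- by move=> x; exact: (cvgM (cvgM (gg x) (cvg_cst (f x))) (cvg_cst (H a x))).
- by move=> m x; rewrite -mulrA normrM ler_wpM2r.
rewrite (_ : (fun m => _) = (fun=> 0 : R)); last first.
  by apply/funext => m; case: (Mg m) => _ _; exact.
by move=> h; rewrite -(cvg_lim _ h)// lim_cst.
Qed.

(* Newton iteration for the sign function on [-1, 1]. *)
Definition sgnit (s : R) := s * (3 - s ^+ 2) / 2.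

Lemma sgnit_norm s : `|s| <= 1 -> `|sgnit s| <= 1.
Proof.
rewrite /sgnit !ler_norml => /andP[h1 h2]; rewrite lerNl -subr_ge0 -[X in _ && X]subr_ge0.
have -> : 1 - s * (3 - s ^+ 2) / 2 = (1 - s) ^+ 2 * (2 + s) / 2 by field.
have -> : 1 - (- (s * (3 - s ^+ 2) / 2)) = (1 + s) ^+ 2 * (2 - s) / 2 by field.
by apply/andP; split; apply: divr_ge0 => //; apply: mulr_ge0; rewrite ?sqr_ge0//; lra.
Qed.

Lemma sgnit_norm_iter m s : `|s| <= 1 -> `|iter m sgnit s| <= 1.
Proof. by move=> s1; elim: m => // m ih; exact: sgnit_norm. Qed.

Lemma sgnitN s : sgnit (- s) = - sgnit s.
Proof. by rewrite /sgnit; field. Qed.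

(** For 0 < r <= 1 the iterates stay in [r, 1], where a step multiplies the distance to 1 by at most
    1 - r / 2; oddness covers the negative values. *)
Lemma sgnit_cvg s : `|s| <= 1 -> iter m sgnit s @[m --> \oo] --> Num.sg s.
Proof.
have pos (r : R) : 0 < r -> r <= 1 -> iter m sgnit r @[m --> \oo] --> (1 : R).
  move=> r0 r1.
  have key m : r <= iter m sgnit r <= 1 /\ 1 - iter m sgnit r <= (1 - r / 2) ^+ m.
    elim: m => [|m [/andP[h1 h2] h3]]; first by rewrite /= lexx r1 expr0; split=> //; lra.
    rewrite iterS; move: (iter m _ _) h1 h2 h3 => q h1 h2 h3.
    have e : 1 - sgnit q = (1 - q) * ((1 - q) * (2 + q) / 2) by rewrite /sgnit; field.
    have q0 : 0 < q by exact: lt_le_trans h1.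
    have qq : 0 <= q ^+ 2 by exact: sqr_ge0.
    have h4 : (1 - q) * (2 + q) / 2 <= 1 - r / 2.
      have -> : (1 - q) * (2 + q) / 2 = 1 - q / 2 - q ^+ 2 / 2 by field.
      lra.
    have h5 : 0 <= (1 - q) * (2 + q) / 2 by rewrite divr_ge0// mulr_ge0//; lra.
    split.
      apply/andP; split; last by rewrite -subr_ge0 e mulr_ge0//; lra.
      apply: (le_trans h1); rewrite -subr_ge0 /sgnit.
      have -> : q * (3 - q ^+ 2) / 2 - q = q * (1 - q ^+ 2) / 2 by field.
      by rewrite divr_ge0// mulr_ge0 ?(ltW q0)// subr_ge0 expr_le1// ltW.
    by rewrite e exprSr ler_pM//; lra.
  have c : (1 - r / 2) ^+ m @[m --> \oo] --> (0 : R).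
    by apply: cvg_expr; rewrite ger0_norm; lra.
  apply: (@squeeze_cvgr nat \oo _ R (fun m => 1 - (1 - r / 2) ^+ m) (fun=> 1)).
  - apply: nearW => m; have [/andP[_ h2] h3] := key m; apply/andP; split => //.
    by rewrite lerBlDr -lerBlDl.
  - by rewrite -[X in _ --> X]subr0; apply: cvgB c; exact: cvg_cst.
  - exact: cvg_cst.
move=> s1; have [s0|s0|->] := ltgtP s 0.
- have h m : iter m sgnit s = - iter m sgnit (- s).
    by elim: m => [|m ih]; rewrite ?opprK//= ih sgnitN.
  rewrite ltr0_sg//; under eq_fun do rewrite h; apply: cvgN; apply: pos; first by rewrite oppr_gt0.
  by move: s1; rewrite ler_norml => /andP[]; rewrite lerNl.
- by rewrite gtr0_sg//; apply: pos => //; rewrite (le_trans (ler_norm _)).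
- rewrite sgr0 (_ : (fun _ => _) = cst 0); first exact: cvg_cst.
  by apply/funext; elim=> //= m ih; rewrite ih /sgnit !mul0r.
Qed.

Lemma multiplier_sg_sin (t s : R) i : multiplier (fun x => Num.sg (sin (t * x i 0 + s))).
Proof.
have Ms m : multiplier (fun x : X => iter m sgnit (sin (t * x i 0 + s))).
  elim: m => [|m ih] /=.
    split; last by move=> f; exact: perp_sin.
      apply: continuous_measurable_cV => x; apply: continuous_comp; last exact: continuous_sin.
      exact: (cvgD (cvgM (cvg_cst t) (@coord_continuous _ _ _ i 0 x)) (cvg_cst s)).
    by exists 1 => x; rewrite ler_norml sin_geN1 sin_le1.
  rewrite /sgnit; apply: multiplierM (multiplier_cst _); apply: multiplierM => //.
  apply: multiplierD; first exact: multiplier_cst.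
  have := multiplierM (multiplier_cst (-1)) (multiplierM ih ih).
  by congr multiplier; apply/funext => x; rewrite mulN1r expr2.
have s1 (x : X) : `|sin (t * x i 0 + s)| <= 1 by rewrite ler_norml sin_geN1 sin_le1.
apply: (multiplier_lim Ms (K := 1)) => [m x|x]; first exact: sgnit_norm_iter.
exact: sgnit_cvg.
Qed.

(** For large m, eps m (x_i - a) lies in (- pi, pi), where the sine has the sign of its argument. *)
Lemma multiplier_sg (a : R) i : multiplier (fun x => Num.sg (x i 0 - a)).
Proof.
apply: (multiplier_lim (fun m => multiplier_sg_sin (eps m) (- eps m * a) i) (K := 1)).
  by move=> m x; rewrite normr_sg; case: (_ != 0).
move=> x; have h : eps m * (x i 0 - a) @[m --> \oo] --> (0 : R).
  by rewrite -(mul0r (x i 0 - a)); apply: cvgM (cvg_cst _); exact: cvg_eps.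
apply: cvg_near_cst.
have hh : \forall m \near \oo, `|eps m * (x i 0 - a)| < pi.
  by exact: cvgr0_norm_lt _ h _ (@pi_gt0 R).
apply: filterS hh => m; have e : eps m * x i 0 + - eps m * a = eps m * (x i 0 - a) by ring.
rewrite e ltr_norml => /andP[h1 h2]; have e0 := @eps_gt0 R m.
have [s0|s0|s0] := ltgtP (x i 0 - a) 0.
- rewrite (ltr0_sg s0) -[eps m * _]opprK sinN ltr0_sg// oppr_lt0 sin_gt0_pi//.
  by rewrite oppr_gt0 pmulr_rlt0// s0/= ltrNl.
- by rewrite (gtr0_sg s0) gtr0_sg// sin_gt0_pi// h2 mulr_gt0.
- by rewrite s0 mulr0 sin0.
Qed.

Lemma multiplier_measurable (A : set X) : measurable A -> multiplier \1_A.
Proof.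
pose D := [set A : set X | multiplier \1_A].
have DC (B : set X) : D B -> D (~` B).
  move=> /(multiplierM (multiplier_cst (-1)))/(multiplierD (multiplier_cst 1)).
  rewrite /D/=; congr multiplier; apply/funext => x; rewrite !indicE in_setC.
  by rewrite mulN1r; case: (_ \in _); rewrite ?subrr ?subr0.
have D0 : D set0.
  by rewrite /D/= (_ : \1_set0 = fun=> 0 : R); [exact: multiplier_cst|rewrite indic0].
have DI (B C : set X) : D B -> D C -> D (B `&` C).
  by move=> hB hC; have := multiplierM hB hC; rewrite /D/= indicI.
have DU (F : nat -> set X) : (forall m, D (F m)) -> D (\bigcup_m F m).
  move=> DF; pose G m := \bigcup_(k < m) F k.
  have DG m : D (G m).
    elim: m => [|m ih]; first by rewrite /G bigcup_mkord big_ord0.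
    rewrite /G bigcup_mkord big_ord_recr/= -bigcup_mkord -[_ `|` _]setCK setCU.
    by apply: (DC); apply: (DI); apply: DC.
  apply: (multiplier_lim DG (K := 1)).
    by move=> m x; rewrite indicE; case: (_ \in _); rewrite ?normr1 ?normr0.
  move=> x; apply: cvg_near_cst; rewrite !indicE.
  have [xF|xF] := pselect ((\bigcup_m F m) x).
    have [k _ Fk] := xF; exists k.+1 => // m /= km; rewrite indicE !mem_set//.
    by exists k.
  apply: nearW => m; rewrite indicE !memNset// => -[k _ Fk]; apply: xF.
  by exists k.
have DB i (B : set (measurableTypeR R)) : measurable B -> D [set x : X | B (x i 0)].
  pose E := [set B : set (measurableTypeR R) | D [set x : X | B (x i 0)]].
  rewrite (RGenOInfty.measurableE R); move: B; suff : <<s @RGenOInfty.G R >> `<=` E by exact.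
  apply: smallest_sub; first split.
  - exact: D0.
  - by move=> C EC; rewrite setTD; exact: DC EC.
  - move=> F EF; rewrite /E/= (_ : [set _ | _] = \bigcup_k [set x : X | F k (x i 0)])//.
    exact: DU.
  move=> _ [a ->]; rewrite /E/D/=.
  have M1 := multiplier_sg a i.
  (* For a sign s, (s + s^2) / 2 is the indicator of s = 1. *)
  have := multiplierM (multiplier_cst 2^-1) (multiplierD M1 (multiplierM M1 M1)).
  congr multiplier; apply/funext => x; rewrite indicE.
  have [h|h|h] := ltgtP (x i 0 - a) 0.
  - rewrite ltr0_sg// memNset; last by rewrite /= in_itv/= andbT -subr_gt0 lt_gtF.
    by rewrite -[false%:R]/(0 : R); field.
  - rewrite gtr0_sg// mem_set; last by rewrite /= in_itv/= andbT -subr_gt0.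
    by rewrite -[true%:R]/(1 : R); field.
  - rewrite h sgr0 memNset; first by rewrite -[false%:R]/(0 : R); field.
    by rewrite /= in_itv/= andbT -subr_gt0 h ltxx.
suff : <<s @mx_cylinders R n 1 >> `<=` D by exact.
apply: smallest_sub; first split.
- exact: D0.
- by move=> C DC'; rewrite setTD; exact: DC.
- exact: DU.
move=> _ [i [j [B [mB ->]]]]; rewrite (_ : [set _ | _] = [set x : X | B (x i 0)]).
  exact: DB.
by rewrite ord1.
Qed.

(** The sign of f, a difference of two indicators, is a multiplier; tested against H_0 = 1 it shows
    that |f| has integral 0. *)
Lemma perp_ae0 f : Lsq gam f -> perp f -> ae_eq gam setT f (fun=> 0).
Proof.
move=> lf pf; have [mf _] := lf.
pose P := [set x | 0 < f x]; pose Q := [set x | f x < 0].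
have mP : measurable P.
  rewrite (_ : P = setT `&` f @^-1` `]0, +oo[%classic); first by apply: mf => //; exact: measurable_itv.
  by rewrite setTI; apply/seteqP; split=> x; rewrite /P /= in_itv/= andbT.
have mQ : measurable Q.
  rewrite (_ : Q = setT `&` f @^-1` `]-oo, 0[%classic); first by apply: mf => //; exact: measurable_itv.
  by rewrite setTI; apply/seteqP; split=> x; rewrite /Q /= in_itv.
have Mg := multiplierD (multiplier_measurable mP)
  (multiplierM (multiplier_cst (-1)) (multiplier_measurable mQ)).
have [_ _ /(_ f lf pf mzero)] := Mg.
rewrite (eq_Rintegral _ (g := fun x => `|f x|)) => [h|x _]; last first.
  rewrite H_zero mulr1 !indicE.
  have [s0|s0|s0] := ltgtP (f x) 0.
  - rewrite ltr0_norm// (memNset (A := P)) ?(mem_set (A := Q))//.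
      by rewrite add0r mulr1 mulN1r.
    by rewrite /P/= lt_gtF.
  - rewrite gtr0_norm// (mem_set (A := P))// (memNset (A := Q)).
      by rewrite mulr0 addr0 mul1r.
    by rewrite /Q/= lt_gtF.
  - by rewrite s0 normr0 mulr0.
have l1 := L1_Lsq gfin lf.
have := @ae_eq_integral_abs _ _ _ gam _ measurableT (EFin \o f).
case=> [|h1 _]; first exact/measurable_EFinP.
have : ae_eq gam setT (EFin \o f) (cst 0%E).
  by apply: h1; rewrite (L1_integralE (L1_norm l1)) h.
by apply: filterS => x hx xT; have [] := hx xT.
Qed.

End hermite_totality.

(** * Hermite coefficients and Parseval's identity *)

Section parseval.
Context {R : realType} (n : nat).
Local Notation X := 'cV[R]_n.
Variables S U : 'M[R]_n.
Hypothesis SU : S = U *m U^T.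
Hypothesis uU : U \in unitmx.
Hypothesis hS : sym_posdef S.
Local Notation gam := (gauss_measure S).
Local Notation H := (hermite_mv U).
Implicit Types (f g : X -> R) (c d : mindex n -> R).

(** Division by a!, the squared norm of H_a, makes these the coefficients of the expansion of f. *)
Definition rcrd f a : R := \int[gam]_x (f x * H a x) / (mfact a)%:R.
Definition hsum m c (x : X) : R := \sum_(k < m) \sum_(a <- grade n k) c a * H a x.
Definition energy m c : R := \sum_(k < m) ip k c c.

Let mf0 (a : mindex n) : (mfact a)%:R != 0 :> R.
Proof. by rewrite pnatr_eq0 -lt0n mfact_gt0. Qed.

Let LsqH := @Lsq_H R n S U hS.

Lemma rcrdE f a : \int[gam]_x (f x * H a x) = (mfact a)%:R * rcrd f a.
Proof. by rewrite /rcrd mulrC divfK. Qed.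

Lemma Lsq_hsum m c : Lsq gam (hsum m c).
Proof.
by apply: Lsq_sum => k; apply: Lsq_sum => a; apply: LsqZl; exact: LsqH.
Qed.

Lemma int_hsum f m c : Lsq gam f ->
  \int[gam]_x (f x * hsum m c x) = \sum_(k < m) ip k c (rcrd f).
Proof.
move=> lf; have l1 a : L1 gam (fun x => f x * H a x) by exact: Lsq_mul lf (LsqH a).
transitivity (\int[gam]_x \sum_(k < m) \sum_(a <- grade n k) c a * (f x * H a x)).
  apply: eq_Rintegral => x _; rewrite mulr_sumr; apply: eq_bigr => k _.
  by rewrite mulr_sumr; apply: eq_bigr => a _; rewrite mulrCA.
rewrite Rintegral_sum; last by move=> k; apply: L1_sum => a; exact: L1Zl.
apply: eq_bigr => k _; rewrite Rintegral_sum; last by move=> a; exact: L1Zl.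
apply: eq_bigr => a _; have -> : \int[gam]_x (c a * (f x * H a x)) = c a * \int[gam]_x (f x * H a x).
  by apply: RintegralZl => //; exact: l1.
by rewrite rcrdE mulrCA.
Qed.

Lemma rcrd_hsum m c a : rcrd (hsum m c) a = if (mdeg a < m)%N then c a else 0.
Proof.
rewrite /rcrd (_ : \int[gam]_x _ = \int[gam]_x (H a x * hsum m c x)); last first.
  by apply: eq_Rintegral => x _; rewrite mulrC.
rewrite int_hsum; last exact: LsqH.
have rH b : rcrd (H a) b = (a == b)%:R.
  rewrite /rcrd (H_orthogonal SU hS uU); case: eqP => [->|_]; last by rewrite mul0r.
  by rewrite divff.
have ipE k : ip k c (rcrd (H a)) = if k == mdeg a then (mfact a)%:R * c a else 0.
  rewrite /ip; case: eqP => [->|ka].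
    rewrite (bigD1_seq a) ?mem_grade ?grade_uniq//= rH eqxx mulr1 big1 ?addr0//.
    by move=> b /negbTE ba; rewrite rH eq_sym ba !mulr0.
  rewrite big_seq big1// => b; rewrite mem_grade rH => /eqP bk.
  by case: eqP => [ab|_]; [case: ka; rewrite -bk ab|rewrite !mulr0].
under eq_bigr do rewrite ipE; case: ifPn => am.
  rewrite (bigD1 (Ordinal am))//= eqxx big1 ?addr0; first by rewrite mulrC mulKf.
  by move=> k /negbTE h; rewrite ifF//; apply/negbTE; move: h; rewrite -val_eqE/= => ->.
rewrite big1 ?mul0r// => k _; rewrite ifF//; apply/negbTE; apply: contraNneq am => <-.
exact: ltn_ord.
Qed.

Lemma ip_trunc k m c d : (k < m)%N ->
  ip k c (fun a => if (mdeg a < m)%N then d a else 0) = ip k c d.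
Proof.
move=> km; rewrite /ip big_seq [RHS]big_seq; apply: eq_bigr => a.
by rewrite mem_grade => /eqP ->; rewrite km.
Qed.

Lemma int_sqrB f g : Lsq gam f -> Lsq gam g ->
  \int[gam]_x ((f x - g x) ^+ 2) =
  \int[gam]_x (f x ^+ 2) - 2 * \int[gam]_x (f x * g x) + \int[gam]_x (g x ^+ 2).
Proof.
move=> lf lg; have l1 := Lsq_mul lf lg; have [_ lf2] := lf; have [_ lg2] := lg.
transitivity (\int[gam]_x (f x ^+ 2 - 2 * (f x * g x) + g x ^+ 2)).
  by apply: eq_Rintegral => x _; ring.
rewrite RintegralD//; last by apply: L1B => //; exact: L1Zl.
by rewrite RintegralB ?RintegralZl//; exact: L1Zl.
Qed.

Lemma energy_hsum p m c : (m <= p)%N ->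
  \int[gam]_x (hsum p c x * hsum m c x) = energy m c.
Proof.
move=> mp; rewrite int_hsum; last exact: Lsq_hsum.
apply: eq_bigr => k _.
rewrite (@eq_ip _ _ k c c (rcrd (hsum p c)) (fun a => if (mdeg a < p)%N then c a else 0))//.
  by rewrite ip_trunc// (leq_trans (ltn_ord k)).
by move=> a; exact: rcrd_hsum.
Qed.

Lemma int_hsumB p m c : (m <= p)%N ->
  \int[gam]_x ((hsum p c x - hsum m c x) ^+ 2) = energy p c - energy m c.
Proof.
move=> mp; rewrite int_sqrB; [|exact: Lsq_hsum|exact: Lsq_hsum].
have e q : \int[gam]_x (hsum q c x ^+ 2) = energy q c.
  by rewrite -(energy_hsum c (leqnn q)); apply: eq_Rintegral => x _; rewrite expr2.
by rewrite !e energy_hsum//; ring.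
Qed.

Lemma int_hsum_proj f m : Lsq gam f ->
  \int[gam]_x ((f x - hsum m (rcrd f) x) ^+ 2) =
  \int[gam]_x (f x ^+ 2) - energy m (rcrd f).
Proof.
move=> lf; rewrite int_sqrB//; last exact: Lsq_hsum.
rewrite int_hsum// -[\sum_(k < m) _]/(energy m (rcrd f)).
rewrite (_ : \int[gam]_x (hsum m (rcrd f) x ^+ 2) = energy m (rcrd f)); first by ring.
by rewrite -(energy_hsum (rcrd f) (leqnn m)); apply: eq_Rintegral => x _; rewrite expr2.
Qed.

Lemma energy_nd c : {homo (energy ^~ c) : m p / (m <= p)%N >-> m <= p}.
Proof.
move=> m p mp; rewrite -subr_ge0 -int_hsumB//.
by apply: Rintegral_ge0 => x _; exact: sqr_ge0.
Qed.

(** The partial sums are Cauchy with the rate L - energy m, so [Lsq_complete] gives g; by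
    Cauchy-Schwarz the coefficients pass to the limit. *)
Lemma hermite_synthesis c (K : R) : (forall m, energy m c <= K) ->
  exists g, [/\ Lsq gam g, (forall a, rcrd g a = c a) &
    energy m c @[m --> \oo] --> \int[gam]_x (g x ^+ 2)].
Proof.
move=> cK; have cv : cvgn (energy ^~ c).
  by apply: nondecreasing_is_cvgn; [exact: energy_nd|exists K => _ [m _ <-]; exact: cK].
set L := limn (energy ^~ c) in cv *.
have EL m : energy m c <= L by apply: nondecreasing_cvgn_le => //; exact: energy_nd.
have e0 : L - energy m c @[m --> \oo] --> (0 : R).
  by rewrite -(subrr L); apply: cvgB cv; exact: cvg_cst.
have [|g [lg gK]] := Lsq_complete (gauss_fin hS) (fun m => Lsq_hsum m c) e0.
  by move=> m p mp; rewrite int_hsumB// lerD2r.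
have rg a : rcrd g a = c a.
  apply: (mulfI (mf0 a)); rewrite -rcrdE; apply/eqP; rewrite -subr_eq0 -sqrf_eq0 eq_le sqr_ge0 andbT.
  have h : (L - energy m c) * \int[gam]_x (H a x ^+ 2) @[m --> \oo] --> (0 : R).
    by rewrite -(mul0r (\int[gam]_x (H a x ^+ 2))); apply: cvgM e0 (cvg_cst _).
  rewrite -(cvg_lim _ h)//; apply: limr_ge; first by apply/cvg_ex; exists 0.
  exists (mdeg a).+1 => // m /= am.
  have lB := LsqB lg (Lsq_hsum m c).
  have -> : \int[gam]_x (g x * H a x) - (mfact a)%:R * c a =
      \int[gam]_x ((g x - hsum m c x) * H a x).
    have -> : (mfact a)%:R * c a = \int[gam]_x (hsum m c x * H a x).
      by rewrite rcrdE rcrd_hsum am.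
    rewrite -RintegralB//; [|exact: Lsq_mul lg (LsqH a)|exact: Lsq_mul (Lsq_hsum m c) (LsqH a)].
    by apply: eq_Rintegral => x _; rewrite mulrBl.
  apply: le_trans (Lsq_CauchySchwarz lB (LsqH a)) _; rewrite ler_wpM2r//; exact: Lsq_int_ge0.
exists g; split=> //.
have gE m : \int[gam]_x ((g x - hsum m c x) ^+ 2) = \int[gam]_x (g x ^+ 2) - energy m c.
  by rewrite -(_ : rcrd g = c) ?int_hsum_proj//; exact/funext.
suff -> : \int[gam]_x (g x ^+ 2) = L by exact: cv.
apply/eqP; rewrite eq_le; apply/andP; split.
  by have := gK 0%N; rewrite gE lerD2r.
apply: limr_le => //; apply: nearW => m.
by rewrite -subr_ge0 -gE; exact: Lsq_int_ge0.
Qed.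

Lemma rcrd_ae f g : measurable_fun setT f -> measurable_fun setT g ->
  ae_eq gam setT f g -> rcrd f =1 rcrd g.
Proof.
move=> mf mg fg a; congr (_ / _); have [mH _] := LsqH a.
apply: ae_eq_Rintegral; [exact: measurable_funM|exact: measurable_funM|].
by apply: filterS fg => x h xT; rewrite h.
Qed.

Lemma rcrd_lin f g (s : R) a : Lsq gam f -> Lsq gam g ->
  rcrd (fun x => s * f x + g x) a = s * rcrd f a + rcrd g a.
Proof.
move=> lf lg; have l1 := Lsq_mul lf (LsqH a); have l2 := Lsq_mul lg (LsqH a).
rewrite /rcrd mulrA -mulrDl; congr (_ / _).
rewrite -RintegralZl// -RintegralD//; last exact: L1Zl.
by apply: eq_Rintegral => x _; ring.
Qed.

(** By Bessel the coefficients of f can be synthesized into some g; f - g is orthogonal to all H_a,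
    hence null by [perp_ae0], and the identity holds for g. *)
Lemma parseval f : Lsq gam f -> energy m (rcrd f) @[m --> \oo] --> \int[gam]_x (f x ^+ 2).
Proof.
move=> lf; have bessel m : energy m (rcrd f) <= \int[gam]_x (f x ^+ 2).
  by rewrite -subr_ge0 -int_hsum_proj//; exact: Lsq_int_ge0.
have [g [lg rg gE]] := hermite_synthesis bessel.
suff -> : \int[gam]_x (f x ^+ 2) = \int[gam]_x (g x ^+ 2) by [].
have /(perp_ae0 uU hS) h : Lsq gam (fun x => -1 * g x + f x) by apply: LsqD => //; exact: LsqZl.
have {}h : ae_eq gam setT f g.
  apply: filterS (h _) => [x /(_ I) e _|a]; first by apply/eqP; rewrite -subr_eq0 -mulN1r addrC e.
  by rewrite rcrdE rcrd_lin// rg mulN1r addNr mulr0.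
apply: ae_eq_Rintegral; [case: lf|case: lg|] => [mf _|mg _|]; try exact: measurable_funX.
by apply: filterS h => x h xT; rewrite h.
Qed.

End parseval.

(** * The quotient space and its Hermite coordinates *)

Section L2_facts.
Context d (T : measurableType d) (R : realType) (mu : {measure set T -> \bar R}).
Implicit Types (f g : T -> R[i]^o).

Lemma modulus_sqr (z : R[i]) : modulus z ^+ 2 = complex.Re z ^+ 2 + complex.Im z ^+ 2.
Proof. by case: z => a b; rewrite /modulus /= sqr_sqrtr// addr_ge0// sqr_ge0. Qed.

Lemma L2normE f : L2norm mu f =
  ((\int[mu]_x (complex.Re (f x) ^+ 2 + complex.Im (f x) ^+ 2)%:E) `^ 2^-1)%E.
Proof.
rewrite /L2norm unlock; congr (_ `^ _)%E; apply: eq_integral => x _ /=.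
by rewrite ger0_norm ?modulus_ge0// powR_mulrn ?modulus_ge0// modulus_sqr.
Qed.

Lemma square_integrableP f : square_integrable mu f <->
  Lsq mu (fun x => complex.Re (f x)) /\ Lsq mu (fun x => complex.Im (f x)).
Proof.
split=> [[[mr mi]]|[lr li]].
  rewrite L2normE => h.
  have {}h : (\int[mu]_x (complex.Re (f x) ^+ 2 + complex.Im (f x) ^+ 2)%:E < +oo)%E.
    exact: lty_poweRy h.
  have m2 : measurable_fun setT (fun x => complex.Re (f x) ^+ 2 + complex.Im (f x) ^+ 2).
    by apply: measurable_funD; exact: measurable_funX.
  have l2 : L1 mu (fun x => complex.Re (f x) ^+ 2 + complex.Im (f x) ^+ 2).
    apply/integrableP; split; first exact/measurable_EFinP.
    by under eq_integral do rewrite /= ger0_norm ?addr_ge0 ?sqr_ge0//.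
  by split; split=> //; apply: L1_le l2; do ?exact: measurable_funX;
    move=> x; rewrite ger0_norm ?sqr_ge0// ?lerDl ?lerDr sqr_ge0.
split; first by split; [case: lr|case: li].
rewrite L2normE L1_integralE; last by apply: L1D; [case: lr|case: li].
by rewrite poweR_EFin ltry.
Qed.

Lemma L2norm_Lsq f : Lsq mu (fun x => complex.Re (f x)) -> Lsq mu (fun x => complex.Im (f x)) ->
  L2norm mu f = (Num.sqrt (\int[mu]_x (complex.Re (f x) ^+ 2) +
    \int[mu]_x (complex.Im (f x) ^+ 2)))%:E.
Proof.
move=> [_ lr] [_ li]; rewrite L2normE L1_integralE; last exact: L1D.
rewrite poweR_EFin powR12_sqrt ?RintegralD//.
by rewrite addr_ge0// Lsq_int_ge0.
Qed.

Lemma L2norm_eq0 f : square_integrable mu f -> L2norm mu f = 0%E ->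
  ae_eq mu setT f (fun=> 0).
Proof.
move=> /square_integrableP[lr li]; rewrite L2norm_Lsq// => -[/eqP].
rewrite sqrtr_eq0 => h.
have r0 := Lsq_int_ge0 mu (fun x => complex.Re (f x)).
have i0 := Lsq_int_ge0 mu (fun x => complex.Im (f x)).
have /(Lsq_ae0 lr) hr : \int[mu]_x (complex.Re (f x) ^+ 2) = 0 by lra.
have /(Lsq_ae0 li) hi : \int[mu]_x (complex.Im (f x) ^+ 2) = 0 by lra.
apply: filterS2 hr hi => x hr hi xT; move: (hr xT) (hi xT); case: (f x) => a b /= -> ->.
by [].
Qed.

Local Open Scope quotient_scope.

Definition L2class (f : L2fun mu) : L2 mu := \pi_(Quotient.quot (@null_pred _ _ _ mu)) f.

Lemma L2class_ae (f : L2fun mu) : ae_eq mu setT (L2class f) f.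
Proof.
have : L2repr (L2class f) - f \in @null_pred _ _ _ mu.
  rewrite (Quotient.idealrBE (@null_pred _ _ _ mu)); apply/eqP.
  by rewrite /L2class /L2repr reprK.
rewrite inE => /eqP /(L2norm_eq0 (L2funP _)).
by apply: filterS => x h xT; apply/eqP; rewrite -subr_eq0; apply/eqP; exact: h xT.
Qed.

(** Classes are evaluated through chosen representatives, which respect the operations only almost
    everywhere. *)
Lemma L2lin_ae (a : R[i]) (u v : L2 mu) :
  ae_eq mu setT (a *: u + v : L2 mu) (fun x => a * u x + v x).
Proof.
have e : a *: u + v = L2class (a *: (repr u : L2fun mu) + (repr v : L2fun mu)).
  rewrite /L2class Quotient.pi_add; congr (_ + _).
  by rewrite reprK.
rewrite e; apply: filterS (L2class_ae (a *: (repr u : L2fun mu) + (repr v : L2fun mu))) => x h xT.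
by rewrite h.
Qed.

Lemma Lsq_L2 (u : L2 mu) : Lsq mu (fun x => complex.Re (u x)) /\ Lsq mu (fun x => complex.Im (u x)).
Proof. by apply/square_integrableP; exact: L2funP. Qed.

Lemma L2_of (r s : T -> R) : Lsq mu r -> Lsq mu s ->
  exists u : L2 mu, ae_eq mu setT (fun x => complex.Re (u x)) r /\
    ae_eq mu setT (fun x => complex.Im (u x)) s.
Proof.
move=> lr ls; pose f : T -> R[i]^o := fun x => (r x +i* s x)%C.
have hf : f \in square_integrable_pred mu by apply/asboolP/square_integrableP.
exists (L2class (MkL2fun hf)).
by split; apply: filterS (L2class_ae (MkL2fun hf)) => x h xT; rewrite h.
Qed.

Lemma rnorm_L2 (u : L2 mu) : rnorm u ^+ 2 =
  \int[mu]_x (complex.Re (u x) ^+ 2) + \int[mu]_x (complex.Im (u x) ^+ 2).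
Proof.
have [lr li] := Lsq_L2 u.
rewrite /rnorm (_ : `|u| = normL2 u)// /normL2 L2norm_Lsq//= sqr_sqrtr//.
by rewrite addr_ge0// Lsq_int_ge0.
Qed.

End L2_facts.

Section L2_coordinates.
Context {R : realType} (n : nat).
Variables S U : 'M[R]_n.
Hypothesis SU : S = U *m U^T.
Hypothesis uU : U \in unitmx.
Hypothesis hS : sym_posdef S.
Local Notation gam := (gauss_measure S).

Definition crd (u : L2 gam) (a : mindex n) : R[i] :=
  (rcrd S U (fun x => complex.Re (u x)) a +i* rcrd S U (fun x => complex.Im (u x)) a)%C.

Let Re_lin (z p q : R[i]) : complex.Re (z * p + q) =
  complex.Re z * complex.Re p + (- complex.Im z * complex.Im p + complex.Re q).
Proof. by case: z p q => [? ?] [? ?] [? ?] /=; ring. Qed.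

Let Im_lin (z p q : R[i]) : complex.Im (z * p + q) =
  complex.Re z * complex.Im p + (complex.Im z * complex.Re p + complex.Im q).
Proof. by case: z p q => [? ?] [? ?] [? ?] /=; ring. Qed.

Lemma crd_lin (z : R[i]) (u v : L2 gam) a : crd (z *: u + v) a = z * crd u a + crd v a.
Proof.
have [lr li] := Lsq_L2 u; have [lr' li'] := Lsq_L2 v; have [lr2 li2] := Lsq_L2 (z *: u + v).
have h := L2lin_ae z u v.
have hr : ae_eq gam setT (fun x => complex.Re ((z *: u + v : L2 gam) x))
    (fun x => complex.Re z * complex.Re (u x) +
      (- complex.Im z * complex.Im (u x) + complex.Re (v x))).
  by apply: filterS h => x h xT; rewrite h// Re_lin.
have hi : ae_eq gam setT (fun x => complex.Im ((z *: u + v : L2 gam) x))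
    (fun x => complex.Re z * complex.Im (u x) +
      (complex.Im z * complex.Re (u x) + complex.Im (v x))).
  by apply: filterS h => x h xT; rewrite h// Im_lin.
have l1 : Lsq gam (fun x => - complex.Im z * complex.Im (u x) + complex.Re (v x)).
  by apply: LsqD => //; exact: LsqZl.
have l2 : Lsq gam (fun x => complex.Im z * complex.Re (u x) + complex.Im (v x)).
  by apply: LsqD => //; exact: LsqZl.
rewrite /crd (rcrd_ae U hS _ _ hr); [|by case: lr2|by case: (LsqD (LsqZl (complex.Re z) lr) l1)].
rewrite (rcrd_ae U hS _ _ hi); [|by case: li2|by case: (LsqD (LsqZl (complex.Re z) li) l2)].
rewrite !rcrd_lin//; apply/eqP; rewrite eq_complex Re_lin Im_lin/=; apply/andP; split; apply/eqP; ring.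
Qed.

Lemma crd_norm u : (fun m => \sum_(k < m) cnorm2 k (crd u)) @ \oo --> rnorm u ^+ 2.
Proof.
have [lr li] := Lsq_L2 u; rewrite rnorm_L2.
rewrite (_ : (fun m => _) = fun m => energy m (rcrd S U (fun x => complex.Re (u x))) +
  energy m (rcrd S U (fun x => complex.Im (u x)))); first by apply: cvgD; exact: parseval.
by apply/funext => m; rewrite /energy -big_split.
Qed.

Lemma crd_surj (c : mindex n -> R[i]) (K : R) :
  (forall m, \sum_(k < m) cnorm2 k c <= K) -> exists u, forall a, crd u a = c a.
Proof.
move=> cK; have e m : \sum_(k < m) cnorm2 k c = energy m (fun a => complex.Re (c a)) +
    energy m (fun a => complex.Im (c a)) by rewrite /energy -big_split.
have e0 m (d : mindex n -> R) : 0 <= energy m d by apply: sumr_ge0 => k _; exact: ip_ge0.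
have [|r [lr rr _]] := @hermite_synthesis _ _ S U SU uU hS (fun a => complex.Re (c a)) K.
  by move=> m; apply: le_trans (cK m); rewrite e lerDl.
have [|s [ls rs _]] := @hermite_synthesis _ _ S U SU uU hS (fun a => complex.Im (c a)) K.
  by move=> m; apply: le_trans (cK m); rewrite e lerDr.
have [u [ur us]] := L2_of lr ls; exists u => a.
have [lr' li'] := Lsq_L2 u.
rewrite /crd (rcrd_ae U hS _ _ ur); [|by case: lr'|by case: lr].
rewrite (rcrd_ae U hS _ _ us); [|by case: li'|by case: ls].
by rewrite rr rs; case: (c a).
Qed.

End L2_coordinates.

(** * The drift-diffusion operator in Hermite coordinates *)

Section linear_maps.
Context {R : realType} (n : nat).
Local Notation X := 'cV[R]_n.
Implicit Types (M : 'M[R]_n).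

Let mulmxE M i : (fun x : X => (M *m x) i 0) = fun x : X => \sum_j M i j * x j 0.
Proof. by apply/funext => x; rewrite mxE. Qed.

Lemma salg_mulmx M i : salg (fun x : X => (M *m x) i 0).
Proof.
by rewrite mulmxE; apply: salg_sum => j; apply: salgM; [exact: salg_cst|exact: salg_coord].
Qed.

Lemma partial_mulmx M i j (x : X) : partial j (fun y : X => (M *m y) i 0) x = M i j.
Proof.
rewrite mulmxE partial_sum => [|k]; last by apply: salgM; [exact: salg_cst|exact: salg_coord].
rewrite (bigD1 j)//= partialZ; last exact: salg_coord.
rewrite partial_coord eqxx mulr1 big1 ?addr0// => k /negbTE kj.
by rewrite partialZ ?partial_coord ?kj ?mulr0//; exact: salg_coord.
Qed.

End linear_maps.

Section weak_equation.
Context {R : realType} (n : nat).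
Local Notation X := 'cV[R]_n.
Variables S U J : 'M[R]_n.
Hypothesis SU : S = U *m U^T.
Hypothesis uU : U \in unitmx.
Hypothesis hS : sym_posdef S.
Hypothesis aJ : antisymmetric_mx J.
Local Notation gam := (gauss_measure S).
Local Notation psi := (gauss_density S).
Local Notation H := (hermite_mv U).
Local Notation A := (drift_conj U J).
Local Notation rc := (rcrd S U).
Implicit Types (f g r s : X -> R) (a : mindex n).

Definition drift_field i (x : X) : R := (drift_mx S J *m x) i 0.
Local Notation b := drift_field.

(** The distributional equation for real functions, with all derivatives on the test function: the
    minus sign of the drift cancels that of its single derivative. *)
Definition weak_eq r s := forall phi, test_function phi ->
  \sum_i \int[lebesgue_cV n]_x (r x * partial i (fun y => b i y * phi y) x) +
  \sum_i \int[lebesgue_cV n]_x (r x * partial i (partial i phi) x) =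
  \int[lebesgue_cV n]_x (s x * phi x).

Let psi0 x : psi x != 0. Proof. by rewrite gt_eqF// gauss_density_gt0. Qed.
Let mpsi : measurable_fun setT psi. Proof. exact: measurable_gauss_density. Qed.

Lemma cbox_div_density g : cbox g -> cbox (fun x => g x / psi x).
Proof.
move=> cg; have cp : continuous psi by apply: salg_continuous; exact: salg_gauss_density.
have := @cboxM R n (fun x => (psi x)^-1) g _ cg.
have -> : (fun x => (psi x)^-1 * g x) = (fun x => g x / psi x).
  by apply/funext => x; rewrite mulrC.
apply => x; apply: (@continuous_comp _ _ _ psi (fun t => t^-1)).
  exact: cp.
exact: inv_continuous.
Qed.

Lemma cbox_Lsq g : cbox g -> Lsq gam g.
Proof.
move=> bg; have [K _ gK] := cbox_bounded bg; have [cg _] := bg.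
have := Lsq_bounded_mul (continuous_measurable_cV cg) gK (Lsq_cst (gauss_fin hS) 1).
by congr Lsq; apply/funext => x; rewrite mulr1.
Qed.

(** Thanks to its compact support, g remains square integrable after division by the density, so
    distributional pairings become scalar products for the Gaussian measure. *)
Lemma integral_lebesgue_gauss f g : Lsq gam f -> cbox g ->
  L1 (lebesgue_cV n) (fun x => f x * g x) /\
  \int[lebesgue_cV n]_x (f x * g x) = \int[gam]_x (f x * (g x / psi x)).
Proof.
move=> lf cg; have lg := cbox_Lsq (cbox_div_density cg).
have l1 := Lsq_mul lf lg; have m1 := L1_measurable l1.
have e : (fun x => f x * (g x / psi x) * psi x) = (fun x => f x * g x).
  by apply/funext => x; rewrite -mulrA divfK.
by split; [rewrite -e; exact/L1_gauss|rewrite Rintegral_gauss// e].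
Qed.

(** Polarization of Parseval's identity. *)
Lemma cvg_ip f g : Lsq gam f -> Lsq gam g ->
  \sum_(k < m) ip k (rc f) (rc g) @[m --> \oo] --> \int[gam]_x (f x * g x).
Proof.
move=> lf lg; have [_ lf2] := lf; have [_ lg2] := lg; have lfg := Lsq_mul lf lg.
have ld := LsqD (LsqZl 1 lf) lg.
have e m : \sum_(k < m) ip k (rc f) (rc g) = (energy m (rc (fun x => 1 * f x + g x)) -
    energy m (rc f) - energy m (rc g)) / 2.
  rewrite /energy -!sumrB mulr_suml; apply: eq_bigr => k _.
  rewrite /ip -!sumrB mulr_suml; apply: eq_bigr => a _.
  by rewrite rcrd_lin//; field.
have -> : \int[gam]_x (f x * g x) = (\int[gam]_x ((1 * f x + g x) ^+ 2) -
    \int[gam]_x (f x ^+ 2) - \int[gam]_x (g x ^+ 2)) / 2.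
  rewrite (_ : \int[gam]_x ((1 * f x + g x) ^+ 2) =
      \int[gam]_x (f x ^+ 2 + 2 * (f x * g x) + g x ^+ 2)); last first.
    by apply: eq_Rintegral => x _; ring.
  rewrite RintegralD//; last by apply: L1D => //; exact: L1Zl.
  by rewrite RintegralD ?RintegralZl//; [field|exact: L1Zl].
under eq_fun do rewrite e.
have c1 := parseval SU uU hS ld; have c2 := parseval SU uU hS lf; have c3 := parseval SU uU hS lg.
by apply: cvgMr_tmp; apply: cvgB; [apply: cvgB; [exact: c1|exact: c2]|exact: c3].
Qed.

Lemma ip_gen_adj m (M : 'M[R]_n) (c d : mindex n -> R) :
  ip m (gen M c) d = ip m c (gen M^T d).
Proof.
case: m => [|m].
  by transitivity (0 : R); [|symmetry]; rewrite /ip big_seq big1// => a;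
    rewrite mem_grade mdeg_eq0 => /eqP ->; rewrite gen_grade0 ?mul0r !mulr0.
rewrite ipC !ip_gen exchange_big/=; congr (- _); apply: eq_bigr => k _.
by apply: eq_bigr => l _; rewrite mxE ipC.
Qed.

Let gen_int (M : 'M[R]_n) r a : Lsq gam r ->
  \int[gam]_x (r x * - \sum_k \sum_l M l k * ((a k)%:R * H (msucc l (mpred k a)) x)) =
  (mfact a)%:R * gen M (rc r) a.
Proof.
move=> lr; rewrite mfact_gen exchange_big/=.
have l1 c : L1 gam (fun x => r x * H c x) by apply: Lsq_mul => //; exact: Lsq_H.
transitivity (\int[gam]_x \sum_k \sum_l (- (M l k * (a k)%:R)) * (r x * H (msucc l (mpred k a)) x)).
  apply: eq_Rintegral => x _; rewrite mulrN mulr_sumr -sumrN; apply: eq_bigr => k _.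
  by rewrite mulr_sumr -sumrN; apply: eq_bigr => l _; ring.
rewrite Rintegral_sum; last by move=> k; apply: L1_sum => l; exact: L1Zl.
rewrite -sumrN; apply: eq_bigr => k _.
rewrite Rintegral_sum; last by move=> l; exact: L1Zl.
rewrite -sumrN; apply: eq_bigr => l _.
have -> : \int[gam]_x (- (M l k * (a k)%:R) * (r x * H (msucc l (mpred k a)) x)) =
   - (M l k * (a k)%:R) * \int[gam]_x (r x * H (msucc l (mpred k a)) x).
  by apply: RintegralZl => //; exact: l1.
by rewrite rcrdE; ring.
Qed.

Section test_function.
Variable phi : X -> R.
Hypothesis tphi : test_function phi.

Let cphi := test_function_cbox tphi.
Let cpphi i := (test_function_partial i tphi).1.
Let dphi i := (test_function_partial i tphi).2.
Let cp2phi i := (test_function_partial2 i i tphi).1.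
Let dp2phi i := (test_function_partial2 i i tphi).2.

Let cbphi i : cbox (fun x => b i x * phi x).
Proof. by apply: cboxM => //; apply: salg_continuous; exact: salg_mulmx. Qed.

Let dbphi i x : is_derive x (delta_mx i 0) (fun x => b i x * phi x)
  (b i x * partial i phi x + drift_mx S J i i * phi x).
Proof.
have [_ db] := salg_partial i (salg_mulmx (drift_mx S J) i).
have := is_deriveM (db x) (dphi i x).
by rewrite partial_mulmx /GRing.scale/= [phi x * _]mulrC.
Qed.

Let pbphiE i : partial i (fun x => b i x * phi x) =
  fun x => b i x * partial i phi x + drift_mx S J i i * phi x.
Proof. by apply/funext => x; apply: partial_eq; exact: dbphi. Qed.

Let cpbphi i : cbox (partial i (fun x => b i x * phi x)).
Proof.
rewrite pbphiE; apply: cboxD; apply: cboxM => //; last exact: cst_continuous.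
by apply: salg_continuous; exact: salg_mulmx.
Qed.

(** The formal adjoint of the operator for Lebesgue measure, applied to phi. *)
Definition adjoint_test (x : X) := \sum_i (partial i (fun y => b i y * phi y) x +
  partial i (partial i phi) x).

Lemma cbox_adjoint_test : cbox adjoint_test.
Proof. by apply: cbox_sum => i; exact: cboxD. Qed.

Lemma weak_eqE r : Lsq gam r ->
  \sum_i \int[lebesgue_cV n]_x (r x * partial i (fun y => b i y * phi y) x) +
  \sum_i \int[lebesgue_cV n]_x (r x * partial i (partial i phi) x) =
  \int[gam]_x (r x * (adjoint_test x / psi x)).
Proof.
move=> lr; have [_ <-] := integral_lebesgue_gauss lr cbox_adjoint_test.
have h1 i := (integral_lebesgue_gauss lr (cpbphi i)).1.
have h2 i := (integral_lebesgue_gauss lr (cp2phi i)).1.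
rewrite -big_split/=.
transitivity (\int[lebesgue_cV n]_x \sum_i (r x * partial i (fun y => b i y * phi y) x +
    r x * partial i (partial i phi) x)).
  rewrite Rintegral_sum; last by move=> i; exact: L1D.
  by apply: eq_bigr => i _; rewrite RintegralD//; [exact: h1|exact: h2].
apply: eq_Rintegral => x _; rewrite mulr_sumr; apply: eq_bigr => i _.
by rewrite mulrDr.
Qed.

(** As phi has compact support, its derivatives can be moved onto H_a, where [generator_H] gives the
    matrix action. *)
Lemma rcrd_adjoint_test : rc (fun x => adjoint_test x / psi x) =1
  gen A^T (rc (fun x => phi x / psi x)).
Proof.
move=> a; have mf0 : (mfact a)%:R != 0 :> R by rewrite pnatr_eq0 -lt0n mfact_gt0.
apply: (mulfI mf0); rewrite -rcrdE -gen_int; last exact: cbox_Lsq (cbox_div_density cphi).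
have lH := Lsq_H U hS a.
transitivity (\int[gam]_x (H a x * (adjoint_test x / psi x))).
  by apply: eq_Rintegral => x _; rewrite mulrC.
have [_ <-] := integral_lebesgue_gauss lH cbox_adjoint_test.
have sH := salg_H U a.
have [pH p2H] : (forall i, salg (partial i (H a))) /\ (forall i, salg (partial i (partial i (H a)))).
  by split=> i; [|apply: (salg_partial i _).1]; apply: (salg_partial i sH).1.
have h1 i : \int[lebesgue_cV n]_x (H a x * partial i (fun y => b i y * phi y) x) =
   - \int[lebesgue_cV n]_x (b i x * partial i (H a) x * phi x).
  have db x : is_derive x (delta_mx i 0) (fun y => b i y * phi y)
      (partial i (fun y => b i y * phi y) x) by rewrite pbphiE; exact: dbphi.
  rewrite -[LHS]opprK -(integral_partial_mul sH (cbphi i) (cpbphi i) db).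
  by congr (- _); apply: eq_Rintegral => x _; ring.
have h2 i : \int[lebesgue_cV n]_x (H a x * partial i (partial i phi) x) =
   \int[lebesgue_cV n]_x (partial i (partial i (H a)) x * phi x).
  rewrite (integral_partial_mul (pH i) cphi (cpphi i) (dphi i)).
  by rewrite (integral_partial_mul sH (cpphi i) (cp2phi i) (dp2phi i)) opprK.
have l1 f : salg f -> L1 (lebesgue_cV n) (fun x => f x * phi x).
  by move=> sf; apply: cbox_integrable; apply: cboxM cphi; exact: salg_continuous.
have sb i : salg (fun x => b i x * partial i (H a) x) by apply: salgM => //; exact: salg_mulmx.
transitivity (\int[lebesgue_cV n]_x ((\sum_i partial i (partial i (H a)) x -
    \sum_i b i x * partial i (H a) x) * phi x)).
  transitivity (\int[lebesgue_cV n]_x \sum_i (H a x * partial i (fun y => b i y * phi y) x +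
      H a x * partial i (partial i phi) x)).
    by apply: eq_Rintegral => x _; rewrite mulr_sumr; apply: eq_bigr => i _; rewrite mulrDr.
  have k1 i : L1 (lebesgue_cV n) (fun x => H a x * partial i (fun y => b i y * phi y) x).
    by apply: cbox_integrable; apply: cboxM (cpbphi i); exact: salg_continuous.
  have k2 i : L1 (lebesgue_cV n) (fun x => H a x * partial i (partial i phi) x).
    by apply: cbox_integrable; apply: cboxM (cp2phi i); exact: salg_continuous.
  rewrite Rintegral_sum; last by move=> i; exact: L1D.
  transitivity (\int[lebesgue_cV n]_x \sum_i (partial i (partial i (H a)) x * phi x -
      b i x * partial i (H a) x * phi x)); last first.
    apply: eq_Rintegral => x _; rewrite -sumrB mulr_suml; apply: eq_bigr => i _.
    by rewrite mulrBl.
  rewrite Rintegral_sum; last by move=> i; apply: L1B; exact: l1.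
  apply: eq_bigr => i _.
  transitivity (\int[lebesgue_cV n]_x (H a x * partial i (fun y => b i y * phi y) x) +
      \int[lebesgue_cV n]_x (H a x * partial i (partial i phi) x)).
    by apply: RintegralD => //; [exact: k1|exact: k2].
  rewrite h1 h2 addrC; apply/esym/RintegralB => //; first exact: l1.
  by apply: (l1 (fun x => b i x * partial i (H a) x)).
pose E x := - \sum_k \sum_l A^T l k * ((a k)%:R * H (msucc l (mpred k a)) x).
have lE : Lsq gam E.
  apply: tame_Lsq => //; apply: tameN; apply: tame_sum => k; apply: tame_sum => l.
  by apply: tameM; [exact: tame_cst|apply: tameM; [exact: tame_cst|exact: tame_H]].
transitivity (\int[lebesgue_cV n]_x (E x * phi x)).
  apply: eq_Rintegral => x _; congr (_ * _); rewrite (generator_H SU)//; congr (- _).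
  by apply: eq_bigr => k _; apply: eq_bigr => l _; rewrite [A^T _ _]mxE.
have [_ ->] := integral_lebesgue_gauss lE cphi.
by apply: eq_Rintegral => x _; rewrite mulrC.
Qed.

End test_function.

(** By [cvg_ip] both sides are sums over degrees of products with the coefficients of phi / psi, and
    [ip_gen_adj] matches them degree by degree. *)
Lemma gen_weak_eq r s : Lsq gam r -> Lsq gam s -> rc s =1 gen A (rc r) -> weak_eq r s.
Proof.
move=> lr ls rs phi tphi; have cphi := test_function_cbox tphi.
rewrite weak_eqE//; have [_ ->] := integral_lebesgue_gauss ls cphi.
have lp := cbox_Lsq (cbox_div_density cphi).
have lw := cbox_Lsq (cbox_div_density (cbox_adjoint_test tphi)).
have c1 := cvg_ip lr lw; have c2 := cvg_ip ls lp.
rewrite -(cvg_lim _ c1)// -(cvg_lim _ c2)//; congr (limn _); apply/funext => m.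
apply: eq_bigr => k _.
rewrite (eq_ip k (frefl (rc r)) (rcrd_adjoint_test tphi)) -ip_gen_adj.
exact: eq_ip.
Qed.

Lemma L1_scale_mul f g m : L1 gam f -> cbox g -> L1 gam (fun x => f x * g (eps m *: x)).
Proof.
move=> lf bg; have [K _ gK] := cbox_bounded bg.
apply: (L1_le _ _ (L1Zl K (L1_norm lf))).
  apply: measurable_funM; first exact: L1_measurable lf.
  by apply: continuous_measurable_cV; case: (cbox_scale (@eps_gt0 R m) bg).
by move=> x; rewrite normrM mulrC ler_wpM2r.
Qed.

Let trJS : \sum_i (J *m S) i i = 0.
Proof.
rewrite -[LHS]/(\tr (J *m S)); have : \tr (J *m S) = - \tr (J *m S).
  rewrite {1}mxtrace_mulC -mxtrace_tr trmx_mul aJ (proj1 hS) mulNmx.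
  exact: (linearN (@mxtrace _ n)).
by move/eqP; rewrite -addr_eq0 -mulr2n -mulr_natl mulf_eq0 pnatr_eq0/= => /eqP.
Qed.

(** Conjugation by psi turns the formal adjoint into the operator with - J. The terms of order zero
    cancel because Tr (J S) = 0 and (S x)^T J (S x) = 0, which says that psi is invariant for every
    J. *)
Lemma adjoint_test_gauss p x : salg p -> adjoint_test (fun y => psi y * p y) x =
  psi x * (\sum_i partial i (partial i p) x -
    \sum_i (drift_mx S (- J) *m x) i 0 * partial i p x).
Proof.
move=> sp; have spsi := salg_gauss_density S.
have dp i : salg (partial i p) by exact: (salg_partial i sp).1.
pose s i (y : X) := (S *m y) i 0; have ss i : salg (s i) by exact: salg_mulmx.
have sq i : salg (fun y => partial i p y - s i y * p y).
  by apply: salgD => //; apply: salgN; exact: salgM.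
have pE i : partial i (fun y => psi y * p y) = fun y => psi y * (partial i p y - s i y * p y).
  by apply/funext => y; rewrite partialM// partial_gauss_density// /s; ring.
have h1 i : partial i (fun y => b i y * (psi y * p y)) x =
    psi x * (b i x * (partial i p x - s i x * p x) + p x * drift_mx S J i i).
  rewrite partialM; [|exact: salg_mulmx|exact: salgM].
  by rewrite pE partial_mulmx; ring.
have h2 i : partial i (partial i (fun y => psi y * p y)) x =
    psi x * (partial i (partial i p) x - 2 * s i x * partial i p x - p x * S i i + s i x ^+ 2 * p x).
  rewrite pE partialM// partial_gauss_density// partialD//; last by apply: salgN; exact: salgM.
  rewrite partialN; last exact: salgM.
  rewrite partialM// partial_mulmx -/(s i x); ring.
pose j i := (J *m S *m x) i 0.
have bE i : b i x = s i x + j i.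
  by rewrite /drift_field /drift_mx mulmxDl mul1mx mulmxDl mxE.
have b'E i : (drift_mx S (- J) *m x) i 0 = s i x - j i.
  by rewrite /drift_mx mulmxDl mul1mx mulNmx mulmxBl [LHS]mxE [X in _ + X]mxE.
have BE i : drift_mx S J i i = S i i + (J *m S) i i.
  by rewrite /drift_mx mulmxDl mul1mx mxE.
have sj : \sum_i s i x * j i = 0.
  rewrite -[RHS](quad_antisym (S *m x) aJ) quad_mxE; apply: eq_bigr => i _.
  by rewrite /j -mulmxA mxE mulr_sumr; apply: eq_bigr => l _; rewrite /s; ring.
rewrite /adjoint_test.
transitivity (psi x * (\sum_i partial i (partial i p) x -
   \sum_i (drift_mx S (- J) *m x) i 0 * partial i p x +
   p x * \sum_i (J *m S) i i - p x * \sum_i s i x * j i)); last first.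
  by rewrite trJS sj mulr0 subr0 addr0.
rewrite -sumrB !mulr_sumr -big_split/= -sumrB mulr_sumr; apply: eq_bigr => i _.
by rewrite h1 h2 b'E bE BE; ring.
Qed.

(* Test against psi * H_a * cut (eps m *: -) and let m go to infinity. *)
Lemma weak_eq_gen r s : Lsq gam r -> Lsq gam s -> weak_eq r s -> rc s =1 gen A (rc r).
Proof.
move=> lr ls rs a; have mf0 : (mfact a)%:R != 0 :> R by rewrite pnatr_eq0 -lt0n mfact_gt0.
apply: (mulfI mf0); rewrite -rcrdE -gen_int//.
have sH := salg_H U a; have tH := tame_H U a.
have sc := @salg_cut R n; have bc := @cbox_cut R n.
have sdc i : salg (partial i (@cut R n)) by exact: (salg_partial i sc).1.
have sd2c i : salg (partial i (partial i (@cut R n))) by exact: (salg_partial i (sdc i)).1.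
have bdc i : cbox (partial i (@cut R n)) by apply: cbox_partial bc _; exact: salg_continuous.
have bd2c i : cbox (partial i (partial i (@cut R n))).
  by apply: cbox_partial (bdc i) _; exact: salg_continuous.
have sdH i : salg (partial i (H a)) by exact: (salg_partial i sH).1.
pose E x := - \sum_k \sum_l A l k * ((a k)%:R * H (msucc l (mpred k a)) x).
have lE : Lsq gam E.
  apply: tame_Lsq => //; apply: tameN; apply: tame_sum => k; apply: tame_sum => l.
  by apply: tameM; [exact: tame_cst|apply: tameM; [exact: tame_cst|exact: tame_H]].
have aNJ : antisymmetric_mx (- J) by rewrite /antisymmetric_mx linearN/= aJ.
have EE x : \sum_i partial i (partial i (H a)) x -
    \sum_i (drift_mx S (- J) *m x) i 0 * partial i (H a) x = E x.
  rewrite (generator_H SU)//; congr (- _); apply: eq_bigr => k _; apply: eq_bigr => l _.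
  by rewrite drift_conjN.
pose chi m (x : X) := cut (eps m *: x).
have schi m : salg (chi m) by apply: salg_scale.
have dchi m i x : partial i (chi m) x = eps m * partial i (@cut R n) (eps m *: x).
  by apply: partial_scale => y; have [_ /(_ y)[]] := salg_partial i sc.
have d2chi m i x : partial i (partial i (chi m)) x =
    eps m ^+ 2 * partial i (partial i (@cut R n)) (eps m *: x).
  rewrite (_ : partial i (chi m) = fun y => eps m * partial i (@cut R n) (eps m *: y)); last first.
    by apply/funext => y; exact: dchi.
  rewrite partialZ; last exact: salg_scale.
  rewrite partial_scale ?expr2 ?mulrA// => y; by have [_ /(_ y)[]] := salg_partial i (sdc i).
(* The coefficient of the first derivatives of the cutoff. These come with a factor [eps m], the
   second derivatives with its square. *)
pose G i x := 2 * partial i (H a) x - (drift_mx S (- J) *m x) i 0 * H a x.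
have lG i : Lsq gam (G i).
  apply: tame_Lsq => //; apply: tameD; first by apply: tameM; [exact: tame_cst|exact: tame_partial_H].
  apply: tameN; apply: tameM => //.
  rewrite (_ : (fun _ => _) = fun x : X => \sum_j drift_mx S (- J) i j * x j 0).
    by apply: tame_sum => j; apply: tameM; [exact: tame_cst|exact: tame_coord].
  by apply/funext => x; rewrite mxE.
have ptest m : test_function (fun x => psi x * (H a x * chi m x)).
  split; first by apply: salg_smooth; apply: salgM; [exact: salg_gauss_density|exact: salgM].
  apply: cbox_compact; have := @cboxM R n (fun x => psi x * H a x) (chi m) _ _.
  rewrite (_ : (fun x => psi x * H a x * chi m x) = fun x => psi x * (H a x * chi m x)).
    apply; last exact: cbox_scale (@eps_gt0 R m) bc.
    by apply: salg_continuous; apply: salgM => //; exact: salg_gauss_density.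
  by apply/funext => x; rewrite mulrA.
have Mchi m x : adjoint_test (fun y => psi y * (H a y * chi m y)) x / psi x =
    E x * cut (eps m *: x) + \sum_i (eps m * (G i x * partial i (@cut R n) (eps m *: x)) +
      eps m ^+ 2 * (H a x * partial i (partial i (@cut R n)) (eps m *: x))).
  rewrite adjoint_test_gauss; last exact: salgM.
  have sdchi i : salg (partial i (chi m)) by exact: (salg_partial i (schi m)).1.
  have p1 i y : partial i (fun z => H a z * chi m z) y =
    H a y * partial i (chi m) y + chi m y * partial i (H a) y by exact: partialM.
  have p2 i : partial i (partial i (fun z => H a z * chi m z)) x =
      H a x * partial i (partial i (chi m)) x + 2 * (partial i (H a) x * partial i (chi m) x) +
      partial i (partial i (H a)) x * chi m x.
    rewrite (_ : partial i (fun z => H a z * chi m z) =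
      fun y => H a y * partial i (chi m) y + chi m y * partial i (H a) y); last first.
      by apply/funext => y; exact: p1.
    rewrite partialD; [|exact: salgM|exact: salgM].
    rewrite (partialM (f := H a) (g := partial i (chi m)))//.
    rewrite (partialM (f := chi m) (g := partial i (H a)))//.
    move: (partial i (partial i (chi m)) x) (partial i (chi m) x) (partial i (partial i (H a)) x).
    by move: (partial i (H a) x) (H a x) (chi m x) => *; ring.
  rewrite [psi x * _]mulrC mulfK// -EE.
  rewrite -[in LHS]sumrB -[in RHS]sumrB mulr_suml -big_split/=; apply: eq_bigr => i _.
  rewrite p1 p2 dchi d2chi /G -/(chi m x).
  move: (partial i (partial i (@cut R n)) _) (partial i (@cut R n) _).
  move: (partial i (partial i (H a)) x) (partial i (H a) x) (H a x) (chi m x).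
  by move: (_ i 0) (eps m) => *; ring.
have e m : \int[gam]_x (r x * (adjoint_test (fun y => psi y * (H a y * chi m y)) x / psi x)) =
    \int[gam]_x (r x * E x * cut (eps m *: x)) +
    \sum_i (eps m * \int[gam]_x (r x * G i x * partial i (@cut R n) (eps m *: x)) +
    eps m ^+ 2 * \int[gam]_x (r x * H a x * partial i (partial i (@cut R n)) (eps m *: x))).
  have l1 := L1_scale_mul m (Lsq_mul lr lE) bc.
  have l2 i := L1_scale_mul m (Lsq_mul lr (lG i)) (bdc i).
  have l3 i := L1_scale_mul m (Lsq_mul lr (Lsq_H U hS a)) (bd2c i).
  have l4 i := L1D (L1Zl (eps m) (l2 i)) (L1Zl (eps m ^+ 2) (l3 i)).
  transitivity (\int[gam]_x (r x * E x * cut (eps m *: x) + \sum_i (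
      eps m * (r x * G i x * partial i (@cut R n) (eps m *: x)) +
      eps m ^+ 2 * (r x * H a x * partial i (partial i (@cut R n)) (eps m *: x))))).
    apply: eq_Rintegral => x _; rewrite Mchi mulrDr mulr_sumr mulrA; congr (_ + _).
    by apply: eq_bigr => i _; ring.
  transitivity (\int[gam]_x (r x * E x * cut (eps m *: x)) + \int[gam]_x \sum_i (
      eps m * (r x * G i x * partial i (@cut R n) (eps m *: x)) +
      eps m ^+ 2 * (r x * H a x * partial i (partial i (@cut R n)) (eps m *: x)))).
    by apply: RintegralD => //; apply: L1_sum => i; exact: l4.
  congr (_ + _); rewrite Rintegral_sum; last by move=> i; exact: l4.
  apply: eq_bigr => i _.
  transitivity (\int[gam]_x (eps m * (r x * G i x * partial i (@cut R n) (eps m *: x))) +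
      \int[gam]_x (eps m ^+ 2 * (r x * H a x * partial i (partial i (@cut R n)) (eps m *: x)))).
    by apply: RintegralD => //; [exact: L1Zl (l2 i)|exact: L1Zl (l3 i)].
  by congr (_ + _); apply: RintegralZl => //; [exact: l2|exact: l3].
have c1 := cvg_cutoff (Lsq_mul lr lE) bc.
have c2 i := cvg_cutoff (Lsq_mul lr (lG i)) (bdc i).
have c3 i := cvg_cutoff (Lsq_mul lr (Lsq_H U hS a)) (bd2c i).
have c4 := cvg_cutoff (Lsq_mul ls (Lsq_H U hS a)) bc.
have {}e m : \int[gam]_x (s x * H a x * cut (eps m *: x)) =
    \int[gam]_x (r x * E x * cut (eps m *: x)) +
    \sum_i (eps m * \int[gam]_x (r x * G i x * partial i (@cut R n) (eps m *: x)) +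
    eps m ^+ 2 * \int[gam]_x (r x * H a x * partial i (partial i (@cut R n)) (eps m *: x))).
  rewrite -e -weak_eqE// rs//.
  have [_ ->] := integral_lebesgue_gauss ls (test_function_cbox (ptest m)).
  by apply: eq_Rintegral => x _; rewrite [psi x * _]mulrC mulfK// mulrA.
(* In the limit only the terms with the cutoff itself survive, and its value at 0 is 1. *)
have c5 : \int[gam]_x (s x * H a x * cut (eps m *: x)) @[m --> \oo] -->
    cut (0 : X) * \int[gam]_x (r x * E x) + \sum_(i < n) (0 : R).
  under eq_fun do rewrite e; apply: cvgD; first exact: c1.
  apply: cvg_sum_seq => i; under eq_fun do rewrite expr2.
  pose L2 := partial i (@cut R n) 0 * \int[gam]_x (r x * G i x).
  pose L3 := partial i (partial i (@cut R n)) 0 * \int[gam]_x (r x * H a x).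
  suff : eps m * \int[gam]_x (r x * G i x * partial i (@cut R n) (eps m *: x)) +
      eps m * eps m * \int[gam]_x (r x * H a x * partial i (partial i (@cut R n)) (eps m *: x))
      @[m --> \oo] --> 0 * L2 + 0 * 0 * L3 by rewrite !mul0r addr0.
  apply: cvgD; first by apply: cvgM; [exact: cvg_eps|exact: c2].
  by apply: cvgM; [apply: cvgM; exact: cvg_eps|exact: c3].
have := cvg_lim _ c4; rewrite (cvg_lim _ c5)// cut0 !mul1r big1// addr0 => <-//.
Qed.

End weak_equation.

Section graph.
Context {R : realType} (n : nat).
Local Notation X := 'cV[R]_n.

Lemma distr_ofE (f : X -> R[i]) phi : distr_of f phi =
  ((\int[lebesgue_cV n]_x (complex.Re (f x) * phi x)) +i*
   (\int[lebesgue_cV n]_x (complex.Im (f x) * phi x)))%C.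
Proof.
rewrite /distr_of /cintegral; congr (_ +i* _)%C; apply: eq_Rintegral => x _.
  by rewrite mulrC Re_rM mulrC.
by rewrite mulrC Im_rM mulrC.
Qed.

Let eq_Re_Im (z w : R[i]) : z = w <->
  complex.Re z = complex.Re w /\ complex.Im z = complex.Im w.
Proof. by case: z w => [a b] [c d] /=; split=> [[-> ->]|[-> ->]]. Qed.

Let ReDsum (F G : 'I_n -> R[i]) : complex.Re (\sum_i F i + \sum_i G i) =
  \sum_i complex.Re (F i) + \sum_i complex.Re (G i).
Proof. by rewrite raddfD !raddf_sum. Qed.

Let ImDsum (F G : 'I_n -> R[i]) : complex.Im (\sum_i F i + \sum_i G i) =
  \sum_i complex.Im (F i) + \sum_i complex.Im (G i).
Proof. by rewrite raddfD !raddf_sum. Qed.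

Lemma distr_generatorP S J (f g : X -> R[i]) :
  (forall phi, test_function phi ->
     distr_generator S J (distr_of f) phi = distr_of g phi) <->
  weak_eq S J (fun x => complex.Re (f x)) (fun x => complex.Re (g x)) /\
  weak_eq S J (fun x => complex.Im (f x)) (fun x => complex.Im (g x)).
Proof.
have e phi : distr_generator S J (distr_of f) phi =
  \sum_i distr_of f (partial i (fun x => drift_field S J i x * phi x)) +
  \sum_i distr_of f (partial i (partial i phi)).
  rewrite /distr_generator /distr_mul /distr_partial -sumrN; congr (_ + _);
    by apply: eq_bigr => i _; rewrite opprK.
have eR phi : complex.Re (distr_generator S J (distr_of f) phi) =
  \sum_i \int[lebesgue_cV n]_x (complex.Re (f x) * partial i (fun y => drift_field S J i y * phi y) x) +
  \sum_i \int[lebesgue_cV n]_x (complex.Re (f x) * partial i (partial i phi) x).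
  by rewrite e ReDsum; congr (_ + _); apply: eq_bigr => i _; rewrite distr_ofE.
have eI phi : complex.Im (distr_generator S J (distr_of f) phi) =
  \sum_i \int[lebesgue_cV n]_x (complex.Im (f x) * partial i (fun y => drift_field S J i y * phi y) x) +
  \sum_i \int[lebesgue_cV n]_x (complex.Im (f x) * partial i (partial i phi) x).
  by rewrite e ImDsum; congr (_ + _); apply: eq_bigr => i _; rewrite distr_ofE.
split=> [h|[h1 h2] phi tphi].
  by split=> phi /h /eq_Re_Im[h1 h2]; rewrite -?eR -?eI ?h1 ?h2 distr_ofE.
by apply/eq_Re_Im; rewrite eR eI h1// h2// distr_ofE.
Qed.

(** The inclusions are [weak_eq_gen] and [gen_weak_eq], applied to real and imaginary parts. All
    results in coordinates thereby apply to the operator with its maximal domain. *)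
Lemma drift_diffusionE (S U J : 'M[R]_n) : S = U *m U^T -> U \in unitmx ->
  sym_posdef S -> antisymmetric_mx J ->
  drift_diffusion S J = gen_graph (@crd R n S U) (drift_conj U J).
Proof.
move=> SU uU hS aJ; apply/seteqP; split=> -[u v]; rewrite /drift_diffusion /gen_graph /=.
  have [lr li] := Lsq_L2 u; have [lr' li'] := Lsq_L2 v.
  move=> /distr_generatorP[h1 h2] a; apply/eq_Re_Im; rewrite Re_gen Im_gen.
  by split; [apply: weak_eq_gen h1 a|apply: weak_eq_gen h2 a].
have [lr li] := Lsq_L2 u; have [lr' li'] := Lsq_L2 v.
move=> h; apply/distr_generatorP; split.
  by apply: (gen_weak_eq SU uU hS aJ) => // a; move/eq_Re_Im: (h a) => -[]; rewrite Re_gen.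
by apply: (gen_weak_eq SU uU hS aJ) => // a; move/eq_Re_Im: (h a) => -[_]; rewrite Im_gen.
Qed.

End graph.

(** * Optimal drifts *)

Section spectra.
Context {R : realType}.

Lemma min_Re_unique (E : set R[i]) (m m' : R) : min_Re E m -> min_Re E m' -> m = m'.
Proof. by move=> [Em lm] [Em' lm']; apply/le_anti; rewrite lm// lm'. Qed.

(** The inequality is added up for the real and imaginary parts of a left eigenvector; the terms in
    Im z cancel. *)
Lemma lyapunov_spectrum n (A : 'M[R]_n) (mu : 'I_n -> R) (c0 : R) z :
  (forall k, 1 <= mu k) -> lyapunov_mx mu c0 A -> mx_spectrum A z -> c0 <= complex.Re z.
Proof.
move=> mu1 lA /eigenvalueP[v vA v0].
pose p j := complex.Re (v 0 j); pose q j := complex.Im (v 0 j).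
have ReE j : \sum_k A k j * p k = complex.Re z * p j - complex.Im z * q j.
  have := congr1 (fun w : 'rV_n => complex.Re (w 0 j)) vA; rewrite !mxE raddf_sum.
  rewrite /p /q; case: z {vA} => a b /=; case: (v 0 j) => c d /= <-.
  by apply: eq_bigr => k _; rewrite [map_mx _ _ _ _]mxE [v 0 k * _]mulrC Re_rM.
have ImE j : \sum_k A k j * q k = complex.Re z * q j + complex.Im z * p j.
  have := congr1 (fun w : 'rV_n => complex.Im (w 0 j)) vA; rewrite !mxE raddf_sum.
  rewrite /p /q; case: z {vA ReE} => a b /=; case: (v 0 j) => c d /= <-.
  by apply: eq_bigr => k _; rewrite [map_mx _ _ _ _]mxE [v 0 k * _]mulrC Im_rM.
have M0 : 0 < \sum_k mu k * (p k ^+ 2 + q k ^+ 2).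
  have h k : 0 <= mu k * (p k ^+ 2 + q k ^+ 2).
    by rewrite mulr_ge0 ?addr_ge0 ?sqr_ge0// (le_trans ler01).
  rewrite lt_def sumr_ge0 ?andbT// psumr_eq0//; apply: contra v0 => /allP hp.
  apply/eqP/rowP => k; have := hp k (mem_index_enum _); rewrite !mxE /p /q mulf_eq0.
  rewrite gt_eqF ?(lt_le_trans ltr01)//= paddr_eq0 ?sqr_ge0// !sqrf_eq0.
  by case: (v 0 k) => a b /= /andP[/eqP-> /eqP->].
rewrite -(ler_pM2r M0); have -> : c0 * \sum_k mu k * (p k ^+ 2 + q k ^+ 2) =
    c0 * (\sum_k mu k * p k ^+ 2) + c0 * (\sum_k mu k * q k ^+ 2).
  by rewrite -mulrDr -big_split; congr (_ * _); apply: eq_bigr => k _; rewrite mulrDr.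
apply: le_trans (lerD (lA p) (lA q)) _; rewrite -big_split mulr_sumr.
apply: ler_sum => j _ /=; rewrite le_eqVlt; apply/orP; left; apply/eqP.
have pull (x : 'I_n -> R) : \sum_k mu j * A k j * (x j * x k) = mu j * x j * \sum_k A k j * x k.
  by rewrite mulr_sumr; apply: eq_bigr => k _; ring.
by rewrite !pull ReE ImE; ring.
Qed.

Lemma enorm_mulmx n (B : 'M[R]_n) : exists2 K : R, 0 <= K &
  forall x : 'cV[R]_n, enorm x = 1 -> enorm (B *m x) <= K.
Proof.
exists (Num.sqrt (\sum_i \sum_j B i j ^+ 2)) => [|x x1]; first exact: sqrtr_ge0.
rewrite /enorm ler_wsqrtr//; apply: ler_sum => i _; rewrite mxE.
apply: le_trans (cauchy_schwarz_sum _ _ _) _.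
suff -> : \sum_j x j 0 ^+ 2 = 1 by rewrite mulr1.
have h0 : 0 <= \sum_i x i 0 ^+ 2 by apply: sumr_ge0 => j _; rewrite sqr_ge0.
by rewrite -(sqr_sqrtr h0) -/(enorm x) x1 expr1n.
Qed.

Lemma le_opnorm n (B : 'M[R]_n) x : enorm x = 1 -> enorm (B *m x) <= opnorm B.
Proof.
move=> x1; apply: ub_le_sup; last by exists x.
by have [K _ hK] := enorm_mulmx B; exists K => _ [y /hK h <-].
Qed.

Lemma enormZ n (a : R) (x : 'cV[R]_n) : enorm (a *: x) = `|a| * enorm x.
Proof.
rewrite /enorm -sqrtr_sqr -sqrtrM ?sqr_ge0// mulr_sumr; congr Num.sqrt.
by apply: eq_bigr => i _; rewrite mxE exprMn.
Qed.

Lemma enorm_gt0 n (x : 'cV[R]_n) : x != 0 -> 0 < enorm x.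
Proof.
move=> x0; rewrite sqrtr_gt0 lt_def sumr_ge0 ?andbT => [|i _]; last by rewrite sqr_ge0.
apply: contra x0; rewrite psumr_eq0 => [/allP h|i _]; last by rewrite sqr_ge0.
by apply/eqP/colP => i; rewrite mxE; apply/eqP; rewrite -sqrf_eq0; exact: h (mem_index_enum _).
Qed.

(** S is tested on a unit vector and its inverse on the normalized image of that vector. *)
Lemma cond_number_ge1 n (S : 'M[R]_n.+1) : S \in unitmx -> 1 <= cond_number S.
Proof.
move=> uS; pose x : 'cV[R]_n.+1 := delta_mx 0 0.
have x1 : enorm x = 1.
  rewrite /enorm (bigD1 0)//= mxE eqxx/= expr1n big1 ?addr0 ?sqrtr1// => i i0.
  by rewrite mxE (negbTE i0)/= expr0n.
have x0 : x != 0 by apply/eqP => e; move: x1; rewrite e -(scale0r x) enormZ normr0 mul0r => /eqP; rewrite eq_sym oner_eq0.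
have Sx0 : S *m x != 0.
  by apply: contra x0 => /eqP e; rewrite -[x](mulKmx uS) e mulmx0.
have y0 := enorm_gt0 Sx0; set y := enorm (S *m x) in y0.
have z1 : enorm (y^-1 *: (S *m x)) = 1.
  by rewrite enormZ ger0_norm ?invr_ge0 ?ltW// mulVf ?gt_eqF.
have := le_opnorm (invmx S) z1; rewrite -scalemxAr mulKmx// enormZ x1 mulr1.
rewrite ger0_norm; last by rewrite invr_ge0 ltW.
move=> h1.
have h2 : y <= opnorm S by exact: le_opnorm.
rewrite /cond_number -[leLHS](divff (lt0r_neq0 y0)); apply: ler_pM => //; first exact: ltW.
by rewrite invr_ge0 ltW.
Qed.

End spectra.

(** * The mean and the distance to it *)

Section mean.
Context {R : realType} (n : nat).
Local Notation X := 'cV[R]_n.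
Variables S U : 'M[R]_n.
Hypothesis SU : S = U *m U^T.
Hypothesis uU : U \in unitmx.
Hypothesis hS : sym_posdef S.
Local Notation gam := (gauss_measure S).
Local Notation crd := (@crd R n S U).

Lemma rcrd_mzero (f : X -> R) : rcrd S U f mzero = \int[gam]_x f x.
Proof.
rewrite /rcrd; have -> : mfact (@mzero n) = 1%N by rewrite /mfact big1// => i _; rewrite ffunE.
by rewrite divr1; apply: eq_Rintegral => x _; rewrite H_zero mulr1.
Qed.

Lemma meanE (u : L2 gam) : mean u = crd u mzero.
Proof.
have [[mr _] [mi _]] := Lsq_L2 u; rewrite /mean /cintegral /crd !rcrd_mzero !Rintegral_gauss//.
congr (_ +i* _)%C; apply: eq_Rintegral => x _.
  by rewrite mulrC Re_rM mulrC.
by rewrite mulrC Im_rM mulrC.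
Qed.

Lemma grade0 : grade n 0 = [:: mzero].
Proof.
apply: perm_small_eq => //; apply: uniq_perm; rewrite ?grade_uniq// => a.
by rewrite mem_grade mdeg_eq0 inE.
Qed.

(** Degree 0 is spanned by H_0 = 1, so subtracting the mean removes exactly the component of degree
    0. *)
Lemma integral_centered (f : X -> R) : Lsq gam f ->
  \int[gam]_x ((f x - rcrd S U f mzero) ^+ 2) =
  \int[gam]_x (f x ^+ 2) - ip 0 (rcrd S U f) (rcrd S U f).
Proof.
move=> lf; have := int_hsum_proj SU uU hS 1 lf; rewrite /energy big_ord1 => <-.
by apply: eq_Rintegral => x _; rewrite /hsum big_ord1 grade0 big_seq1 H_zero mulr1.
Qed.

Lemma dist_cst_ge0 (u : L2 gam) z : 0 <= dist_cst u z.
Proof. by rewrite fine_ge0// L2norm_ge0. Qed.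

Lemma cvg_dist_mean (u : L2 gam) :
  \sum_(k < m) cnorm2 k.+1 (crd u) @[m --> \oo] --> dist_cst u (mean u) ^+ 2.
Proof.
have [lr li] := Lsq_L2 u.
have c := Lsq_cst (gauss_fin hS).
have -> : dist_cst u (mean u) ^+ 2 = rnorm u ^+ 2 - cnorm2 0 (crd u).
  rewrite /dist_cst L2norm_Lsq/=; last 2 first.
  - have := LsqB lr (c (complex.Re (mean u))); congr Lsq; apply/funext => x.
    by case: (u x) (mean u) => [? ?] [? ?].
  - have := LsqB li (c (complex.Im (mean u))); congr Lsq; apply/funext => x.
    by case: (u x) (mean u) => [? ?] [? ?].
  rewrite sqr_sqrtr; last by rewrite addr_ge0// Lsq_int_ge0.
  rewrite rnorm_L2 /cnorm2 opprD addrACA meanE; congr (_ + _).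
    rewrite -integral_centered//; apply: eq_Rintegral => x _; congr (_ ^+ 2).
    by rewrite /crd; case: (u x).
  rewrite -integral_centered//; apply: eq_Rintegral => x _; congr (_ ^+ 2).
  by rewrite /crd; case: (u x).
have h := @crd_norm R n S U SU uU hS u.
have {}h : \sum_(k < m.+1) cnorm2 k (crd u) @[m --> \oo] --> rnorm u ^+ 2.
  by move: h; rewrite -(cvg_shiftS (fun m => \sum_(k < m) cnorm2 k (crd u))).
have -> : (fun m => \sum_(k < m) cnorm2 k.+1 (crd u)) =
    (fun m => \sum_(k < m.+1) cnorm2 k (crd u) - cnorm2 0 (crd u)).
  by apply/funext => m; rewrite big_ord_recl/= [X in X - _]addrC addrK.
by apply: cvgB; [exact: h|exact: cvg_cst].
Qed.

End mean.

(** * Spectral optimum and decay *)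

Section optimal.
Context {R : realType} (n : nat).
Variable S : 'M[R]_n.+1.
Hypothesis hS : sym_posdef S.

Lemma drift_diffusion_theory : forall J, antisymmetric_mx J ->
  [/\ exists T, generates (drift_diffusion S J) T,
    has_compact_resolvent (drift_diffusion S J),
    forall m, min_Re (mx_spectrum (drift_mx S J)) m <->
      min_Re (spectrum (oppop (drift_diffusion S J)) `\` [set 0]) m
  & exists2 m, min_Re (mx_spectrum (drift_mx S J)) m & m <= \tr S / n.+1%:R].
Proof.
move=> J aJ; have [U SU uU] := posdef_factor hS.
have [lam lam0 /(_ J aJ) cA] := coercive_drift_conj uU.
rewrite (drift_diffusionE SU uU hS aJ) (mx_spectrum_drift J SU uU).
have cl := crd_lin U hS; have cn := crd_norm SU uU hS; have cs := crd_surj SU uU hS.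
split.
- exists (exp_gen (@crd R n.+1 S U) (drift_conj U J)); split.
    exact: (exp_gen_contraction cl cn cs lam0 cA).
  exact: (exp_gen_generator cl cn cs lam0 cA).
- exact: (gen_graph_compact_resolvent cl cn cs lam0 cA).
- by move=> m; exact: (min_Re_spectrum cl cn cs lam0 cA).
- by have [m h1 h2] := min_Re_mx_spectrum (drift_conj U J); exists m; rewrite -?(tr_drift_conj SU aJ).
Qed.

(** [lyapunov_spectrum] bounds the matrix spectrum from below and the trace bounds its minimum from
    above. For the norm, the mean is conserved and all positive degrees decay with the same
    constant, so the sums over degrees can be compared. *)
Lemma optimal_decay : exists J : 'M[R]_n.+1, [/\ antisymmetric_mx J,
    min_Re (mx_spectrum (drift_mx S J)) (\tr S / n.+1%:R)
  & forall T, generates (drift_diffusion S J) T ->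
    forall (u : L2 (gauss_measure S)) (t : R), 0 <= t ->
    dist_cst (T t u) (mean u) <=
    Num.sqrt n.+1%:R * expR (- (\tr S / n.+1%:R) * t) * dist_cst u (mean u)].
Proof.
have [U [J [mu [SU uU aJ mu1 lA]]]] := optimal_drift hS.
have [lam lam0 /(_ J aJ) cA] := coercive_drift_conj uU.
have cl := crd_lin U hS; have cn := crd_norm SU uU hS; have cs := crd_surj SU uU hS.
exists J; split=> //.
  have [_ _ _ [m hm mle]] := drift_diffusion_theory aJ.
  suff <- : m = \tr S / n.+1%:R by [].
  apply/le_anti; rewrite mle/=; have [[z zA <-] _] := hm.
  move: zA; rewrite (mx_spectrum_drift J SU uU); apply: lyapunov_spectrum lA.
  by move=> k; have /andP[] := mu1 k.
move=> T [cT gT] u t t0; rewrite (drift_diffusionE SU uU hS aJ) in gT.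
set c0 := \tr S / _ in lA *.
have mE : mean u = mean (T t u).
  by rewrite !(meanE U) (semigroup_mean cl cn cs lam0 cA u cT gT t0).
have d1 := @cvg_dist_mean R n.+1 S U SU uU hS (T t u).
have d2 := @cvg_dist_mean R n.+1 S U SU uU hS u.
rewrite mE; set D1 := dist_cst (T t u) _ in d1 *; rewrite -mE; set D2 := dist_cst u _ in d2 *.
have D20 : 0 <= D2 by exact: dist_cst_ge0.
have E0 := expR_ge0 (- c0 * t).
rewrite -(@ler_pXn2r _ 2)// ?nnegrE ?mulr_ge0 ?sqrtr_ge0 ?dist_cst_ge0//.
rewrite !exprMn sqr_sqrtr// -expRM_natl.
have d3 : n.+1%:R * expR (- (2 * c0) * t) * \sum_(k < m) cnorm2 k.+1 (@crd R n.+1 S U u)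
    @[m --> \oo] --> n.+1%:R * expR (- (2 * c0) * t) * D2 ^+ 2.
  by apply: cvgM d2; exact: cvg_cst.
have -> : 2%:R * (- c0 * t) = - (2 * c0) * t by ring.
apply: (ler_cvg_to d1 d3); apply: nearW => m; rewrite mulr_sumr; apply: ler_sum => k _.
exact: (semigroup_decay cl cn cs lam0 cA _ _ cT gT mu1 lA t0).
Qed.

End optimal.

Theorem theorem2 (R : realType) (N : nat) (hN : (0 < N)%N) :
  exists C : R, forall S : 'M[R]_N, sym_posdef S ->
  [/\ forall J : 'M[R]_N, antisymmetric_mx J ->
        (exists T, generates (drift_diffusion S J) T) /\
        has_compact_resolvent (drift_diffusion S J),
      forall J : 'M[R]_N, antisymmetric_mx J -> exists m : R,
        min_Re (spectrum (oppop (drift_diffusion S J)) `\` [set 0]) m,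
      is_max [set m : R | exists2 J : 'M[R]_N, antisymmetric_mx J &
          min_Re (spectrum (oppop (drift_diffusion S J)) `\` [set 0]) m]
        (\tr S / N%:R),
      is_max [set m : R | exists2 J : 'M[R]_N, antisymmetric_mx J &
          min_Re (mx_spectrum (drift_mx S J)) m]
        (\tr S / N%:R) /\
      (forall J : 'M[R]_N, antisymmetric_mx J ->
        min_Re (mx_spectrum (drift_mx S J)) (\tr S / N%:R) ->
        min_Re (spectrum (oppop (drift_diffusion S J)) `\` [set 0])
          (\tr S / N%:R))
    & exists J : 'M[R]_N,
      [/\ antisymmetric_mx J,
          min_Re (mx_spectrum (drift_mx S J)) (\tr S / N%:R)
        & forall T, generates (drift_diffusion S J) T ->
          forall (u : L2 (gauss_measure S)) (t : R), 0 <= t ->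
          dist_cst (T t u) (mean u) <=
            C * cond_number S `^ (7 / 2) * expR (- (\tr S / N%:R) * t) *
            dist_cst u (mean u)]].
Proof.
case: N hN => // n _; exists (Num.sqrt n.+1%:R) => S hS.
have th := drift_diffusion_theory hS.
have [Jo [aJo mJo dJo]] := optimal_decay hS.
have ub J m : antisymmetric_mx J -> min_Re (mx_spectrum (drift_mx S J)) m ->
    m <= \tr S / n.+1%:R.
  by move=> /th[_ _ _ [m' hm' m'le]] hm; rewrite (min_Re_unique hm hm').
split.
- by move=> J /th[].
- by move=> J /th[_ _ e [m hm _]]; exists m; apply/e.
- split; first by exists Jo => //; have [_ _ e _] := th _ aJo; apply/e.
  by move=> m [J aJ hm]; have [_ _ e _] := th J aJ; exact: (ub J m aJ (proj2 (e m) hm)).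
- split; last by move=> J /th[_ _ e _] /e.
  by split; [exists Jo|move=> m [J aJ hm]; exact: (ub J)].
exists Jo; split=> // T gT u t t0; apply: le_trans (dJo T gT u t t0) _.
rewrite ler_wpM2r ?dist_cst_ge0// ler_wpM2r ?expR_ge0// ler_peMr ?sqrtr_ge0//.
have k1 : 1 <= cond_number S.
  by apply: cond_number_ge1; rewrite unitmxE unitfE gt_eqF//; case: (integral_gaussian hS).
have e1 : 1 `^ (7 / 2) = 1 :> R by rewrite powR1.
rewrite -[leLHS]e1; apply: ge0_ler_powR; rewrite ?nnegrE ?divr_ge0//.
by rewrite (le_trans _ k1).
Qed.
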